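(* Suppose that $C^{\bullet} = [0 \to C^1 \to C^2 \to C^3 \to 0] \in \mathsf{C}^b(\mathsf{Codiv})$ and $D^{\bullet} = [0 \to D^1 \to D^2 \to D^3 \to 0] \in \mathsf{C}^b(\mathsf{Div})$ are short strictly exact complexes; let furthermore $C \in \mathsf{Codiv}$ and $D \in \mathsf{Div}$ be given. (i) If $D^n_{\mathbb{Z}} = 0$ for all $n$, then $\mathrm{Hom}^{\bullet}(C, D^{\bullet}) \in \mathsf{C}^b(\mathsf{TAb})$ is strictly exact. (ii) If $C_{\mathbb{S}^1} = 0$, then $\mathrm{Hom}^{\bullet}(C, [\mathbb{Q} \to \mathbb{A} \to \mathbb{Q}^{\vee}]) \in \mathsf{C}^b(\mathsf{TAb})$ is strictly exact. (iii) If $C^n_{\mathbb{S}^1} = 0$ for all $n$, then $\mathrm{Hom}^{\bullet}(C^{\bullet}, D) \in \mathsf{C}^b(\mathsf{TAb})$ is strictly exact. (iv) If $D_{\mathbb{Z}} = 0$, then $\mathrm{Hom}^{\bullet}([\mathbb{Q} \to \mathbb{A} \to \mathbb{Q}^{\vee}], D) \in \mathsf{C}^b(\mathsf{TAb})$ is strictly exact.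
   Context: $\mathsf{TAb}$ is the category of abelian Hausdorff topological groups and continuous homomorphisms; $\mathsf{LCAb} \subseteq \mathsf{TAb}$ is the full subcategory of locally compact (Hausdorff) abelian (LCA) groups; $\mathsf{C}^b$ denotes bounded complexes. A morphism $f: A\to B$ is strict if the induced monomorphism $A/\ker(f) \to B$ is a closed embedding; a complex is strictly exact if it is exact and all differentials are strict. $A^{\vee} = \mathrm{Hom}(A, \mathbb{S}^1)$ is the Pontryagin dual, $\mathbb{S}^1=\mathbb{R}/\mathbb{Z}$. An LCA group $A$ is divisible if $n\cdot: A \to A$ is surjective for all integers $n \ge 1$, and codivisible if $A^{\vee}$ is divisible; $\mathsf{Div}, \mathsf{Codiv} \subseteq \mathsf{LCAb}$ are the corresponding full subcategories. Every LCA group $A$ has a unique chain of closed subgroups $0 \subseteq A_{\mathbb{S}^1} \subseteq F_{\mathbb{Z}} A \subseteq A$ such that $A_{\mathbb{S}^1}$ is compact and connected, $A_{\mathbb{Z}} := A/F_{\mathbb{Z}} A$ is discrete and torsionfree, and $F_{\mathbb{Z}} A/A_{\mathbb{S}^1}$ is isomorphic to a direct sum of some $\mathbb{R}^m$ and a topological torsion group (an LCA group $T$ with $\lim_{k\to\infty} k!\,t = 0$ for all $t \in T$). $\mathrm{Hom}(A,B)$ carries the compact-open topology; $\mathrm{Hom}^{\bullet}(A^{\bullet},B^{\bullet})$ is the total complex of the Hom-double complex, single objects being regarded as complexes in degree $0$. $[\mathbb{Q} \to \mathbb{A} \to \mathbb{Q}^{\vee}]$ is the complex (zero in other degrees) given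 by the diagonal embedding of discrete $\mathbb{Q}$ into the adele group $\mathbb{A}$ of $\mathbb{Q}$ and the quotient map $\mathbb{A} \to \mathbb{A}/\mathbb{Q} \cong \mathbb{Q}^{\vee}$. *)

(* Defs.v *)
From HB Require Import structures.
From mathcomp Require Import all_boot all_order all_algebra.
From mathcomp Require Import all_classical all_reals all_analysis.
Import numFieldNormedType.Exports.
Set Implicit Arguments.
Unset Strict Implicit.
Unset Printing Implicit Defensive.
Import Order.TTheory GRing.Theory Num.Theory.
Local Open Scope classical_set_scope.
Local Open Scope ring_scope.

(* [tabType] is TAb and [lcabType] its full subcategory LCAb; the morphisms of
   both are the elements of [tophom A B] below. *)
HB.mixin Record isHausdorff T & Topological T := {
  hausdorffP : hausdorff_space T
}.

#[short(type="tabType")]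
HB.structure Definition TAb := {A of TopologicalZmodule A & isHausdorff A}.

HB.mixin Record isLocallyCompact T & Topological T := {
  locally_compactP : locally_compact [set: T]
}.

#[short(type="lcabType")]
HB.structure Definition LCAb := {A of TAb A & isLocallyCompact A}.

Arguments hausdorffP {s}.

Section TopGroupTheory.
Variable A : topologicalZmodType.
Implicit Types (x y : A) (U : set A).

Lemma nbhs_sub x y U : nbhs (x - y) U ->
  exists V W, [/\ nbhs x V, nbhs y W & forall v w, V v -> W w -> U (v - w)].
Proof.
move=> /(@sub_continuous A (x, y)) [[V W] /= [Vx Wy] VWU].
by exists V, W; split => // v w Vv Ww; apply: (VWU (v, w)).
Qed.

Lemma nbhs_shift x y U : nbhs (x + y) U -> nbhs y [set z | U (x + z)].
Proof.
move=> /(@add_continuous A (x, y)) [[V W] /= [Vx Wy] VWU].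
apply: filterS Wy => z Wz; apply: (VWU (x, z)); split => //=.
exact: nbhs_singleton.
Qed.

Lemma nbhs_subr x y U : nbhs (y - x) U -> nbhs y [set z | U (z - x)].
Proof.
rewrite addrC => /nbhs_shift; apply: filterS => z /=.
by rewrite addrC.
Qed.

Lemma nbhs_regular x U : nbhs x U ->
  exists2 V, nbhs x V & closure V `<=` U.
Proof.
rewrite -{1}[x]subr0 => /nbhs_sub[V [W [Vx W0 VWU]]]; exists V => // y clV.
have /clV[z [Vz /= Wz]] : nbhs y [set z | W (z - y)].
  by apply: nbhs_subr; rewrite subrr.
by have := VWU _ _ Vz Wz; rewrite opprB addrC subrK.
Qed.

End TopGroupTheory.

(* A space separated by continuous maps to Hausdorff spaces is Hausdorff. *)
Lemma separated_hausdorff (X : topologicalType) :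
  (forall x y : X, x <> y -> exists (Y : topologicalType) (f : X -> Y),
    [/\ hausdorff_space Y, continuous f & f x <> f y]) ->
  hausdorff_space X.
Proof.
move=> sep p q clpq; apply: contrapT => /sep[Y [f [hY cf]]]; apply.
apply: hY => U V /cf fU /cf fV; have [z [Uz Vz]] := clpq _ _ fU fV.
by exists (f z).
Qed.

Record tophom (A B : topologicalZmodType) := TopHom {
  hom_fun :> A -> B;
  hom_cont : continuous hom_fun;
  hom_add : {morph hom_fun : x y / x + y} }.

Section HomGroup.
Variables A B : topologicalZmodType.
Implicit Types f g h : tophom A B.

Lemma tophom_eq f g : f =1 g -> f = g.
Proof.
case: f g => [f cf af] [g cg ag] /= /funext fg; rewrite fg in cf af *.
by congr TopHom; exact: Prop_irrelevance.
Qed.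

Lemma tophom0 f : f 0 = 0.
Proof. by apply: (addrI (f 0)); rewrite -hom_add !addr0. Qed.

Lemma tophomN f x : f (- x) = - f x.
Proof. by apply: (addrI (f x)); rewrite -hom_add !subrr tophom0. Qed.

Lemma tophomB f x y : f (x - y) = f x - f y.
Proof. by rewrite hom_add tophomN. Qed.

HB.instance Definition _ := gen_eqMixin (tophom A B).
HB.instance Definition _ := gen_choiceMixin (tophom A B).

Program Definition hom_zero : tophom A B := @TopHom A B (fun=> 0) _ _.
Next Obligation. by move=> x; exact: cvg_cst. Qed.
Next Obligation. by move=> x y; rewrite addr0. Qed.

Program Definition hom_opp f : tophom A B := @TopHom A B (fun x => - f x) _ _.
Next Obligation.
by move=> f x; apply: continuous_comp; [exact: hom_cont|exact: opp_continuous].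
Qed.
Next Obligation. by move=> f x y; rewrite hom_add opprD. Qed.

Program Definition hom_plus f g : tophom A B :=
  @TopHom A B (fun x => f x + g x) _ _.
Next Obligation.
move=> f g x.
apply: (@continuous_comp _ _ _ (fun x => (f x, g x)) (fun z => z.1 + z.2)).
  by apply: cvg_pair; exact: hom_cont.
exact: add_continuous.
Qed.
Next Obligation. by move=> f g x y; rewrite !hom_add addrACA. Qed.

Fact hom_plusA : associative hom_plus.
Proof. by move=> f g h; apply: tophom_eq => x /=; rewrite addrA. Qed.
Fact hom_plusC : commutative hom_plus.
Proof. by move=> f g; apply: tophom_eq => x /=; rewrite addrC. Qed.
Fact hom_plus0 : left_id hom_zero hom_plus.
Proof. by move=> f; apply: tophom_eq => x /=; rewrite add0r. Qed.
Fact hom_plusN : left_inverse hom_zero hom_opp hom_plus.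
Proof. by move=> f; apply: tophom_eq => x /=; rewrite addNr. Qed.

HB.instance Definition _ := GRing.isZmodule.Build (tophom A B)
  hom_plusA hom_plusC hom_plus0 hom_plusN.

(* Hom(A, B) with the topology induced by the compact-open one. *)
HB.instance Definition _ := Topological.copy (tophom A B)
  (initial_topology (fun f : tophom A B => (f : A -> B) : {compact-open, A -> B})).

Lemma tophom_cvgP (F : set_system (tophom A B)) f : Filter F ->
  (F --> f) <-> forall K O, compact K -> open O -> f @` K `<=` O ->
    F [set g : tophom A B | g @` K `<=` O].
Proof.
move=> FF; split=> [Ff K O cK oO fKO|FKO].
  apply: Ff; apply: open_nbhs_nbhs; split => //.
  by exists [set g : {compact-open, A -> B} | g @` K `<=` O] => //;
    exact: compact_open_open.
have : (fun g : tophom A B => (g : A -> B) : {compact-open, A -> B}) @ F -->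
    ((f : A -> B) : {compact-open, A -> B}).
  by apply/compact_open_cvgP => K O cK oO fKO; exact: FKO.
move=> Ff U; rewrite nbhsE => -[_ [[V oV <-] Vf] VU].
by apply: (@filterS _ F _ _ _ VU); apply: Ff; exact: open_nbhs_nbhs.
Qed.

Fact tophom_sub_continuous :
  continuous (fun fg : tophom A B * tophom A B => fg.1 - fg.2).
Proof.
move=> [f g]; apply/tophom_cvgP => K O cK oO fgKO /=.
have := cK => /compact_near_coveringP/near_covering_withinP covK.
suff : nbhs ((f, g) : tophom A B * tophom A B)
    [set fg : tophom A B * tophom A B | K `<=` [set x | O (fg.1 x - fg.2 x)]].
  by apply: filterS => fg fgK _ [x Kx <-]; exact: fgK.
apply: (covK (tophom A B * tophom A B)%type (nbhs (f, g))
  (fun fg x => O (fg.1 x - fg.2 x))) => x Kx.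
have /nbhs_sub[U [V [Ux Vx UVO]]] : nbhs (f x - g x) O.
  by apply: open_nbhs_nbhs; split => //; apply: fgKO; exists x.
have [U' U'x cU'] := nbhs_regular (nbhs_interior Ux).
have [V' V'x cV'] := nbhs_regular (nbhs_interior Vx).
pose N := K `&` (f @^-1` closure U' `&` g @^-1` closure V').
have cN : compact N.
  apply: compact_closedI => //; apply: closedI.
    by move/continuous_closedP: (@hom_cont _ _ f); apply; exact: closed_closure.
  by move/continuous_closedP: (@hom_cont _ _ g); apply; exact: closed_closure.
have near_in (h : tophom A B) (Z : set B) : h @` N `<=` Z° ->
    nbhs h [set h' : tophom A B | h' @` N `<=` Z].
  move=> hNZ; have /tophom_cvgP/(_ N Z° cN) := @cvg_id _ (nbhs h).
  move=> /(_ (@open_interior _ _) hNZ).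
  by apply: (@filterS _ (nbhs h)) => h' hN y /hN /interior_subset.
have fN : nbhs f [set f' : tophom A B | f' @` N `<=` U].
  by apply: near_in => _ [y [_ [fy _]] <-]; exact: cU'.
have gN : nbhs g [set g' : tophom A B | g' @` N `<=` V].
  by apply: near_in => _ [y [_ [_ gy]] <-]; exact: cV'.
exists ([set y | U' (f y) /\ V' (g y)],
        [set fg : tophom A B * tophom A B |
           fg.1 @` N `<=` U /\ fg.2 @` N `<=` V]).
  split => /=.
    by apply: filterI; exact: hom_cont.
  by exists ([set f' : tophom A B | f' @` N `<=` U],
             [set g' : tophom A B | g' @` N `<=` V]) => // -[f' g'] /= [].
move=> [y [f' g']] /= [[U'y V'y] [f'N g'N]] Ky.
have Ny : N y by split => //; split; exact: subset_closure.
by apply: UVO; [apply: f'N|apply: g'N]; exists y.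
Qed.

HB.instance Definition _ :=
  PreTopologicalNmodule_isTopologicalZmodule.Build (tophom A B)
    tophom_sub_continuous.

End HomGroup.

Lemma tophom_eval_continuous (A B : topologicalZmodType) (x : A) :
  continuous (fun f : tophom A B => f x).
Proof.
move=> f U; rewrite /= nbhsE => -[V [oV Vfx] VU].
have /tophom_cvgP/(_ [set x] V (@compact_set1 _ x) oV) := @cvg_id _ (nbhs f).
rewrite image_set1 sub1set inE => /(_ Vfx).
by apply: (@filterS _ (nbhs f)) => g /= gV; apply: VU; apply: gV; exists x.
Qed.

Fact tophom_hausdorff (A : topologicalZmodType) (B : tabType) :
  hausdorff_space (tophom A B).
Proof.
apply: separated_hausdorff => f g fg.
have [x fgx] : exists x, f x <> g x.
  apply: contrapT => nfg; apply: fg; apply: tophom_eq => x.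
  by apply: contrapT => fgx; apply: nfg; exists x.
exists B, (fun h : tophom A B => h x); split => //.
  exact: hausdorffP.
exact: tophom_eval_continuous.
Qed.

HB.instance Definition _ (A : topologicalZmodType) (B : tabType) :=
  isHausdorff.Build (tophom A B) (@tophom_hausdorff A B).

Record csubgroup (A : topologicalZmodType) := CSubgroup {
  cs_set :> set A;
  cs0 : cs_set 0;
  csB : forall x y, cs_set x -> cs_set y -> cs_set (x - y);
  cs_closed : closed cs_set }.

Section SubgroupTheory.
Variables (A : topologicalZmodType) (H : csubgroup A).

Lemma csN x : cs_set H x -> cs_set H (- x).
Proof. by move=> Hx; rewrite -[- x]add0r; apply: csB => //; exact: cs0. Qed.

Lemma csD x y : cs_set H x -> cs_set H y -> cs_set H (x + y).
Proof. by move=> Hx Hy; rewrite -[y]opprK; apply: csB => //; exact: csN. Qed.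

Definition subgroup_type : Type := set_type H.

HB.instance Definition _ := Topological.copy subgroup_type (set_type H).
HB.instance Definition _ := SubChoice.copy subgroup_type (set_type H).

Lemma subgroup_valP (x : subgroup_type) : cs_set H (\val x).
Proof. by have := valP x => /set_mem. Qed.

Definition subgroup_sub x (Hx : cs_set H x) : subgroup_type := exist _ x (mem_set Hx).

Definition sub_zero : subgroup_type := subgroup_sub (cs0 H).
Definition sub_opp (x : subgroup_type) : subgroup_type :=
  subgroup_sub (csN (subgroup_valP x)).
Definition sub_plus (x y : subgroup_type) : subgroup_type :=
  subgroup_sub (csD (subgroup_valP x) (subgroup_valP y)).

Fact sub_plusA : associative sub_plus.
Proof. by move=> x y z; apply: val_inj; rewrite /= addrA. Qed.
Fact sub_plusC : commutative sub_plus.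
Proof. by move=> x y; apply: val_inj; rewrite /= addrC. Qed.
Fact sub_plus0 : left_id sub_zero sub_plus.
Proof. by move=> x; apply: val_inj; rewrite /= add0r. Qed.
Fact sub_plusN : left_inverse sub_zero sub_opp sub_plus.
Proof. by move=> x; apply: val_inj; rewrite /= addNr. Qed.

HB.instance Definition _ := GRing.isZmodule.Build subgroup_type
  sub_plusA sub_plusC sub_plus0 sub_plusN.

Lemma sub_val_continuous : continuous (fun x : subgroup_type => \val x : A).
Proof. exact: initial_continuous. Qed.

Fact sub_sub_continuous :
  continuous (fun z : subgroup_type * subgroup_type => z.1 - z.2).
Proof.
move=> [x y] U; rewrite /= nbhsE => -[_ [[V oV <-] /= Vxy] VU].
have /nbhs_sub[V1 [V2 [V1x V2y V12]]] : nbhs (\val x - \val y) V.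
  exact: open_nbhs_nbhs.
exists ((fun z : subgroup_type => \val z) @^-1` V1,
        (fun z : subgroup_type => \val z) @^-1` V2).
  by split; exact: sub_val_continuous.
by move=> [z1 z2] [/= Vz1 Vz2]; apply: VU; exact: (V12 (\val z1) (\val z2)).
Qed.

HB.instance Definition _ :=
  PreTopologicalNmodule_isTopologicalZmodule.Build subgroup_type
    sub_sub_continuous.

Definition quot_rel : rel A := [rel x y | `[< cs_set H (x - y) >]].

Fact quot_rel_refl : reflexive quot_rel.
Proof. by move=> x; apply/asboolP; rewrite subrr; exact: cs0. Qed.
Fact quot_rel_sym : symmetric quot_rel.
Proof.
by move=> x y; apply/asboolP/asboolP => /csN; rewrite opprB.
Qed.
Fact quot_rel_trans : transitive quot_rel.
Proof.
move=> y x z /asboolP xy /asboolP yz; apply/asboolP.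
by have := csD xy yz; rewrite addrA subrK.
Qed.

Canonical quot_equiv := EquivRel quot_rel quot_rel_refl quot_rel_sym
  quot_rel_trans.

Definition quotient_group : Type := quotient_topology {eq_quot quot_equiv}%qT.

HB.instance Definition _ := Topological.copy quotient_group
  (quotient_topology {eq_quot quot_equiv}%qT).
HB.instance Definition _ := Quotient.copy quotient_group
  (quotient_topology {eq_quot quot_equiv}%qT).

Definition quot_pi (x : A) : quotient_group := (\pi_quotient_group x)%qT.
Definition quot_repr (x : quotient_group) : A := repr x.

Lemma quot_reprK x : quot_pi (quot_repr x) = x.
Proof. exact: reprK. Qed.

Lemma quot_piP x y : quot_pi x = quot_pi y <-> cs_set H (x - y).
Proof.
split=> [xy|Hxy]; first by apply/asboolP; exact: (introT (eqmodP quot_equiv x y) xy).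
by apply: (elimT (eqmodP quot_equiv x y)); exact/asboolP.
Qed.

Definition quot_zero : quotient_group := quot_pi 0.
Definition quot_opp (x : quotient_group) := quot_pi (- quot_repr x).
Definition quot_plus (x y : quotient_group) :=
  quot_pi (quot_repr x + quot_repr y).

Lemma quot_repr_pi x : cs_set H (quot_repr (quot_pi x) - x).
Proof. by apply/quot_piP; rewrite quot_reprK. Qed.

Lemma quot_piD x y : quot_plus (quot_pi x) (quot_pi y) = quot_pi (x + y).
Proof.
apply/quot_piP; rewrite opprD addrACA.
by apply: csD; exact: quot_repr_pi.
Qed.

Lemma quot_piN x : quot_opp (quot_pi x) = quot_pi (- x).
Proof.
by apply/quot_piP; rewrite -opprD; apply: csN; exact: quot_repr_pi.
Qed.

Fact quot_plusA : associative quot_plus.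
Proof.
move=> x y z; rewrite -[x]quot_reprK -[y]quot_reprK -[z]quot_reprK.
by rewrite !quot_piD addrA.
Qed.
Fact quot_plusC : commutative quot_plus.
Proof. by move=> x y; rewrite /quot_plus addrC. Qed.
Fact quot_plus0 : left_id quot_zero quot_plus.
Proof. by move=> x; rewrite -[x]quot_reprK quot_piD add0r. Qed.
Fact quot_plusN : left_inverse quot_zero quot_opp quot_plus.
Proof. by move=> x; rewrite -[x]quot_reprK quot_piN quot_piD addNr. Qed.

HB.instance Definition _ := GRing.isZmodule.Build quotient_group
  quot_plusA quot_plusC quot_plus0 quot_plusN.

Lemma quot_pi_add : {morph quot_pi : x y / x + y}.
Proof. by move=> x y; rewrite -quot_piD. Qed.

Lemma quot_pi_opp : {morph quot_pi : x / - x}.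
Proof. by move=> x; rewrite -quot_piN. Qed.

Lemma quot_pi_continuous : continuous quot_pi.
Proof. exact: pi_continuous. Qed.

Lemma quot_pi_open (U : set A) : open U -> open (quot_pi @` U).
Proof.
move=> oU; rewrite /open /= /quotient_open /=.
rewrite openE => x /= [u Uu /quot_piP Hux].
have /nbhs_subr Uux : nbhs (x - (x - u)) U.
  by rewrite opprB addrC subrK; exact: open_nbhs_nbhs.
apply: filterS Uux => y /= Uy; exists (y - (x - u)) => //.
by apply/quot_piP; rewrite addrAC subrr add0r opprB.
Qed.

Lemma quot_pi_nbhs x (U : set A) : nbhs x U -> nbhs (quot_pi x) (quot_pi @` U).
Proof.
rewrite nbhsE => -[V [oV Vx] VU].
apply: filterS (image_subset quot_pi VU) _; apply: open_nbhs_nbhs.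
by split; [exact: quot_pi_open|exists x].
Qed.

Fact quot_sub_continuous :
  continuous (fun z : quotient_group * quotient_group => z.1 - z.2).
Proof.
move=> [x y] U /=; rewrite -[x]quot_reprK -[y]quot_reprK.
set a := quot_repr x; set b := quot_repr y.
rewrite -quot_pi_opp -quot_pi_add => /quot_pi_continuous.
move=> /nbhs_sub[V [W [Va Wb VWU]]].
exists (quot_pi @` V, quot_pi @` W); first by split; exact: quot_pi_nbhs.
move=> [_ _] [/= [v Vv <-] [w Ww <-]] /=.
by rewrite -quot_pi_opp -quot_pi_add; exact: VWU.
Qed.

HB.instance Definition _ :=
  PreTopologicalNmodule_isTopologicalZmodule.Build quotient_group
    quot_sub_continuous.

Fact quot_hausdorff : hausdorff_space quotient_group.
Proof.
move=> p q; rewrite -[p]quot_reprK -[q]quot_reprK.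
set x := quot_repr p; set y := quot_repr q => clxy.
apply/quot_piP; apply: contrapT => nHxy.
have /nbhs_sub[V [W [Vx Wy VWH]]] : nbhs (x - y) (~` H).
  by apply: open_nbhs_nbhs; split => //; apply: closed_openC; exact: cs_closed.
have [_ [[v Vv <-] [w Ww /quot_piP Hwv]]] :=
  clxy _ _ (quot_pi_nbhs Vx) (quot_pi_nbhs Wy).
by apply: (VWH _ _ Vv Ww); rewrite -opprB; exact: csN.
Qed.

HB.instance Definition _ := isHausdorff.Build quotient_group quot_hausdorff.

Definition quot_map : tophom A quotient_group :=
  TopHom quot_pi_continuous quot_pi_add.

End SubgroupTheory.

Fact sub_hausdorff (A : tabType) (H : csubgroup A) :
  hausdorff_space (subgroup_type H).
Proof.
apply: separated_hausdorff => x y xy; exists A, (fun z => \val z).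
split; [exact: hausdorffP|exact: sub_val_continuous|].
by move=> /val_inj.
Qed.

HB.instance Definition _ (A : tabType) (H : csubgroup A) :=
  isHausdorff.Build (subgroup_type H) (@sub_hausdorff A H).

HB.instance Definition _ (R : realType) :=
  isHausdorff.Build R (@norm_hausdorff _ R).

Section DiscreteGroup.
Variable V : zmodType.

HB.instance Definition _ := GRing.Zmodule.copy (discrete_topology V) V.

Fact discrete_sub_continuous : continuous
  (fun z : discrete_topology V * discrete_topology V => z.1 - z.2).
Proof.
move=> [x y] U /= /nbhs_singleton Uxy.
exists ([set x], [set y]); first by split; exact: discrete_set1.
by move=> [_ _] [/= -> ->].
Qed.

HB.instance Definition _ :=
  PreTopologicalNmodule_isTopologicalZmodule.Build (discrete_topology V)
    discrete_sub_continuous.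

HB.instance Definition _ :=
  isHausdorff.Build (discrete_topology V) discrete_hausdorff.

End DiscreteGroup.

(* [prod] already carries the library's Tvs instances, hence the alias. *)
Definition pair_group (A B : topologicalZmodType) : Type := (A * B)%type.

Section PairGroup.
Variables A B : topologicalZmodType.

HB.instance Definition _ := Topological.copy (pair_group A B) (A * B)%type.
HB.instance Definition _ := GRing.Zmodule.copy (pair_group A B) (A * B)%type.

Fact pair_sub_continuous :
  continuous (fun z : pair_group A B * pair_group A B => z.1 - z.2).
Proof.
move=> [[a b] [a' b']] U /= [[UA UB] /= [Ua Ub] UAB].
have [V [V' [Va Va' VU]]] := nbhs_sub Ua.
have [W [W' [Wb Wb' WU]]] := nbhs_sub Ub.
exists (V `*` W, V' `*` W') => /=.
  by split; [exists (V, W)|exists (V', W')].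
move=> [[v w] [v' w']] [/= [Vv Ww] [Vv' Ww']].
by apply: UAB; split => /=; [exact: VU|exact: WU].
Qed.

HB.instance Definition _ :=
  PreTopologicalNmodule_isTopologicalZmodule.Build (pair_group A B)
    pair_sub_continuous.

End PairGroup.

Fact pair_hausdorff (A B : tabType) : hausdorff_space (pair_group A B).
Proof.
apply: separated_hausdorff => -[a b] [a' b'] abN.
have [aa'|aa'] := eqVneq a a'.
  exists B, snd; split; [exact: hausdorffP|by move=> [u v]; exact: cvg_snd|].
  by move=> /= bb'; apply: abN; rewrite aa' bb'.
exists A, fst; split; [exact: hausdorffP|by move=> [u v]; exact: cvg_fst|].
by move=> /= aa; rewrite aa eqxx in aa'.
Qed.

HB.instance Definition _ (A B : tabType) :=
  isHausdorff.Build (pair_group A B) (@pair_hausdorff A B).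

Definition prod_group (I : eqType) (T : I -> topologicalZmodType) : Type :=
  prod_topology T.

Section ProdGroup.
Variables (I : eqType) (T : I -> topologicalZmodType).
Local Notation P := (prod_group T).

HB.instance Definition _ := Topological.copy P (prod_topology T).

Definition prod_zero : P := fun i => 0.
Definition prod_opp (x : P) : P := fun i => - x i.
Definition prod_plus (x y : P) : P := fun i => x i + y i.

Fact prod_plusA : associative prod_plus.
Proof.
by move=> x y z; apply: functional_extensionality_dep => i; exact: addrA.
Qed.
Fact prod_plusC : commutative prod_plus.
Proof.
by move=> x y; apply: functional_extensionality_dep => i; exact: addrC.
Qed.
Fact prod_plus0 : left_id prod_zero prod_plus.
Proof.
by move=> x; apply: functional_extensionality_dep => i; exact: add0r.
Qed.
Fact prod_plusN : left_inverse prod_zero prod_opp prod_plus.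
Proof.
by move=> x; apply: functional_extensionality_dep => i; exact: addNr.
Qed.

HB.instance Definition _ := GRing.isZmodule.Build P
  prod_plusA prod_plusC prod_plus0 prod_plusN.

Lemma prod_cvgP (F : set_system P) (x : P) : Filter F ->
  (F --> x) <-> forall i (U : set (T i)), nbhs (x i) U -> F [set y | U (y i)].
Proof.
move=> FF; split=> [Fx i U Ui|Fx].
  by apply: Fx; exact: (@proj_continuous I T i x).
apply/cvg_sup => i U; rewrite nbhsE => -[_ [[V oV <-] /= Vx] VU].
apply: (@filterS _ F _ _ _ VU).
by apply: (Fx i V); exact: open_nbhs_nbhs.
Qed.

Lemma prod_proj_continuous i : continuous (fun x : P => x i).
Proof. exact: (@proj_continuous I T i). Qed.

Fact prod_sub_continuous : continuous (fun z : P * P => z.1 - z.2).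
Proof.
move=> [x y]; apply/prod_cvgP => i U.
move=> /nbhs_sub[V [W [Vx Wy VWU]]].
exists ([set z : P | V (z i)], [set z : P | W (z i)]).
  by split; exact: prod_proj_continuous.
by move=> [v w] [/= Vv Ww]; exact: VWU.
Qed.

HB.instance Definition _ :=
  PreTopologicalNmodule_isTopologicalZmodule.Build P prod_sub_continuous.

End ProdGroup.

Fact prod_hausdorff (I : eqType) (T : I -> tabType) :
  hausdorff_space (prod_group T).
Proof. by apply: hausdorff_product => i; exact: hausdorffP. Qed.

HB.instance Definition _ (I : eqType) (T : I -> tabType) :=
  isHausdorff.Build (prod_group T) (@prod_hausdorff I T).

(* Restricted product of the G i with respect to open subgroups H i; a basis of
   its topology consists of the boxes prod_i V i with V i open for all i and
   V i = H i for almost all i. *)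
Record osubgroup (A : topologicalZmodType) := OSubgroup {
  os_set :> set A;
  os0 : os_set 0;
  osB : forall x y, os_set x -> os_set y -> os_set (x - y);
  os_open : open os_set }.

Section RestrictedProduct.
Variables (I : eqType) (G : I -> topologicalZmodType).
Variable H : forall i, osubgroup (G i).

Definition restricted_set : set (prod_group G) :=
  [set x | finite_set [set i | ~ os_set (H i) (x i)]].

Definition restricted_product : Type := set_type restricted_set.
Local Notation P := restricted_product.

HB.instance Definition _ := SubChoice.copy P (set_type restricted_set).

Definition restr_val (x : P) : prod_group G := \val x.

Lemma restr_valP (x : P) : finite_set [set i | ~ os_set (H i) (restr_val x i)].
Proof. by have := valP x => /set_mem. Qed.

Definition restr_mk x (Px : restricted_set x) : P := exist _ x (mem_set Px).

Fact restr_zeroP : restricted_set 0.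
Proof.
rewrite /restricted_set /= (_ : mkset _ = set0); first exact: finite_set0.
by apply/seteqP; split=> i //= /(_ (os0 (H i))).
Qed.

Fact restr_subP x y :
  restricted_set x -> restricted_set y -> restricted_set (x - y).
Proof.
move=> fx fy; apply: (@sub_finite_set _ _
  ([set i | ~ os_set (H i) (x i)] `|` [set i | ~ os_set (H i) (y i)])).
  move=> i /= nH; apply: contrapT => /not_orP[/contrapT Hx /contrapT Hy].
  by apply: nH; exact: osB.
by rewrite finite_setU.
Qed.

Fact restr_oppP x : restricted_set x -> restricted_set (- x).
Proof. by move=> fx; rewrite -[- x]add0r; exact: (restr_subP restr_zeroP). Qed.

Fact restr_addP x y :
  restricted_set x -> restricted_set y -> restricted_set (x + y).
Proof. by move=> fx /restr_oppP fy; rewrite -[y]opprK; exact: restr_subP. Qed.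

Definition restr_zero : P := restr_mk restr_zeroP.
Definition restr_opp (x : P) : P := restr_mk (restr_oppP (restr_valP x)).
Definition restr_plus (x y : P) : P :=
  restr_mk (restr_addP (restr_valP x) (restr_valP y)).

Fact restr_plusA : associative restr_plus.
Proof. by move=> x y z; apply: val_inj; exact: addrA. Qed.
Fact restr_plusC : commutative restr_plus.
Proof. by move=> x y; apply: val_inj; exact: addrC. Qed.
Fact restr_plus0 : left_id restr_zero restr_plus.
Proof. by move=> x; apply: val_inj; exact: add0r. Qed.
Fact restr_plusN : left_inverse restr_zero restr_opp restr_plus.
Proof. by move=> x; apply: val_inj; exact: addNr. Qed.

HB.instance Definition _ := GRing.isZmodule.Build P
  restr_plusA restr_plusC restr_plus0 restr_plusN.

Lemma restr_valB (x y : P) i :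
  restr_val (x - y) i = restr_val x i - restr_val y i.
Proof. by []. Qed.

Definition restr_box (V : forall i, set (G i)) : set P :=
  [set x | forall i, V i (restr_val x i)].

Definition basic_box (V : forall i, set (G i)) : Prop :=
  (forall i, open (V i)) /\ finite_set [set i | V i <> H i :> set _].

Definition restr_open : set_system P :=
  [set U | forall x, U x -> exists V,
    [/\ basic_box V, restr_box V x & restr_box V `<=` U]].

Fact restr_openT : restr_open setT.
Proof.
move=> x _; have fx := restr_valP x.
exists (fun i => if pselect (os_set (H i) (restr_val x i)) then os_set (H i)
   else setT).
split=> //; last by move=> i /=; case: pselect.
split=> [i /=|].
  by case: pselect => ? /=; [exact: os_open|exact: openT].
by apply: sub_finite_set fx => i /=; case: pselect.
Qed.

Fact restr_openI : setI_closed restr_open.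
Proof.
move=> U W oU oW x [/oU[V [[oV fV] Vx VU]] /oW[V' [[oV' fV'] V'x VW]]].
exists (fun i => V i `&` V' i); split=> [|i|y Vy]; last 2 first.
- by split; [exact: Vx|exact: V'x].
- by split; [apply: VU|apply: VW] => i; case: (Vy i).
split=> [i|]; first exact: openI.
apply: (@sub_finite_set _ _ ([set i | V i <> H i :> set _] `|`
                             [set i | V' i <> H i :> set _])).
  move=> i /= nVH; apply: contrapT => /not_orP[/contrapT VH /contrapT V'H].
  by apply: nVH; rewrite VH V'H setIid.
by rewrite finite_setU.
Qed.

Fact restr_open_bigU (J : Type) (f : J -> set P) :
  (forall j, restr_open (f j)) -> restr_open (\bigcup_j f j).
Proof.
move=> of_ x [j _ /of_[V [bV Vx Vf]]]; exists V; split=> // y Vy.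
by exists j => //; exact: Vf.
Qed.

HB.instance Definition _ := isOpenTopological.Build P
  restr_openT restr_openI restr_open_bigU.

Lemma restr_nbhsP (x : P) (U : set P) : nbhs x U <->
  exists V, [/\ basic_box V, restr_box V x & restr_box V `<=` U].
Proof.
rewrite nbhsE; split=> [[W [oW Wx] WU]|[V [bV Vx VU]]].
  have [V [bV Vx VW]] := oW x Wx; exists V; split=> //.
  exact: subset_trans WU.
have oV : restr_open (restr_box V) by move=> y Vy; exists V; split.
by exists (restr_box V) => //; split.
Qed.

Lemma restr_proj_continuous i : continuous (fun x : P => restr_val x i).
Proof.
move=> x U; rewrite /= nbhsE => -[W [oW Wx] WU].
have fx := restr_valP x.
apply/restr_nbhsP.
pose V0 j : set (G j) :=
  if pselect (os_set (H j) (restr_val x j)) then os_set (H j) else setT.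
have V0x j : V0 j (restr_val x j) by rewrite /V0; case: pselect.
have oV0 j : open (V0 j).
  by rewrite /V0; case: pselect => ? /=; [exact: os_open|exact: openT].
exists (fun j => V0 j `&` [set y | forall e : i = j, W (ecast k (G k) (esym e) y)]).
split.
- split=> [j|].
    apply: openI => //; have [ij|ij] := eqVneq i j.
      case: _ / ij; rewrite (_ : [set y | _] = W)//.
      apply/seteqP; split => y /=; first by move=> /(_ erefl).
      by move=> Wy e; rewrite (eq_irrelevance e erefl).
    rewrite (_ : [set y | _] = setT); first exact: openT.
    by apply/seteqP; split => y //= _ e; rewrite e eqxx in ij.
  apply: (@sub_finite_set _ _ ([set j | ~ os_set (H j) (restr_val x j)] `|`
                               [set i])).
    move=> j /= nV; apply: contrapT => /not_orP[/contrapT Hx ij].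
    apply: nV; rewrite (_ : [set y | _] = setT) ?setIT.
      by rewrite /V0; case: pselect.
    by apply/seteqP; split => y //= _ e; case: ij; rewrite e.
  by rewrite finite_setU; split=> //; exact: finite_set1.
- by move=> j; split=> // e; case: _ / e.
- by move=> y /(_ i) [_ /(_ erefl)] /= /WU.
Qed.

Fact restr_sub_continuous : continuous (fun z : P * P => z.1 - z.2).
Proof.
move=> [x y] U /= /restr_nbhsP[V [[oV fV] Vxy VU]].
have loc i : exists PQ : set (G i) * set (G i),
    [/\ open PQ.1 /\ PQ.1 (restr_val x i), open PQ.2 /\ PQ.2 (restr_val y i),
        forall p q, PQ.1 p -> PQ.2 q -> V i (p - q) &
        V i = H i :> set _ -> os_set (H i) (restr_val x i) ->
        os_set (H i) (restr_val y i) ->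
        PQ.1 = H i :> set _ /\ PQ.2 = H i :> set _].
  have [[VH Hx Hy]|nH] := pselect [/\ V i = H i :> set _,
      os_set (H i) (restr_val x i) & os_set (H i) (restr_val y i)].
    exists (os_set (H i), os_set (H i)); split=> //=.
    - by split=> //; exact: os_open.
    - by split=> //; exact: os_open.
    - by rewrite VH; exact: osB.
  have : nbhs (restr_val x i - restr_val y i) (V i).
    by apply: open_nbhs_nbhs; split; [exact: oV|rewrite -restr_valB; exact: Vxy].
  move=> /nbhs_sub[P0 [Q0 []]].
  rewrite !nbhsE => -[P1 [oP1 P1x] P10] -[Q1 [oQ1 Q1y] Q10] PQV.
  exists (P1, Q1); split=> //=.
    by move=> p q /P10 P0p /Q10 Q0q; exact: PQV.
  by move=> VH Hx Hy; case: nH.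
pose PQ i := projT1 (cid (loc i)).
have PQP i := projT2 (cid (loc i)).
have finPQ : finite_set ([set i | V i <> H i :> set _] `|`
    [set i | ~ os_set (H i) (restr_val x i)] `|`
    [set i | ~ os_set (H i) (restr_val y i)]).
  by rewrite !finite_setU; split; [split=> //|]; exact: restr_valP.
exists (restr_box (fun i => (PQ i).1), restr_box (fun i => (PQ i).2)).
  split=> /=; apply/restr_nbhsP.
    exists (fun i => (PQ i).1); split=> // [|i]; last by case: (PQP i) => -[].
    split=> [i|]; first by case: (PQP i) => -[].
    apply: sub_finite_set finPQ => i /= nP; apply: contrapT.
    move=> /not_orP[/not_orP[/contrapT VH /contrapT Hx] /contrapT Hy].
    by apply: nP; case: (PQP i) => _ _ _ /(_ VH Hx Hy)[].
  exists (fun i => (PQ i).2); split=> // [|i]; last by case: (PQP i) => _ -[].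
  split=> [i|]; first by case: (PQP i) => _ -[].
  apply: sub_finite_set finPQ => i /= nP; apply: contrapT.
  move=> /not_orP[/not_orP[/contrapT VH /contrapT Hx] /contrapT Hy].
  by apply: nP; case: (PQP i) => _ _ _ /(_ VH Hx Hy)[].
move=> [p q] [/= Pp Qq]; apply: VU => i; rewrite restr_valB.
by case: (PQP i) => _ _ PQV _; exact: (PQV _ _ (Pp i) (Qq i)).
Qed.

HB.instance Definition _ :=
  PreTopologicalNmodule_isTopologicalZmodule.Build P restr_sub_continuous.

End RestrictedProduct.

Fact restr_hausdorff (I : eqType) (G : I -> tabType)
    (H : forall i, osubgroup (G i)) : hausdorff_space (restricted_product H).
Proof.
apply: separated_hausdorff => x y xy.
have [i xyi] : exists i, restr_val x i <> restr_val y i.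
  apply: contrapT => nxy; apply: xy; apply: val_inj.
  apply: functional_extensionality_dep => i.
  by apply: contrapT => xyi; apply: nxy; exists i.
exists (G i), (fun z => restr_val z i).
by split; [exact: hausdorffP|exact: restr_proj_continuous|].
Qed.

HB.instance Definition _ (I : eqType) (G : I -> tabType)
    (H : forall i, osubgroup (G i)) :=
  isHausdorff.Build (restricted_product H) (@restr_hausdorff I G H).

Definition rational_group : tabType := discrete_topology rat.

(* p^k Z_(p), where Z_(p) is the localization of Z at p. *)
Definition padic_ball_set (p k : nat) : set rat :=
  [set q | exists (a : int) (b : nat),
     ~~ (p %| b)%N /\ q = (p ^ k)%:R * (a%:~R / b%:R)].

Section PadicBall.
Variables (p : {p : nat | prime p}) (k : nat).
Let pr_p : prime (\val p) := valP p.

Fact padic_ball0 : padic_ball_set (\val p) k 0.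
Proof.
exists 0, 1%N; split; first by rewrite dvdn1 neq_ltn prime_gt1 ?orbT.
by rewrite mul0r mulr0.
Qed.

Fact padic_ballB x y : padic_ball_set (\val p) k x ->
  padic_ball_set (\val p) k y -> padic_ball_set (\val p) k (x - y).
Proof.
move=> [a [b [pb ->]]] [c [d [pd ->]]].
exists (a * d%:Z - c * b%:Z), (b * d)%N; split.
  by rewrite Euclid_dvdM // negb_or pb.
have nz n : ~~ (\val p %| n)%N -> n%:R != 0 :> rat.
  by apply: contraNneq => /eqP; rewrite pnatr_eq0 => /eqP ->; rewrite dvdn0.
rewrite -mulrBr; congr (_ * _).
by rewrite -mulNr addf_div ?nz// natrM rmorphB !rmorphM /= mulNr.
Qed.

Definition padic_ball : csubgroup rational_group :=
  @CSubgroup rational_group (padic_ball_set (\val p) k) padic_ball0 padic_ballB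
    (@discrete_closed (discrete_topology rat) _).

End PadicBall.

Section Padic.
Variable p : {p : nat | prime p}.

(* The additive group of Q_p, as the completion of Q for the p-adic topology:
   the inverse limit over k of the discrete groups Q / p^k Z_(p). The subgroup
   Z_p is the kernel of the projection to Q / Z_(p). *)
Definition padic_tower : tabType :=
  prod_group (fun k : nat => quotient_group (padic_ball p k)).

Definition padic_set : set padic_tower :=
  [set x | forall k, quot_pi (padic_ball p k) (quot_repr (x k.+1)) = x k].

Lemma padic_ballS k q :
  cs_set (padic_ball p k.+1) q -> cs_set (padic_ball p k) q.
Proof.
move=> [a [b [pb ->]]]; exists ((\val p)%:Z * a), b; split => //.
by rewrite expnSr natrM rmorphM /= !mulrA.
Qed.

Lemma padic_setP (x : padic_tower) : padic_set x <->
  forall k, exists2 q : rational_group, quot_pi (padic_ball p k.+1) q = x k.+1 &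
                             quot_pi (padic_ball p k) q = x k.
Proof.
split=> [xP k|xP k].
  by exists (quot_repr (x k.+1)); [exact: quot_reprK|exact: xP].
have [q <- <-] := xP k; apply/quot_piP; apply: padic_ballS.
exact: quot_repr_pi.
Qed.

Fact padic0 : padic_set 0.
Proof. by apply/padic_setP => k; exists 0. Qed.

Fact padicB x y : padic_set x -> padic_set y -> padic_set (x - y).
Proof.
move=> /padic_setP xP /padic_setP yP; apply/padic_setP => k.
have [q q1 q0] := xP k; have [r r1 r0] := yP k.
exists (q - r).
  by rewrite quot_pi_add quot_pi_opp q1 r1.
by rewrite quot_pi_add quot_pi_opp q0 r0.
Qed.

Lemma quot_discrete k (U : set (quotient_group (padic_ball p k))) : open U.
Proof. exact: (@discrete_open (discrete_topology rat)). Qed.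

Fact padic_closed : closed padic_set.
Proof.
move=> x clx k.
have nk j : nbhs x [set y : padic_tower | y j = x j].
  have : nbhs (x j) [set x j].
    by apply: open_nbhs_nbhs; split => //; exact: quot_discrete.
  by move=> /(@prod_proj_continuous _ _ j x).
have [y [yP [<- <-]]] := clx _ (filterI (nk k.+1) (nk k)).
exact: yP.
Qed.

Definition padic_subgroup : csubgroup padic_tower :=
  CSubgroup padic0 padicB padic_closed.

Definition padic : tabType := subgroup_type padic_subgroup.

Definition padic_int_set : set padic :=
  [set x | (\val x : padic_tower) 0%N = 0].

Fact padic_int0 : padic_int_set 0. Proof. by []. Qed.

Fact padic_intB x y :
  padic_int_set x -> padic_int_set y -> padic_int_set (x - y).
Proof.
move=> x0 y0; rewrite /padic_int_set /=.
transitivity ((\val x : padic_tower) 0%N - (\val y : padic_tower) 0%N) => //.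
by rewrite x0 y0 subrr.
Qed.

Fact padic_int_open : open padic_int_set.
Proof.
have -> : padic_int_set =
  (fun x : padic => (\val x : padic_tower) 0%N) @^-1` [set 0] by [].
apply: open_comp; last exact: quot_discrete.
move=> x _; apply: (@continuous_comp padic padic_tower _ (fun x => \val x)
  (fun y => y 0%N)).
  exact: sub_val_continuous.
exact: prod_proj_continuous.
Qed.

Definition padic_int : osubgroup padic :=
  OSubgroup padic_int0 padic_intB padic_int_open.

Fact padic_of_ratP (q : rat) :
  padic_set (fun k => quot_pi (padic_ball p k) q).
Proof. by apply/padic_setP => k; exists q. Qed.

Definition padic_of_rat (q : rat) : padic :=
  @subgroup_sub _ padic_subgroup _ (padic_of_ratP q).

Lemma padic_of_rat_int q :
  padic_int_set (padic_of_rat q) <-> padic_ball_set (\val p) 0 q.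
Proof.
rewrite /padic_int_set /=; split=> [/quot_piP|Hq].
  by rewrite /= subr0.
by apply/quot_piP; rewrite /= subr0.
Qed.

Lemma padic_of_ratD : {morph padic_of_rat : x y / x + y}.
Proof.
move=> x y; apply: val_inj; apply: functional_extensionality_dep => k.
exact: quot_pi_add.
Qed.

End Padic.

Lemma discrete_subgroup_closed (A : tabType) (H U : set A) :
  (forall x y, H x -> H y -> H (x - y)) -> nbhs 0 U ->
  (forall x, H x -> U x -> x = 0) -> closed H.
Proof.
move=> HB U0 HU x clx.
have /nbhs_sub[V [W [Vx Wx VWU]]] : nbhs (x - x) U by rewrite subrr.
have [z [Hz [Vz Wz]]] := clx _ (filterI Vx Wx).
suff <- : z = x by [].
apply: hausdorffP => B C zB xC.
have [y [Hy [[Vy Wy] Cy]]] := clx _ (filterI (filterI Vx Wx) xC).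
exists y; split=> //; suff -> : y = z by exact: nbhs_singleton.
by apply/eqP; rewrite -subr_eq0; apply/eqP/HU; [exact: HB|exact: VWU].
Qed.

Definition finite_adele : tabType := restricted_product padic_int.

Definition adele (R : realType) : tabType := pair_group R finite_adele.

Lemma denq_dvd (q : rat) (a : int) (b : nat) :
  b != 0%N -> q = a%:~R / b%:R -> (`|denq q| %| b)%N.
Proof.
move=> b0 qE; have bR : b%:R != 0 :> rat by rewrite pnatr_eq0.
have /eqP : numq q * b%:Z = a * denq q.
  apply/eqP; rewrite -(eqr_int rat) !rmorphM /=; apply/eqP.
  apply: (@mulIf _ (denq q)%:~R^-1); first by rewrite invr_eq0 intr_eq0 denq_eq0.
  rewrite -[RHS]mulrA divff ?intr_eq0 ?denq_eq0// mulr1 mulrAC divq_num_den.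
  by rewrite {1}qE -mulrA mulVf// mulr1.
move=> /eqP /(congr1 absz); rewrite !abszM absz_nat => nb.
have : (`|denq q| %| `|numq q| * b)%N by rewrite nb dvdn_mull.
by rewrite Gauss_dvdr // coprime_sym; exact: coprime_num_den.
Qed.

Lemma padic_ball_denq (p : nat) (q : rat) : prime p ->
  padic_ball_set p 0 q <-> ~~ (p %| `|denq q|)%N.
Proof.
move=> pr_p; split=> [[a [b [pb qE]]]|pd].
  rewrite expn0 mul1r in qE.
  have b0 : b != 0%N by apply: contraNneq pb => ->; rewrite dvdn0.
  by apply: contra pb => /dvdn_trans; apply; exact: denq_dvd qE.
exists (numq q), `|denq q|%N; split=> //.
rewrite expn0 mul1r -[LHS]divq_num_den; congr (_ / _).
by rewrite -[in LHS](gtz0_abs (denq_gt0 q)) natr_absz abszE.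
Qed.

Fact diagonal_finP (q : rat) :
  restricted_set padic_int (fun p => padic_of_rat p q).
Proof.
rewrite /restricted_set /=.
apply: (@sub_finite_set _ _ (val @^-1` `I_(`|denq q|.+1)%N)).
  move=> p /= nint; rewrite ltnS; apply: dvdn_leq.
    by rewrite absz_gt0 denq_eq0.
  apply: contrapT => /negP pd; apply: nint; apply/padic_of_rat_int.
  exact/(padic_ball_denq _ (valP p)).
apply: finite_preimage; last exact: finite_II.
by move=> x y _ _; exact: val_inj.
Qed.

Definition finite_diagonal (q : rat) : finite_adele := restr_mk (diagonal_finP q).

Lemma finite_diagonalD : {morph finite_diagonal : x y / x + y}.
Proof.
move=> x y; apply: val_inj; apply: functional_extensionality_dep => p.
exact: padic_of_ratD.
Qed.

Section Adele.
Variable R : realType.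

Definition diagonal_fun (q : rational_group) : adele R :=
  (ratr (q : rat), finite_diagonal q).

Fact diagonal_continuous : continuous diagonal_fun.
Proof.
move=> q U /nbhs_singleton Uq.
apply: (@filterS _ (nbhs q) _ [set q]) => [_ ->//|].
exact: (@discrete_set1 (discrete_topology rat)).
Qed.

Fact diagonalD : {morph diagonal_fun : x y / x + y}.
Proof.
move=> x y; rewrite /diagonal_fun finite_diagonalD.
congr pair; exact: rmorphD.
Qed.

Definition diagonal : tophom rational_group (adele R) :=
  TopHom diagonal_continuous diagonalD.

Fact range_diagonal0 : range diagonal 0.
Proof. by exists 0 => //; rewrite tophom0. Qed.

Fact range_diagonalB x y :
  range diagonal x -> range diagonal y -> range diagonal (x - y).
Proof.
by move=> [q _ <-] [r _ <-]; exists (q - r) => //; rewrite tophomB.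
Qed.

(* Q is discrete in the adeles: a rational of absolute value < 1 that is
   integral at all primes is 0. *)
Lemma diagonal_discrete : exists2 U, nbhs (0 : adele R) U &
  forall q, U (diagonal q) -> q = 0.
Proof.
exists ([set x : R | `|x| < 1] `*`
  restr_box (fun p => os_set (padic_int p) : set (padic p))).
  exists ([set x : R | `|x| < 1],
          restr_box (fun p => os_set (padic_int p) : set (padic p))) => //.
  split => /=.
    apply/nbhs_ballP; exists 1 => //= x.
    by rewrite /ball /= sub0r normrN.
  apply/restr_nbhsP; exists (fun p => os_set (padic_int p)).
  split=> //.
  split=> [p|]; first exact: os_open.
  rewrite (_ : mkset _ = set0); first exact: finite_set0.
  by apply/seteqP; split=> p //= /(_ erefl).
move=> q [/= q1 qint].
have dq : `|denq q|%N = 1%N.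
  apply/eqP; rewrite eqn_leq absz_gt0 denq_eq0 andbT leqNgt; apply/negP => d1.
  have pr := pdiv_prime d1.
  have /padic_of_rat_int/(padic_ball_denq _ pr) := qint (exist (fun p : nat => prime p) _ pr).
  by rewrite pdiv_dvd.
have qE : q = (numq q)%:~R :> rat.
  rewrite -[LHS]divq_num_den -[denq q in LHS](gtz0_abs (denq_gt0 q)).
  by rewrite dq divr1.
move: q1; rewrite qE ratr_int -intr_norm -[1]/(1%:~R) ltr_int => q1.
suff -> : numq q = 0 by [].
by move: q1; case: (numq q) => -[].
Qed.

Fact range_diagonal_closed : closed (range diagonal).
Proof.
have [U U0 Uq] := diagonal_discrete.
apply: (discrete_subgroup_closed range_diagonalB U0) => _ [q _ <-] /Uq ->.
exact: tophom0.
Qed.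

Definition diagonal_subgroup : csubgroup (adele R) :=
  CSubgroup range_diagonal0 range_diagonalB range_diagonal_closed.

Definition adele_class_group : tabType := quotient_group diagonal_subgroup.

End Adele.

Section Circle.
Variable R : realType.

Definition integer_set : set R := range intr.

Fact integer0 : integer_set 0. Proof. by exists 0. Qed.

Fact integerB x y : integer_set x -> integer_set y -> integer_set (x - y).
Proof. by move=> [m _ <-] [n _ <-]; exists (m - n) => //; rewrite rmorphB. Qed.

Fact integer_closed : closed integer_set.
Proof.
apply: (@discrete_subgroup_closed R _ [set x : R | `|x| < 1] integerB).
  by apply/nbhs_ballP; exists 1 => //= x; rewrite /ball /= sub0r normrN.
move=> _ [m _ <-] /=; rewrite -intr_norm -[1]/(1%:~R) ltr_int.
by case: m => -[].
Qed.

Definition integer_subgroup : csubgroup R :=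
  CSubgroup integer0 integerB integer_closed.

Definition circle : tabType := quotient_group integer_subgroup.

Definition pontryagin_dual (A : topologicalZmodType) : tabType := tophom A circle.

End Circle.

Definition divisible (A : zmodType) : Prop :=
  forall n, (0 < n)%N -> forall x : A, exists y, y *+ n = x.

Definition codivisible (R : realType) (A : topologicalZmodType) : Prop :=
  divisible (pontryagin_dual R A).

Section HomTheory.

Lemma hom_comp_continuous (A B C : topologicalZmodType)
  (g : tophom B C) (f : tophom A B) : continuous (fun x => g (f x)).
Proof. by move=> x; apply: continuous_comp; exact: hom_cont. Qed.

Lemma hom_comp_add (A B C : topologicalZmodType)
  (g : tophom B C) (f : tophom A B) : {morph (fun x => g (f x)) : x y / x + y}.
Proof. by move=> x y; rewrite !hom_add. Qed.

Definition hom_comp (A B C : topologicalZmodType)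
    (g : tophom B C) (f : tophom A B) : tophom A C :=
  TopHom (@hom_comp_continuous _ _ _ g f) (@hom_comp_add _ _ _ g f).

Definition hom_id (A : topologicalZmodType) : tophom A A :=
  @TopHom A A id (fun x => cvg_id) (fun x y => erefl).

Lemma hom_post_continuous (A B C : topologicalZmodType) (g : tophom B C) :
  continuous (fun f : tophom A B => hom_comp g f).
Proof.
move=> f; apply/(tophom_cvgP _ (fmap_filter _ (nbhs_filter f))) => K V cK oV fKV.
have /tophom_cvgP/(_ K (g @^-1` V) cK) := @cvg_id _ (nbhs f).
have oW : open (g @^-1` V).
  by apply: open_comp => // x _; exact: hom_cont.
move=> /(_ oW); set N := [set h : tophom A B | h @` K `<=` g @^-1` V].
have fN : f @` K `<=` g @^-1` V.
  by move=> _ [x Kx <-] /=; apply: fKV; exists x.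
move=> /(_ fN); apply: (@filterS _ (nbhs f)) => h hN _ [x Kx <-] /=.
by apply: hN; exists x.
Qed.

Lemma hom_post_add (A B C : topologicalZmodType) (g : tophom B C) :
  {morph (fun f : tophom A B => hom_comp g f) : f h / f + h}.
Proof. by move=> f h; apply: tophom_eq => x /=; exact: hom_add. Qed.

Lemma hom_pre_continuous (A B C : topologicalZmodType) (f : tophom A B) :
  continuous (fun g : tophom B C => hom_comp g f).
Proof.
move=> g; apply/(tophom_cvgP _ (fmap_filter _ (nbhs_filter g))) => K V cK oV gKV.
have cfK : compact (f @` K).
  apply: continuous_compact => //.
  by apply: continuous_subspaceT => x; exact: hom_cont.
have gN : g @` (f @` K) `<=` V.
  by move=> _ [_ [x Kx <-] <-]; apply: gKV; exists x.
have /tophom_cvgP/(_ (f @` K) V cfK oV gN) := @cvg_id _ (nbhs g).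
apply: (@filterS _ (nbhs g)) => h hN _ [x Kx <-] /=.
by apply: hN; exists (f x) => //; exists x.
Qed.

Lemma hom_pre_add (A B C : topologicalZmodType) (f : tophom A B) :
  {morph (fun g : tophom B C => hom_comp g f) : g h / g + h}.
Proof. by move=> g h; apply: tophom_eq. Qed.

Definition hom_post (A B C : topologicalZmodType) (g : tophom B C) :
    tophom (tophom A B) (tophom A C) :=
  TopHom (@hom_post_continuous A B C g) (@hom_post_add A B C g).

Definition hom_pre (A B C : topologicalZmodType) (f : tophom A B) :
    tophom (tophom B C) (tophom A C) :=
  TopHom (@hom_pre_continuous A B C f) (@hom_pre_add A B C f).

Definition prod_proj (I : eqType) (T : I -> topologicalZmodType) i :
    tophom (prod_group T) (T i) :=
  @TopHom (prod_group T) (T i) (fun x => x i)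
    (@prod_proj_continuous I T i) (fun x y => erefl).

Lemma prod_lift_continuous (A : topologicalZmodType) (I : eqType)
    (T : I -> topologicalZmodType) (f : forall i, tophom A (T i)) :
  continuous (fun x => (fun i => f i x) : prod_group T).
Proof. by move=> x; apply/prod_cvgP => i U /hom_cont. Qed.

Lemma prod_lift_add (A : topologicalZmodType) (I : eqType)
    (T : I -> topologicalZmodType) (f : forall i, tophom A (T i)) :
  {morph (fun x => (fun i => f i x) : prod_group T) : x y / x + y}.
Proof.
by move=> x y; apply: functional_extensionality_dep => i; exact: hom_add.
Qed.

Definition prod_lift (A : topologicalZmodType) (I : eqType)
    (T : I -> topologicalZmodType) (f : forall i, tophom A (T i)) :
    tophom A (prod_group T) :=
  TopHom (@prod_lift_continuous A I T f) (@prod_lift_add A I T f).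

End HomTheory.

Record top_iso (A B : topologicalZmodType) := TopIso {
  iso_hom :> tophom A B;
  iso_inv : tophom B A;
  iso_homK : cancel iso_hom iso_inv;
  iso_invK : cancel iso_inv iso_hom }.

Definition top_iso_id (A : topologicalZmodType) : top_iso A A :=
  @TopIso A A (hom_id A) (hom_id A) (fun x => erefl) (fun x => erefl).

Section Strict.
Variables (A B : tabType) (f : tophom A B).

Fact kernel0 : [set x | f x = 0] 0. Proof. exact: tophom0. Qed.

Fact kernelB x y : f x = 0 -> f y = 0 -> f (x - y) = 0.
Proof. by move=> fx fy; rewrite tophomB fx fy subrr. Qed.

Lemma closed_zero : closed [set 0 : B].
Proof.
move=> x cl0; apply: hausdorffP => U V xU zV.
have [_ [-> U0]] := cl0 _ xU.
by exists 0; split=> //; exact: nbhs_singleton.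
Qed.

Fact kernel_closed : closed [set x | f x = 0].
Proof.
by move/continuous_closedP: (@hom_cont _ _ f) => /(_ _ closed_zero).
Qed.

Definition kernel : csubgroup A := CSubgroup kernel0 kernelB kernel_closed.

Definition coimage_map (x : quotient_group kernel) : B := f (quot_repr x).

Lemma coimage_mapE x : coimage_map (quot_pi kernel x) = f x.
Proof.
by apply/eqP; rewrite -subr_eq0 -tophomB; apply/eqP; exact: (@quot_repr_pi _ kernel x).
Qed.

End Strict.

Definition closed_embedding (X Y : topologicalType) (g : X -> Y) : Prop :=
  [/\ injective g,
      forall U, open U <-> exists2 V, open V & U = g @^-1` V &
      closed (range g)].

Definition strict_hom (A B : tabType) (f : tophom A B) : Prop :=
  closed_embedding (@coimage_map A B f).

(* Bounded cochain complexes in TAb. Degrees i, j with a proof of i + 1 = j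
   replace a differential X i -> X (i + 1), which avoids transports. *)
Record bcomplex := BComplex {
  ob :> int -> tabType;
  cdiff : forall i j : int, i + 1 = j -> tophom (ob i) (ob j);
  cdiffK : forall (i j k : int) (ij : i + 1 = j) (jk : j + 1 = k) (x : ob i),
    cdiff jk (cdiff ij x) = 0;
  cbounded : exists N : nat, forall n : int, (N < `|n|)%N ->
    forall x : ob n, x = 0 }.

Arguments cdiff b {i j} ij.

Definition exact_complex (X : bcomplex) : Prop :=
  forall (i j k : int) (ij : i + 1 = j) (jk : j + 1 = k) (x : X j),
    cdiff X jk x = 0 -> exists y, cdiff X ij y = x.

Definition strictly_exact (X : bcomplex) : Prop :=
  exact_complex X /\
  forall (i j : int) (ij : i + 1 = j), strict_hom (cdiff X ij).

Definition zero_group : tabType := discrete_topology 'I_1.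

Lemma zero_groupP (x : zero_group) : x = 0.
Proof. by apply: (@val_inj _ _ 'I_1); case: x => -[]. Qed.

(* [0 -> A1 -> A2 -> A3 -> 0] with A1, A2, A3 in degrees 1, 2, 3. *)
Section Short.
Variables (A1 A2 A3 : tabType) (f : tophom A1 A2) (g : tophom A2 A3).
Hypothesis gf0 : forall x, g (f x) = 0.

Definition short_ob (n : int) : tabType :=
  match n with
  | Posz 1 => A1 | Posz 2 => A2 | Posz 3 => A3 | _ => zero_group
  end.

Definition short_diff (i j : int) :
    tophom (short_ob i) (short_ob j) :=
  match i, j return tophom (short_ob i) (short_ob j) with
  | Posz 1, Posz 2 => f
  | Posz 2, Posz 3 => g
  | _, _ => 0
  end.

Fact short_diffK (i j k : int) : i + 1 = j -> j + 1 = k ->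
  forall x, short_diff j k (short_diff i j x) = 0.
Proof.
move=> <- <-; case: i => [[|[|[|[|n]]]]|[|[|[|n]]]] x //=; exact: tophom0.
Qed.

Fact short_bounded : exists N : nat, forall n : int, (N < `|n|)%N ->
  forall x : short_ob n, x = 0.
Proof.
by exists 3%N => -[[|[|[|[|n]]]]|n] //= _ x; exact: zero_groupP.
Qed.

Definition short_complex : bcomplex :=
  @BComplex short_ob (fun i j _ => short_diff i j) short_diffK short_bounded.

End Short.

Section Single.
Variable A : tabType.

Definition single_ob (n : int) : tabType :=
  if n is Posz 0 then A else zero_group.

Fact single_bounded : exists N : nat, forall n : int, (N < `|n|)%N ->
  forall x : single_ob n, x = 0.
Proof. by exists 0%N => -[[|n]|n] //= _ x; exact: zero_groupP. Qed.

Definition single : bcomplex :=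
  @BComplex single_ob (fun _ _ _ => 0) (fun _ _ _ _ _ _ => erefl)
    single_bounded.

End Single.

Lemma tophom_mulz (X Y : topologicalZmodType) (g : tophom X Y) (z : int) y :
  (g *~ z) y = g y *~ z.
Proof.
case: z => k; rewrite ?NegzE ?mulrNz -?pmulrn /=.
  by elim: k => [|k IHk]; rewrite ?mulr0n // !mulrS -IHk.
by congr (- _); elim: k.+1 => [|l IHl]; rewrite ?mulr0n // !mulrS -IHl.
Qed.

Lemma tophomMz (X Y : topologicalZmodType) (g : tophom X Y) (z : int) y :
  g (y *~ z) = g y *~ z.
Proof.
have gn k : g (y *+ k) = g y *+ k.
  by elim: k => [|k IHk]; rewrite ?mulr0n ?tophom0// !mulrS hom_add IHk.
by case: z => k; rewrite ?NegzE ?mulrNz -?pmulrn ?tophomN gn.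
Qed.

Section HomComplex.
Variables A B : bcomplex.

(* The degree n part of the total complex is the product of the
   Hom(A^p, B^q) with p + n = q. Only finitely many factors are nonzero, so that
   this is also the direct sum. The differential is
   f |-> d_B o f - (-1)^n f o d_A. *)
Definition hom_index (n : int) : Type := {pq : int * int | pq.1 + n == pq.2}.

Definition hom_ob (n : int) : tabType :=
  prod_group (fun i : hom_index n => tophom (A (\val i).1) (B (\val i).2)).

Section Diff.
Variables (n m : int) (nm : n + 1 = m) (i : hom_index m).
Let p := (\val i).1.
Let q := (\val i).2.

Fact hom_index_tgtP : p + n == q - 1.
Proof.
by have /eqP := valP i; rewrite -/p -/q -nm addrA => <-; rewrite addrK.
Qed.

Fact hom_index_srcP : p + 1 + n == q.
Proof.
by have /eqP := valP i; rewrite -/p -/q -nm addrA => <-; rewrite addrAC.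
Qed.

Definition hom_diff_comp : tophom (hom_ob n) (tophom (A p) (B q)) :=
  let tgt : hom_index n := Sub (p, q - 1) hom_index_tgtP in
  let src : hom_index n := Sub (p + 1, q) hom_index_srcP in
  hom_comp (hom_post (A p) (cdiff B (subrK 1 q)))
    (prod_proj (fun i : hom_index n => tophom (A (\val i).1) (B (\val i).2)) tgt)
  - hom_comp (hom_pre (B q) (cdiff A (erefl (p + 1))))
    (prod_proj (fun i : hom_index n => tophom (A (\val i).1) (B (\val i).2)) src)
    *~ ((-1) ^ n).

End Diff.

Definition hom_diff (n m : int) (nm : n + 1 = m) :
    tophom (hom_ob n) (hom_ob m) :=
  prod_lift (hom_diff_comp nm).

Lemma hom_diffE (n m : int) (nm : n + 1 = m) (f : hom_ob n) (i : hom_index m) x :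
  hom_diff nm f i x =
    cdiff B (subrK 1 (\val i).2)
      (f (Sub ((\val i).1, (\val i).2 - 1) (hom_index_tgtP nm i)) x)
    - f (Sub ((\val i).1 + 1, (\val i).2) (hom_index_srcP nm i))
        (cdiff A (erefl ((\val i).1 + 1)) x) *~ (-1) ^ n.
Proof.
rewrite /hom_diff /= /hom_diff_comp.
set src := hom_comp (hom_pre _ _) _; set s := (-1) ^ n.
by rewrite -[f _ (cdiff A _ x)]/(src f x) -!tophom_mulz.
Qed.

Fact hom_diffK (n m k : int) (nm : n + 1 = m) (mk : m + 1 = k) (f : hom_ob n) :
  hom_diff mk (hom_diff nm f) = 0.
Proof.
apply: functional_extensionality_dep => i; apply: tophom_eq => x.
rewrite !hom_diffE /= tophomB !cdiffK tophomMz sub0r tophom0 mul0rz subr0.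
have -> : (-1 : int) ^ m = - (-1) ^ n.
  by rewrite -nm exprzDr ?unitrN1// expr1z mulrN1.
rewrite mulrNz opprK.
set h1 := hom_index_srcP _ _; set h2 := hom_index_tgtP _ _.
by rewrite (bool_irrelevance h1 h2) addNr.
Qed.

Fact hom_bounded : exists N : nat, forall n : int, (N < `|n|)%N ->
  forall f : hom_ob n, f = 0.
Proof.
have [NA A0] := cbounded A; have [NB B0] := cbounded B.
exists (NA + NB)%N => n Nn f.
apply: functional_extensionality_dep => i; apply: tophom_eq => x.
have /eqP pq := valP i.
have [/A0 zA|Ap] := ltnP NA `|(\val i).1|%N; first by rewrite (zA x) !tophom0.
apply: B0; rewrite ltnNge; apply/negP => Bq; move: Nn; apply/negP.
rewrite -leqNgt; have -> : n = (\val i).2 - (\val i).1.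
  by rewrite -pq addrAC subrr add0r.
rewrite addnC; apply: (@leq_trans (`|(\val i).2| + `|(\val i).1|)%N).
  by rewrite -lez_nat PoszD !abszE; exact: ler_normB.
exact: leq_add.
Qed.

Definition hom_complex : bcomplex := BComplex hom_diffK hom_bounded.

End HomComplex.

Section Chain.
Variable R : realType.

Definition discrete_group (A : topologicalZmodType) : Prop :=
  forall U : set A, open U.

Definition torsion_free (A : zmodType) : Prop :=
  forall n, (0 < n)%N -> forall x : A, x *+ n = 0 -> x = 0.

Definition topological_torsion (T : topologicalZmodType) : Prop :=
  forall t : T, (fun k => t *+ k`!) @ \oo --> (0 : T).

Section Restrict.
Variables (A : tabType) (S F : csubgroup A).

Definition restrict_set : set (subgroup_type F) :=
  [set x | cs_set S (\val x)].

Fact restrict0 : restrict_set 0. Proof. exact: cs0. Qed.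

Fact restrictB x y : restrict_set x -> restrict_set y -> restrict_set (x - y).
Proof. by move=> Sx Sy; exact: csB. Qed.

Fact restrict_closed : closed restrict_set.
Proof.
have /continuous_closedP := @sub_val_continuous _ F.
by apply; exact: cs_closed.
Qed.

Definition restrict : csubgroup (subgroup_type F) :=
  CSubgroup restrict0 restrictB restrict_closed.

End Restrict.

Definition euclidean_group (m : nat) : tabType :=
  prod_group (fun _ : 'I_m => R : tabType).

(* The defining properties of S = A_{S^1} and F = F_Z A. *)
Definition canonical_chain (A : lcabType) (S F : csubgroup A) : Prop :=
  [/\ S `<=` F,
      compact S /\ connected S,
      discrete_group (quotient_group F) /\ torsion_free (quotient_group F) &
      exists (m : nat) (T : lcabType), topological_torsion T /\
        inhabited (top_iso (quotient_group (restrict S F))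
                           (pair_group (euclidean_group m) T))].

(* The canonical chain of A exists and is unique: the two predicates below say
   that the term A_{S^1}, respectively A_Z = A / F_Z A, of this chain is 0. *)
Definition S1_part_zero (A : lcabType) : Prop :=
  exists S F : csubgroup A, canonical_chain S F /\ S = [set 0] :> set A.

Definition Z_part_zero (A : lcabType) : Prop :=
  exists S F : csubgroup A,
    canonical_chain S F /\ forall x : quotient_group F, x = 0.

End Chain.

Section AdeleComplex.
Variable R : realType.

Fact adele_complexK (E : tabType) (phi : top_iso (adele_class_group R) E) q :
  hom_comp phi (quot_map (diagonal_subgroup R)) (diagonal R q) = 0.
Proof.
rewrite /= (_ : quot_pi _ _ = 0) ?tophom0//.
by apply/quot_piP; rewrite subr0; exists q.
Qed.

(* The complex Q -> A -> E, where phi identifies A/Q with E: the last term is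
   A/Q itself for phi = id, and the dual of Q for phi : A/Q ~ Q^vee. *)
Definition adele_complex (E : tabType)
    (phi : top_iso (adele_class_group R) E) : bcomplex :=
  short_complex (adele_complexK phi).

End AdeleComplex.

(* Main.v *)
From HB Require Import structures.
Require Import Defs.
From mathcomp Require Import all_boot all_order all_algebra.
From mathcomp Require Import finmap.
From mathcomp Require Import all_classical all_reals all_analysis.
From mathcomp Require Import ring lra zify.
Import numFieldNormedType.Exports.
Set Implicit Arguments.
Unset Strict Implicit.
Unset Printing Implicit Defensive.
Import Order.TTheory GRing.Theory Num.Theory.
Local Open Scope classical_set_scope.
Local Open Scope ring_scope.

(** In each of the four complexes only one slot varies. So, up to signs and a
    shift of degrees, the complex is Hom(C, -) or Hom(-, D) applied to a short
    exact sequence of an embedding i and an open surjection q. A complex is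
    strictly exact once it is exact and its differentials are open onto their
    images ([strictly_exactP]). Hence the content is that homomorphisms lift
    along q, respectively extend from the kernel of q, and that small ones have
    small lifts and extensions ([hom_from_exact], [hom_to_exact]).

    Existence. Both problems ask that Ext(Y, D) vanishes for Y codivisible and D
    divisible ([extension_property]): a lift of f : C -> D3 along q : D2 -> D3
    comes from an extension of the identity of D1 to the fibre product of f and
    q ([hom_lift_exists]). Homomorphisms from G into a compact group L are
    governed by duality: they are the additive maps from the dual of L to the
    dual of G ([hom_to_compact]), and such maps can be corrected or extended as
    soon as the relevant group of characters is divisible
    ([compact_hom_extension], [compact_hom_lift]). If the discrete part of D
    vanishes, then D is an extension of R^m x T, with T a topological torsion
    group, by a compact group. On a compactly generated open subgroup, the real
    coordinates of f extend by a theorem of Hyers type ([real_hom_extension]);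
    what remains after subtracting them has values in a compact subgroup, since
    a compactly generated topological torsion group is compact. The resulting
    homomorphism on an open subgroup is glued with f because D is divisible
    ([hom_glue], [extension_Z_part]). If the compact connected part of Y
    vanishes, then Y has an open subgroup R^m x T0 with T0 compact, over which
    the extension has a section, as one-parameter groups lift and T0 is
    codivisible; the section yields an extension of f to an open subgroup
    ([extension_S1_part]).

    Openness. Near 0, a locally compact group is the sum of one-parameter groups
    and a small compact subgroup ([local_structure]). If the number of
    one-parameter groups is minimal, they provide local coordinates, even on a
    quotient ([local_coordinates]). The coordinates of a homomorphism that is
    small on a large compact subset of a compactly generated group are additive
    there, hence are restrictions of real homomorphisms ([local_hom_lift]). So a
    small homomorphism is a sum of small one-parameter parts and of a
    homomorphism into a small compact subgroup ([small_hom_decomposition]), and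
    each of these extends or lifts with control.

    Duality is used in two forms only: characters separate points, and compact
    groups are reflexive. For compact groups, separation is a theorem of Peter
    and Weyl, obtained from an invariant mean: power iteration of a convolution
    operator gives an idempotent, a minimal idempotent satisfies d'Alembert's
    equation, and its solutions are cosines of characters
    ([compact_characters_separate]). A compactly generated group has a lattice
    with compact quotient ([cocompact_lattice]), which reduces the locally
    compact case to the compact one.

    Finally, multiplication by n is an automorphism of the adeles that preserves
    the rational numbers ([adele_div]), so that the adele class group is
    codivisible. *)

(** * Equations in abelian groups *)

(** Equations in abelian groups are decided by comparing the integral
    coefficients of the atoms on both sides. *)
Inductive zexp := ZVar of nat | ZZero | ZAdd of zexp & zexp | ZOpp of zexp.

Fixpoint zeval (V : zmodType) (env : seq V) (e : zexp) : V :=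
  match e with
  | ZVar i => nth 0 env i
  | ZZero => 0
  | ZAdd a b => zeval env a + zeval env b
  | ZOpp a => - zeval env a
  end.

Fixpoint zcoef (e : zexp) (i : nat) : int :=
  match e with
  | ZVar j => if i == j then 1 else 0
  | ZZero => 0
  | ZAdd a b => zcoef a i + zcoef b i
  | ZOpp a => - zcoef a i
  end.

Lemma zevalE (V : zmodType) (env : seq V) e :
  zeval env e = \sum_(i < size env) env`_i *~ zcoef e i.
Proof.
elim: e => [j||a IHa b IHb|a IHa] /=.
- have [js|js] := ltnP j (size env).
    rewrite (bigD1 (Ordinal js)) //= eqxx mulr1z big1 ?addr0// => i ij.
    have [ijE|_] := eqVneq (nat_of_ord i) j; last by rewrite mulr0z.
    by rewrite -val_eqE /= ijE eqxx in ij.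
  rewrite nth_default// big1// => i _.
  by rewrite ltn_eqF ?mulr0z// (leq_trans (ltn_ord i)).
- by rewrite big1// => i _; rewrite mulr0z.
- by rewrite IHa IHb -big_split; apply: eq_bigr => i _; rewrite mulrzDr.
- by rewrite IHa -sumrN; apply: eq_bigr => i _; rewrite mulrNz.
Qed.

Lemma zeval_eq (V : zmodType) (env : seq V) e f :
  all (fun i => zcoef e i == zcoef f i) (iota 0 (size env)) ->
  zeval env e = zeval env f.
Proof.
move=> /allP ef; rewrite !zevalE; apply: eq_bigr => i _.
by rewrite (eqP (ef i _))// mem_iota /= add0n.
Qed.

Ltac zmod_mem x l :=
  lazymatch l with
  | nil => constr:(false)
  | cons ?y ?t => match goal with
      | _ => let _ := match goal with _ => unify x y end in constr:(true)
      | _ => zmod_mem x t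
      end
  end.

Ltac zmod_atoms t l :=
  lazymatch t with
  | (?a + ?b)%R => let l1 := zmod_atoms a l in zmod_atoms b l1
  | (- ?a)%R => zmod_atoms a l
  | 0%R => l
  | _ => let m := zmod_mem t l in
         lazymatch m with true => l | false => constr:(cons t l) end
  end.

Ltac zmod_index x l :=
  lazymatch l with
  | cons ?y ?t => match goal with
      | _ => let _ := match goal with _ => unify x y end in constr:(0%N)
      | _ => let n := zmod_index x t in constr:(S n)
      end
  end.

Ltac zmod_reify t l :=
  lazymatch t with
  | (?a + ?b)%R => let x := zmod_reify a l in let y := zmod_reify b l in
                   constr:(ZAdd x y)
  | (- ?a)%R => let x := zmod_reify a l in constr:(ZOpp x)
  | 0%R => constr:(ZZero)
  | _ => let n := zmod_index t l in constr:(ZVar n)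
  end.

Ltac zmod :=
  lazymatch goal with
  | |- @eq ?T ?a ?b =>
    let l0 := constr:(@nil T) in
    let l1 := zmod_atoms a l0 in
    let l := zmod_atoms b l1 in
    let x := zmod_reify a l in
    let y := zmod_reify b l in
    refine (@zeval_eq _ l x y _); vm_compute; reflexivity
  end.

(** * Subgroups and topological groups *)

(** Compactness as an induction principle: a property of sets that is stable
    under finite unions and subsets, and that holds locally, holds for a
    compact set. This replaces the choice of finite subcovers. *)
Lemma compact_induction (X : topologicalType) (K : set X) (Q : set X -> Prop) :
  compact K -> Q set0 -> (forall A B, Q A -> Q B -> Q (A `|` B)) ->
  (forall A B, A `<=` B -> Q B -> Q A) ->
  (forall x, K x -> exists2 U, nbhs x U & Q U) -> Q K.
Proof.
move=> cK Q0 QU Qsub Qloc; apply: contrapT => nQK.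
(* The complements in K of the sets satisfying Q form a proper filter. *)
pose F : set_system X := [set S | Q (K `\` S)].
have FF : ProperFilter F.
  apply: Build_ProperFilter_ex => [S FS|].
    apply: contrapT => nS; apply: nQK; apply: Qsub FS => x Kx; split=> // Sx.
    by apply: nS; exists x.
  split=> [|S T FS FT|S T ST FS].
  - by apply: Qsub Q0 => x [? nT]; case: nT.
  - by apply: Qsub (QU _ _ FS FT) => x [Kx /not_andP[nS|nT]]; [left|right].
  - by apply: Qsub FS => x [Kx nT]; split=> // /ST.
have FK : F K by apply: Qsub Q0 => x [? nT]; case: nT.
have [x [Kx clx]] := cK F FF FK.
have [U xU QU'] := Qloc x Kx.
have FU : F (~` U) by apply: Qsub QU' => y [_ /contrapT].
by have [y []] := clx _ _ FU xU.
Qed.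

Definition is_subgroup (E : zmodType) (H : set E) : Prop :=
  H 0 /\ forall x y, H x -> H y -> H (x - y).

Definition additive_on (E D : zmodType) (H : set E) (f : E -> D) : Prop :=
  forall x y, H x -> H y -> f (x + y) = f x + f y.

Section Subgroups.
Variable E : zmodType.
Implicit Types (H : set E) (x y : E).

Lemma subgroupT : is_subgroup [set: E]. Proof. by []. Qed.

Lemma subgroup0 : is_subgroup [set 0 : E].
Proof. by split=> // x y -> ->; rewrite subr0. Qed.

Lemma subgroupN H x : is_subgroup H -> H x -> H (- x).
Proof. by case=> H0 HB Hx; rewrite -sub0r; exact: HB. Qed.

Lemma subgroupD H x y : is_subgroup H -> H x -> H y -> H (x + y).
Proof.
by move=> sH Hx Hy; rewrite -[y]opprK; apply: sH.2 => //; exact: subgroupN.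
Qed.

Lemma subgroupMn H x n : is_subgroup H -> H x -> H (x *+ n).
Proof.
move=> sH Hx; elim: n => [|n IHn]; first by rewrite mulr0n; case: sH.
by rewrite mulrS; exact: subgroupD.
Qed.

Lemma subgroupMz H x (n : int) : is_subgroup H -> H x -> H (x *~ n).
Proof.
move=> sH Hx; case: n => n; first exact: subgroupMn.
by rewrite NegzE mulrNz; apply: subgroupN => //; exact: subgroupMn.
Qed.

Lemma subgroup_cs (A : topologicalZmodType) (H : csubgroup A) : is_subgroup H.
Proof. by split; [exact: cs0|move=> x y; exact: csB]. Qed.

Lemma subgroupI H K : is_subgroup H -> is_subgroup K -> is_subgroup (H `&` K).
Proof.
by move=> sH sK; split; [split; [case: sH|case: sK]|
  move=> x y [Hx Kx] [Hy Ky]; split; [exact: sH.2|exact: sK.2]].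
Qed.

End Subgroups.

Section AdditiveOn.
Variables E D : zmodType.
Implicit Types (H : set E) (f : E -> D).

Lemma additive_on0 H f : is_subgroup H -> additive_on H f -> f 0 = 0.
Proof. by case=> H0 _ fD; apply: (addrI (f 0)); rewrite -fD// !addr0. Qed.

Lemma additive_onN H f x : is_subgroup H -> additive_on H f -> H x ->
  f (- x) = - f x.
Proof.
move=> sH fD Hx; apply: (addrI (f x)).
by rewrite -fD ?subrr//; [exact: additive_on0 fD|exact: subgroupN].
Qed.

Lemma additive_onB H f x y : is_subgroup H -> additive_on H f -> H x -> H y ->
  f (x - y) = f x - f y.
Proof.
by move=> sH fD Hx Hy; rewrite fD// ?(additive_onN sH)//; exact: subgroupN.
Qed.

Lemma additive_onMz H f x (n : int) : is_subgroup H -> additive_on H f -> H x ->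
  f (x *~ n) = f x *~ n.
Proof.
move=> sH fD Hx.
have fn k : f (x *+ k) = f x *+ k.
  elim: k => [|k IHk]; first by rewrite !mulr0n; exact: additive_on0 fD.
  by rewrite !mulrS fD// ?IHk//; exact: subgroupMn.
case: n => n; first exact: fn.
rewrite NegzE !mulrNz (additive_onN sH) //; last exact: subgroupMn.
by congr (- _); exact: fn.
Qed.

End AdditiveOn.

Definition set_add (E : zmodType) (A B : set E) : set E :=
  [set x | exists a b, [/\ A a, B b & x = a + b]].

Definition set_opp (E : zmodType) (A : set E) : set E := [set x | A (- x)].

Lemma set_addP (E : zmodType) (A B : set E) a b : A a -> B b -> set_add A B (a + b).
Proof. by move=> Aa Bb; exists a, b. Qed.

Section TopGroups.
Variable A : topologicalZmodType.
Implicit Types (x y : A) (U V : set A).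

Lemma nbhs_shiftE x U : nbhs x U <-> nbhs 0 [set u | U (x + u)].
Proof.
split=> [Ux|U0]; first by apply: nbhs_shift; rewrite addr0.
have : nbhs x [set z | [set u | U (x + u)] (z - x)].
  by apply: nbhs_subr; rewrite subrr.
by apply: filterS => z /=; rewrite addrC subrK.
Qed.

Lemma nbhs0N U : nbhs 0 U -> nbhs (0 : A) [set u | U (- u)].
Proof. by move=> U0; apply: (@opp_continuous A 0); rewrite oppr0. Qed.

Lemma nbhs0_halve U : nbhs 0 U -> exists V : set A,
  [/\ nbhs 0 V, V `<=` U, forall x, V x -> V (- x) &
      forall x y, V x -> V y -> U (x + y)].
Proof.
move=> U0; have : nbhs (0 - 0 : A) U by rewrite subr0.
move=> /nbhs_sub[V [W [V0 W0 VWU]]].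
pose N := V `&` W; have N0 : nbhs (0 : A) N by exact: filterI.
exists ((U `&` N) `&` [set u | (U `&` N) (- u)]); split.
- by apply: filterI; [|apply: nbhs0N]; exact: filterI.
- by move=> x [[]].
- by move=> x [Nx Nx'] /=; split=> //=; rewrite opprK.
- move=> x y [[_ [Vx _]] _] [_ [_ [_ Wy]]].
  by rewrite -[y]opprK; exact: VWU.
Qed.

Lemma nbhs0_sums (n : nat) U : nbhs 0 U -> exists V : set A,
  [/\ nbhs 0 V, V `<=` U, forall x, V x -> V (- x) &
      forall (k : nat) (f : nat -> A), (k <= n)%N -> (forall i, V (f i)) ->
        U (\sum_(i < k) f i)].
Proof.
elim: n U => [|n IHn] U U0.
  have [V [V0 VU VN _]] := nbhs0_halve U0; exists V; split=> // k f.
  by rewrite leqn0 => /eqP -> _; rewrite big_ord0; exact: nbhs_singleton U0.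
have [V [V0 VU VN VD]] := nbhs0_halve U0.
have [W [W0 WV WN WS]] := IHn V V0.
exists W; split=> // [x /WV/VU//|k f]; case: k => [|k] kn Wf.
  by rewrite big_ord0; exact: nbhs_singleton U0.
rewrite big_ord_recr /=; apply: VD; last exact/WV.
exact: WS.
Qed.

Lemma open_subgroup_closed (H : set A) : is_subgroup H -> nbhs 0 H -> closed H.
Proof.
move=> sH H0 x clx.
have /clx[y [Hy Hyx]] : nbhs x [set y | H (y - x)].
  by apply: nbhs_subr; rewrite subrr.
by rewrite -[x](subKr y); apply: sH.2.
Qed.

(** Local compactness as it is used here; the subgroups and quotients built
    below carry no bundled instance of it. *)
Definition lcg : Prop := exists2 V : set A, nbhs 0 V & compact V.

Lemma lcg_in U : lcg -> nbhs 0 U -> exists V : set A,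
  [/\ nbhs 0 V, compact V & V `<=` U].
Proof.
move=> [V V0 cV] U0; have [W W0 WU] := nbhs_regular U0.
exists (V `&` closure W); split.
- by apply: filterI => //; apply: filterS W0; exact: subset_closure.
- by apply: compact_closedI => //; exact: closed_closure.
- by move=> x [_ /WU].
Qed.

Lemma compact_add U V : compact U -> compact V -> compact (set_add U V).
Proof.
move=> cU cV.
have -> : set_add U V = (fun z : A * A => z.1 + z.2) @` (U `*` V).
  apply/seteqP; split=> x /=.
    by move=> [a [b [Ua Vb ->]]]; exists (a, b).
  by move=> [[a b] [/= Ua Vb] <-]; exists a, b.
apply: continuous_compact; last exact: compact_setX.
by apply: continuous_subspaceT => z; exact: add_continuous.
Qed.

Lemma compact_opp U : compact U -> compact (set_opp U).
Proof.
move=> cU; have -> : set_opp U = -%R @` U.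
  apply/seteqP; split=> x /=; first by move=> Ux; exists (- x); rewrite ?opprK.
  by move=> [y Uy <-]; rewrite /set_opp /= opprK.
apply: continuous_compact => //.
by apply: continuous_subspaceT => z; exact: opp_continuous.
Qed.

End TopGroups.

Lemma compact_image (X Y : topologicalType) (f : X -> Y) (K : set X) :
  continuous f -> compact K -> compact (f @` K).
Proof.
by move=> cf cK; apply: continuous_compact => //; exact: continuous_subspaceT.
Qed.

Lemma additive_continuous (A B : topologicalZmodType) (f : A -> B) :
  {morph f : x y / x + y} -> (forall U, nbhs 0 U -> nbhs 0 (f @^-1` U)) ->
  continuous f.
Proof.
move=> fD f0 x U /nbhs_shiftE/f0 fU; apply/nbhs_shiftE.
by apply: filterS fU => u /=; rewrite fD.
Qed.

Lemma tophom_nbhs0 (A B : topologicalZmodType) (f : tophom A B) U :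
  nbhs 0 U -> nbhs 0 (f @^-1` U).
Proof. by move=> U0; apply: (@hom_cont _ _ f 0); rewrite tophom0. Qed.

Lemma tophom_sum (A B : topologicalZmodType) (f : tophom A B) (I : finType)
  (F : I -> A) : f (\sum_i F i) = \sum_i f (F i).
Proof.
by apply: (big_morph f); [exact: hom_add|exact: tophom0].
Qed.

Lemma tophomMn (A B : topologicalZmodType) (f : tophom A B) x n :
  f (x *+ n) = f x *+ n.
Proof. exact: (tophomMz f n%:Z x). Qed.

Lemma sum_tophomE (A B : topologicalZmodType) (I : finType)
  (F : I -> tophom A B) x : (\sum_i F i) x = \sum_i F i x.
Proof. by apply: (big_morph (fun f : tophom A B => f x)). Qed.

(** Continuous homomorphisms on a subgroup, as functions on the ambient group
    whose values elsewhere are arbitrary. This avoids subgroup types where a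
    homomorphism is only to be extended. *)
Definition hom_on (A B : topologicalZmodType) (H : set A) (f : A -> B) : Prop :=
  additive_on H f /\
  forall U, nbhs 0 U -> exists2 V, nbhs 0 V & forall x, H x -> V x -> U (f x).

Lemma tophom_hom_on (A B : topologicalZmodType) (H : set A) (f : tophom A B) :
  hom_on H f.
Proof.
split=> [x y _ _|U U0]; first exact: hom_add.
by exists (f @^-1` U) => //; exact: tophom_nbhs0.
Qed.

Lemma hom_on_comp (A B C : topologicalZmodType) (H : set A) (f : A -> B)
  (g : tophom B C) : hom_on H f -> hom_on H (g \o f).
Proof.
move=> [fD fc]; split=> [x y Hx Hy|U U0] /=; first by rewrite fD// hom_add.
by have [V V0 Vf] := fc _ (tophom_nbhs0 g U0); exists V.
Qed.

Lemma hom_on_sub (A B : topologicalZmodType) (H : set A) (f g : A -> B) :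
  hom_on H f -> hom_on H g -> hom_on H (fun x => f x - g x).
Proof.
move=> [fD fc] [gD gc]; split=> [x y Hx Hy|U U0].
  by rewrite fD// gD// opprD addrACA.
have [W [W0 _ WN WD]] := nbhs0_halve U0.
have [V V0 Vf] := fc _ W0; have [V' V'0 Vg] := gc _ W0.
exists (V `&` V'); first exact: filterI.
by move=> x Hx [Vx V'x]; apply: WD; [exact: Vf|apply: WN; exact: Vg].
Qed.

(** * Extension of homomorphisms to divisible groups *)

Section DivisibleExtension.
Variables (E D : zmodType) (H : set E) (Z : set D) (f : E -> D).
Hypotheses (sH : is_subgroup H) (sZ : is_subgroup Z) (fD : additive_on H f).
Hypothesis fZ : forall x, H x -> Z (f x).
Hypothesis divZ : forall n, (0 < n)%N -> forall z, Z z -> exists2 y, Z y & y *+ n = z.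

(* Graphs of additive functions on subgroups of E that extend f. *)
Let graph (g : set (E * D)) : Prop :=
  [/\ is_subgroup g, forall d, g (0, d) -> d = 0,
      forall p, g p -> Z p.2 & forall x, H x -> g (x, f x)].

Let graph_fun g x d d' : graph g -> g (x, d) -> g (x, d') -> d = d'.
Proof.
move=> [sg g0 _ _] gd gd'; apply/eqP; rewrite -subr_eq0; apply/eqP/g0.
by have := sg.2 _ _ gd gd'; rewrite /GRing.add /= /add_pair /= subrr.
Qed.

(** Baer: divisible groups are injective. The values are kept in a divisible
    subgroup Z of D, which makes the lemma provide retractions onto Z as well.
    A maximal graph is total, since a value at x is determined by dividing the
    value at the least positive multiple of x in its domain. *)
Lemma divisible_extension : exists g : E -> D,
  [/\ {morph g : x y / x + y}, forall x, H x -> g x = f x & forall x, Z (g x)].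
Proof.
pose g0 : set (E * D) := [set p | H p.1 /\ p.2 = f p.1].
have graph0 : graph g0.
  split=> [|d [/= _ ->]|p [Hp ->]|x Hx].
  - split; first by split; [case: sH|rewrite /= (additive_on0 sH fD)].
    move=> [x d] [y e] [/= Hx ->] [/= Hy ->]; split => /=; first exact: sH.2.
    by rewrite (additive_onB sH fD).
  - exact: additive_on0 sH fD.
  - exact: fZ.
  - by split.
have [F tF FP|g [gP gmax]] := @Zorn_bigcup _ (fun g => g = set0 \/ graph g).
  have [nF|] := pselect (forall X, F X -> X = set0).
    left; apply/seteqP; split=> // p [X FX Xp].
    by rewrite -(nF _ FX).
  move=> /existsNP[X0 /not_implyP[FX0 X00]]; right.
  have FG X p : F X -> X p -> graph X.
    by move=> /tF[->//|].
  have X0G : graph X0 by case: (tF _ FX0).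
  split.
  - split; first by exists X0 => //; case: X0G => -[].
    move=> p q [X FX Xp] [Y FY Yq]; have [XY|YX] := FP _ _ FX FY.
      by exists Y => //; have [[_ YB] _ _ _] := FG _ _ FY Yq; apply: YB => //; exact: XY.
    by exists X => //; have [[_ XB] _ _ _] := FG _ _ FX Xp; apply: XB => //; exact: YX.
  - by move=> d [X FX Xd]; have [_ X0' _ _] := FG _ _ FX Xd; exact: X0'.
  - by move=> p [X FX Xp]; have [_ _ XZ _] := FG _ _ FX Xp; exact: XZ.
  - by move=> x Hx; exists X0 => //; case: X0G => _ _ _; exact.
have gG : graph g.
  case: gP => // g0E; exfalso; apply: (gmax g0); last by right.
  split; first by rewrite g0E.
  by move=> /(_ (0, 0)); rewrite g0E; apply; split; [case: sH|rewrite /= (additive_on0 sH fD)].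
have [sg gz gZ gf] := gG.
suff gT x : exists d, g (x, d).
  have [h hP] := choice gT; exists h; split=> [x y|x Hx|x].
  - by apply: (graph_fun gG (hP _)); exact: subgroupD sg (hP x) (hP y).
  - by apply: (graph_fun gG (hP _)); exact: gf.
  - exact: gZ (hP x).
apply: contrapT => nx.
have ndom z d : g (z, d) -> z <> x.
  by move=> gzd zx; apply: nx; exists d; rewrite -zx.
have gD p q a b : g (p, a) -> g (q, b) -> g (p - q, a - b).
  by move=> gp gq; exact: sg.2 gp gq.
have gMz p a (k : int) : g (p, a) -> g (p *~ k, a *~ k).
  move=> gp; have gn j : g (p *+ j, a *+ j).
    elim: j => [|j IHj]; first by rewrite !mulr0n; case: sg.
    by rewrite !mulrSr; exact: subgroupD sg IHj gp.
  case: k => k; first exact: gn.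
  by rewrite NegzE !mulrNz; exact: subgroupN sg (gn _).
(* d0 is the value at x of the extension of g to dom g + Z x. *)
have [d0 Zd0 d0P] : exists2 d0, Z d0 &
    forall (k : int) d, g (x *~ k, d) -> d = d0 *~ k.
  have [ex|nex] := pselect (exists n, (0 < n)%N && `[< exists d, g (x *+ n, d) >]).
    case: (ex_minnP ex) => n /andP[n0 /asboolP[d gnd]] nmin.
    have [d0 Zd0 d0n] := divZ n0 (gZ _ gnd).
    exists d0 => // k d' gk.
    have nz : n%:Z != 0 by rewrite eqz_nat -lt0n.
    pose q := (k %/ n%:Z)%Z; pose r := `|(k %% n%:Z)%Z|%N.
    have rE : r%:Z = (k %% n%:Z)%Z by rewrite /r gez0_abs// modz_ge0.
    have kE : k = q * n%:Z + r%:Z by rewrite rE; exact: divz_eq.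
    have rn : (r < n)%N by rewrite -ltz_nat rE ltz_pmod.
    have Mq (V : zmodType) (v : V) : v *~ k = v *+ n *~ q + v *+ r.
      by rewrite kE mulrzDr mulrzA mulrzAC.
    have gr : g (x *+ r, d' - d *~ q).
      by have := gD _ _ _ _ gk (gMz _ _ q gnd); rewrite Mq addrC addKr.
    have r0 : r = 0%N.
      case: (posnP r) => // r0; suff : (n <= r)%N by rewrite leqNgt rn.
      by apply: nmin; rewrite r0 /=; apply/asboolP; exists (d' - d *~ q).
    move: gr; rewrite r0 mulr0n => /gz/eqP; rewrite subr_eq0 => /eqP ->.
    by rewrite Mq r0 mulr0n addr0 d0n.
  exists 0; first by case: sZ.
  move=> k d gk; rewrite mul0rz; have [k0|k0] := eqVneq k 0.
    by move: gk; rewrite k0 mulr0z => /gz.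
  exfalso; apply: nex; exists `|k|%N; rewrite absz_gt0 k0 /=; apply/asboolP.
  have := gMz _ _ (sgz k) gk; rewrite -mulrzA mulrC -abszEsg.
  by rewrite pmulrn; exists (d *~ sgz k).
pose g1 : set (E * D) :=
  [set p | exists a b (k : int), g (a, b) /\ p = (a + x *~ k, b + d0 *~ k)].
apply: (gmax g1).
  split=> [[a b] gab|].
    by exists a, b, 0; rewrite !mulr0z !addr0.
  move=> /(_ (x, d0)) g1g; apply: nx; exists d0; apply: g1g.
  by exists 0, 0, 1; rewrite !add0r; split=> //; case: sg.
right; split.
- split; first by exists 0, 0, 0; rewrite !mulr0z !addr0; split=> //; case: sg.
  move=> _ _ [a [b [k [gab ->]]]] [a' [b' [k' [gab' ->]]]].
  exists (a - a'), (b - b'), (k - k'); split; first exact: gD.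
  by congr pair; rewrite /= mulrzBr opprD addrACA.
- move=> d [a [b [k [gab [/esym/eqP]]]]].
  rewrite addrC addr_eq0 => /eqP xk ->.
  have := gMz _ _ (-1) gab; rewrite !mulrN1z -xk => /d0P <-.
  by rewrite addrN.
- move=> _ [a [b [k [gab ->]]]] /=; apply: subgroupD => //; first exact: gZ gab.
  exact: subgroupMz.
- move=> y Hy; exists y, (f y), 0; rewrite !mulr0z !addr0; split=> //; exact: gf.
Qed.

End DivisibleExtension.

(** Continuity of an additive map is decided on an open subgroup. Hence a
    homomorphism on an open subgroup P and an additive map on Q that agree on
    the intersection define a map on P + Q whose additive extension is
    automatically continuous. *)
Lemma hom_glue (G D : topologicalZmodType) (P Q : set G) (f g : G -> D) :
  divisible D -> is_subgroup P -> is_subgroup Q -> nbhs 0 P ->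
  hom_on P f -> additive_on Q g -> (forall x, P x -> Q x -> f x = g x) ->
  exists F : tophom G D, (forall x, P x -> F x = f x) /\
                         (forall x, Q x -> F x = g x).
Proof.
move=> divD sP sQ P0 [fD fc] gD fg.
have sPQ : is_subgroup (set_add P Q).
  split; first by exists 0, 0; rewrite addr0; split=> //; [case: sP|case: sQ].
  move=> _ _ [a [b [Pa Qb ->]]] [c [d [Pc Qd ->]]].
  exists (a - c), (b - d); split; [exact: sP.2|exact: sQ.2|].
  by rewrite opprD addrACA.
have ex x : exists y, forall a b, P a -> Q b -> x = a + b -> y = f a + g b.
  have [[a [b [Pa Qb ->]]]|nx] := pselect (set_add P Q x); last first.
    by exists 0 => a b Pa Qb xE; exfalso; apply: nx; exists a, b.
  exists (f a + g b) => a' b' Pa' Qb' ab.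
  have abE : a - a' = b' - b 
    by rewrite -[a in LHS](addrK b) ab addrAC [a' + b']addrC addrK.
  have : f (a - a') = g (a - a').
    by apply: fg; [exact: sP.2|rewrite abE; exact: sQ.2].
  rewrite {2}abE (additive_onB sP fD)// (additive_onB sQ gD)// => /eqP.
  by rewrite subr_eq addrAC -subr_eq opprK => /eqP ->; rewrite addrC.
have [h hP] := choice ex.
have hPQ a b : P a -> Q b -> h (a + b) = f a + g b by move=> Pa Qb; exact: (hP (a + b)).
have hD : additive_on (set_add P Q) h.
  move=> _ _ [a [b [Pa Qb ->]]] [c [d [Pc Qd ->]]].
  rewrite addrACA !hPQ//; try exact: subgroupD.
  by rewrite fD// gD// addrACA.
have [F [FD FE _]] := @divisible_extension G D (set_add P Q) setT h sPQ
  (subgroupT D) hD (fun _ _ => I)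
  (fun n n0 z _ => let: ex_intro y yz := divD n n0 z in ex_intro2 _ _ y I yz).
have FP x : P x -> F x = f x.
  move=> Px; have xE : x = x + 0 by rewrite addr0.
  rewrite FE; last by exists x, 0; split=> //; case: sQ.
  by rewrite {1}xE hPQ ?(additive_on0 sQ gD) ?addr0//; case: sQ.
have Fc : continuous F.
  apply: additive_continuous => // U /fc[V V0 VU].
  apply: filterS (filterI P0 V0) => x [Px Vx] /=; rewrite FP//; exact: VU.
exists (TopHom Fc FD); split=> //= x Qx.
have xE : x = 0 + x by rewrite add0r.
rewrite FE; last by exists 0, x; split=> //; case: sP.
by rewrite {1}xE hPQ ?(additive_on0 sP fD) ?add0r//; case: sP.
Qed.

(** * The circle *)

Section Circle.
Variable R : realType.
Local Notation circle := (circle R).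

Fact cpi_key : {c : tophom R circle | c = quot_map (integer_subgroup R)}.
Proof. by exists (quot_map (integer_subgroup R)). Qed.

(** The projection of R onto R/Z with an opaque body: the quotient construction
    must not be unfolded by simplification. *)
Definition cpi : tophom R circle := sval cpi_key.

Lemma cpiE x : cpi x = quot_pi (integer_subgroup R) x.
Proof. by rewrite /cpi; case: cpi_key => _ /= ->. Qed.

Lemma cpi_eq x y : cpi x = cpi y <-> exists m : int, x - y = m%:~R.
Proof.
rewrite !cpiE; split=> [/quot_piP[m _ mE]|[m mE]]; first by exists m.
by apply/quot_piP; exists m.
Qed.

Lemma cpi_int (m : int) : cpi m%:~R = 0.
Proof. by rewrite -(tophom0 cpi); apply/cpi_eq; exists m; rewrite subr0. Qed.

Lemma cpi_onto z : exists x, cpi x = z.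
Proof. by exists (quot_repr z); rewrite cpiE; exact: quot_reprK. Qed.

Lemma cpi_rep z : exists2 t, `|t| <= 1 / 2 & cpi t = z.
Proof.
have [x <-] := cpi_onto z; pose m := Num.floor (x + 1 / 2).
have /andP[m1 m2] : m%:~R <= x + 1 / 2 < (m + 1)%:~R by exact: floor_itv.
exists (x - m%:~R); last by rewrite tophomB cpi_int subr0.
by rewrite ler_norml; move: m1 m2; rewrite intrD; lra.
Qed.

Lemma cpi_inj x y : `|x - y| < 1 -> cpi x = cpi y -> x = y.
Proof.
move=> xy1 /cpi_eq[m xyE]; move: xy1; rewrite xyE -intr_norm -[1]/(1%:~R) ltr_int.
move=> m1; have m0 : m = 0 by move: m1; case: (m) => -[].
by apply/eqP; rewrite -subr_eq0 xyE m0.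
Qed.

Lemma cpi0 x : `|x| < 1 -> cpi x = 0 -> x = 0.
Proof. by move=> x1; rewrite -(tophom0 cpi); apply: cpi_inj; rewrite subr0. Qed.

Definition cball (d : R) : set circle := [set cpi t | t in [set t | `|t| < d]].

Lemma nbhs0_real (U : set R) : nbhs 0 U <-> exists2 d : R, 0 < d & forall t, `|t| < d -> U t.
Proof.
split=> [/nbhs_ballP[d d0 dU]|[d d0 dU]]; [exists d => // t td|].
  by apply: dU; rewrite /ball /= sub0r normrN.
by apply/nbhs_ballP; exists d => // t; rewrite /ball /= sub0r normrN; exact: dU.
Qed.

Lemma cball_nbhs d : 0 < d -> nbhs 0 (cball d).
Proof.
move=> d0; rewrite (_ : cball d = quot_pi (integer_subgroup R) @` [set t | `|t| < d]).
  by apply: quot_pi_nbhs; apply/nbhs0_real; exists d.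
by apply/seteqP; split=> _ [t /= td <-]; exists t; rewrite ?cpiE.
Qed.

Lemma nbhs_cball (U : set circle) : nbhs 0 U -> exists2 d, 0 < d & cball d `<=` U.
Proof.
move=> /(tophom_nbhs0 cpi)/nbhs0_real[d d0 dU]; exists d => // _ [t td <-].
exact: dU.
Qed.

Lemma cballW d e : d <= e -> cball d `<=` cball e.
Proof. by move=> de _ [t /= td <-]; exists t => //=; exact: lt_le_trans de. Qed.

Lemma cballN d z : cball d z -> cball d (- z).
Proof. by move=> [t /= td <-]; exists (- t); rewrite /= ?normrN// tophomN. Qed.

Lemma cballD d e z w : cball d z -> cball e w -> cball (d + e) (z + w).
Proof.
move=> [t /= td <-] [u /= ue <-]; exists (t + u); rewrite /= ?hom_add//.
by rewrite (le_lt_trans (ler_normD _ _))// ltrD.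
Qed.

Lemma cball0 d : 0 < d -> cball d 0.
Proof. by move=> d0; exists 0; rewrite /= ?normr0// tophom0. Qed.

(** The circle has no small subgroups: a point whose multiples all stay in a
    quarter turn has multiples that lift to multiples of one small real number.
    *)
Lemma cball_no_small z : (forall n, cball (1 / 4) (z *+ n)) -> z = 0.
Proof.
move=> zn; have [t /= t4 tz] := zn 1%N; rewrite mulr1n in tz.
have tn n : `|t *+ n| < 1 / 4.
  elim: n => [|n IHn]; first by rewrite mulr0n normr0; lra.
  have [u /= u4 uz] := zn n.+1; suff -> : t *+ n.+1 = u by [].
  apply: cpi_inj; last by rewrite uz tophomMn tz.
  move: IHn; rewrite (mulrSr t n) !ltr_norml => /andP[? ?].
  by move: u4 t4; rewrite !ltr_norml => /andP[? ?] /andP[? ?]; apply/andP; split; lra.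
suff t0 : t = 0 by rewrite -tz t0 tophom0.
apply: contrapT => /eqP t0.
have tp : 0 < `|t| by rewrite normr_gt0.
have := tn (Num.truncn (`|t|^-1)).+1.
rewrite normrMn -(mulr_natl `|t|) ltNge => /negP; apply.
apply: (@le_trans _ _ 1); first lra.
by rewrite mulr_natl -(mulr_natr `|t|) -ler_pdivrMl// mulr1 ltW// truncnS_gt.
Qed.

Lemma cball_small_char (G : topologicalZmodType) (H : set G) (f : G -> circle) :
  is_subgroup H -> additive_on H f -> (forall x, H x -> cball (1 / 4) (f x)) ->
  forall x, H x -> f x = 0.
Proof.
move=> sH fD fs x Hx; apply: cball_no_small => n.
by have := additive_onMz n%:Z sH fD Hx; rewrite -[f x *~ _]pmulrn => <-; apply: fs; exact: subgroupMz.
Qed.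

Lemma circle_divisible : divisible circle.
Proof.
move=> n n0 z; have [x <-] := cpi_onto z.
exists (cpi (x / n%:R)); rewrite -tophomMn -(mulr_natr (x / _)) divfK//.
by rewrite pnatr_eq0 -lt0n.
Qed.

Lemma real_divisible : divisible R.
Proof.
move=> n n0 x; exists (x / n%:R); rewrite -(mulr_natr (x / _)) divfK//.
by rewrite pnatr_eq0 -lt0n.
Qed.

Lemma circle_compact : compact [set: circle].
Proof.
have -> : [set: circle] = cpi @` `[- (1 / 2), 1 / 2].
  apply/seteqP; split=> // z _; have [t t2 <-] := cpi_rep z; exists t => //=.
  by rewrite in_itv /= -ler_norml.
by apply: compact_image; [exact: hom_cont|exact: segment_compact].
Qed.

Fact scale_cont (a : R) : continuous (fun t : R => a * t).
Proof. exact: mulrl_continuous. Qed.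

Definition scale_hom (a : R) : tophom R R := TopHom (@scale_cont a) (mulrDr a).

Definition real_char (a : R) : tophom R circle := hom_comp cpi (scale_hom a).

(** After subtracting a character t -> a t that agrees at d / 2, the values are
    periodic and stay within a quarter turn, so that they vanish. *)
Lemma real_charE (f : tophom R circle) : exists a, forall t, f t = cpi (a * t).
Proof.
have /(tophom_nbhs0 f)/nbhs0_real[d d0 dP] := @cball_nbhs (1 / 8) ltac:(lra).
have [c c8 fc] : exists2 c, `|c| < 1 / 8 & cpi c = f (d / 2).
  have [|t /= t8 tE] := dP (d / 2); last by exists t.
  by rewrite ger0_norm; lra.
exists (c / (d / 2)) => t; apply/eqP; rewrite -subr_eq0; apply/eqP.
have d2 : 0 < d / 2 by lra.
pose g := f - real_char (c / (d / 2)).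
have gE s : g s = f s - cpi (c / (d / 2) * s) by [].
have gd : g (d / 2) = 0 by rewrite gE divfK ?gt_eqF// fc subrr.
rewrite -gE; apply: (@cball_small_char R setT g) => // [x y _ _|{}t _].
  exact: hom_add.
pose m := Num.floor (t / (d / 2)).
have /andP[m1 m2] : m%:~R <= t / (d / 2) < (m + 1)%:~R by exact: floor_itv.
pose s := t - d / 2 *~ m.
have sE : s = t - m%:~R * (d / 2) by rewrite /s -mulrzl.
have s0 : 0 <= s by rewrite sE subr_ge0 -ler_pdivlMr.
have sd : s < d / 2.
  by move: m2; rewrite ltr_pdivrMr// intrD mulrDl mul1r sE; lra.
have -> : g t = g s by rewrite /s tophomB tophomMz gd mul0rz subr0.
rewrite gE (_ : 1 / 4 = 1 / 8 + 1 / 8); last lra.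
apply: cballD; first by apply: dP; rewrite ger0_norm//; lra.
apply: cballN; exists (c / (d / 2) * s) => //=.
rewrite normrM (ger0_norm s0) (le_lt_trans _ c8)// normrM normfV (gtr0_norm d2).
by rewrite -mulrA ler_piMr// mulrC ler_pdivrMr// mul1r ltW.
Qed.

Lemma circle_charE (f : tophom circle circle) : exists m : int, forall z, f z = z *~ m.
Proof.
have [a aE] := real_charE (hom_comp f cpi).
have [m mE] : exists m : int, a = m%:~R.
  have /esym := aE 1; rewrite mulr1 /= [cpi 1](cpi_int 1) tophom0 -(tophom0 cpi).
  by move=> /cpi_eq[m]; rewrite subr0; exists m.
exists m => z; have [t <-] := cpi_onto z.
by have /= -> := aE t; rewrite mE mulrzl tophomMz.
Qed.

End Circle.

(** * The invariant mean of a compact abelian group *)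

Section Mean.
Variables (R : realType) (S : tabType).
Hypothesis cS : compact [set: S].
Implicit Types (f g : S -> R) (U : set S) (s t : seq S).

Definition unif U (e : R) f : Prop := forall x u, U u -> `|f (x + u) - f x| <= e.

Lemma continuous_unif f (e : R) : continuous f -> 0 < e ->
  exists2 U, nbhs 0 U & unif U e f.
Proof.
move=> cf e0.
suff [U U0 UP] : exists2 U, nbhs 0 U &
    forall x u, [set: S] x -> U u -> `|f (x + u) - f x| <= e.
  by exists U => // x u; exact: UP.
apply: (compact_induction (Q := fun A => exists2 U, nbhs 0 U &
    forall x u, A x -> U u -> `|f (x + u) - f x| <= e)) cS _ _ _ _.
- by exists setT => //; exact: filterT.
- move=> A B [U U0 UA] [V V0 VB]; exists (U `&` V); first exact: filterI.
  by move=> x u [/UA|/VB] + [Uu Vu]; apply.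
- by move=> A B AB [U U0 UB]; exists U => // x u /AB; exact: UB.
- move=> x _; have : nbhs x [set y | `|f y - f x| < e / 2].
    have e2 : 0 < e / 2 by lra.
    have /cvgrPdist_lt/(_ _ e2) := cf x.
    by apply: filterS => y; rewrite distrC.
  move=> /nbhs_shiftE/nbhs0_halve[W [W0 WV _ WD]].
  exists [set y | W (y - x)]; first by apply: nbhs_subr; rewrite subrr.
  exists W => // y u Wyx Wu.
  have /= h1 := WD _ _ Wyx Wu; have /= h2 := WV _ Wyx.
  move: h1 h2; rewrite addrA [x + (y - x)]addrC subrK.
  by rewrite !ltr_norml ler_norml => /andP[? ?] /andP[? ?]; apply/andP; split; lra.
Qed.

Lemma unif_continuous f :
  (forall e, 0 < e -> exists2 U, nbhs 0 U & unif U e f) -> continuous f.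
Proof.
move=> fU x; apply/cvgrPdist_le => e /fU[U U0 Ue].
have : nbhs x [set y | U (y - x)] by apply: nbhs_subr; rewrite subrr.
apply: filterS => y /= /(Ue x).
by rewrite [x + _]addrC subrK distrC.
Qed.

Lemma continuous_bounded f : continuous f -> exists B, forall x, `|f x| <= B.
Proof.
move=> cf.
suff [B BP] : exists B, forall x, [set: S] x -> `|f x| <= B by exists B => x; exact: BP.
apply: (compact_induction (Q := fun A => exists B, forall x, A x -> `|f x| <= B)) cS _ _ _ _.
- by exists 0.
- move=> A B [a aP] [b bP]; exists (Num.max a b) => x; rewrite le_max.
  by move=> [/aP ->|/bP ->]; rewrite ?orbT.
- by move=> A B AB [b bP]; exists b => x /AB/bP.
- move=> x _; exists [set y | `|f x - f y| < 1].
    by have /cvgrPdist_lt/(_ _ ltr01) := cf x.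
  exists (`|f x| + 1) => y /= xy; rewrite -[f y](subKr (f x)).
  by rewrite (le_trans (ler_normB _ _))// lerD2l ltW.
Qed.

Lemma finite_translates U : nbhs 0 U ->
  exists2 s, s != [::] & forall x, exists2 a, a \in s & U (x - a).
Proof.
move=> U0.
suff [s sP] : exists s, forall x, [set: S] x -> exists2 a, a \in s & U (x - a).
  exists s => [|x]; last exact: sP.
  by have [a + _] := sP 0 I; apply: contraTneq => ->; rewrite in_nil.
apply: (compact_induction (Q := fun A => exists s, forall x, A x ->
  exists2 a, a \in s & U (x - a))) cS _ _ _ _.
- by exists [::].
- move=> A B [s sP] [t tP]; exists (s ++ t) => x [/sP|/tP] [a sa Ua];
    by exists a; rewrite // mem_cat sa ?orbT.
- by move=> A B AB [s sP]; exists s => x /AB/sP.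
- move=> x _; exists [set y | U (y - x)]; first by apply: nbhs_subr; rewrite subrr.
  by exists [:: x] => y Uyx; exists x; rewrite ?mem_head.
Qed.

Definition avg s f : S -> R := fun x => (\sum_(a <- s) f (x + a)) / (size s)%:R.

Lemma size_gt0R s : s != [::] -> 0 < (size s)%:R :> R.
Proof. by rewrite ltr0n lt0n size_eq0. Qed.

Lemma sum_const_seq (k : R) s : \sum_(a <- s) k = k *+ size s.
Proof. by rewrite big_const_seq count_predT iter_addr_0. Qed.

Lemma avg_ge s f m : s != [::] -> (forall x, m <= f x) -> forall x, m <= avg s f x.
Proof.
move=> s0 mf x; rewrite ler_pdivlMr ?size_gt0R// mulr_natr -sum_const_seq.
exact: ler_sum.
Qed.

Lemma avgN s f x : avg s (fun y => - f y) x = - avg s f x.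
Proof. by rewrite /avg sumrN mulNr. Qed.

Lemma avg_le s f m : s != [::] -> (forall x, f x <= m) -> forall x, avg s f x <= m.
Proof.
move=> s0 fm x; rewrite -lerN2 -avgN; apply: avg_ge => // y.
by rewrite lerN2.
Qed.

Lemma avg_comp s t f x :
  avg s (avg t f) x = avg [seq a + b | a <- s, b <- t] f x.
Proof.
rewrite /avg size_allpairs big_flatten big_map -mulr_suml natrM invfM mulrA mulrAC.
congr (_ / _ / _); apply: eq_bigr => a _.
by rewrite big_map; apply: eq_bigr => b _; rewrite addrA.
Qed.

Lemma avgC s t f x : avg s (avg t f) x = avg t (avg s f) x.
Proof.
rewrite /avg -!mulr_suml exchange_big /= mulrAC.
by under eq_bigr => a _ do under eq_bigr => b _ do rewrite addrAC.
Qed.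

Lemma avg_unif U e s f : s != [::] -> unif U e f -> unif U e (avg s f).
Proof.
move=> s0 fU x u Uu; rewrite /avg -mulrBl -sumrB normrM normfV.
rewrite (gtr0_norm (size_gt0R s0)) ler_pdivrMr ?size_gt0R// mulr_natr -sum_const_seq.
rewrite (le_trans (ler_norm_sum _ _ _))//; apply: ler_sum => a _.
by rewrite addrAC; exact: fU.
Qed.

(** An average over translates by a net of S contracts the oscillation of f by
    a fixed factor: if f takes a value in the lower half of its range, then
    each average contains a term near that value. *)
Lemma avg_contract U e s : s != [::] ->
  (forall x, exists2 a, a \in s & U (x - a)) ->
  forall f m M, unif U e f -> 0 <= e -> (forall x, m <= f x <= M) ->
  exists m' M', (forall x, m' <= avg s f x <= M') /\
    M' - m' <= (1 - ((size s)%:R * 2)^-1) * (M - m) + e / (size s)%:R.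
Proof.
move=> s0 sU f m M fU e0 mfM.
have N0 := size_gt0R s0; set N := (size s)%:R : R.
have N1 : 1 <= N by rewrite ler1n lt0n size_eq0.
have mM : m <= M by have /andP[] := mfM 0; exact: le_trans.
have iN : 0 < N^-1 by rewrite invr_gt0.
have iN1 : N^-1 <= 1 by rewrite invf_le1.
have i2 : (N * 2)^-1 = N^-1 / 2 by rewrite invfM.
have eN : 0 <= e / N by rewrite divr_ge0// ltW.
have [[x0 x0m]|nlow] := pselect (exists x0, f x0 <= (m + M) / 2).
  exists m, (M - (M - m) / 2 / N + e / N); split; last first.
    by rewrite i2; nra.
  move=> x; rewrite avg_ge//=; last by move=> y; case/andP: (mfM y).
  have [a sa Ua] := sU (x0 - x).
  rewrite /avg ler_pdivrMr// (big_rem a)//=.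
  have fa : f (x + a) <= (m + M) / 2 + e.
    have := fU (x + a) _ Ua; have -> : x + a + (x0 - x - a) = x0.
      by rewrite [x + a + _]addrC -[x0 - x - a]addrA -opprD subrK.
    by rewrite ler_norml => /andP[+ _]; lra.
  have rest : \sum_(b <- rem a s) f (x + b) <= M * (N - 1).
    apply: (@le_trans _ _ (\sum_(b <- rem a s) M)).
      by apply: ler_sum => b _; case/andP: (mfM (x + b)).
    rewrite sum_const_seq size_rem// -mulr_natr -subn1 natrB//.
    by rewrite lt0n size_eq0.
  rewrite mulrDl mulrBl divfK ?gt_eqF// mulfVK ?gt_eqF// -/N; lra.
exists ((m + M) / 2), M; split; last by rewrite i2; nra.
move=> x; rewrite avg_ge//=; last first.
  by move=> y; rewrite leNgt; apply/negP => /ltW fy; apply: nlow; exists y.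
by rewrite avg_le// => y; case/andP: (mfM y).
Qed.

(** The translates can be chosen uniformly in f, which is needed for iterated
    means. *)
Lemma avg_nearly_constant U e B : nbhs 0 U -> 0 < e ->
  exists2 s, s != [::] & forall f, unif U e f -> (forall x, `|f x| <= B) ->
    exists m, forall x, `|avg s f x - m| <= e * 3.
Proof.
move=> U0 e0; have [s s0 sU] := finite_translates U0.
have N0 := size_gt0R s0; set N := (size s)%:R : R.
have N1 : 1 <= N by rewrite ler1n lt0n size_eq0.
pose c := (N * 2)^-1; have i2 : c = N^-1 / 2 by rewrite /c invfM.
have iN : 0 < N^-1 by rewrite invr_gt0.
have iN1 : N^-1 <= 1 by rewrite invf_le1.
pose B' := Num.max B 0.
have B'0 : 0 <= B' by rewrite le_max lexx orbT.
have iter (j : nat) : exists2 t, t != [::] & forall f, unif U e f ->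
    (forall x, `|f x| <= B) -> exists m M, (forall x, m <= avg t f x <= M) /\
    M - m <= (1 - c) ^+ j * (B' * 2) + e * 2.
  elim: j => [|j [t t0 tP]].
    exists [:: 0] => // f fU fB; exists (- B'), B'; split; last first.
      by rewrite expr0 mul1r; lra.
    move=> x; rewrite /avg big_seq1 addr0 divr1 -ler_norml.
    by rewrite (le_trans (fB x))// le_max lexx.
  exists [seq a + b | a <- s, b <- t].
    by rewrite -size_eq0 size_allpairs muln_eq0 !size_eq0 negb_or s0.
  move=> f fU fB; have [m [M [mM MmE]]] := tP f fU fB.
  have [m' [M' [mM' Mm']]] := avg_contract s0 sU (avg_unif t0 fU) (ltW e0) mM.
  exists m', M'; split=> [x|]; first by rewrite -avg_comp.
  apply: (le_trans Mm'); rewrite -/N -/c exprS.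
  have c1 : 0 <= 1 - c by rewrite i2; lra.
  have key : (1 - c) * (e * 2) = e * 2 - e / N by rewrite i2; field; rewrite gt_eqF.
  have h : (1 - c) * (M - m) <= (1 - c) * ((1 - c) ^+ j * (B' * 2)) + (e * 2 - e / N).
    by rewrite -key -mulrDr; exact: ler_wpM2l.
  by rewrite -mulrA; lra.
have c01 : `|1 - c| < 1 by rewrite ltr_norml i2; apply/andP; split; lra.
have [j jP] : exists j, (1 - c) ^+ j * (B' * 2) <= e.
  have /cvgrPdist_le/(_ (e / (B' * 2 + 1))) := cvg_expr c01.
  have B1 : 0 < B' * 2 + 1 by lra.
  rewrite divr_gt0// => /(_ isT)[j _ /(_ j (leqnn j))] /=.
  rewrite sub0r normrN ler_pdivlMr// => jP; exists j; apply: le_trans jP.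
  have := ler_norm ((1 - c) ^+ j); have := normr_ge0 ((1 - c) ^+ j).
  by nra.
have [t t0 tP] := iter j; exists t => // f fU fB.
have [m [M [mM MmE]]] := tP f fU fB; exists m => x.
have /andP[] := mM x; rewrite ler_norml => h1 h2.
by apply/andP; split; lra.
Qed.

(** Averages of f over suitable finite sets of translates are nearly constant;
    the mean is the constant that they approach. It replaces the Haar integral.
    *)
Definition mean f : R :=
  sup [set m | exists2 s, s != [::] & forall x, m <= avg s f x].

Lemma mean_le f s m B : (forall x, `|f x| <= B) ->
  s != [::] -> (forall x, avg s f x <= m) -> mean f <= m.
Proof.
move=> fB s0 fm; apply: ge_sup.
  exists (- B); exists [:: 0] => // x; rewrite /avg big_seq1 addr0 divr1.
  by have := fB x; rewrite ler_norml => /andP[].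
move=> m' [t t0 tm']; apply: (le_trans (avg_ge s0 tm' 0)).
by rewrite avgC; exact: avg_le.
Qed.

Lemma mean_ge f s m B : (forall x, `|f x| <= B) ->
  s != [::] -> (forall x, m <= avg s f x) -> m <= mean f.
Proof.
move=> fB s0 fm; apply: ub_le_sup; last by exists s.
exists B => m' [t t0 tm']; apply: (le_trans (tm' 0)); apply: avg_le => // x.
by have := fB x; rewrite ler_norml => /andP[].
Qed.

Lemma mean_uniform_approx U e B : nbhs 0 U -> 0 < e ->
  exists2 s, s != [::] & forall f, unif U e f -> (forall x, `|f x| <= B) ->
    forall x, `|avg s f x - mean f| <= e * 6.
Proof.
move=> U0 e0; have [s s0 sP] := avg_nearly_constant B U0 e0.
exists s => // f fU fB x; have [m mP] := sP f fU fB.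
have lo y : m - e * 3 <= avg s f y.
  by have := mP y; rewrite ler_norml => /andP[]; lra.
have up y : avg s f y <= m + e * 3.
  by have := mP y; rewrite ler_norml => /andP[]; lra.
have := mean_le fB s0 up; have := mean_ge fB s0 lo; have := lo x; have := up x.
rewrite ler_norml.
by move=> *; apply/andP; split; lra.
Qed.

Lemma mean_eq f c : continuous f ->
  (forall e, 0 < e -> exists2 s, s != [::] & forall x, `|avg s f x - c| <= e) ->
  mean f = c.
Proof.
move=> /continuous_bounded[B fB] fc; apply/eqP; rewrite -subr_eq0 -normr_le0.
apply/ler_addgt0Pl => e /fc[s s0 sP]; rewrite addr0 ler_norml; apply/andP; split.
  rewrite lerBrDl; apply: (mean_ge fB s0) => x.
  by have := sP x; rewrite ler_norml => /andP[]; lra.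
rewrite lerBlDl; apply: (mean_le fB s0) => x.
by have := sP x; rewrite ler_norml => /andP[]; lra.
Qed.

Lemma mean_approx2 f g e : continuous f -> continuous g -> 0 < e ->
  exists s, [/\ s != [::], forall x, `|avg s f x - mean f| <= e &
    forall x, `|avg s g x - mean g| <= e].
Proof.
move=> cf cg e0; have e6 : 0 < e / 6%:R by rewrite divr_gt0.
have [U U0 Uf] := continuous_unif cf e6; have [V V0 Vg] := continuous_unif cg e6.
have [B fB] := continuous_bounded cf; have [C gC] := continuous_bounded cg.
have [s s0 sP] := mean_uniform_approx (Num.max B C) (filterI U0 V0) e6.
have eE : e / 6%:R * 6 = e by field.
exists s; split=> // x; rewrite -eE; apply: sP.
- by move=> y u [Uu _]; exact: Uf.
- by move=> y; rewrite le_max fB.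
- by move=> y u [_ Vu]; exact: Vg.
- by move=> y; rewrite le_max gC orbT.
Qed.

Lemma meanD f g : continuous f -> continuous g ->
  mean (fun x => f x + g x) = mean f + mean g.
Proof.
move=> cf cg; apply: mean_eq => [x|e e0]; first by apply: cvgD; [exact: cf|exact: cg].
have e2 : 0 < e / 2 by lra.
have [s [s0 sf sg]] := mean_approx2 cf cg e2; exists s => // x.
have -> : avg s (fun x => f x + g x) x = avg s f x + avg s g x.
  by rewrite /avg big_split mulrDl.
rewrite opprD addrACA (le_trans (ler_normD _ _))//.
by have := sf x; have := sg x; lra.
Qed.

Lemma meanZ f k : continuous f -> mean (fun x => k * f x) = k * mean f.
Proof.
move=> cf; apply: mean_eq => [x|e e0]; first by apply: cvgMr; exact: cf.
have k1 : 0 < `|k| + 1 by rewrite ltr_wpDl.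
have e2 : 0 < e / (`|k| + 1) by rewrite divr_gt0.
have [s [s0 sf _]] := mean_approx2 cf cf e2; exists s => // x.
have -> : avg s (fun x => k * f x) x = k * avg s f x.
  by rewrite /avg -mulr_sumr mulrA.
rewrite -mulrBr normrM; have := sf x; rewrite ler_pdivlMr// => h.
apply: le_trans h; rewrite mulrC ler_wpM2l// lerDl//.
Qed.

Lemma mean_cst (k : R) : mean (fun=> k) = k.
Proof.
apply: mean_eq => [x|e e0]; first exact: cvg_cst.
exists [:: 0] => // x; rewrite /avg big_seq1 divr1 subrr normr0; exact: ltW.
Qed.

Lemma mean_ge0 f : continuous f -> (forall x, 0 <= f x) -> 0 <= mean f.
Proof.
move=> /continuous_bounded[B fB] f0; apply: (@mean_ge f [:: 0] 0 B) => //.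
exact: avg_ge.
Qed.

Lemma mean_shift f a : continuous f -> mean (fun x => f (x + a)) = mean f.
Proof.
move=> cf; apply: mean_eq => [x|e e0].
  apply: (@continuous_comp _ _ _ (fun x => x + a) f); last exact: cf.
  by apply: (@continuous_comp _ _ _ (fun x => (x, a)) (fun z => z.1 + z.2));
    [apply: cvg_pair => //; exact: cvg_cst|exact: add_continuous].
have [s [s0 sf _]] := mean_approx2 cf cf e0; exists s => // x.
have -> : avg s (fun x => f (x + a)) x = avg s f (x + a).
  by rewrite /avg; under eq_bigr => b _ do rewrite addrAC.
exact: sf.
Qed.

Lemma mean_opp f : continuous f -> mean (fun x => f (- x)) = mean f.
Proof.
move=> cf; apply: mean_eq => [x|e e0].
  by apply: (@continuous_comp _ _ _ -%R f); [exact: opp_continuous|exact: cf].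
have [s [s0 sf _]] := mean_approx2 cf cf e0.
exists (map -%R s) => [|x]; first by rewrite -size_eq0 size_map size_eq0.
have -> : avg (map -%R s) (fun x => f (- x)) x = avg s f (- x).
  by rewrite /avg size_map big_map; under eq_bigr => b _ do rewrite opprD opprK.
exact: sf.
Qed.

Lemma mean_gt0 f x0 : continuous f -> (forall x, 0 <= f x) -> 0 < f x0 -> 0 < mean f.
Proof.
move=> cf f0 fx0; have [B fB] := continuous_bounded cf.
have fx2 : 0 < f x0 / 2 by lra.
have /nbhs_shiftE : nbhs x0 [set y | `|f x0 - f y| < f x0 / 2].
  by have /cvgrPdist_lt/(_ _ fx2) := cf x0.
move=> /finite_translates[s s0 sP].
have s'0 : map -%R s != [::] by rewrite -size_eq0 size_map size_eq0.
apply: (@lt_le_trans _ _ (f x0 / 2 / (size s)%:R)); first by rewrite divr_gt0// size_gt0R.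
apply: (mean_ge fB s'0) => x.
rewrite /avg size_map ler_pM2r ?invr_gt0 ?size_gt0R// big_map.
have [a sa /=] := sP (x - x0); have -> : x0 + (x - x0 - a) = x - a.
  by rewrite addrA [x0 + _]addrC subrK.
rewrite ltr_norml => /andP[_ fa].
rewrite (big_rem a)//= -[leLHS]addr0; apply: lerD; first lra.
exact: sumr_ge0.
Qed.

Lemma mean_norm f (k : R) : continuous f -> (forall x, `|f x| <= k) -> `|mean f| <= k.
Proof.
move=> cf fk; rewrite ler_norml; apply/andP; split.
  apply: (@mean_ge f [:: 0] _ k) => //; apply: avg_ge => // x.
  by have := fk x; rewrite ler_norml => /andP[].
apply: (@mean_le f [:: 0] _ k) => //; apply: avg_le => // x.
by have := fk x; rewrite ler_norml => /andP[].
Qed.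

(** Averages over one finite set of translates approximate the means in the
    first variable uniformly in the second one, and finite averages commute
    with the mean. *)
Lemma mean_fubini (F : S -> S -> R) B :
  (forall e, 0 < e -> exists2 U, nbhs 0 U &
     (forall y, unif U e (fun x => F x y)) /\ (forall x, unif U e (F x))) ->
  (forall x y, `|F x y| <= B) ->
  mean (fun x => mean (F x)) = mean (fun y => mean (fun x => F x y)).
Proof.
move=> FU FB.
have c1 x : continuous (F x).
  by apply: unif_continuous => e /FU[U U0 [_ UF]]; exists U.
have c2 y : continuous (fun x => F x y).
  by apply: unif_continuous => e /FU[U U0 [UF _]]; exists U.
have mB (f g : S -> R) : continuous f -> continuous g ->
    mean f - mean g = mean (fun x => f x - g x).
  move=> cf cg; rewrite -mulN1r -meanZ// -meanD//; last by move=> x; apply: cvgMr; exact: cg.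
  by congr mean; apply/funext => x; rewrite mulN1r.
have cB (f g : S -> R) : continuous f -> continuous g -> continuous (fun x => f x - g x).
  by move=> cf cg x; apply: cvgB; [exact: cf|exact: cg].
have uni U e : (forall y, unif U e (fun x => F x y)) -> unif U e (fun x => mean (F x)).
  move=> UF x u Uu; rewrite mB//; apply: mean_norm => [|y]; first exact: cB.
  exact: UF.
have uni2 U e : (forall x, unif U e (F x)) -> unif U e (fun y => mean (fun x => F x y)).
  move=> UF x u Uu; rewrite mB//; apply: mean_norm => [|y]; first exact: cB.
  exact: UF.
have cm1 : continuous (fun x => mean (F x)).
  by apply: unif_continuous => e /FU[U U0 [UF _]]; exists U => //; exact: uni.
have cm2 : continuous (fun y => mean (fun x => F x y)).
  by apply: unif_continuous => e /FU[U U0 [_ UF]]; exists U => //; exact: uni2.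
have mb x : `|mean (F x)| <= B by exact: mean_norm.
apply/eqP; rewrite -subr_eq0 -normr_le0; apply/ler_addgt0Pl => e e0; rewrite addr0.
have e12 : 0 < e / 12%:R by rewrite divr_gt0.
have [U U0 [UF _]] := FU _ e12.
have [s s0 sP] := mean_uniform_approx B U0 e12.
have h1 := sP _ (uni _ _ UF) mb 0.
have h2 : `|mean (fun y => mean (fun x => F x y)) - avg s (fun x => mean (F x)) 0| <= e / 12%:R * 6.
  have -> : avg s (fun x => mean (F x)) 0 = mean (fun y => avg s (fun x => F x y) 0).
    have cs (r : seq S) : continuous (fun y => \sum_(a <- r) F (0 + a) y) /\
        mean (fun y => \sum_(a <- r) F (0 + a) y) = \sum_(a <- r) mean (F (0 + a)).
      elim: r => [|a r [IHc IHm]].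
        rewrite big_nil; split; last first.
          by rewrite -[RHS](mean_cst 0); congr mean; apply/funext => y; rewrite big_nil.
        rewrite (_ : (fun _ => _) = fun=> 0); first by move=> y; exact: cvg_cst.
        by apply/funext => y; rewrite big_nil.
      rewrite big_cons -IHm -meanD//.
      have -> : (fun y => \sum_(b <- a :: r) F (0 + b) y) =
          (fun y => F (0 + a) y + \sum_(b <- r) F (0 + b) y).
        by apply/funext => y; rewrite big_cons.
      by split=> // y; apply: cvgD; [exact: c1|exact: IHc].
    have [sc sm] := cs s; rewrite /avg -sm mulrC -meanZ//.
    by congr mean; apply/funext => y; rewrite mulrC.
  rewrite mB//; last first.
    apply: unif_continuous => e' e'0; have [V V0 [_ VF]] := FU _ e'0.
    exists V => // y u Vu; rewrite /avg -mulrBl -sumrB normrM normfV.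
    rewrite (gtr0_norm (size_gt0R s0)) ler_pdivrMr ?size_gt0R// mulr_natr -sum_const_seq.
    by rewrite (le_trans (ler_norm_sum _ _ _))//; apply: ler_sum => a _; exact: VF.
  apply: mean_norm => [|y].
    apply: cB => //.
    apply: unif_continuous => e' e'0; have [V V0 [_ VF]] := FU _ e'0.
    exists V => // y u Vu; rewrite /avg -mulrBl -sumrB normrM normfV.
    rewrite (gtr0_norm (size_gt0R s0)) ler_pdivrMr ?size_gt0R// mulr_natr -sum_const_seq.
    by rewrite (le_trans (ler_norm_sum _ _ _))//; apply: ler_sum => a _; exact: VF.
  by rewrite distrC; exact: sP.
have -> : e = e / 12%:R * 6 + e / 12%:R * 6.
  by field.
rewrite (_ : _ - _ = (mean (fun x => mean (F x)) - avg s (fun x => mean (F x)) 0)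
  - (mean (fun y => mean (fun x => F x y)) - avg s (fun x => mean (F x)) 0)); last ring.
by rewrite (le_trans (ler_normB _ _))// lerD// distrC.
Qed.

End Mean.

(** * Convolution *)

Section Convolution.
Variables (R : realType) (S : tabType).
Hypothesis cS : compact [set: S].
Implicit Types (p q r : S -> R) (x y : S).
Local Notation mean := (@mean R S).

Lemma continuous_mul p q : continuous p -> continuous q -> continuous (fun x => p x * q x).
Proof. by move=> cp cq x; apply: cvgM; [exact: cp|exact: cq]. Qed.

Lemma continuous_add p q : continuous p -> continuous q -> continuous (fun x => p x + q x).
Proof. by move=> cp cq x; apply: cvgD; [exact: cp|exact: cq]. Qed.

Lemma continuous_scale k p : continuous p -> continuous (fun x => k * p x).
Proof. by move=> cp x; apply: cvgMr; exact: cp. Qed.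

Lemma continuous_subf p q : continuous p -> continuous q -> continuous (fun x => p x - q x).
Proof. by move=> cp cq x; apply: cvgB; [exact: cp|exact: cq]. Qed.

Lemma continuous_arg_opp q : continuous q -> continuous (fun y => q (- y)).
Proof.
by move=> cq y; apply: (@continuous_comp _ _ _ -%R q); [exact: opp_continuous|exact: cq].
Qed.

Lemma continuous_arg_add q x : continuous q -> continuous (fun y => q (y + x)).
Proof.
move=> cq y; apply: (@continuous_comp _ _ _ (fun y => y + x) q); last exact: cq.
by apply: (@continuous_comp _ _ _ (fun y => (y, x)) (fun z => z.1 + z.2));
  [apply: cvg_pair => //; exact: cvg_cst|exact: add_continuous].
Qed.

Lemma continuous_arg_sub q x : continuous q -> continuous (fun y => q (x - y)).
Proof.
move=> /(@continuous_arg_add _ x)/continuous_arg_opp cq.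
by rewrite (_ : (fun y => _) = (fun y => q (- y + x)))//; apply/funext => y; rewrite addrC.
Qed.

Lemma meanB p q : continuous p -> continuous q ->
  mean (fun x => p x - q x) = mean p - mean q.
Proof.
move=> cp cq; rewrite -mulN1r -meanZ// -meanD//; last exact: continuous_scale.
by congr mean; apply/funext => x; rewrite mulN1r.
Qed.

(** The inner product of L^2(S). *)
Definition ip p q := mean (fun x => p x * q x).

Lemma ip_ge0 p : continuous p -> 0 <= ip p p.
Proof.
move=> cp; apply: mean_ge0 => // [|x]; first exact: continuous_mul.
by rewrite -expr2 sqr_ge0.
Qed.

Lemma ip_gt0 p x : continuous p -> p x != 0 -> 0 < ip p p.
Proof.
move=> cp px; apply: (@mean_gt0 _ _ cS _ x); first exact: continuous_mul.
  by move=> y; rewrite -expr2 sqr_ge0.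
by rewrite -expr2 lt_def sqr_ge0 expf_neq0.
Qed.

Lemma ip_eq0 p : continuous p -> ip p p = 0 -> forall x, p x = 0.
Proof.
move=> cp p0 x; apply/eqP; apply: contraT => /(ip_gt0 cp).
by rewrite p0 ltxx.
Qed.

Lemma ip_quad p q k : continuous p -> continuous q ->
  ip (fun x => p x + k * q x) (fun x => p x + k * q x) =
  ip p p + k * (2 * ip p q) + k ^+ 2 * ip q q.
Proof.
move=> cp cq; rewrite /ip -!meanZ//; try (by do ?apply: continuous_scale; exact: continuous_mul).
rewrite -!meanD//; try (by do ?apply: continuous_add; do ?apply: continuous_scale; exact: continuous_mul).
by congr mean; apply/funext => x; ring.
Qed.

Lemma ip_cauchy_schwarz p q : continuous p -> continuous q ->
  ip p q ^+ 2 <= ip p p * ip q q.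
Proof.
move=> cp cq; have [q0|q0] := eqVneq (ip q q) 0.
  have /(ip_eq0 cq) qz := q0; rewrite q0 mulr0 /ip.
  rewrite (_ : (fun x => _) = (fun=> 0)) ?mean_cst ?expr0n//.
  by apply/funext => x; rewrite qz mulr0.
have qp : 0 < ip q q by rewrite lt_def q0 ip_ge0.
have cpq : continuous (fun x => p x + - (ip p q / ip q q) * q x).
  by apply: continuous_add => //; exact: continuous_scale.
have := ip_ge0 cpq; rewrite ip_quad//.
have -> : ip p p + - (ip p q / ip q q) * (2 * ip p q) + (- (ip p q / ip q q)) ^+ 2 * ip q q
   = ip p p - ip p q ^+ 2 / ip q q by field.
by rewrite subr_ge0 ler_pdivrMr.
Qed.

Definition conv p q x := mean (fun y => p y * q (x - y)).

Definition even_fun p := forall x, p (- x) = p x.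

Lemma mean_reflect p x : continuous p -> mean (fun y => p (x - y)) = mean p.
Proof.
move=> cp; rewrite -(mean_opp cS cp) -(mean_shift cS (- x) (continuous_arg_opp cp)).
by congr mean; apply/funext => y; rewrite opprB.
Qed.

Lemma convC p q : continuous p -> continuous q -> conv p q = conv q p.
Proof.
move=> cp cq; apply/funext => x; rewrite /conv -[RHS](mean_reflect x).
  by congr mean; apply/funext => y; rewrite subKr mulrC.
by apply: continuous_mul => //; exact: continuous_arg_sub.
Qed.

Lemma conv_le p q x k B : continuous p -> continuous q ->
  (forall y, `|p y| <= B) -> (forall y, `|q y| <= k) -> `|conv p q x| <= B * k.
Proof.
move=> cp cq pB qk; apply: mean_norm => // [|y].
  by apply: continuous_mul => //; exact: continuous_arg_sub.
by rewrite normrM ler_pM.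
Qed.

Lemma convBr p q r x : continuous p -> continuous q -> continuous r ->
  conv p (fun y => q y - r y) x = conv p q x - conv p r x.
Proof.
move=> cp cq cr; rewrite /conv -meanB; last 2 first.
- by apply: continuous_mul => //; exact: continuous_arg_sub.
- by apply: continuous_mul => //; exact: continuous_arg_sub.
by congr mean; apply/funext => y; rewrite mulrBr.
Qed.

Lemma convDr p q r x : continuous p -> continuous q -> continuous r ->
  conv p (fun y => q y + r y) x = conv p q x + conv p r x.
Proof.
move=> cp cq cr; rewrite /conv -meanD//; last 2 first.
- by apply: continuous_mul => //; exact: continuous_arg_sub.
- by apply: continuous_mul => //; exact: continuous_arg_sub.
by congr mean; apply/funext => y; rewrite mulrDr.
Qed.

Lemma convZr p q k x : continuous p -> continuous q ->
  conv p (fun y => k * q y) x = k * conv p q x.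
Proof.
move=> cp cq; rewrite /conv -meanZ//.
  by congr mean; apply/funext => y; rewrite mulrCA.
by apply: continuous_mul => //; exact: continuous_arg_sub.
Qed.

Lemma conv_shiftr p q a x : conv p (fun y => q (y + a)) x = conv p q (x + a).
Proof. by congr mean; apply/funext => y; rewrite addrAC. Qed.

Lemma conv_continuous p q : continuous p -> continuous q -> continuous (conv p q).
Proof.
move=> cp cq; apply: unif_continuous => e e0.
have [B pB] := continuous_bounded cS cp.
have B0 : 0 <= B by exact: le_trans (pB 0).
have e' : 0 < e / (B + 1) by rewrite divr_gt0// ltr_wpDl.
have [U U0 UP] := continuous_unif cS cq e'.
exists U => // x u Uu.
rewrite -conv_shiftr -convBr//; last exact: continuous_arg_add.
apply: le_trans (conv_le x cp _ pB (fun y => UP y u Uu)) _.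
  by apply: continuous_subf => //; exact: continuous_arg_add.
rewrite mulrCA ger_pMr// ler_pdivrMr ?ltr_wpDl// mul1r lerDl//.
Qed.

Lemma conv_even p q : continuous p -> continuous q -> even_fun p -> even_fun q ->
  even_fun (conv p q).
Proof.
move=> cp cq ep eq x; rewrite /conv -[LHS](mean_opp cS).
  by congr mean; apply/funext => y; rewrite ep -opprD eq.
by apply: continuous_mul => //; exact: continuous_arg_sub.
Qed.

Lemma conv0E p q : even_fun q -> conv p q 0 = ip p q.
Proof. by move=> eq; congr mean; apply/funext => y; rewrite sub0r eq. Qed.

(** The Cauchy-Schwarz inequality for p and a reflected translate of q. *)
Lemma conv_sqr_le p q x : continuous p -> continuous q ->
  conv p q x ^+ 2 <= ip p p * ip q q.
Proof.
move=> cp cq; have cq' : continuous (fun y => q (x - y)) by exact: continuous_arg_sub.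
have := ip_cauchy_schwarz cp cq'; rewrite -/(conv p q x).
rewrite [ip (fun y => q (x - y)) _](_ : _ = ip q q)//.
exact: (@mean_reflect (fun y => q y * q y) x (continuous_mul cq cq)).
Qed.

Lemma convA p q r : continuous p -> continuous q -> continuous r ->
  conv (conv p q) r = conv p (conv q r).
Proof.
move=> cp cq cr; apply/funext => x.
have [A pA] := continuous_bounded cS cp; have [B qB] := continuous_bounded cS cq.
have [C rC] := continuous_bounded cS cr.
have A0 : 0 <= A by exact: le_trans (pA 0).
have B0 : 0 <= B by exact: le_trans (qB 0).
have C0 : 0 <= C by exact: le_trans (rC 0).
pose F y z := p z * q (y - z) * r (x - y).
have -> : conv (conv p q) r x = mean (fun y => mean (F y)).
  congr mean; apply/funext => y; rewrite mulrC -meanZ//; last first.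
    by apply: continuous_mul => //; exact: continuous_arg_sub.
  by congr mean; apply/funext => z; rewrite /F; ring.
rewrite (mean_fubini cS (B := A * B * C)).
- congr mean; apply/funext => z; rewrite /conv -meanZ//; last first.
    by apply: continuous_mul => //; exact: continuous_arg_sub.
  rewrite -(mean_shift cS z); last first.
    by apply: continuous_mul; [apply: continuous_scale; exact: continuous_arg_add|exact: continuous_arg_sub].
  congr mean; apply/funext => y; rewrite /F addrK -mulrA; congr (_ * (_ * r _)).
  by rewrite opprD addrA addrAC.
- move=> e e0; have M0 : 0 < A * B + B * C + A * C + 1.
    by rewrite ltr_wpDl// !addr_ge0// mulr_ge0.
  pose e' := e / ((A * B + B * C + A * C + 1) * 2).
  have e'0 : 0 < e' by rewrite divr_gt0// mulr_gt0.
  have [U U0 UP] := continuous_unif cS cp e'0.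
  have [V V0 VP] := continuous_unif cS cq e'0.
  have [W W0 WP] := continuous_unif cS cr e'0.
  have V'0 := nbhs0N V0; have W'0 := nbhs0N W0.
  have bnd a b : 0 <= a -> 0 <= b -> a + b <= (A * B + B * C + A * C) * 2 -> (a + b) * e' <= e.
    move=> a0 b0 ab; rewrite /e' mulrCA ger_pMr// ler_pdivrMr ?mulr_gt0// mul1r.
    by rewrite (le_trans ab)// ler_pM2r//; lra.
  have AB := mulr_ge0 A0 B0; have BC := mulr_ge0 B0 C0; have AC := mulr_ge0 A0 C0.
  exists (U `&` V `&` W `&` [set u | V (- u)] `&` [set u | W (- u)]).
    by do !apply: filterI.
  split=> [z y u [[[[Uu Vu] Wu] Vnu] Wnu]|y z u [[[[Uu Vu] Wu] Vnu] Wnu]].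
  + have q1 := VP (y - z) u Vu; have r1 := WP (x - y) (- u) Wnu.
    rewrite /F (addrAC y u) opprD addrA.
    rewrite (_ : _ - _ = p z * (q (y - z + u) - q (y - z)) * r (x - y - u)
        + p z * q (y - z) * (r (x - y - u) - r (x - y))); last by ring.
    rewrite (le_trans (ler_normD _ _))// !normrM.
    apply: le_trans (bnd (A * C) (A * B) _ _ _) => //; last by lra.
    rewrite mulrDl; apply: lerD; last by rewrite ler_pM// ?mulr_ge0// ler_pM.
    by rewrite mulrAC ler_pM// ?mulr_ge0// ler_pM.
  + have q1 := VP (y - z) (- u) Vnu; have p1 := UP z u Uu.
    rewrite /F opprD addrA.
    rewrite (_ : _ - _ = (p (z + u) - p z) * (q (y - z - u)) * r (x - y)
        + p z * (q (y - z - u) - q (y - z)) * r (x - y)); last by ring.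
    rewrite (le_trans (ler_normD _ _))// !normrM.
    apply: le_trans (bnd (B * C) (A * C) _ _ _) => //; last by lra.
    rewrite mulrDl; apply: lerD; last by rewrite mulrAC ler_pM// ?mulr_ge0// ler_pM.
    by rewrite -mulrA mulrC ler_pM// ?mulr_ge0// ler_pM.
- by move=> y z; rewrite /F !normrM ler_pM// ?mulr_ge0// ler_pM.
Qed.

Lemma convDl p q r : continuous p -> continuous q -> continuous r ->
  conv (fun y => p y + q y) r = fun x => conv p r x + conv q r x.
Proof.
move=> cp cq cr; rewrite convC//; last exact: continuous_add.
by apply/funext => x; rewrite convDr// [conv r p]convC// [conv r q]convC.
Qed.

Lemma convZl p q k : continuous p -> continuous q ->
  conv (fun y => k * p y) q = fun x => k * conv p q x.
Proof.
move=> cp cq; rewrite convC//; last exact: continuous_scale.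
by apply/funext => x; rewrite convZr// [conv q p]convC.
Qed.

End Convolution.

(** * Power iteration *)

Section PowerIteration.
Variables (R : realType) (S : tabType).
Hypothesis cS : compact [set: S].
Local Notation ip := (@ip R S).
Local Notation conv := (@conv R S).
Local Notation even_fun := (@even_fun R S).

Lemma bernoulli_ge (x : R) (N : nat) : 0 <= x <= 1 -> 1 - x *+ N <= (1 - x) ^+ N.
Proof.
move=> /andP[x0 x1]; elim: N => [|N IHN]; first by rewrite expr0 mulr0n subr0.
rewrite exprS mulrS; have := ler_wpM2l (_ : 0 <= 1 - x) IHN.
have xN : 0 <= x *+ N by rewrite mulrn_wge0.
by rewrite subr_ge0 => /(_ x1); nra.
Qed.

Section Iterates.
Variables (w : S -> R) (x0 : S).
Hypotheses (cw : continuous w) (ew : even_fun w) (wx0 : w x0 != 0).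

(** The convolution powers of w; [wpow n] has n + 1 factors. *)
Fixpoint wpow n : S -> R := if n is n'.+1 then conv w (wpow n') else w.

Let W := wpow.
Let b n := ip (W n) (W n).

Lemma wpow_cont n : continuous (W n).
Proof. by elim: n => [//|n IHn]; exact: conv_continuous. Qed.
Let cW := wpow_cont.

Lemma wpow_even n : even_fun (W n).
Proof. by elim: n => [//|n IHn]; exact: conv_even. Qed.

Lemma wpow_conv m n : conv (W m) (W n) = W (m + n).+1.
Proof.
elim: m => [//|m IHm].
by rewrite [LHS](convA cS) ?IHm//; exact: cW.
Qed.

Let ipW m n : ip (W m) (W n) = W (m + n).+1 0.
Proof. by rewrite -wpow_conv conv0E//; exact: wpow_even. Qed.

Let b_convex n : b n.+1 ^+ 2 <= b n * b n.+2.
Proof.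
have -> : b n.+1 = ip (W n) (W n.+2) by rewrite /b !ipW addSn -addnS.
exact: ip_cauchy_schwarz.
Qed.

Let b_gt0 n : 0 < b n.
Proof.
suff [] : 0 < b n /\ 0 < b n.+1 by [].
elim: n => [|n [bn bn1]].
  have b0 : 0 < b 0%N by exact: (@ip_gt0 _ _ cS _ x0).
  split=> //; apply: (@ip_gt0 _ _ cS _ 0) => //.
  by rewrite -[W 1 0](ipW 0 0) gt_eqF.
split=> //; have := b_convex n.
have : 0 < b n.+1 ^+ 2 by rewrite exprn_gt0.
by move=> /lt_le_trans/[apply]; rewrite pmulr_rgt0.
Qed.

Let r n := b n.+1 / b n.

Let r_nondecr : nondecreasing_seq r.
Proof.
apply/nondecreasing_seqP => n; rewrite /r ler_pdivrMr ?b_gt0// mulrAC ler_pdivlMr ?b_gt0//.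
by rewrite -expr2 mulrC b_convex.
Qed.

Let mean_sq_le (p : S -> R) k : continuous p -> (forall x, p x ^+ 2 <= k) -> ip p p <= k.
Proof.
move=> cp pk; apply: le_trans (ler_norm _) _; apply: mean_norm => // [|x].
  exact: continuous_mul.
by rewrite -expr2 ger0_norm ?sqr_ge0.
Qed.

Let r_le n : r n <= b 0%N.
Proof.
rewrite ler_pdivrMr ?b_gt0//; apply: mean_sq_le => // x.
exact: conv_sqr_le.
Qed.

Let mu := sup (range r).

Let r_mu n : r n <= mu.
Proof.
apply: ub_le_sup; last by exists n.
by exists (b 0%N) => _ [m _ <-].
Qed.

Let mu_gt0 : 0 < mu.
Proof. by apply: lt_le_trans (r_mu 0); rewrite divr_gt0 ?b_gt0. Qed.

Let r_near s : s < 1 -> exists J, forall j, (J <= j)%N -> s * mu <= r j.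
Proof.
move=> s1; have : s * mu < mu by rewrite gtr_pMl.
move=> /(@sup_gt _ (range r))[|_ [J _ <-] sJ]; first by exists (r 0%N); exists 0%N.
exists J => j Jj; apply: ltW; apply: lt_le_trans sJ _.
exact: r_nondecr.
Qed.

Let a n := b n / mu ^+ n.+1.

Let muX n : 0 < mu ^+ n. Proof. by rewrite exprn_gt0. Qed.

Let a_gt0 n : 0 < a n. Proof. by rewrite divr_gt0 ?b_gt0. Qed.

Let aS n : a n.+1 = a n * (r n / mu).
Proof.
rewrite /a /r exprS; field.
by rewrite !gt_eqF ?b_gt0 ?muX.
Qed.

Let a_nonincr : nonincreasing_seq a.
Proof.
apply/nonincreasing_seqP => n; rewrite aS ger_pMr//.
by rewrite ler_pdivrMr// mul1r.
Qed.

Let a_double n : a (n + n).+1 <= a n ^+ 2.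
Proof.
rewrite /a expr_div_n -exprM muln2 -addnn addSn addnS ler_pM2r ?invr_gt0//.
apply: mean_sq_le => // x; rewrite -wpow_conv.
rewrite [leRHS]expr2; exact: conv_sqr_le.
Qed.

(** The norms a n are submultiplicative along n -> 2n + 1, while their
    successive ratios tend to 1: a value below 1 would make them decay at a
    geometric rate that the ratios exclude. *)
Let a_ge1 n : 1 <= a n.
Proof.
rewrite leNgt; apply/negP => an1.
set t := a n in an1; have t0 : 0 < t by exact: a_gt0.
pose N := (n.+1 * 2)%N.
have N0 : 0 < N%:R :> R by rewrite ltr0n muln_gt0.
pose s := 1 - (1 - t) / N%:R.
have N1 : 1 <= N%:R :> R by rewrite ler1n muln_gt0.
have x01 : 0 <= (1 - t) / N%:R <= 1.
  apply/andP; split; first by rewrite divr_ge0 ?subr_ge0 ?ltW.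
  by rewrite ler_pdivrMr// mul1r; lra.
have s1 : s < 1 by rewrite /s ltrBlDr ltrDl divr_gt0// subr_gt0.
have s0 : 0 <= s by rewrite subr_ge0; case/andP: x01.
have sN : t <= s ^+ N.
  apply: le_trans (bernoulli_ge N x01).
  by rewrite -(mulr_natr (_ / _)) divfK ?gt_eqF//; lra.
have [J JP] := r_near s1.
have aJ (i : nat) : a J * s ^+ i <= a (J + i)%N.
  elim: i => [|i IHi]; first by rewrite expr0 mulr1 addn0.
  have h0 : 0 <= a J * s ^+ i by rewrite mulr_ge0 ?exprn_ge0// ltW// a_gt0.
  rewrite exprSr mulrA addnS aS; apply: ler_pM => //.
  by rewrite ler_pdivlMr// JP// leq_addr.
have aj (j : nat) : (J <= j)%N -> a J * s ^+ j <= a j.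
  move=> Jj; have := aJ (j - J)%N; rewrite subnKC// => /(le_trans _); apply.
  by rewrite ler_pM2l ?a_gt0//; apply: ler_wiXn2l => //; [exact: ltW|exact: leq_subr].
pose m k := (2 ^ k * n.+1).-1.
have mS k : (m k).+1 = (2 ^ k * n.+1)%N by rewrite prednK// muln_gt0 expn_gt0.
have am k : a (m k) <= t ^+ (2 ^ k).
  elim: k => [|k IHk]; first by rewrite /m mul1n expr1.
  have -> : m k.+1 = (m k + m k).+1.
    apply: succn_inj; rewrite mS expnS -mulnA -mS mul2n -addnn addSn addnS//.
  apply: (le_trans (a_double _)); rewrite expnS mulnC exprM.
  by rewrite ler_sqr ?nnegrE ?exprn_ge0// ltW.
pose sg := s ^+ n.+1.
have sg0 : 0 <= sg by rewrite exprn_ge0.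
have sg1 : sg < 1 by rewrite exprn_ilt1.
have key k : (J <= m k)%N -> 0 < sg -> a J <= sg ^+ (2 ^ k).
  move=> Jm sgp; have := le_trans (aj _ Jm) (am k).
  move=> h; have sp : 0 < s by rewrite lt_def s0 andbT; apply: contraTneq sgp => s_0; rewrite /sg s_0 expr0n ltxx.
  have h1 : a J * s ^+ (m k).+1 <= t ^+ (2 ^ k).
    apply: le_trans h; rewrite ler_pM2l ?a_gt0// exprS ger_pMl ?exprn_gt0//.
    exact: ltW.
  have h2 : t ^+ (2 ^ k) <= sg ^+ (2 ^ k) * sg ^+ (2 ^ k).
    rewrite -exprMn -/sg /sg -exprD addnn -muln2.
    by apply: lerXn2r => //; rewrite nnegrE ?exprn_ge0// ltW.
  have sgE : s ^+ (m k).+1 = sg ^+ (2 ^ k) by rewrite mS mulnC exprM.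
  rewrite sgE in h1; have := le_trans h1 h2.
  by rewrite ler_pM2r ?exprn_gt0.
have sgp : 0 < sg.
  rewrite lt_def sg0 andbT; apply: contraTneq t0 => sg_0; rewrite -leNgt.
  by apply: (le_trans sN); rewrite exprM -/sg sg_0 expr0n.
have : `|sg| < 1 by rewrite ger0_norm.
move=> /cvg_expr/cvgrPdist_lt/(_ (a J) (a_gt0 J))[K _ KP].
pose k := (J + K)%N.
have k2 : (k <= 2 ^ k)%N by rewrite ltnW// ltn_expl.
have /= := KP (2 ^ k)%N (leq_trans (leq_addl _ _) k2).
rewrite sub0r normrN ger0_norm ?exprn_ge0// ltNge => /negP; apply; apply: key => //.
rewrite -ltnS mS; apply: (@leq_trans (2 ^ k * 1)); last by rewrite leq_mul2l orbT.
rewrite muln1; apply: leq_trans (ltn_expl k _); last by [].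
by rewrite ltnS leq_addr.
Qed.

Let phi n x := (mu ^+ n.+1)^-1 * W (n + n).+1 x.

Let cphi n : continuous (phi n). Proof. exact: continuous_scale. Qed.

Let phi_even n : even_fun (phi n).
Proof. by move=> x; rewrite /phi wpow_even. Qed.

Let phi_conv m n : conv (phi m) (phi n) = phi (m + n).+1.
Proof.
rewrite /phi convZl//; last exact: continuous_scale.
apply/funext => x; rewrite convZr// wpow_conv mulrA -invfM -exprD.
congr (_^-1 * W _ x); last by lia.
by congr (_ ^+ _); lia.
Qed.

Let phi0 n : phi n 0 = a n.
Proof. by rewrite /phi /a /b ipW mulrC. Qed.

Let ip_phi m n : ip (phi m) (phi n) = a (m + n).+1.
Proof. by rewrite -phi0 -phi_conv conv0E. Qed.

Let alim := inf (range a).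

Let a_lim n : alim <= a n.
Proof.
apply: ge_inf; last by exists n.
by exists 0 => _ [m _ <-]; exact: ltW.
Qed.

Let a_near e : 0 < e -> exists N, forall n, (N <= n)%N -> a n <= alim + e.
Proof.
move=> e0; have : alim < alim + e by rewrite ltrDl.
move=> /(@inf_lt _ (range a))[|_ [N _ <-] aN]; first by exists (a 0%N); exists 0%N.
by exists N => n Nn; exact: le_trans (a_nonincr Nn) (ltW aN).
Qed.

Let phi_sqr m n x : (phi n.+1 x - phi m.+1 x) ^+ 2 <=
  a 1%N * (a (n + n).+1 - 2 * a (n + m).+1 + a (m + m).+1).
Proof.
have -> : phi n.+1 x - phi m.+1 x = conv (phi 0%N) (fun y => phi n y - phi m y) x.
  by rewrite convBr// !phi_conv !add0n.
have cd : continuous (fun y => phi n y - phi m y) by exact: continuous_subf.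
apply: (le_trans (conv_sqr_le cS x (@cphi 0%N) cd)).
rewrite ip_phi le_eqVlt; apply/orP; left; apply/eqP; congr (_ * _).
rewrite (_ : (fun y => _) = (fun y => phi n y + (-1) * phi m y)); last first.
  by apply/funext => y; rewrite mulN1r.
by rewrite ip_quad// !ip_phi; ring.
Qed.

Let phi_cauchy e : 0 < e -> exists N, forall m n x, (N <= m)%N -> (N <= n)%N ->
  `|phi n x - phi m x| <= e.
Proof.
move=> e0; have a1 := a_gt0 1.
have d0 : 0 < e ^+ 2 / (2 * a 1%N) by rewrite divr_gt0 ?exprn_gt0// mulr_gt0.
have [N NP] := a_near d0; exists N.+1 => -[//|m] [//|n] x Nm Nn.
rewrite -[leRHS](ger0_norm (ltW e0)) -ler_sqr ?nnegrE// !real_normK ?num_real//.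
apply: (le_trans (phi_sqr _ _ _)); rewrite mulrC -ler_pdivlMr//.
have h1 := NP (n + n).+1 ltac:(lia); have h2 := NP (m + m).+1 ltac:(lia).
have h3 := a_lim (n + m).+1.
have -> : e ^+ 2 / a 1%N = 2 * (e ^+ 2 / (2 * a 1%N)) by field; rewrite gt_eqF.
by lra.
Qed.

(** The convolution powers of w, normalised by the top eigenvalue mu of the
    operator of convolution with w * w, form a Cauchy sequence. The limit psi
    is the projection to the top eigenspace, an idempotent for convolution. *)
Lemma power_iteration : exists (nu : R) (psi : S -> R),
  [/\ 0 < nu, continuous psi, even_fun psi, psi 0 != 0 &
      conv psi psi = psi /\ conv (conv w w) psi = fun x => nu * psi x].
Proof.
have cvg_phi x : cvgn (fun n => phi n x).
  apply/cauchy_cvgP/cauchy_exP => e e0.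
  have [|N NP] := @phi_cauchy (e / 2); first lra.
  exists (phi N x); exists N => // n Nn; rewrite /ball /= distrC.
  by apply: le_lt_trans (NP N n x (leqnn _) Nn) _; lra.
pose psi x := limn (fun n => phi n x).
have psiP e : 0 < e -> exists N, forall n x, (N <= n)%N -> `|phi n x - psi x| <= e.
  move=> e0; have [N NP] := phi_cauchy e0; exists N => n x Nn.
  have h : (fun m => `|phi n x - phi m x|) @ \oo --> `|phi n x - psi x|.
    by apply: cvg_norm; apply: cvgB; [exact: cvg_cst|exact: cvg_phi].
  rewrite -(cvg_lim _ h)//; apply: limr_le; first by apply/cvg_ex; eexists; exact: h.
  by exists N => // m /= Nm; exact: NP.
have cpsi : continuous psi.
  apply: unif_continuous => e e0; have [|N NP] := psiP (e / 3); first lra.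
  have [|U U0 UP] := continuous_unif cS (@cphi N) (e := e / 3); first lra.
  exists U => // x u /(UP x) h; have := NP N x (leqnn _); have := NP N (x + u) (leqnn _).
  by move: h; rewrite !ler_norml => /andP[? ?] /andP[? ?] /andP[? ?]; apply/andP; split; lra.
have epsi : even_fun psi by move=> x; congr (limn _); apply/funext => n; exact: phi_even.
have psi1 : 1 <= psi 0.
  apply: limr_ge; first exact: cvg_phi.
  by apply: nearW => n; rewrite phi0; exact: a_ge1.
(* p * psi is the limit of p * phi_n. *)
have conv_lim p q : continuous p -> (forall e, 0 < e -> exists N, forall n x,
    (N <= n)%N -> `|conv p (phi n) x - q x| <= e) -> conv p psi = q.
  move=> cp pq; apply/funext => x; apply/eqP; rewrite -subr_eq0 -normr_le0.
  apply/ler_addgt0Pl => e e0; rewrite addr0.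
  have [B pB] := continuous_bounded cS cp.
  have B0 : 0 <= B by exact: le_trans (pB 0).
  have [|N NP] := psiP (e / (2 * (B + 1))); first by rewrite divr_gt0// mulr_gt0// ltr_wpDl.
  have [|M MP] := pq (e / 2); first lra.
  pose n := (N + M)%N.
  have -> : conv p psi x - q x = conv p (fun y => psi y - phi n y) x + (conv p (phi n) x - q x).
    by rewrite convBr//; ring.
  rewrite (le_trans (ler_normD _ _))// (_ : e = e / 2 + e / 2); last lra.
  apply: lerD; last by apply: MP; exact: leq_addl.
  apply: le_trans (conv_le x cp (k := e / (2 * (B + 1))) _ pB _) _.
  - exact: continuous_subf.
  - by move=> y; rewrite distrC; apply: NP; exact: leq_addr.
  have B1 : 0 < B + 1 by rewrite ltr_wpDl.
  have -> : B * (e / (2 * (B + 1))) = e / 2 * (B / (B + 1)) by field; rewrite gt_eqF.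
  have e2 : 0 <= e / 2 by lra.
  by rewrite ler_piMr// ler_pdivrMr// mul1r lerDl.
have phipsi m : conv (phi m) psi = psi.
  apply: conv_lim => // e /psiP[N NP]; exists N => n x Nn; rewrite phi_conv.
  by apply: NP; lia.
exists mu, psi; split=> //; first by rewrite gt_eqF// (lt_le_trans _ psi1).
split.
  apply: conv_lim => // e /psiP[N NP]; exists N => n x Nn.
  by rewrite convC// phipsi subrr normr0; exact: le_trans (normr_ge0 _) (NP n x Nn).
have := phipsi 0%N; rewrite /phi convZl//.
move=> h; apply/funext => x; rewrite -[in RHS]h expr1 mulrA divff ?gt_eqF// mul1r.
by [].
Qed.

End Iterates.

End PowerIteration.

(** * Minimal idempotents and cosine functions *)

Section CosineFunctions.
Variables (R : realType) (S : tabType).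
Hypothesis cS : compact [set: S].
Local Notation ip := (@ip R S).
Local Notation conv := (@conv R S).
Local Notation even_fun := (@even_fun R S).
Implicit Types (p q : S -> R).

Definition symm (y : S) p x := (p (x + y) + p (x - y)) / 2.

Lemma symm_cont y p : continuous p -> continuous (symm y p).
Proof.
move=> cp; rewrite /symm (_ : (fun x => _) = (fun x => 2^-1 * (p (x + y) + p (x - y)))).
  by apply: continuous_scale; apply: continuous_add; exact: continuous_arg_add.
by apply/funext => x; rewrite mulrC.
Qed.

Lemma symm_even y p : even_fun p -> even_fun (symm y p).
Proof.
move=> ep x; rewrite /symm (_ : - x + y = - (x - y)); last by rewrite opprB addrC.
by rewrite -opprD !ep addrC.
Qed.

Lemma conv_symm y p q : continuous p -> continuous q ->
  conv p (symm y q) = symm y (conv p q).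
Proof.
move=> cp cq; apply/funext => x.
have c1 := @continuous_arg_add R S q y cq; have c2 := @continuous_arg_add R S q (- y) cq.
rewrite (_ : symm y q = (fun x => 2^-1 * (q (x + y) + q (x - y)))); last first.
  by apply/funext => z; rewrite /symm mulrC.
rewrite convZr//; last exact: continuous_add.
by rewrite convDr// !conv_shiftr /symm mulrC.
Qed.

(** By the Cauchy-Schwarz inequality p(0) <= p(0)^2. So p(0), the dimension of
    the range of the projection, cannot decrease forever. *)
Lemma idempotent_ge1 p x : continuous p -> even_fun p -> conv p p = p ->
  p x != 0 -> 1 <= p 0.
Proof.
move=> cp ep pp px.
have p0 : p 0 = ip p p by rewrite -[in LHS]pp conv0E.
have p0_gt0 : 0 < p 0 by rewrite p0; exact: ip_gt0 px.
have : ip p p <= p 0 ^+ 2.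
  apply: le_trans (ler_norm _) _; apply: mean_norm => // [|y].
    exact: continuous_mul.
  rewrite -expr2 ger0_norm ?sqr_ge0// -[in leLHS]pp (le_trans (conv_sqr_le _ _ _ _))//.
  by rewrite -p0 expr2.
by rewrite -p0 expr2 ler_pMr.
Qed.

Section Minimal.
Variables (w : S -> R) (nu : R).
Hypothesis cw : continuous w.

(** Idempotents below the eigenprojection of the convolution square of w. *)
Let good p := [/\ continuous p, even_fun p, conv p p = p, p 0 != 0 &
  conv (conv w w) p = fun x => nu * p x].

(** Apply power iteration to v = p + S_y p, where S_y is the symmetrised
    translation by y. The resulting idempotent q lies below p. If it differs
    from p, then p - q is an idempotent too, so that q(0) is smaller by at
    least 1. If q = p, then v acts on the range of p with square nu, and
    positivity shows that v is a multiple of p. *)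
Let reduce p y : good p -> (exists c, forall x, symm y p x = c * p x) \/
  exists2 q, good q & q 0 <= p 0 - 1.
Proof.
move=> [cp ep pp p0 wp].
pose v x := p x + symm y p x.
have cs : continuous (symm y p) by exact: symm_cont.
have cv : continuous v by exact: continuous_add.
have ev : even_fun v by move=> x; rewrite /v ep symm_even.
have pv : conv p v = v by apply/funext => x; rewrite convDr// conv_symm// pp.
have [v0|nv0] := pselect (forall x, v x = 0).
  left; exists (-1) => x; rewrite mulN1r; apply/eqP.
  by rewrite -addr_eq0 addrC -/(v x) v0.
have [x1 vx1] : exists x1, v x1 != 0.
  by apply: contrapT => nx; apply: nv0 => x; apply/eqP; apply: contrapT => /negP vx; apply: nx; exists x.
have [nu' [q [nu'0 cq eq q0 [qq vq]]]] := power_iteration cS cv ev vx1.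
have cvv : continuous (conv v v) by exact: conv_continuous.
have pq : conv p q = q.
  have : conv p (conv (conv v v) q) = conv (conv v v) q.
    by rewrite -!(convA cS)// ?pv//; exact: conv_continuous.
  rewrite vq => h; apply/funext => x.
  have : conv p (fun x0 => nu' * q x0) x = nu' * q x by rewrite h.
  rewrite convZr// => /(mulfI _); apply; by rewrite gt_eqF.
have cww : continuous (conv w w) by exact: conv_continuous.
have gq : good q.
  split=> //; rewrite -{1}pq -(convA cS)// wp convZl//.
  by apply/funext => x; rewrite pq.
have [qp|nqp] := pselect (q = p); last first.
  right; exists q => //; rewrite lerBrDl addrC -lerBrDl.
  have [x2 qx2] : exists x2, p x2 - q x2 != 0.
    apply: contrapT => nx; apply: nqp; apply/funext => x.
    apply/eqP; rewrite eq_sym -subr_eq0; apply: contrapT => /negP vx; apply: nx; by exists x.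
  have cpq : continuous (fun x => p x - q x) by exact: continuous_subf.
  apply: (idempotent_ge1 cpq _ _ qx2) => [x|]; first by rewrite ep eq.
  have qpE : conv q p = q by rewrite convC.
  apply/funext => x; rewrite convBr//.
  rewrite [conv _ p](_ : _ = fun x => p x - q x); last first.
    by rewrite convC//; apply/funext => z; rewrite convBr// pp pq.
  rewrite [conv _ q](_ : _ = fun x => 0) ?subr0//.
  by rewrite convC//; apply/funext => z; rewrite convBr// qq qpE subrr.
left; rewrite {q cq eq q0 qq pq gq}qp in vq.
have vv : conv v v = fun x => nu' * p x.
  by rewrite -vq (convA cS)// [conv v p]convC// pv.
pose k := Num.sqrt nu'; have k0 : 0 < k by rewrite sqrtr_gt0.
have k2 : k ^+ 2 = nu' by rewrite sqr_sqrtr// ltW.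
pose B x := v x + (- k) * p x.
have ckp : continuous (fun x => (- k) * p x) by exact: continuous_scale.
have cB : continuous B by exact: continuous_add.
have Bv x : conv B v x = - k * B x.
  by rewrite convDl// convZl// pv vv /B -k2; ring.
have Bp : conv B p = B.
  by rewrite convDl// convZl// pp [conv v p]convC// pv.
have Bv' x : conv B v x = B x + symm y B x by rewrite convDr// conv_symm// Bp.
have cBy : continuous (fun x => B (x + y)) by exact: continuous_arg_add.
have cBy' : continuous (fun x => B (x - y)) by exact: continuous_arg_add.
have ipy z : continuous (fun x => B (x + z)) -> - ip B B <= ip (fun x => B (x + z)) B.
  move=> cz; have cq : continuous (fun x => B (x + z) + 1 * B x).
    by apply: continuous_add => //; exact: continuous_scale.
  have := ip_ge0 cS cq; rewrite ip_quad//.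
  have -> : ip (fun x => B (x + z)) (fun x => B (x + z)) = ip B B.
    by rewrite /ip (mean_shift cS z (continuous_mul cB cB)).
  by lra.
have ipE : ip (symm y B) B = (ip (fun x => B (x + y)) B + ip (fun x => B (x - y)) B) / 2.
  rewrite /ip -meanD//; try exact: continuous_mul.
  rewrite mulrC -meanZ//; last by apply: continuous_add; exact: continuous_mul.
  by congr mean; apply/funext => x; rewrite /symm; field.
have ipE2 : ip (symm y B) B = (- k - 1) * ip B B.
  rewrite /ip -meanZ//; last exact: continuous_mul.
  congr mean; apply/funext => x; rewrite mulrA; congr (_ * _).
  by have := Bv x; rewrite Bv' => h; rewrite mulrBl -h mul1r addrAC subrr add0r.
have B0 : ip B B = 0.
  have h1 := ipy y cBy; have h2 := ipy (- y) cBy'; have h3 := ip_ge0 cS cB.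
  by apply/eqP; rewrite eq_le h3 andbT -(pmulr_rle0 _ k0); lra.
exists (k - 1) => x; have := ip_eq0 cS cB B0 x.
by rewrite /B /v => /eqP; rewrite mulNr subr_eq0 => /eqP h; rewrite mulrBl -h; ring.
Qed.

Lemma minimal_idempotent p : good p ->
  exists2 q, good q & forall y, exists c, forall x, symm y q x = c * q x.
Proof.
move=> gp.
have [N pN] : exists N : nat, p 0 < N%:R.
  by exists (Num.truncn (p 0)).+1; exact: truncnS_gt.
elim: N p gp pN => [|N IHN] p gp pN.
  by have [cp ep pp p0 _] := gp; have := idempotent_ge1 cp ep pp p0; lra.
have [?|] := pselect (forall y, exists c, forall x, symm y p x = c * p x); first by exists p.
move=> /existsNP[y ny]; have [//|[q gq qp]] := reduce y gp.
by apply: (IHN q) => //; rewrite -natr1 in pN; lra.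
Qed.

End Minimal.

(** Normalising a minimal idempotent p, whose symmetrised translates are
    multiples of p, gives a solution of the equation of d'Alembert. To make it
    distinguish x1 from 0, the iteration starts from w = u - S_{x1} u: if g(x1)
    were 1, then convolution with w would annihilate p. *)
Lemma cosine_function x1 : x1 != 0 -> exists g : S -> R,
  [/\ continuous g, g 0 = 1, forall x y, g (x + y) + g (x - y) = 2 * g x * g y,
      forall x, `|g x| <= 1 & g x1 != 1].
Proof.
move=> x10.
have nS := compact_normal hausdorffP cS.
have cl1 (z : S) : closed [set z] by apply: compact_closed; [exact: hausdorffP|exact: compact_set1].
have /(uniform_separatorP (R := R))[f [cf f01 f0 f1]] : uniform_separator [set (0 : S)] [set x1].
  move/normal_separatorP : nS; apply => //; apply/seteqP; split=> // z [/= -> /eqP].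
  by rewrite eq_sym (negbTE x10).
pose u x := f x + f (- x).
have cu : continuous u by apply: continuous_add => //; exact: continuous_arg_opp.
have eu : even_fun u by move=> x; rewrite /u opprK addrC.
have ge0 z : 0 <= f z by have /= := f01 (f z) ltac:(by exists z); rewrite in_itv /= => /andP[].
have u0 : u 0 = 0 by rewrite /u oppr0 (f0 (f 0)) ?addr0//; exists 0.
have u1 : 1 <= u x1 by rewrite /u (f1 (f x1)); [rewrite lerDl|exists x1].
pose w x := u x + (-1) * symm x1 u x.
have cs : continuous (symm x1 u) by exact: symm_cont.
have cms : continuous (fun x => (-1) * symm x1 u x) by exact: continuous_scale.
have cw : continuous w by exact: continuous_add.
have ew : even_fun w by move=> x; rewrite /w eu symm_even.
have w0 : w 0 != 0.
  by rewrite /w u0 /symm !add0r eu lt_eqF// mulN1r; lra.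
have [nu [p0 [nu0 cp0 ep0 p00 [pp0 wp0]]]] := power_iteration cS cw ew w0.
have [p [cp ep pp pn0 wp] psymm] := minimal_idempotent cw (And5 cp0 ep0 pp0 p00 wp0).
have p1 := idempotent_ge1 cp ep pp pn0.
have pgt : 0 < p 0 by lra.
have pE : p 0 = ip p p by rewrite -[in LHS]pp conv0E.
pose g x := p x / p 0.
have gE x : p x = g x * p 0 by rewrite /g divfK.
exists g; split.
- rewrite /g (_ : (fun x => _) = fun x => (p 0)^-1 * p x); first exact: continuous_scale.
  by apply/funext => x; rewrite mulrC.
- by rewrite /g divff.
- move=> x y; have [c cE] := psymm y.
  have := cE 0; rewrite /symm add0r sub0r ep => h0.
  have := cE x; rewrite /symm => hx.
  have cg : c = g y by apply: (mulIf pn0); rewrite -gE -h0; lra.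
  by rewrite cg (gE (x + y)) (gE (x - y)) (gE x) in hx; apply: (mulIf pn0); lra.
- move=> x; rewrite /g normrM normfV (gtr0_norm pgt) ler_pdivrMr// mul1r.
  rewrite -[leRHS]gtr0_norm// -ler_sqr ?nnegrE// !real_normK ?num_real//.
  by rewrite -[in leLHS]pp (le_trans (conv_sqr_le cS _ _ _))// -pE expr2.
- apply/eqP => g1; have [c cE] := psymm x1.
  have px1 : p x1 = p 0 by rewrite gE g1 mul1r.
  have c1 : c = 1.
    have := cE 0; rewrite /symm add0r sub0r ep px1 => h.
    by apply: (mulIf pn0); rewrite -h; lra.
  have sp : symm x1 p = p by apply/funext => x; rewrite cE c1 mul1r.
  have wp0' : conv w p = fun=> 0.
    rewrite convDl// convZl//; apply/funext => x.
    by rewrite [conv (symm x1 u) p]convC// conv_symm// [conv p u]convC// -conv_symm// sp; ring.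
  have wwp : conv w (conv w p) = fun=> 0.
    rewrite wp0'; apply/funext => x; rewrite -[RHS](mean_cst cS 0).
    by congr mean; apply/funext => z; rewrite mulr0.
  have h0 : nu * p 0 = 0 by rewrite -[LHS](congr1 (fun h => h 0) wp) (convA cS)// wwp.
  by move/eqP: h0; rewrite mulf_eq0 (negbTE pn0) gt_eqF.
Qed.

End CosineFunctions.

(** * Characters from cosine functions *)

(** The angle of a full turn, kept opaque: its numeral would otherwise be
    rewritten by lemmas on multiples. *)
Definition full_turn (R : realType) : R := 2 * pi.

Section CharactersFromCosines.
Variables (R : realType) (S : tabType) (g : S -> R).
Hypotheses (cg : continuous g) (g0 : g 0 = 1) (g1 : forall x, `|g x| <= 1).
Hypothesis gD : forall x y, g (x + y) + g (x - y) = 2 * g x * g y.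

Local Notation tau := (full_turn R).

Let tau_gt0 : 0 < tau. Proof. by rewrite /full_turn mulr_gt0// pi_gt0. Qed.

Let tauE : tau = pi + pi. Proof. by rewrite /full_turn mulr_natl mulr2n. Qed.

Lemma cos_eq1 (t : R) : `|t| <= 1 / 2 -> cos (tau * t) = 1 -> t = 0.
Proof.
move=> t2; have -> : cos (tau * t) = cos (tau * `|t|).
  by have [t0|t0] := ger0P t; rewrite // mulrN cosN.
rewrite -[RHS]cos0 => /cos_inj; rewrite !in_itv /= => h.
apply/eqP; rewrite -normr_eq0 -(mulrI_eq0 _ (mulfI (lt0r_neq0 tau_gt0))); apply/eqP/h.
  have p0 := pi_gt0 R; have t0 := normr_ge0 t.
  by apply/andP; split; [rewrite mulr_ge0// ltW|rewrite tauE; nra].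
by rewrite lexx/= pi_ge0.
Qed.

Lemma cos_int (m : int) : cos (tau * m%:~R) = 1 /\ sin (tau * m%:~R) = 0.
Proof.
have cn (n : nat) : cos (tau * n%:R) = 1 /\ sin (tau * n%:R) = 0.
  elim: n => [|n [IHc IHs]]; first by rewrite mulr0 cos0 sin0.
  have -> : tau * n.+1%:R = tau * n%:R + pi *+ 2.
    by rewrite -natr1 mulrDr mulr1 tauE -mulr2n.
  by rewrite cosD2pi sinD2pi.
case: m => n; first exact: cn.
rewrite NegzE mulrNz mulrN cosN sinN; have [-> ->] := cn n.+1.
by rewrite oppr0.
Qed.

(** Points of the unit circle have an angle, which is measured in turns in
    order to define a point of R/Z. *)
Lemma angle_exists (a b : R) : a ^+ 2 + b ^+ 2 = 1 ->
  exists2 t, `|t| <= 1 / 2 & cos (tau * t) = a /\ sin (tau * t) = b.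
Proof.
move=> ab; have a1 : -1 <= a <= 1.
  have h : `|a| ^+ 2 <= 1 by have := sqr_ge0 b; rewrite real_normK ?num_real//; lra.
  by rewrite -ler_norml; move: h; rewrite expr_le1.
have ac : cos (acos a) = a by rewrite acosK.
have as_ : sin (acos a) = Num.sqrt (b ^+ 2).
  by rewrite sin_acos//; congr Num.sqrt; lra.
have A0 := acos_ge0 a1; have A1 := acos_lepi a1.
have tK x : tau * (x / tau) = x by rewrite mulrC divfK// gt_eqF.
have p0 := pi_gt0 R.
have tn x : `|x| <= pi -> `|x / tau| <= 1 / 2.
  move=> xp; rewrite normrM normfV (gtr0_norm tau_gt0) ler_pdivrMr//.
  by apply: (le_trans xp); rewrite tauE; lra.
have [b0|b0] := lerP 0 b.
  exists (acos a / tau); first by rewrite tn// ger0_norm.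
  by rewrite tK ac as_ sqrtr_sqr ger0_norm.
exists (- acos a / tau); first by rewrite tn// normrN ger0_norm.
by rewrite tK cosN sinN ac as_ sqrtr_sqr ltr0_norm// opprK.
Qed.

Lemma angle_eq (t u : R) : cos (tau * t) = cos (tau * u) ->
  sin (tau * t) = sin (tau * u) -> cpi R t = cpi R u.
Proof.
move=> ct st; have c1 : cos (tau * (t - u)) = 1.
  by rewrite mulrBr cosB ct st -!expr2 cos2Dsin2.
have [v v2 vE] := cpi_rep (cpi R (t - u)).
apply/eqP; rewrite -subr_eq0 -tophomB -vE.
suff -> : v = 0 by rewrite tophom0.
apply: cos_eq1 => //; rewrite -c1; have /cpi_eq[m mE] := vE.
have -> : v = t - u + m%:~R by rewrite -mE addrC subrK.
have [cm sm] := cos_int m.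
by rewrite (mulrDr _ (t - u)) cosD cm sm mulr0 subr0 mulr1.
Qed.

Lemma angle_continuous (e : R) : 0 < e -> exists2 d, 0 < d & forall t,
  `|t| <= 1 / 2 -> 1 - d < cos (tau * t) -> `|t| < e.
Proof.
move=> e0; pose e' := Num.min e (1 / 2).
have e'0 : 0 < e' by rewrite lt_min e0; lra.
have e'2 : e' <= 1 / 2 by rewrite ge_min lexx orbT.
have p0 := pi_gt0 R.
have itv x : 0 <= x <= 1 / 2 -> tau * x \in `[0, (pi : R)].
  by move=> /andP[x0 x2]; rewrite in_itv /=; apply/andP; split; [rewrite mulr_ge0// ltW|rewrite tauE; nra].
have lt1 : cos (tau * e') < 1.
  rewrite -[ltRHS]cos0 ltr_cos ?mulr_gt0//; first by rewrite in_itv /= lexx ltW.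
  by rewrite itv// (ltW e'0).
exists (1 - cos (tau * e')); first by rewrite subr_gt0.
move=> t t2; rewrite subKr.
have -> : cos (tau * t) = cos (tau * `|t|).
  by have [t0|t0] := ger0P t; rewrite // mulrN cosN.
rewrite ltr_cos; last 2 first.
- by rewrite itv// normr_ge0.
- by rewrite itv// (ltW e'0).
by rewrite ltr_pM2l// lt_min => /andP[].
Qed.

Lemma character_of_unit_circle (s : S -> R) :
  (forall x, g x ^+ 2 + s x ^+ 2 = 1) ->
  (forall x y, g (x + y) = g x * g y - s x * s y) ->
  (forall x y, s (x + y) = s x * g y + g x * s y) ->
  exists chi : tophom S (circle R), forall x, chi x = 0 -> g x = 1.
Proof.
move=> gs1 gadd sadd.
have ex x : exists t, [/\ `|t| <= 1 / 2, cos (tau * t) = g x & sin (tau * t) = s x].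
  by have [t t2 [ct st]] := angle_exists (gs1 x); exists t.
have [a aP] := choice ex.
pose chi x := cpi R (a x).
have chiD : {morph chi : x y / x + y}.
  move=> x y; rewrite /chi -hom_add.
  have [_ cx sx] := aP x; have [_ cy sy] := aP y; have [_ cxy sxy] := aP (x + y).
  by apply: angle_eq; rewrite mulrDr ?cosD ?sinD ?cxy ?sxy ?gadd ?sadd cx sx cy sy// addrC.
have cchi : continuous chi.
  apply: additive_continuous => // U /nbhs_cball[e e0 eU].
  have [d d0 dP] := angle_continuous e0.
  have : nbhs 0 [set x | `|g 0 - g x| < d] by have /cvgrPdist_lt/(_ _ d0) := @cg 0.
  apply: filterS => x; rewrite /= g0 ltr_norml => /andP[_ gx]; apply: eU.
  have [a2 ca _] := aP x; exists (a x) => //=; apply: dP => //.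
  by rewrite ca; lra.
exists (TopHom cchi chiD) => x /= chi0.
have [a2 ca _] := aP x; rewrite -ca.
have /cpi_eq[m mE] : cpi R (a x) = cpi R 0 by rewrite tophom0.
by rewrite subr0 in mE; rewrite mE; case: (cos_int m).
Qed.

(** If g^2 = 1, then g is itself a sign character. Otherwise the sine is
    obtained from a point a with g(a)^2 < 1, as the addition theorem s(x) s(a)
    = (g(x - a) - g(x + a)) / 2 prescribes; the addition theorems for g and s
    then follow from the functional equation of g. *)
Lemma cosine_character : exists chi : tophom S (circle R),
  forall x, chi x = 0 -> g x = 1.
Proof.
have ge x : g (- x) = g x.
  by have := gD 0 x; rewrite !add0r g0; lra.
have gB x y : g (x - y) = 2 * g x * g y - g (x + y) by rewrite -gD; lra.
have g2 x : g (x + x) = 2 * g x ^+ 2 - 1.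
  by have := gD x x; rewrite subrr g0 expr2; lra.
have [sq|] := pselect (forall x, g x ^+ 2 = 1).
  have gM x y : g (x + y) = g x * g y.
    have h1 := sq x; have h2 := sq y; have h3 := gD x y.
    have h4 := sq (x + y); have h5 := sq (x - y).
    have : (g (x + y) - g (x - y)) ^+ 2 = 0.
      have : (g (x + y) + g (x - y)) ^+ 2 = 4 by rewrite h3 !exprMn h1 h2; lra.
      by lra.
    by move=> /eqP; rewrite sqrf_eq0 subr_eq0 => /eqP h6; rewrite -h6 in h3; lra.
  apply: (@character_of_unit_circle (fun=> 0)) => [x|x y|x y].
  - by rewrite sq expr0n addr0.
  - by rewrite gM mulr0 subr0.
  - by rewrite mul0r mulr0 addr0.
move=> /existsNP[a /eqP ga].
have ga1 : g a ^+ 2 <= 1.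
  by rewrite -(real_normK (num_real _)) expr_le1.
have gp : 0 < 1 - g a ^+ 2 by rewrite subr_gt0 lt_def ga1 eq_sym ga.
pose sg := Num.sqrt (1 - g a ^+ 2).
have sg0 : 0 < sg by rewrite sqrtr_gt0.
have sg2 : sg ^+ 2 = 1 - g a ^+ 2 by rewrite sqr_sqrtr// ltW.
pose s x := (g (x - a) - g (x + a)) / (2 * sg).
have sE x : s x * (2 * sg) = g (x - a) - g (x + a).
  by rewrite /s divfK// gt_eqF// mulr_gt0.
have inj4 (u v : R) : u * (4 * sg ^+ 2) = v * (4 * sg ^+ 2) -> u = v.
  by apply: mulIf; rewrite gt_eqF// mulr_gt0// exprn_gt0.
have ss x y : s x * s y = (g (x - y) - g (x + y)) / 2.
  apply: inj4; have -> : s x * s y * (4 * sg ^+ 2) = (s x * (2 * sg)) * (s y * (2 * sg)) by ring.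
  rewrite !sE sg2.
  have h1 := gD (x - a) (y - a); have h2 := gD (x - a) (y + a).
  have h3 := gD (x + a) (y - a); have h4 := gD (x + a) (y + a).
  have e1 : x - a + (y - a) = x + y - (a + a) by rewrite addrACA opprD.
  have e2 : x - a - (y - a) = x - y by rewrite opprB addrA subrK.
  have e3 : x - a + (y + a) = x + y by rewrite addrACA addNr addr0.
  have e4 : x - a - (y + a) = x - y - (a + a) by rewrite !opprD !addrA (addrAC x (- a) (- y)).
  have e5 : x + a + (y - a) = x + y by rewrite addrACA subrr addr0.
  have e6 : x + a - (y - a) = x - y + (a + a) by rewrite opprB !addrA addrAC (addrAC x a (- y)) .
  have e7 : x + a + (y + a) = x + y + (a + a) by rewrite addrACA.
  have e8 : x + a - (y + a) = x - y by rewrite opprD addrACA subrr addr0.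
  rewrite e1 e2 in h1; rewrite e3 e4 in h2; rewrite e5 e6 in h3; rewrite e7 e8 in h4.
  have h5 := gD (x + y) (a + a); have h6 := gD (x - y) (a + a); have h7 := g2 a.
  rewrite h7 in h5 h6; nra.
have sD x y : s (x + y) = s x * g y + g x * s y.
  apply: (@mulIf _ (4 * sg)); first by rewrite gt_eqF// mulr_gt0.
  have -> : s (x + y) * (4 * sg) = 2 * (s (x + y) * (2 * sg)) by ring.
  have -> : (s x * g y + g x * s y) * (4 * sg) =
    2 * g y * (s x * (2 * sg)) + 2 * g x * (s y * (2 * sg)) by ring.
  rewrite !sE.
  have h1 := gD (x - a) y; have h2 := gD (x + a) y; have h3 := gD x (y - a); have h4 := gD x (y + a).
  have e1 : x - a + y = x + y - a by rewrite addrAC.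
  have e2 : x + a + y = x + y + a by rewrite addrAC.
  have e3 : x - (y - a) = x + a - y by rewrite opprB addrA.
  have e4 : x - (y + a) = x - a - y by rewrite opprD addrA addrAC.
  rewrite e1 in h1; rewrite e2 in h2; rewrite e3 !addrA in h3; rewrite e4 !addrA in h4.
  by lra.
apply: (@character_of_unit_circle s) => // [x|x y].
  by rewrite [s x ^+ 2]expr2 ss subrr g0 g2; lra.
by rewrite ss gB; lra.
Qed.

End CharactersFromCosines.

(** Peter and Weyl. *)
Theorem compact_characters_separate (R : realType) (S : tabType) (x : S) :
  compact [set: S] -> x != 0 -> exists chi : tophom S (circle R), chi x != 0.
Proof.
move=> cS x0; have [g [cg g0 gD g1 gx]] := @cosine_function R S cS x x0.
have [chi chiP] := cosine_character cg g0 g1 gD.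
by exists chi; apply: contra_neq gx; exact: chiP.
Qed.

(** * Compactly generated groups *)

(** Compactly generated groups, with a generating set that is also a
    neighbourhood of 0. *)
Definition cgen (G : topologicalZmodType) : Prop := exists V : set G,
  [/\ nbhs 0 V, compact V & forall A, is_subgroup A -> V `<=` A -> forall x, A x].

Lemma compact_finite_image (X : topologicalType) (f : nat -> X) n :
  compact [set f j | j in `I_n].
Proof. by apply: finite_compact; apply: finite_image; exact: finite_II. Qed.

Section LinearCombinations.
Variable G : zmodType.

Definition lin n (e : 'I_n -> G) (z : 'I_n -> int) : G := \sum_i e i *~ z i.

Lemma linD n (e : 'I_n -> G) z z' : lin e (fun i => z i + z' i) = lin e z + lin e z'.
Proof. by rewrite /lin -big_split; apply: eq_bigr => i _; rewrite mulrzDr. Qed.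

Lemma linN n (e : 'I_n -> G) z : lin e (fun i => - z i) = - lin e z.
Proof. by rewrite /lin -sumrN; apply: eq_bigr => i _; rewrite mulrNz. Qed.

Lemma lin0 n (e : 'I_n -> G) : lin e (fun=> 0) = 0.
Proof. by rewrite /lin big1// => i _; rewrite mulr0z. Qed.

Definition ord_cons (T : Type) n (x : T) (e : 'I_n -> T) (i : 'I_n.+1) : T :=
  if unlift ord0 i is Some j then e j else x.

Lemma ord_cons0 (T : Type) n (x : T) (e : 'I_n -> T) : ord_cons x e ord0 = x.
Proof. by rewrite /ord_cons unlift_none. Qed.

Lemma ord_consS (T : Type) n (x : T) (e : 'I_n -> T) j : ord_cons x e (lift ord0 j) = e j.
Proof. by rewrite /ord_cons liftK. Qed.

Lemma lin_cons n x (e : 'I_n -> G) z :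
  lin (ord_cons x e) z = x *~ z ord0 + lin e (fun j => z (lift ord0 j)).
Proof.
rewrite /lin big_ord_recl ord_cons0; congr (_ + _).
by apply: eq_bigr => j _; rewrite ord_consS.
Qed.

End LinearCombinations.

Lemma finite_set_add (G : zmodType) (A B : set G) :
  finite_set A -> finite_set B -> finite_set (set_add A B).
Proof.
move=> fA fB; rewrite (_ : set_add A B = (fun z : G * G => z.1 + z.2) @` (A `*` B)).
  by apply: finite_image; exact: finite_setX.
apply/seteqP; split=> x; first by move=> [a [b [Aa Bb ->]]]; exists (a, b).
by move=> [[a b] [/= Aa Bb] <-]; exists a, b.
Qed.

Lemma finite_lin (G : zmodType) n (e : 'I_n -> G) (b : nat) :
  exists2 L, finite_set L & forall z, (forall i, (`|z i| <= b)%N) -> L (lin e z).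
Proof.
suff H (r : seq 'I_n) : exists2 L, finite_set L &
    forall z, (forall i, (`|z i| <= b)%N) -> L (\sum_(i <- r) e i *~ z i).
  by have [L fL LP] := H (index_enum 'I_n); exists L.
elim: r => [|i r [L fL LP]].
  by exists [set 0] => [|z _]; [exact: finite_set1|rewrite big_nil].
exists (set_add [set e i *~ (j%:Z - b%:Z) | j in `I_(b + b).+1] L).
  by apply: finite_set_add => //; apply: finite_image; exact: finite_II.
move=> z zb; rewrite big_cons; apply: set_addP; last exact: LP.
have zib := zb i; exists (absz (z i + b%:Z)); first by rewrite /=; lia.
by congr (_ *~ _); lia.
Qed.

Lemma compact_lin (G : topologicalZmodType) n (e : 'I_n -> G) (b : nat) :
  exists2 L, compact L & forall z, (forall i, (`|z i| <= b)%N) -> L (lin e z).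
Proof.
by have [L fL LP] := finite_lin e b; exists L => //; exact: finite_compact.
Qed.

Section Weil.
Variables (G : topologicalZmodType) (V A : set G) (x : G).
Hypotheses (V0 : nbhs 0 V) (cV : compact V) (sA : is_subgroup A).

(** Either some multiple of x returns to every neighbourhood of A arbitrarily
    late, and compactness bounds the gaps between the returns; or the multiples
    of x are discrete modulo A. *)
Lemma weil_dichotomy :
  (exists2 M, compact M & forall n : int, exists2 a, A a & M (x *~ n - a)) \/
  (forall M, compact M -> exists b : nat, forall (n : int) a, A a ->
     M (x *~ n + a) -> (`|n| <= b)%N).
Proof.
have [P|] := pselect (forall U, nbhs 0 U -> forall N : nat,
    exists2 n : nat, (N < n)%N & exists2 a, A a & U (x *~ n - a)); last first.
  move=> /existsNP[U /not_implyP[U0 /existsNP[N nP]]]; right => M cM.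
  have nU (n : nat) a : A a -> U (x *~ n - a) -> (n <= N)%N.
    move=> Aa Ua; rewrite leqNgt; apply/negP => Nn; apply: nP.
    by exists n => //; exists a.
  have [W [W0 _ WN WD]] := nbhs0_halve U0.
  apply: (compact_induction (Q := fun B => exists b : nat, forall (n : int) a, A a ->
     B (x *~ n + a) -> (`|n| <= b)%N)) cM _ _ _ _.
  - by exists 0%N.
  - move=> B C [b bP] [c cP]; exists (maxn b c) => n a Aa [/(bP _ _ Aa)|/(cP _ _ Aa)];
      by rewrite leq_max => ->; rewrite ?orbT.
  - by move=> B C BC [c cP]; exists c => n a Aa /BC; exact: cP.
  - move=> y _; exists [set z | W (z - y)]; first by apply: nbhs_subr; rewrite subrr.
    have [[n0 [a0 [Aa0 Wn0]]]|nex] := pselect (exists (n : int) a, A a /\ W (x *~ n + a - y));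
      last by exists 0%N => n a Aa /= Wn; exfalso; apply: nex; exists n, a.
    exists (`|n0| + N)%N => n a Aa /= Wn.
    have [n0n|nn0] := leP n0 n.
      suff : (`|n - n0| <= N)%N by lia.
      apply: (nU _ (a0 - a)); first exact: sA.2.
      have := WD _ _ Wn (WN _ Wn0).
      have -> : `|n - n0|%N%:Z = n - n0 by lia.
      by congr U; rewrite mulrzBr; zmod.
    suff : (`|n0 - n| <= N)%N by lia.
    apply: (nU _ (a - a0)); first exact: sA.2.
    have := WD _ _ Wn0 (WN _ Wn).
    have -> : `|n0 - n|%N%:Z = n0 - n by lia.
    by congr U; rewrite mulrzBr; zmod.
left.
have [V1 [V10 _ V1N V1S]] := nbhs0_sums 3 V0.
have V13 a b c : V1 a -> V1 b -> V1 c -> V (a + b + c).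
  move=> Va Vb Vc; have := V1S 3%N (fun i => nth 0 [:: a; b; c] i) (leqnn _).
  rewrite !big_ord_recl big_ord0 /= addr0 addrA; apply.
  by case=> [|[|[|i]]] //=; rewrite nth_nil; exact: nbhs_singleton V10.
have [N0 N0P] : exists N0 : nat, forall v, V v -> forall (m : int) a, A a ->
    v = x *~ m - a -> exists n : nat, (0 < n <= N0)%N /\
    exists2 a', A a' & V (x *~ (m - n%:Z) - a').
  apply: (compact_induction (Q := fun B => exists N0 : nat, forall v, B v ->
    forall (m : int) a, A a -> v = x *~ m - a -> exists n : nat, (0 < n <= N0)%N /\
    exists2 a', A a' & V (x *~ (m - n%:Z) - a'))) cV _ _ _ _.
  - by exists 0%N.
  - move=> B C [b bP] [c cP]; exists (maxn b c) => v [/bP|/cP] vP m a Aa vE;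
      have [n [/andP[n0 nb] ?]] := vP m a Aa vE; exists n; split=> //;
      by rewrite n0 leq_max nb ?orbT.
  - by move=> B C BC [c cP]; exists c => v /BC; exact: cP.
  - move=> y _; exists [set z | V1 (z - y)]; first by apply: nbhs_subr; rewrite subrr.
    have [[m0 [a0 [Aa0 Vm0]]]|nex] := pselect (exists (m : int) a, A a /\ V1 (y - (x *~ m - a)));
      last first.
      exists 0%N => v /= Vvy m a Aa vE; exfalso; apply: nex; exists m, a; split=> //.
      by rewrite -vE -opprB; exact: V1N.
    have [n' n'm0 [a1 Aa1 Va1]] := P V1 V10 `|m0|%N.
    exists (absz (m0 + n'%:Z)) => v /= Vvy m a Aa vE; exists (absz (m0 + n'%:Z)); split; first lia.
    exists (a - a0 - a1); first by apply: sA.2 => //; exact: sA.2.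
    have := V13 _ _ _ Vvy Vm0 (V1N _ Va1); congr V.
    have -> : (absz (m0 + n'%:Z))%:Z = m0 + n'%:Z by lia.
    by rewrite vE mulrzBr mulrzDr; zmod.
have desc (d : nat) (m : int) a : A a -> V (x *~ m - a) -> exists j : nat,
    (j <= N0)%N /\ exists2 a', A a' & V (x *~ (m - d%:Z + j%:Z) - a').
  elim/ltn_ind: d m a => d IHd m a Aa Va.
  have [dN|Nd] := leqP d N0.
    by exists d; split=> //; exists a => //; rewrite subrK.
  have [n [/andP[n0 nN] [a' Aa' Va']]] := N0P _ Va _ _ Aa erefl.
  have [|j [jN [a2 Aa2 Va2]]] := IHd (d - n)%N _ _ _ Aa' Va'; first lia.
  exists j; split=> //; exists a2 => //.
  by move: Va2; congr (V (x *~ _ - _)); lia.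
exists (set_add V [set - (x *~ j%:Z) | j in `I_N0.+1]).
  by apply: compact_add => //; exact: compact_finite_image.
move=> k; have [n kn [a Aa Va]] := P V V0 `|k|%N.
have [j [jN [a' Aa' Va']]] := desc `|n%:Z - k|%N _ _ Aa Va.
exists a' => //; exists (x *~ (k + j%:Z) - a'), (- (x *~ j%:Z)); split.
- by move: Va'; congr (V (x *~ _ - _)); lia.
- by exists j.
- by rewrite mulrzDr; zmod.
Qed.

End Weil.

Section CompactlyGenerated.
Variables (G : topologicalZmodType) (H : set G).
Hypotheses (gG : cgen G) (sH : is_subgroup H).

Fixpoint zspan (F : seq G) : set G :=
  if F is x :: F' then [set y | exists (k : int) c, zspan F' c /\ y = x *~ k + c]
  else [set 0].

Lemma zspan_subgroup F : is_subgroup (zspan F).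
Proof.
elim: F => [|x F IHF]; first exact: subgroup0.
split; first by exists 0, 0; rewrite mulr0z add0r; split=> //; case: IHF.
move=> _ _ [k [c [Fc ->]]] [l [d [Fd ->]]]; exists (k - l), (c - d).
by split; [exact: IHF.2|rewrite mulrzBr opprD addrACA].
Qed.

Lemma zspan_mem F x : x \in F -> zspan F x.
Proof.
elim: F => [//|y F IHF]; rewrite in_cons => /predU1P[->|/IHF Fx].
  by exists 1, 0; rewrite addr0; split=> //; case: (zspan_subgroup F).
by exists 0, x; rewrite mulr0z add0r.
Qed.

(** The lattice of the combinations of e is discrete, and independent of H, in
    the quotient by H. *)
Definition proper_mod n (e : 'I_n -> G) : Prop :=
  forall M, compact M -> exists b : nat, forall z h, H h -> M (lin e z + h) ->
    forall i, (`|z i| <= b)%N.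

(** Generators are added one by one: by the dichotomy, a new generator either
    stays in a compact set modulo what is already there, or enlarges the
    lattice. *)
Lemma zspan_decomposition F : exists n (e : 'I_n -> G) M,
  [/\ proper_mod e, compact M &
      forall c, zspan F c -> exists z h, H h /\ M (c - lin e z - h)].
Proof.
have [V [V0 cV _]] := gG.
elim: F => [|x F [n [e [M [pe cM MP]]]]].
  exists 0%N, (fun=> 0), [set 0]; split=> [M _||c ->].
  - by exists 0%N => z h _ _ [].
  - exact: compact_set1.
  - by exists (fun=> 0), 0; rewrite lin0 !subr0; split=> //; case: sH.
pose A : set G := [set a | exists z h, H h /\ a = lin e z + h].
have sA : is_subgroup A.
  split; first by exists (fun=> 0), 0; rewrite lin0 addr0; split=> //; case: sH.
  move=> _ _ [z [h [Hh ->]]] [z' [h' [Hh' ->]]].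
  exists (fun i => z i + - z' i), (h - h'); rewrite linD linN; split; first exact: sH.2.
  by rewrite opprD addrACA.
have [[M2 cM2 M2P]|xP] := weil_dichotomy x V0 cV sA.
  exists n, e, (set_add M2 M); split=> //; first exact: compact_add.
  move=> _ [k [c [Fc ->]]].
  have [_ [z [h [Hh ->]]] M2k] := M2P k; have [z' [h' [Hh' Mc]]] := MP c Fc.
  exists (fun i => z i + z' i), (h + h'); split; first exact: subgroupD.
  rewrite linD; have := set_addP M2k Mc; congr set_add.
  by zmod.
exists n.+1, (ord_cons x e), M; split=> //.
  move=> M' cM'; have [b0 b0P] := xP M' cM'.
  pose X := [set - (x *~ (j%:Z - b0%:Z)) | j in `I_(b0 + b0).+1].
  have [b bP] := pe (set_add M' X) (compact_add cM' (@compact_finite_image _ _ _)).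
  exists (maxn b0 b) => z h Hh; rewrite lin_cons => Mz i.
  have z0 : (`|z ord0| <= b0)%N.
    apply: (b0P _ (lin e (fun j => z (lift ord0 j)) + h)); last by rewrite addrA.
    by exists (fun j => z (lift ord0 j)), h.
  have [j ->|->] := unliftP ord0 i; last by rewrite leq_max z0.
  rewrite leq_max (bP (fun j => z (lift ord0 j)) h Hh) ?orbT//.
  exists (x *~ z ord0 + lin e (fun j => z (lift ord0 j)) + h), (- (x *~ z ord0)); split=> //.
    by exists (absz (z ord0 + b0%:Z)); [rewrite /=; lia|congr (- (x *~ _)); lia].
  by zmod.
move=> _ [k [c [Fc ->]]]; have [z [h [Hh Mc]]] := MP c Fc.
exists (ord_cons k z), h; split=> //; rewrite lin_cons ord_cons0.
rewrite (_ : (fun j => ord_cons k z (lift ord0 j)) = z); last first.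
  by apply/funext => j; rewrite ord_consS.
by rewrite opprD addrA (addrAC (x *~ k)) subrr add0r.
Qed.

(** A compact neighbourhood W is covered by finitely many translates of itself.
    Hence W + W lies in F + W for a finite set F, and then everything lies in
    the span of F, up to W. *)
Lemma cgen_zspan : exists F K, compact K /\
  forall x, exists2 c, zspan F c & K (x - c).
Proof.
have [V [V0 cV gV]] := gG.
pose W := V `|` set_opp V.
have cW : compact W by apply: compactU => //; exact: compact_opp.
have W0 : nbhs 0 W by apply: filterS V0 => y Vy; left.
have WN y : W y -> W (- y).
  by move=> [Vy|Vy]; [right; rewrite /set_opp /= opprK|left].
pose Q (B : set G) := exists F : seq G, forall y, B y -> exists2 f : G, f \in F & W (y - f).
have [F FP] : Q (set_add W W).
  have cWW := compact_add cW cW.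
  apply: (compact_induction cWW).
  - by exists [::].
  - move=> B C [s sP] [t tP]; exists (s ++ t) => y [/sP|/tP] [f sf Wf];
      by exists f; rewrite // mem_cat sf ?orbT.
  - by move=> B C BC [s sP]; exists s => y /BC/sP.
  - move=> y _; exists [set z | W (z - y)]; first by apply: nbhs_subr; rewrite subrr.
    by exists [:: y] => z Wz; exists y; rewrite ?mem_head.
exists F, W; split=> //.
pose B y := exists2 c, zspan F c & W (y - c).
have BW y v : B y -> W v -> B (y + v).
  move=> [c Fc Wc] Wv; have [f Ff Wf] := FP _ (set_addP Wc Wv).
  exists (c + f); first exact: subgroupD (zspan_subgroup F) Fc (zspan_mem Ff).
  by rewrite opprD addrA (addrAC y v).
pose St : set G := [set v | forall y, B y -> B (y + v) /\ B (y - v)].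
have sSt : is_subgroup St.
  split=> [y By|v w Sv Sw y By]; first by rewrite subr0 addr0.
  have [h1 h2] := Sv y By; split.
    by rewrite addrA; case: (Sw _ h1).
  by rewrite opprB addrA addrAC; case: (Sw _ h2).
have VSt : V `<=` St.
  by move=> v Vv y By; split; apply: BW => //; [left|apply: WN; left].
move=> y; have [] := gV St sSt VSt y 0.
  exists 0; first by case: (zspan_subgroup F).
  by rewrite subrr; exact: nbhs_singleton.
by rewrite add0r.
Qed.

Lemma cgen_decomposition : exists n (e : 'I_n -> G) M,
  [/\ proper_mod e, compact M & forall x, exists z h, H h /\ M (x - lin e z - h)].
Proof.
have [F [K [cK KP]]] := cgen_zspan.
have [n [e [M [pe cM MP]]]] := zspan_decomposition F.
exists n, e, (set_add K M); split=> //; first exact: compact_add.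
move=> x; have [c Fc Kc] := KP x; have [z [h [Hh Mc]]] := MP c Fc.
exists z, h; split=> //; have := set_addP Kc Mc; congr set_add.
by rewrite !addrA subrK.
Qed.

(** In the decomposition x = lin e z + h + m, the element h of H can be chosen
    in the subgroup generated by the part of H in a compact set: this holds for
    x in a generating set, and it is preserved by sums because lin e z is
    bounded for bounded x. *)
Lemma cgen_subgroup : exists K, compact K /\
  forall A, is_subgroup A -> K `&` H `<=` A -> H `<=` A.
Proof.
have [V [V0 cV gV]] := gG.
pose W := V `|` set_opp V.
have cW : compact W by apply: compactU => //; exact: compact_opp.
have WN y : W y -> W (- y).
  by move=> [Vy|Vy]; [right; rewrite /set_opp /= opprK|left].
have W0 : W 0 by left; exact: nbhs_singleton.
have [n [e [M [pe cM MP]]]] := cgen_decomposition.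
pose M0 := M `|` [set 0].
have cM0 : compact M0 by apply: compactU => //; exact: compact_set1.
pose X := set_add M0 W; have cX : compact X by exact: compact_add.
pose Y := set_add X (set_opp M); have cY : compact Y by apply: compact_add => //; exact: compact_opp.
have [b bP] := pe Y cY; have [b' b'P] := pe _ (compact_opp cM).
have [L cL LP] := compact_lin e b; have [L' cL' L'P] := compact_lin e b'.
exists (set_add Y (set_opp L) `|` set_add L' M); split.
  by apply: compactU; apply: compact_add => //; exact: compact_opp.
move=> A sA KA h Hh.
pose A' := A `&` H; have sA' : is_subgroup A' by exact: subgroupI.
have A'P y : set_add Y (set_opp L) y -> H y -> A' y.
  by move=> Ky Hy; split=> //; apply: KA; split=> //; left.
have XP y : X y -> exists z h, A' h /\ M (y - lin e z - h).
  move=> Xy; have [z [h' [Hh' My]]] := MP y; exists z, h'; split=> //.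
  apply: A'P => //.
  have Yz : Y (lin e z + h').
    have -> : lin e z + h' = y + - (y - lin e z - h').
      by rewrite -addrA -opprD subKr.
    by apply: set_addP => //; rewrite /set_opp /= opprK.
  have zb := bP z h' Hh' Yz.
  have -> : h' = lin e z + h' + - lin e z by rewrite addrC addKr.
  by apply: set_addP => //; rewrite /set_opp /= opprK; exact: LP.
pose B y := exists z h, A' h /\ M (y - lin e z - h).
have B0 : B 0.
  by apply: XP; rewrite -(addr0 0); apply: set_addP => //; right.
have BW y w : B y -> W w -> B (y + w).
  move=> [z [h1 [A1 M1]]] Ww.
  have [z2 [h2 [A2 M2]]] := XP _ (set_addP (or_introl M1) Ww).
  exists (fun i => z i + z2 i), (h1 + h2); split; first exact: subgroupD.
  move: M2; rewrite linD; congr M.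
  by zmod.
have [z [h' [A'h' Mh]]] : B h.
  pose St : set G := [set v | forall y, B y -> B (y + v) /\ B (y - v)].
  have sSt : is_subgroup St.
    split=> [y By|v w Sv Sw y By]; first by rewrite subr0 addr0.
    have [h1 h2] := Sv y By; split.
      by rewrite addrA; case: (Sw _ h1).
    by rewrite opprB addrA addrAC; case: (Sw _ h2).
  have VSt : V `<=` St.
    by move=> v Vv y By; split; apply: BW => //; [left|apply: WN; left].
  by have [] := gV St sSt VSt h 0 B0; rewrite add0r.
have Hd : H (h - h') by apply: sH.2 => //; case: A'h'.
have zb : forall i, (`|z i| <= b')%N.
  apply: (b'P z (h' - h)); first by apply: sH.2 => //; case: A'h'.
  rewrite /set_opp /=; move: Mh; congr M.
  by rewrite opprD opprB addrCA addrA addrAC.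
rewrite -[h](subrK h'); apply: subgroupD => //; last by case: A'h'.
apply: KA; split=> //; right.
have -> : h - h' = lin e z + (h - lin e z - h') by rewrite addrA addrCA subrr addr0.
by apply: set_addP => //; exact: L'P.
Qed.

End CompactlyGenerated.

(** * Closed subgroups and quotients *)

Lemma nbhs0_all_eq0 (G : tabType) (x : G) : (forall U, nbhs 0 U -> U x) -> x = 0.
Proof.
move=> Ux; apply: hausdorffP => U V xU V0; exists x; split; last exact: Ux.
exact: nbhs_singleton.
Qed.

Section SubgroupTransfer.
Variables (G : tabType) (H : csubgroup G).
Local Notation Hs := (subgroup_type H).

Lemma sub_val_add : {morph (fun x : Hs => \val x : G) : x y / x + y}.
Proof. by []. Qed.

Definition sub_incl : tophom Hs G := TopHom (@sub_val_continuous G H) sub_val_add.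

(** Since H is closed, its intersection with K is compact. *)
Lemma sub_compact (K : set G) : compact K -> compact [set x : Hs | K (\val x)].
Proof.
move=> cK F FF FK.
have cKH : compact (K `&` H) by apply: compact_closedI => //; exact: cs_closed.
pose F' : set_system G := [set A | F [set x : Hs | A (\val x)]].
have FF' : ProperFilter F' by exact: fmap_proper_filter.
have F'K : F' (K `&` H).
  by apply: (@filterS _ F _ _ _ _ FK) => x Kx; split; [exact: Kx|exact: subgroup_valP].
have [p [[Kp Hp] clp]] := cKH F' FF' F'K.
exists (subgroup_sub Hp); split=> // A B FA.
rewrite nbhsE => -[_ [[V oV <-] /= Vp] VB].
have F'A : F' [set y | exists2 x : Hs, A x & \val x = y].
  by apply: (@filterS _ F _ _ _ _ FA) => x Ax; exists x.
have Vn : nbhs p V by apply: open_nbhs_nbhs.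
have [_ [[x Ax <-] Vx]] := clp _ _ F'A Vn.
by exists x; split=> //; exact: VB.
Qed.

Lemma sub_nbhs0 (U : set G) : nbhs 0 U -> nbhs (0 : Hs) [set x : Hs | U (\val x)].
Proof. by move=> U0; exact: (@sub_val_continuous G H 0). Qed.

Lemma sub_nbhs0P (W : set Hs) : nbhs 0 W ->
  exists2 U : set G, nbhs 0 U & forall x : Hs, U (\val x) -> W x.
Proof.
rewrite nbhsE => -[_ [[V oV <-] /= V0] VW]; exists V => [|x Vx]; last exact: VW.
exact: open_nbhs_nbhs.
Qed.

Lemma sub_lcg : lcg G -> lcg Hs.
Proof.
move=> [V V0 cV]; exists [set x : Hs | V (\val x)]; first exact: sub_nbhs0.
exact: sub_compact.
Qed.

Lemma hom_on_restrict (D : topologicalZmodType) (g : G -> D) : hom_on H g ->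
  exists f : tophom Hs D, forall x, f x = g (\val x).
Proof.
move=> [gD gc]; pose f (x : Hs) := g (\val x).
have fD : {morph f : x y / x + y} by move=> x y; apply: gD; exact: subgroup_valP.
have fc : continuous f.
  apply: additive_continuous => // U /gc[V V0 VU].
  by apply: filterS (sub_nbhs0 V0) => x /= Vx; apply: VU => //; exact: subgroup_valP.
by exists (TopHom fc fD).
Qed.

Lemma hom_on_extend0 (D : topologicalZmodType) (f : tophom Hs D) :
  exists2 g : G -> D, hom_on H g & forall x, g (\val x) = f x.
Proof.
have ex x : exists y, forall Hx : cs_set H x, y = f (subgroup_sub Hx).
  have [Hx|nHx] := pselect (cs_set H x); last by exists 0.
  by exists (f (subgroup_sub Hx)) => Hx'; rewrite (Prop_irrelevance Hx Hx').
have [g gP] := choice ex.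
have gE (x : Hs) : g (\val x) = f x.
  by rewrite (gP _ (subgroup_valP x)); congr (f _); exact: val_inj.
exists g => //; split=> [x y Hx Hy|U U0].
  rewrite -[x + y]/(\val (subgroup_sub Hx + subgroup_sub Hy)) gE hom_add.
  by rewrite -!gE.
have [V V0 VU] := sub_nbhs0P (tophom_nbhs0 f U0).
exists V => // x Hx Vx; have -> : x = \val (subgroup_sub Hx) by [].
by rewrite gE; exact: (VU (subgroup_sub Hx)).
Qed.

Lemma hom_extend_open (D : topologicalZmodType) (f : tophom Hs D) : divisible D ->
  nbhs 0 (cs_set H) -> exists F : tophom G D, forall x : Hs, F (\val x) = f x.
Proof.
move=> divD H0; have [g gH gE] := hom_on_extend0 f.
have [|x Hx ->|F [FE _]] := @hom_glue G D H [set 0] g (fun=> 0) divD (subgroup_cs H) (subgroup0 G) H0 gH.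
- by move=> x y _ _; rewrite addr0.
- by rewrite (additive_on0 (subgroup_cs H) gH.1).
- by exists F => x; rewrite FE ?gE//; exact: subgroup_valP.
Qed.

End SubgroupTransfer.

Section GeneratedSubgroup.
Variables (G : tabType) (V : set G).
Hypotheses (V0 : nbhs 0 V) (cV : compact V).

Definition generated : set G := [set x | forall A, is_subgroup A -> V `<=` A -> A x].

Lemma generated_subgroup : is_subgroup generated.
Proof.
split=> [A sA _|x y gx gy A sA VA]; first by case: sA.
by apply: sA.2; [exact: gx|exact: gy].
Qed.

Lemma generated_sub : V `<=` generated.
Proof. by move=> x Vx A _; exact. Qed.

Lemma generated_nbhs : nbhs 0 generated.
Proof. exact: filterS generated_sub V0. Qed.

Definition generated_cs : csubgroup G :=
  CSubgroup generated_subgroup.1 generated_subgroup.2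
    (open_subgroup_closed generated_subgroup generated_nbhs).

Lemma generated_cgen : cgen (subgroup_type generated_cs).
Proof.
exists [set x | V (\val x)]; split; first exact: sub_nbhs0.
  exact: sub_compact.
move=> A sA VA x.
pose B : set G := [set y | exists2 z : subgroup_type generated_cs, A z & \val z = y].
have sB : is_subgroup B.
  split; first by exists 0 => //; case: sA.
  by move=> _ _ [y Ay <-] [z Az <-]; exists (y - z) => //; exact: sA.2.
have VB : V `<=` B.
  by move=> y Vy; exists (@subgroup_sub _ generated_cs _ (generated_sub Vy)) => //; exact: VA.
by have [z Az /val_inj <-] := subgroup_valP x B sB VB.
Qed.

End GeneratedSubgroup.

Section Quotient.
Variables (G : tabType) (A : csubgroup G).
Local Notation Q := (quotient_group A).

Lemma quot_map0 x : quot_map A x = 0 <-> cs_set A x.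
Proof.
rewrite -(tophom0 (quot_map A)); split=> [/quot_piP|Ax]; first by rewrite subr0.
by apply/quot_piP; rewrite subr0.
Qed.

Lemma quot_map_onto z : exists x, quot_map A x = z.
Proof. by exists (quot_repr z); exact: quot_reprK. Qed.

Lemma quot_map_nbhs0 U : nbhs 0 U -> nbhs 0 (quot_map A @` U).
Proof. by move=> U0; rewrite -(tophom0 (quot_map A)); exact: quot_pi_nbhs. Qed.

Lemma quot_lcg : lcg G -> lcg Q.
Proof.
move=> [V V0 cV]; exists (quot_map A @` V); first exact: quot_map_nbhs0.
by apply: compact_image => //; exact: hom_cont.
Qed.

End Quotient.

(** * Characters of locally compact groups *)

(** The lattice spanned by large multiples of a maximal family e; the multiples
    are so large that they miss the given point y. *)
Lemma cocompact_lattice (G : tabType) (y : G) : cgen G -> exists A : csubgroup G,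
  [/\ y <> 0 -> ~ cs_set A y, exists2 U, nbhs 0 U & forall x, cs_set A x -> U x -> x = 0 &
      compact [set: quotient_group A]].
Proof.
move=> gG; have [n [e [M [pe cM MP]]]] := cgen_decomposition gG (subgroup0 G).
have [V [V0 cV _]] := gG.
have [b bP] := pe [set y] (@compact_set1 _ y).
pose N := b.+1.
pose A0 : set G := [set x | exists z, x = lin e (fun i => z i * N%:Z)].
have sA0 : is_subgroup A0.
  split; first by exists (fun=> 0); rewrite -(lin0 e); congr lin; apply/funext => i; rewrite mul0r.
  move=> _ _ [z ->] [z' ->]; exists (fun i => z i - z' i).
  rewrite -linN -linD; congr lin; apply/funext => i; rewrite mulrBl//.
have [U U0 UP] : exists2 U, nbhs 0 U & forall x, A0 x -> U x -> x = 0.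
  have [c cP] := pe V cV; have [L fL LP] := finite_lin e c.
  exists (V `&` ~` (L `\ 0)).
    apply: filterI => //; apply: open_nbhs_nbhs; split; last by move=> [_]; exact.
    apply: closed_openC; apply: compact_closed; first exact: hausdorffP.
    by apply: finite_compact; exact: finite_setD.
  move=> _ [z ->] [Vz nL]; apply: contrapT => z0; apply: nL; split=> //.
  by apply: LP; apply: (cP _ 0); rewrite ?addr0.
have clA0 : closed A0 by apply: (discrete_subgroup_closed sA0.2 U0 UP).
pose A := CSubgroup sA0.1 sA0.2 clA0.
exists A; split; last 2 first.
- by exists U.
- have [L cL LP] := compact_lin e N.
  have -> : [set: quotient_group A] = quot_map A @` (set_add L M).
    apply/seteqP; split=> // q _; have [x <-] := quot_map_onto q.
    have [z [_ [-> Mx]]] := MP x; rewrite subr0 in Mx.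
    pose z1 i := (z i %/ N%:Z)%Z; pose z2 i := (z i %% N%:Z)%Z.
    have zE : z = fun i => z1 i * N%:Z + z2 i by apply/funext => i; exact: divz_eq.
    exists (lin e z2 + (x - lin e z)).
      apply: set_addP => //; apply: LP => i.
      have h1 : 0 <= z2 i by apply: modz_ge0.
      have h2 : z2 i < N%:Z by apply: ltz_pmod.
      by lia.
    have zl : lin e z = lin e (fun i => z1 i * N%:Z) + lin e z2 by rewrite {1}zE linD.
    apply/quot_piP; exists (fun i => - z1 i).
    have -> : lin e (fun i => - z1 i * N%:Z) = - lin e (fun i => z1 i * N%:Z).
      by rewrite -linN; congr lin; apply/funext => i; rewrite mulNr.
    by rewrite zl; zmod.
  apply: compact_image; first exact: hom_cont.
  exact: compact_add.
move=> y0 [z yE]; apply: y0.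
have zb i : ((absz (z i * N%:Z)%R) <= b)%N.
  by apply: (bP (fun i => z i * N%:Z) 0 erefl _ i); rewrite addr0 -yE.
rewrite yE -(lin0 e); congr lin; apply/funext => i; have := zb i.
have [->|zi] := eqVneq (z i) 0; first by rewrite mul0r.
by rewrite abszM; nia.
Qed.

Section Duality.
Variable R : realType.
Local Notation circle := (circle R).
Local Notation dual A := (tophom A circle).

(** A compactly generated open subgroup containing y maps to a compact quotient
    in which y survives, and characters of open subgroups extend. *)
Lemma lcg_characters_separate (Y : tabType) (y : Y) : lcg Y -> y <> 0 ->
  exists chi : dual Y, chi y <> 0.
Proof.
move=> [V V0 cV] y0; pose W := V `|` [set y].
have W0 : nbhs 0 W by apply: filterS V0 => x; left.
have cW : compact W by apply: compactU => //; exact: compact_set1.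
pose H := generated_cs W0; have Hy : cs_set H y by apply: generated_sub; right.
pose ys : subgroup_type H := subgroup_sub Hy.
have ys0 : ys <> 0 by move=> /(congr1 (fun z : subgroup_type H => \val z)).
have [A [Ay _ cQ]] := cocompact_lattice ys (generated_cgen W0 cW).
have qy : quot_map A ys != 0 by apply/eqP => /quot_map0; exact: Ay.
have [chi /eqP chiy] := compact_characters_separate R cQ qy.
have [g gH gE] := hom_on_extend0 (hom_comp chi (quot_map A)).
have [F FE] := hom_extend_open (hom_comp chi (quot_map A)) (circle_divisible (R := R)) (generated_nbhs W0).
by exists F; have /= -> := FE ys.
Qed.

Lemma characters_separate_subgroup (Y : tabType) (N : csubgroup Y) y : lcg Y ->
  ~ cs_set N y -> exists2 chi : dual Y, forall x, cs_set N x -> chi x = 0 & chi y <> 0.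
Proof.
move=> lY Ny; have qy : quot_map N y <> 0 by move/quot_map0.
have [chi chiy] := lcg_characters_separate (quot_lcg N lY) qy.
exists (hom_comp chi (quot_map N)) => // x /quot_map0 qx.
by rewrite -[LHS]/(chi (quot_map N x)) qx tophom0.
Qed.

Lemma pair_lcg (A B : topologicalZmodType) : lcg A -> lcg B -> lcg (pair_group A B).
Proof.
move=> [U U0 cU] [V V0 cV]; exists (U `*` V); last exact: compact_setX.
by exists (U, V).
Qed.

Section PairMaps.
Variables A B : topologicalZmodType.

Fact pair_inl_cont : continuous (fun x : A => (x, 0) : pair_group A B).
Proof. by move=> x; apply: cvg_pair => //; exact: cvg_cst. Qed.
Fact pair_inl_add : {morph (fun x : A => (x, 0) : pair_group A B) : x y / x + y}.
Proof. by move=> x y; rewrite /GRing.add /= /add_pair /= addr0. Qed.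
Definition pair_inl : tophom A (pair_group A B) := TopHom pair_inl_cont pair_inl_add.

Fact pair_inr_cont : continuous (fun x : B => (0, x) : pair_group A B).
Proof. by move=> x; apply: cvg_pair => //; exact: cvg_cst. Qed.
Fact pair_inr_add : {morph (fun x : B => (0, x) : pair_group A B) : x y / x + y}.
Proof. by move=> x y; rewrite /GRing.add /= /add_pair /= addr0. Qed.
Definition pair_inr : tophom B (pair_group A B) := TopHom pair_inr_cont pair_inr_add.

Fact pair_fst_cont : continuous (fun x : pair_group A B => x.1).
Proof. by move=> [x y]; exact: cvg_fst. Qed.
Definition pair_fst : tophom (pair_group A B) A :=
  TopHom pair_fst_cont (fun x y => erefl).

Fact pair_snd_cont : continuous (fun x : pair_group A B => x.2).
Proof. by move=> [x y]; exact: cvg_snd. Qed.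
Definition pair_snd : tophom (pair_group A B) B :=
  TopHom pair_snd_cont (fun x y => erefl).

End PairMaps.

Lemma circle_lcg : lcg circle.
Proof. by exists setT; [exact: filterT|exact: circle_compact]. Qed.

Section GraphSubgroup.
Variables (G : tabType) (H : csubgroup G) (f : G -> circle).
Hypothesis fH : hom_on H f.

Let N : set (pair_group G circle) := [set p | cs_set H p.1 /\ p.2 = f p.1].

Let sN : is_subgroup N.
Proof.
have sH := subgroup_cs H; have [fD _] := fH.
split; first by split; [case: sH|rewrite /= (additive_on0 sH fD)].
move=> [x t] [y u] [/= Hx ->] [/= Hy ->]; split => /=; first exact: sH.2.
by rewrite (additive_onB sH fD).
Qed.

Let clN : closed N.
Proof.
have sH := subgroup_cs H; have [fD fc] := fH.
move=> [x t] clx; have Hx : cs_set H x.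
  apply: (cs_closed (c := H)) => U Ux.
  have [|[y u] [[/= Hy _] [/= Uy _]]] := clx (U `*` setT); last by exists y.
  by exists (U, setT) => //; split => //; exact: filterT.
split=> //=; apply/eqP; rewrite -subr_eq0; apply/eqP/nbhs0_all_eq0 => W /nbhs0_halve.
move=> [W1 [W10 _ W1N W1D]]; have [V V0 VW] := fc _ W10.
have : nbhs ((x, t) : G * circle) ([set y | V (y - x)] `*` [set u | W1 (u - t)]).
  exists ([set y | V (y - x)], [set u | W1 (u - t)]) => //.
  by split; apply: nbhs_subr; rewrite subrr.
move=> /clx[[y u] [[/= Hy ->] [/= Vy Wu]]].
have h1 := VW _ (sH.2 _ _ Hy Hx) Vy; rewrite (additive_onB sH fD)// in h1.
have := W1D _ _ h1 (W1N _ Wu); congr W; zmod.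
Qed.

Let Ncs : csubgroup (pair_group G circle) := CSubgroup sN.1 sN.2 clN.

(** The characters of G x R/Z that vanish on the graph of f separate the points
    outside it. Their restrictions to R/Z have degrees that form a subgroup J
    of Z, which must be all of Z. A character of degree 1 solves the problem up
    to sign. *)
Lemma character_extension_aux : lcg G ->
  exists chi : dual G, forall x, cs_set H x -> chi x = f x.
Proof.
move=> lG; have [fD fc] := fH; have sH := subgroup_cs H.
have lP : lcg (pair_group G circle) := pair_lcg lG circle_lcg.
(* J is the group of the degrees on the circle of the characters of
   G x R/Z that vanish on the graph of f; it is all of Z. *)
pose J : set int := [set m | exists2 psi : dual (pair_group G circle),
  forall p, N p -> psi p = 0 & forall t, psi (0, t) = t *~ m].
have sJ : is_subgroup J.
  split; first by exists 0.
  move=> m n [psi psiN psim] [phi phiN phin]; exists (psi - phi).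
    by move=> p Np; rewrite -[LHS]/(psi p - phi p) psiN// phiN// subrr.
  by move=> t; rewrite -[LHS]/(psi _ - phi _) psim phin mulrzBr.
have JP (t : circle) : t != 0 -> exists2 m, J m & t *~ m != 0.
  move=> /eqP t0; have Nt : ~ N (0, t) by move=> [_ /= tE]; apply: t0; rewrite tE (additive_on0 sH fD).
  have [psi psiN psit] := @characters_separate_subgroup _ Ncs _ lP Nt.
  have [m mE] := circle_charE (hom_comp psi (pair_inr G circle)).
  exists m; first by exists psi => // u; exact: mE.
  by apply/eqP; rewrite -mE.
have J1 : J 1.
  have ex : exists d : nat, (0 < d)%N && `[< J d%:Z >].
    have h0 : cpi R (1 / 2) != 0.
      by apply/eqP => /cpi0; rewrite ger0_norm; lra.
    have [m Jm tm] := JP _ h0.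
    exists `|m|%N; rewrite absz_gt0; apply/andP; split.
      by apply: contraNneq tm => ->; rewrite mulr0z.
    apply/asboolP; case: (m) Jm => k //= Jk.
    by have := subgroupN sJ Jk; rewrite NegzE opprK.
  case: (ex_minnP ex) => d /andP[d0 /asboolP Jd] dmin.
  have dvd m : J m -> exists q : int, m = d%:Z * q.
    move=> Jm; exists (m %/ d%:Z)%Z.
    have dz : d%:Z != 0 by rewrite eqz_nat -lt0n.
    have mE := divz_eq m d%:Z; set q := (m %/ d%:Z)%Z in mE *; set r := (m %% d%:Z)%Z in mE.
    have r0 : 0 <= r by apply: modz_ge0.
    have rd : r < d%:Z by apply: ltz_pmod.
    have Jr : J r.
      have -> : r = m - d%:Z *~ q by rewrite mulrzz mE mulrC addrC addKr.
      by apply: sJ.2 => //; exact: subgroupMz.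
    suff : r = 0 by move=> r_0; rewrite mE r_0 addr0 mulrC.
    apply: contrapT => /eqP rn0; have := dmin `|r|%N.
    rewrite absz_gt0 rn0 gez0_abs// (asboolT Jr) => /(_ isT).
    by lia.
  have [d1|d1] := leqP d 1; first by have <- : d%:Z = 1 by lia.
  have dR : 0 < d%:R :> R by rewrite ltr0n.
  have h0 : cpi R (d%:R^-1) != 0.
    apply/eqP => /cpi0; rewrite ger0_norm ?invr_ge0 ?ler0n//.
    rewrite invf_lt1// ltr1n d1 => /(_ isT)/eqP.
    by rewrite invr_eq0 gt_eqF.
  have [m /dvd[q ->]] := JP _ h0.
  rewrite mulrzA -tophomMz -[_ *~ d%:Z](mulr_natr (d%:R^-1)) mulVf ?gt_eqF//.
  by rewrite [cpi R 1](cpi_int R 1) mul0rz eqxx.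
have [psi psiN psi1] := J1.
exists (- hom_comp psi (pair_inl G circle)) => x Hx.
rewrite -[LHS]/(- psi (x, 0)).
have := psiN (x, f x) (conj Hx erefl).
have -> : (x, f x) = (x, 0) + (0, f x) :> pair_group G circle.
  by rewrite /GRing.add /= /add_pair /= addr0 add0r.
by rewrite hom_add psi1 mulr1z => /eqP; rewrite addr_eq0 => /eqP ->; rewrite opprK.
Qed.

End GraphSubgroup.

Lemma character_extension (G : tabType) (H : csubgroup G) (f : G -> circle) :
  lcg G -> hom_on H f -> exists chi : dual G, forall x, cs_set H x -> chi x = f x.
Proof. by move=> lG fH; exact: character_extension_aux. Qed.

(** * Duality for compact groups *)

Section CompactDuality.
Variable L : tabType.
Hypothesis cL : compact [set: L].

Lemma compact_lcg : lcg L.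
Proof. by exists setT => //; exact: filterT. Qed.

Let pow k : tabType := prod_group (fun _ : 'I_k => circle : tabType).

Let pow_compact k : compact [set: pow k].
Proof.
have := @tychonoff 'I_k (fun=> circle) (fun=> setT) (fun=> @circle_compact R).
by congr compact; apply/seteqP; split.
Qed.

Let pow_inj k (i : 'I_k) : tophom circle (pow k) :=
  prod_lift (fun j => if j == i then hom_id circle else 0).

Let pow_sum k (t : pow k) : t = \sum_i pow_inj i (t i).
Proof.
apply: functional_extensionality_dep => j.
rewrite -[RHS]/(prod_proj (fun _ : 'I_k => circle : topologicalZmodType) j (\sum_i pow_inj i (t i))).
rewrite tophom_sum (bigD1 j)//= eqxx big1 ?addr0// => i ij.
by rewrite eq_sym (negbTE ij).
Qed.

(** The image of L in the finite torus given by the characters c is closed. A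
    point outside it would be separated by a character of the torus, which is
    an integral relation among the c. *)
Lemma compact_dual_finite k (c : 'I_k -> dual L) (h : dual L -> circle) :
  {morph h : x y / x + y} -> exists s : L, forall i, c i s = h (c i).
Proof.
move=> hD; pose Phi : tophom L (pow k) := prod_lift c.
have sP : is_subgroup (range Phi).
  split; first by exists 0 => //; rewrite tophom0.
  by move=> _ _ [x _ <-] [y _ <-]; exists (x - y) => //; rewrite tophomB.
have clP : closed (range Phi).
  apply: compact_closed; first exact: hausdorffP.
  by apply: compact_image => //; exact: hom_cont.
pose P := CSubgroup sP.1 sP.2 clP.
pose hc : pow k := fun i => h (c i).
have [[s _ sE]|nP] := pselect (range Phi hc).
  by exists s => i; rewrite -[RHS]/(hc i) -sE.
have lpow : lcg (pow k) by exists setT; [exact: filterT|exact: pow_compact].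
have [psi psiP psih] := @characters_separate_subgroup (pow k) P hc lpow nP.
have [m mE] := choice (fun i => circle_charE (hom_comp psi (pow_inj i))).
have psiE t : psi t = \sum_i t i *~ m i.
  by rewrite {1}[t]pow_sum tophom_sum; apply: eq_bigr => i _; exact: mE.
exfalso; apply: psih; rewrite psiE.
have h0 : h 0 = 0 by apply: (addrI (h 0)); rewrite -hD !addr0.
have hMz x (n : int) : h (x *~ n) = h x *~ n.
  by apply: (additive_onMz n (subgroupT _)) => // ? ? _ _; exact: hD.
rewrite -[LHS](_ : h (\sum_i c i *~ m i) = _); last first.
  by rewrite (big_morph h hD h0); apply: eq_bigr => i _; exact: hMz.
rewrite (_ : \sum_i c i *~ m i = 0)//; apply: tophom_eq => s.
rewrite sum_tophomE -[RHS](psiP (Phi s)); last by exists s.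
by rewrite psiE; apply: eq_bigr => i _; rewrite tophom_mulz.
Qed.

(** Pontryagin duality for a compact group L: every homomorphism from the
    discrete dual of L to the circle is the evaluation at a point. Compactness
    reduces this to finitely many characters. *)
Lemma compact_duality (h : dual L -> circle) : {morph h : x y / x + y} ->
  exists s : L, forall chi : dual L, chi s = h chi.
Proof.
move=> hD; apply: contrapT => nex.
have bad (s : L) : exists chi : dual L, chi s <> h chi.
  by apply: contrapT => nb; apply: nex; exists s => chi; apply: contrapT => ?; apply: nb; exists chi.
pose Q (B : set L) := exists C : seq (dual L), forall s, B s ->
  exists2 i, (i < size C)%N & nth 0 C i s <> h (nth 0 C i).
have [C CP] : Q setT.
  apply: (compact_induction cL).
  - by exists [::].
  - move=> A B [C CP] [D DP]; exists (C ++ D) => s [/CP[i iC]|/DP[i iD]] nE.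
      by exists i; rewrite ?size_cat ?nth_cat ?iC// ltn_addr.
    exists (size C + i)%N; first by rewrite size_cat ltn_add2l.
    by rewrite nth_cat ltnNge leq_addr /= addKn.
  - by move=> A B AB [C CP]; exists C => s /AB/CP.
  - move=> s _; have [chi chis] := bad s; exists [set s' | chi s' <> h chi].
      have : open (chi @^-1` (~` [set h chi])).
        apply: open_comp => [x _|]; first exact: hom_cont.
        apply: closed_openC; apply: compact_closed; last exact: compact_set1.
        exact: hausdorffP.
      by move=> oc; apply: open_nbhs_nbhs.
    by exists [:: chi] => s' /= ?; exists 0%N.
have [s sE] := compact_dual_finite (fun i : 'I_(size C) => nth 0 C i) hD.
by have [i iC] := CP s I; rewrite -[i]/(nat_of_ord (Ordinal iC)) sE.
Qed.

(** Both topologies are compact and Hausdorff, and one is coarser. *)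
Lemma compact_nbhs_characters (U : set L) : nbhs 0 U -> exists (k : nat) (c : 'I_k -> dual L),
  exists2 d : R, 0 < d & forall s, (forall i, cball d (c i s)) -> U s.
Proof.
move=> U0.
pose Q (B : set L) := exists C : seq (dual L), exists2 d : R, 0 < d &
  forall s, B s -> (forall i, (i < size C)%N -> cball d (nth 0 C i s)) -> U s.
have [C [d d0 CP]] : Q setT.
  apply: (compact_induction cL).
  - by exists [::], 1.
  - move=> A B [C [d d0 CP]] [D [e e0 DP]]; exists (C ++ D), (Num.min d e).
      by rewrite lt_min d0.
    move=> s [As|Bs] sP; [apply: CP|apply: DP] => // i iC.
      apply: (@cballW _ (Num.min d e)); first by rewrite ge_min lexx.
      have := sP i; rewrite size_cat nth_cat iC; apply; exact: ltn_addr.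
    apply: (@cballW _ (Num.min d e)); first by rewrite ge_min lexx orbT.
    have := sP (size C + i)%N; rewrite size_cat ltn_add2l => /(_ iC).
    by rewrite nth_cat ltnNge leq_addr /= addKn.
  - by move=> A B AB [C [d d0 CP]]; exists C, d => // s /AB; exact: CP.
  - move=> s _; have [->|/eqP s0] := eqVneq s 0.
      by exists U => //; exists [::], 1.
    have [chi chis] := lcg_characters_separate compact_lcg s0.
    have [d d0 dP] : exists2 d : R, 0 < d & ~ cball d (chi s).
      apply: contrapT => nd; apply: chis; apply: nbhs0_all_eq0 => W /nbhs_cball[d d0].
      by apply; apply: contrapT => nc; apply: nd; exists d.
    have d2 : 0 < d / 2 by lra.
    exists [set s' | cball (d / 2) (chi (s' - s))].
      apply: (@nbhs_subr _ s s (chi @^-1` cball (d / 2))); rewrite subrr.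
      exact: tophom_nbhs0 (cball_nbhs d2).
    exists [:: chi], (d / 2) => // s' /= h1 /(_ 0%N isT) /= h2; exfalso; apply: dP.
    have := cballD h2 (cballN h1); rewrite -tophomB subKr.
    by rewrite (_ : d / 2 + d / 2 = d)//; lra.
exists (size C), (fun i => nth 0 C i), d => // s sP; apply: CP => // i iC.
exact: (sP (Ordinal iC)).
Qed.

Lemma compact_eq (s t : L) : (forall chi : dual L, chi s = chi t) -> s = t.
Proof.
move=> st; apply/eqP; rewrite -subr_eq0; apply/eqP; apply: contrapT => st0.
have [chi] := lcg_characters_separate compact_lcg st0.
by apply; rewrite tophomB st subrr.
Qed.

(** Homomorphisms into a compact group are constructed by giving the dual map
    on characters. *)
Lemma hom_to_compact (G : topologicalZmodType) (Phi : dual L -> dual G) :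
  {morph Phi : x y / x + y} ->
  exists F : tophom G L, forall (chi : dual L) g, chi (F g) = Phi chi g.
Proof.
move=> PhiD.
have ex g : exists s, forall chi : dual L, chi s = Phi chi g.
  by apply: (compact_duality (h := fun chi => Phi chi g)) => x y; rewrite PhiD.
have [F FP] := choice ex.
have FD : {morph F : x y / x + y}.
  by move=> x y; apply: compact_eq => chi; rewrite hom_add !FP hom_add.
have Fc : continuous F.
  apply: additive_continuous => // U /compact_nbhs_characters[k [c [d d0 cU]]].
  have : nbhs 0 [set g | forall i, cball d (Phi (c i) g)].
    by apply: filter_forall => i; exact: tophom_nbhs0 (cball_nbhs d0).
  by apply: filterS => g gP; apply: cU => i; rewrite FP; exact: gP.
by exists (TopHom Fc FD).
Qed.

End CompactDuality.

End Duality.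

(** * Independence up to torsion *)

Lemma lin_delta (E : zmodType) k (e : 'I_k -> E) j :
  lin e (fun i => (i == j)%:Z) = e j.
Proof.
rewrite /lin (bigD1 j)//= eqxx mulr1z big1 ?addr0// => i /negbTE ->.
by rewrite mulr0z.
Qed.

Section IndependentBasis.
Variables (R : realType) (E : zmodType).

(** A finite sequence in an abelian group is, up to torsion, in the span of a
    finite family that is independent, as is witnessed by dual functionals.
    Enlarging the family by c requires a functional that vanishes on it and
    takes the value 1 at c; it exists because R is divisible. *)
Lemma independent_basis (cs : seq E) : exists k (chi : 'I_k -> E) (a : 'I_k -> E -> R),
  [/\ forall i, {morph a i : x y / x + y}, forall i j, a i (chi j) = (i == j)%:R &
      forall c, c \in cs -> exists2 n, (0 < n)%N & exists m, c *+ n = lin chi m].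
Proof.
elim: cs => [|c cs [k [chi [a [aD aE csP]]]]].
  by exists 0%N, (fun=> 0), (fun _ _ => 0); split=> // -[].
have [[n n0 [m cm]]|nc] := pselect (exists2 n, (0 < n)%N & exists m, c *+ n = lin chi m).
  exists k, chi, a; split=> // d; rewrite in_cons => /predU1P[->|/csP//].
  by exists n => //; exists m.
pose H : set E := [set x | exists m z, x = lin chi m + c *~ z].
have uniq_z m z m' z' : lin chi m + c *~ z = lin chi m' + c *~ z' -> z = z'.
  move=> mz; apply: contrapT => /eqP zz; apply: nc.
  have cz : c *~ (z - z') = lin chi (fun i => m' i - m i).
    rewrite linD linN mulrzBr; apply: (addrI (lin chi m)); apply: (addIr (c *~ z'));
    by transitivity (lin chi m + c *~ z); [zmod|rewrite mz; zmod].
  exists (absz (z - z')); first by rewrite absz_gt0 subr_eq0.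
  have [h|h] := leP z' z.
    by exists (fun i => m' i - m i); rewrite -cz pmulrn; congr (_ *~ _); lia.
  exists (fun i => - (m' i - m i)); rewrite linN -cz pmulrn -mulrNz; congr (_ *~ _); lia.
have [f fP] : exists f : E -> R, forall m z, f (lin chi m + c *~ z) = z%:~R.
  have ex x : exists y : R, forall m z, x = lin chi m + c *~ z -> y = z%:~R.
    have [[m [z xE]]|nx] := pselect (H x).
      by exists z%:~R => m' z'; rewrite xE => /uniq_z ->.
    by exists 0 => m z xE; exfalso; apply: nx; exists m, z.
  by have [f fP] := choice ex; exists f => m z; apply: fP.
have sH : is_subgroup H.
  split; first by exists (fun=> 0), 0; rewrite lin0 mulr0z addr0.
  move=> _ _ [m [z ->]] [m' [z' ->]]; exists (fun i => m i - m' i), (z - z').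
  by rewrite linD linN mulrzBr; zmod.
have fD : additive_on H f.
  move=> _ _ [m [z ->]] [m' [z' ->]]; rewrite !fP -intrD -(fP (fun i => m i + m' i)).
  by congr f; rewrite linD mulrzDr; zmod.
have dR n : (0 < n)%N -> forall z : R, setT z -> exists2 y, setT y & y *+ n = z.
  by move=> n0 z _; have [y yn] := real_divisible n0 z; exists y.
have [g [gD gf _]] := @divisible_extension E R H setT f sH (subgroupT _) fD (fun _ _ => I) dR.
have gchi j : g (chi j) = 0.
  rewrite gf; first by have := fP (fun i => (i == j)%:Z) 0; rewrite lin_delta mulr0z addr0 mulr0z.
  by exists (fun i => (i == j)%:Z), 0; rewrite lin_delta mulr0z addr0.
have gc : g c = 1.
  rewrite gf; first by have := fP (fun=> 0) 1; rewrite lin0 mulr1z add0r.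
  by exists (fun=> 0), 1; rewrite lin0 mulr1z add0r.
exists k.+1, (ord_cons c chi), (ord_cons g (fun i x => a i x - a i c * g x)); split.
- move=> i; case: (unliftP ord0 i) => [j|] ->; rewrite ?ord_consS ?ord_cons0// => x y.
  by rewrite aD gD mulrDr; ring.
- move=> i j; case: (unliftP ord0 i) => [i'|] ->; case: (unliftP ord0 j) => [j'|] ->;
    rewrite ?ord_consS ?ord_cons0.
  + by rewrite gchi mulr0 subr0 aE (inj_eq lift_inj).
  + by rewrite gc mulr1 subrr eq_sym (negbTE (neq_lift _ _)).
  + by rewrite gchi (negbTE (neq_lift _ _)).
  + by rewrite gc eqxx.
- move=> d; rewrite in_cons => /predU1P[->|/csP[n n0 [m dm]]].
    exists 1%N => //; exists (ord_cons 1 (fun=> 0)).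
    rewrite lin_cons ord_cons0 mulr1z mulr1n -[LHS]addr0 -(lin0 chi); congr (_ + lin _ _).
    by apply/funext => j; rewrite ord_consS.
  exists n => //; exists (ord_cons 0 m).
  rewrite lin_cons ord_cons0 mulr0z add0r dm; congr lin.
  by apply/funext => j; rewrite ord_consS.
Qed.

End IndependentBasis.

(** * Local structure of locally compact groups *)

Section LocalStructure.
Variable R : realType.
Local Notation circle := (circle R).
Local Notation dual A := (tophom A circle).

Section Evaluation.
Variable X : topologicalZmodType.
Implicit Types (k : nat).

Definition ev k (g : 'I_k -> tophom R X) (v : 'I_k -> R) : X := \sum_i g i (v i).

Lemma evD k (g : 'I_k -> tophom R X) v w : ev g (fun i => v i + w i) = ev g v + ev g w.
Proof. by rewrite /ev -big_split; apply: eq_bigr => i _; rewrite hom_add. Qed.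

Lemma evN k (g : 'I_k -> tophom R X) v : ev g (fun i => - v i) = - ev g v.
Proof. by rewrite /ev -sumrN; apply: eq_bigr => i _; rewrite tophomN. Qed.

Lemma evB k (g : 'I_k -> tophom R X) v w : ev g (fun i => v i - w i) = ev g v - ev g w.
Proof. by rewrite evD evN. Qed.

Lemma ev0 k (g : 'I_k -> tophom R X) : ev g (fun=> 0) = 0.
Proof. by rewrite /ev big1// => i _; rewrite tophom0. Qed.

Lemma ev_small k (g : 'I_k -> tophom R X) (U : set X) : nbhs 0 U ->
  exists2 d : R, 0 < d & forall v, (forall i, `|v i| < d) -> U (ev g v).
Proof.
move=> /(nbhs0_sums k)[V [V0 VU VN VS]].
have : nbhs 0 [set t : R | forall i, V (g i t)].
  by apply: (@filter_forall R _ _ (nbhs (0 : R))) => i; exact: (tophom_nbhs0 (g i) V0).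
move=> /nbhs0_real[d d0 dP]; exists d => // v vd.
pose f n := if insub n is Some i then g i (v i) else 0.
have -> : ev g v = \sum_(i < k) f i by apply: eq_bigr => i _; rewrite /f valK.
apply: VS => // n; rewrite /f; case: insubP => [i _ _|_]; first exact: dP.
exact: nbhs_singleton.
Qed.

End Evaluation.

Lemma hom_ev (X Y : topologicalZmodType) (q : tophom X Y) k (g : 'I_k -> tophom R X) v :
  q (ev g v) = ev (fun i => hom_comp q (g i)) v.
Proof. exact: tophom_sum. Qed.

Definition open_hom (X Y : topologicalZmodType) (q : tophom X Y) : Prop :=
  forall U, nbhs 0 U -> nbhs 0 (q @` U).

(** Near 0, every point of Y comes from a small cube in R^k and from L. *)
Definition locally_spans (X Y : topologicalZmodType) (q : tophom X Y) k
    (g : 'I_k -> tophom R X) (L : set X) : Prop :=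
  forall d : R, 0 < d -> nbhs 0 [set y | exists v l,
    [/\ forall i, `|v i| < d, L l & y = q (ev g v + l)]].

Lemma cball_torsion n (z : circle) : cball n.+1%:R^-1 z -> z *+ n.+1 = 0 -> z = 0.
Proof.
move=> [t /= tn <-]; rewrite -tophomMn => tz.
have n0 : 0 < n.+1%:R :> R by rewrite ltr0n.
have : t *+ n.+1 = 0.
  apply: (cpi0 _ tz); rewrite -(mulr_natr t n.+1) normrM (gtr0_norm n0).
  by rewrite -ltr_pdivlMr// mul1r.
by move=> /eqP; rewrite mulrn_eq0 /= => /eqP ->; rewrite tophom0.
Qed.

(** L is the common kernel of finitely many characters that define U. The dual
    functionals of an independent basis chi of these characters define
    one-parameter groups along which the chi are the coordinates. What is left
    after subtracting the coordinates is a small torsion point for the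
    remaining characters, hence is killed by them. *)
Lemma compact_local_structure (S : tabType) (U : set S) : compact [set: S] -> nbhs 0 U ->
  exists k (g : 'I_k -> tophom R S) (L : csubgroup S),
    [/\ compact L, L `<=` U & locally_spans (hom_id S) g L].
Proof.
move=> cS /(compact_nbhs_characters R cS)[N [c [d d0 cU]]].
have [k [chi [a [aD aE cP]]]] := independent_basis R [seq c j | j <- enum 'I_N].
have gex i : exists g : tophom R S, forall (psi : dual S) t, psi (g t) = cpi R (a i psi * t).
  apply: (hom_to_compact cS (Phi := fun psi => real_char (a i psi))) => x y.
  by apply: tophom_eq => t; rewrite /= aD mulrDl hom_add.
have [g gP] := choice gex.
pose Ls : set S := [set s | forall j, c j s = 0].
have sL : is_subgroup Ls.
  split=> [j|x y Lx Ly j]; first exact: tophom0.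
  by rewrite tophomB Lx Ly subrr.
have clL : closed Ls.
  move=> s cls j; apply: nbhs0_all_eq0 => V V0.
  have : nbhs s [set x | V (c j (s - x))].
    have h := tophom_nbhs0 (c j) (nbhs0N V0); rewrite -{1}(subrr s) in h.
    by apply: filterS (nbhs_subr h) => x /=; rewrite -tophomN opprB.
  by move=> /cls[x [Lx /=]]; rewrite tophomB Lx subr0.
pose L := CSubgroup sL.1 sL.2 clL.
exists k, g, L; split.
- by apply: (subclosed_compact clL cS).
- by move=> s Ls_; apply: cU => i; rewrite Ls_; exact: cball0.
move=> e e0.
have nex j : exists n, exists m, c j *+ n.+1 = lin chi m.
  have [|[//|n] n0 [m cm]] := cP (c j); last by exists n, m.
  by apply/mapP; exists j => //; rewrite mem_enum.
have [n nP] := choice nex.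
pose W : set S := [set s | forall j, cball (n j).+1%:R^-1 (c j s)].
have W0 : nbhs 0 W.
  apply: filter_forall => j; apply: (tophom_nbhs0 (c j)); apply: cball_nbhs.
  by rewrite invr_gt0 ltr0n.
have [V [V0 _ VN VD]] := nbhs0_halve W0.
have [d1 d10 d1P] := ev_small g V0.
pose d2 := Num.min d1 e.
have d20 : 0 < d2 by rewrite lt_min d10.
have B0 : nbhs 0 [set s | forall i, cball d2 (chi i s)].
  by apply: filter_forall => i; apply: (tophom_nbhs0 (chi i)); exact: cball_nbhs.
apply: filterS (filterI B0 V0) => s [/= sB sV].
have vex i : exists t : R, `|t| < d2 /\ cpi R t = chi i s.
  by have [t td tE] := sB i; exists t.
have [v vP] := choice vex.
have vd i : `|v i| < d2 by have [] := vP i.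
have vE i : cpi R (v i) = chi i s by have [] := vP i.
pose s' := s - ev g v.
have chi0 i : chi i s' = 0.
  rewrite tophomB tophom_sum (bigD1 i)//= gP aE eqxx mul1r vE big1 ?addr0 ?subrr// => j ij.
  by rewrite gP aE (negbTE ij) mul0r tophom0.
exists v, s'; split.
- by move=> i; apply: lt_le_trans (vd i) _; rewrite ge_min lexx orbT.
- move=> j; apply: (@cball_torsion (n j)).
    have : W s'.
      apply: VD => //; apply: VN; apply: d1P => i.
      by apply: lt_le_trans (vd i) _; rewrite ge_min lexx.
    exact.
  have [m cm] := nP j.
  rewrite -[LHS](tophom_mulz (c j) (n j).+1%:Z) -pmulrn cm sum_tophomE big1// => i _.
  by rewrite tophom_mulz chi0 mul0rz.
- by rewrite /= addrC subrK.
Qed.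

Section LocalHomReal.
Variables (X : topologicalZmodType) (phi : R -> X) (d : R).
Hypotheses (d0 : 0 < d).
Hypothesis phiD : forall s t, `|s| < d -> `|t| < d -> `|s + t| < d -> phi (s + t) = phi s + phi t.
Hypothesis phi0 : forall U, nbhs 0 U -> nbhs (0 : R) (phi @^-1` U).

Let phiM n s : `|s| * n.+1%:R < d -> phi (s * n.+1%:R) = phi s *+ n.+1.
Proof.
elim: n s => [|n IHn] s sd; first by rewrite mulr1 mulr1n.
have n0 : 0 <= n.+1%:R :> R by rewrite ler0n.
have sn : `|s| * n.+1%:R < d.
  by apply: le_lt_trans sd; rewrite ler_wpM2l// ler_nat.
have s1 : `|s| < d.
  by apply: le_lt_trans sd; rewrite ler_peMr// ler1n.
rewrite -[n.+2]addn1 natrD mulrDr mulr1 phiD//; first by rewrite IHn// mulrnDr mulr1n.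
  by rewrite normrM (ger0_norm n0).
have -> : s * n.+1%:R + s = s * n.+2%:R by rewrite -[n.+2]addn1 natrD mulrDr mulr1.
by rewrite normrM (ger0_norm (ler0n _ _)).
Qed.

Let indep t n m : `|t| < d * n.+1%:R -> `|t| < d * m.+1%:R ->
  phi (t / n.+1%:R) *+ n.+1 = phi (t / m.+1%:R) *+ m.+1.
Proof.
have half a b : `|t| < d * a.+1%:R ->
    phi (t / a.+1%:R) = phi (t / (a.+1%:R * b.+1%:R)) *+ b.+1.
  move=> ta; have a0 : 0 < a.+1%:R :> R by rewrite ltr0n.
  have b0 : 0 < b.+1%:R :> R by rewrite ltr0n.
  have h : t / (a.+1%:R * b.+1%:R) * b.+1%:R = t / a.+1%:R.
    by field; rewrite !gt_eqF.
  rewrite -phiM ?h//; rewrite -{2}(gtr0_norm b0) -normrM h normrM normfV (gtr0_norm a0).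
  by rewrite ltr_pdivrMr.
move=> tn tm; rewrite (half n m)// (half m n)// -!mulrnA.
by rewrite [m.+1%:R * _]mulrC mulnC.
Qed.

(** A local homomorphism on (- d, d) extends to R as phi (t / n) * n, which
    does not depend on n. *)
Lemma local_hom_real : exists g : tophom R X, forall t, `|t| < d -> g t = phi t.
Proof.
have bex (t : R) : exists n, `|t| < d * n.+1%:R.
  exists (Num.truncn (`|t| / d)); rewrite mulrC -ltr_pdivrMr//.
  exact: truncnS_gt.
have [N NP] := choice bex.
pose g t := phi (t / (N t).+1%:R) *+ (N t).+1.
have gE t n : `|t| < d * n.+1%:R -> g t = phi (t / n.+1%:R) *+ n.+1.
  by move=> tn; apply: indep.
have gphi t : `|t| < d -> g t = phi t.
  by move=> td; rewrite (gE t 0%N) ?mulr1// divr1.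
have gD : {morph g : x y / x + y}.
  move=> s t; pose n := (N s + N t + N (s + t)%R)%N.
  have n0 : 0 < n.+1%:R :> R by rewrite ltr0n.
  have le m u : (m <= n)%N -> `|u| < d * m.+1%:R -> `|u| < d * n.+1%:R.
    by move=> mn ud; apply: lt_le_trans ud _; rewrite ler_pM2l// ler_nat ltnS.
  have hs : `|s| < d * n.+1%:R by apply: le (NP s); rewrite /n; lia.
  have ht : `|t| < d * n.+1%:R by apply: le (NP t); rewrite /n; lia.
  have hst : `|s + t| < d * n.+1%:R by apply: le (NP (s + t)); rewrite /n; lia.
  rewrite !(gE _ n)// mulrDl phiD ?mulrnDl//;
    by rewrite -?mulrDl normrM normfV (gtr0_norm n0) ltr_pdivrMr.
have gc : continuous g.
  apply: additive_continuous => // U /phi0 Up.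
  have D0 : nbhs (0 : R) [set t | `|t| < d] by apply/nbhs0_real; exists d.
  by apply: filterS (filterI Up D0) => t [/= Ut td]; rewrite gphi.
by exists (TopHom gc gD).
Qed.

End LocalHomReal.

Lemma open_quot_map (G : tabType) (A : csubgroup G) : open_hom (quot_map A).
Proof. by move=> U; exact: quot_map_nbhs0. Qed.

Lemma locally_spansW (X Y : topologicalZmodType) (q : tophom X Y) k
    (g : 'I_k -> tophom R X) (L : set X) :
  (exists2 e : R, 0 < e & forall d, 0 < d -> d < e -> nbhs 0 [set y | exists v l,
    [/\ forall i, `|v i| < d, L l & y = q (ev g v + l)]]) -> locally_spans q g L.
Proof.
move=> [e e0 eP] d d0; pose d' := Num.min d (e / 2).
have d'0 : 0 < d' by rewrite lt_min d0 divr_gt0.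
have d'e : d' < e by apply: (@le_lt_trans _ _ (e / 2)); [rewrite ge_min lexx orbT|lra].
apply: filterS (eP d' d'0 d'e) => y [v [l [vd Ll ->]]]; exists v, l; split=> // i.
by apply: lt_le_trans (vd i) _; rewrite ge_min lexx.
Qed.

Section Lift.
Variables (D : tabType) (A : csubgroup D) (U1 W : set D).
Local Notation S := (quotient_group A).
Local Notation q := (quot_map A).
Hypotheses (U10 : nbhs 0 U1) (U1W : U1 `<=` W) (cU1 : compact U1).
(* W is so small that the projection is injective on sums of few elements. *)
Hypothesis WA : forall x y z, W x -> W y -> W z -> cs_set A (x + y - z) -> x + y = z.
Hypothesis WN : forall x, W x -> W (- x).

Let W0 : W 0. Proof. by apply: U1W; exact: nbhs_singleton. Qed.

Let q_inj x y : W x -> W y -> q x = q y -> x = y.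
Proof.
move=> Wx Wy /eqP; rewrite -subr_eq0 -tophomB => /eqP/quot_map0 Axy.
by rewrite -[x]addr0; apply: WA; rewrite ?addr0.
Qed.

(** The local inverse of the projection turns g into a local homomorphism,
    which extends to the line. *)
Lemma lift_one_parameter (g : tophom R S) : exists2 h : tophom R D,
  forall t, q (h t) = g t & exists2 d : R, 0 < d & forall t, `|t| < d -> U1 (h t).
Proof.
have /(tophom_nbhs0 g)/nbhs0_real[d d0 dP] := quot_map_nbhs0 A U10.
have ex t : exists x, `|t| < d -> U1 x /\ q x = g t.
  have [td|td] := pselect (`|t| < d); last by exists 0.
  by have [x Ux xE] := dP t td; exists x.
have [phi phiP] := choice ex.
have phiD s t : `|s| < d -> `|t| < d -> `|s + t| < d -> phi (s + t) = phi s + phi t.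
  move=> /phiP[/U1W Us sE] /phiP[/U1W Ut tE] /phiP[/U1W Ust stE].
  apply/esym/WA => //; apply/quot_map0.
  by rewrite tophomB hom_add sE tE stE -hom_add subrr.
have phi0 V : nbhs 0 V -> nbhs (0 : R) (phi @^-1` V).
  move=> V0; have VU : nbhs 0 (U1 `&` V) by exact: filterI.
  have D0 : nbhs (0 : R) [set t | `|t| < d] by apply/nbhs0_real; exists d.
  apply: filterS (filterI D0 (tophom_nbhs0 g (quot_map_nbhs0 A VU))) => t [/= td [x [Ux Vx] xE]].
  have [Up pE] := phiP t td.
  by rewrite (@q_inj (phi t) x) ?pE//; exact: U1W.
have [h hE] := local_hom_real d0 phiD phi0.
exists h; last by exists d => // t td; rewrite hE//; have [] := phiP t td.
move=> t; pose n := (Num.truncn (`|t| / d)).+1.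
have n0 : 0 < n%:R :> R by rewrite ltr0n.
have tn : `|t / n%:R| < d.
  rewrite normrM normfV (gtr0_norm n0) ltr_pdivrMr// mulrC -ltr_pdivrMr//.
  exact: truncnS_gt.
have -> : t = (t / n%:R) *+ n by rewrite -(mulr_natr (t / _)) divfK ?gt_eqF.
by rewrite !tophomMn hE//; have [_ ->] := phiP _ tn.
Qed.

Lemma lift_compact_subgroup (L : csubgroup S) : L `<=` q @` U1 ->
  exists L' : csubgroup D, [/\ compact L', L' `<=` U1,
    forall x, U1 x -> cs_set L (q x) -> cs_set L' x & forall l, cs_set L' l -> cs_set L (q l)].
Proof.
move=> LU; pose L' : set D := [set x | U1 x /\ cs_set L (q x)].
have sL : is_subgroup L'.
  split; first by split; [exact: nbhs_singleton|rewrite tophom0; exact: cs0].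
  move=> x y [Ux Lx] [Uy Ly]; have Lxy : cs_set L (q (x - y)) by rewrite tophomB; exact: csB.
  have [z Uz zE] := LU _ Lxy.
  suff xyz : x - y = z by split=> //; rewrite xyz.
  apply: WA; [exact: U1W|by apply/WN/U1W|exact: U1W|].
  by apply/quot_map0; rewrite tophomB zE subrr.
have cL : compact L'.
  apply: compact_closedI => //.
  by move/continuous_closedP: (@hom_cont _ _ q); apply; exact: cs_closed.
have clL : closed L' by apply: compact_closed => //; exact: hausdorffP.
by exists (CSubgroup sL.1 sL.2 clL); split=> // x [].
Qed.

End Lift.

(** Modulo a lattice, a compactly generated group is compact, and it has the
    same local structure. *)
Lemma local_structure (D : tabType) (U : set D) : lcg D -> nbhs 0 U ->
  exists k (g : 'I_k -> tophom R D) (L : csubgroup D),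
    [/\ compact L, L `<=` U & locally_spans (hom_id D) g L].
Proof.
(* It is enough to treat an open compactly generated subgroup. *)
wlog gD : D U / cgen D => [th lD U0|_ U0].
  have [V [V0 cV VU]] := lcg_in lD U0.
  have [k [g [L [cL LU sL]]]] := th (subgroup_type (generated_cs V0)) _
    (generated_cgen V0 cV) (sub_lcg _ lD) (sub_nbhs0 _ U0).
  pose i := sub_incl (generated_cs V0); pose L' := i @` L.
  have cL' : compact L' by apply: compact_image => //; exact: hom_cont.
  have sL' : is_subgroup L'.
    split; first by exists 0 => //; exact: cs0.
    by move=> _ _ [x Lx <-] [y Ly <-]; exists (x - y) => //; exact: csB.
  have clL' : closed L' by apply: compact_closed => //; exact: hausdorffP.
  exists k, (fun j => hom_comp i (g j)), (CSubgroup sL'.1 sL'.2 clL'); split=> //.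
    by move=> _ [x Lx <-]; exact: LU.
  move=> d d0; have [B B0 BP] := sub_nbhs0P (sL d d0).
  apply: filterS (filterI B0 (generated_nbhs V0)) => x [/= Bx Hx].
  have [v [l [vd Ll xE]]] := BP (@subgroup_sub _ (generated_cs V0) _ Hx) Bx.
  exists v, (i l); split=> //; first by exists l.
  by rewrite -[x]/(i (@subgroup_sub _ (generated_cs V0) _ Hx)) xE /= -hom_ev.
have [A [_ [W1 W10 W1A] cS]] := cocompact_lattice 0 gD.
have [W [W0 WW1 WN WS]] := nbhs0_sums 3 W10.
have W13 a b c : W a -> W b -> W c -> W1 (a + b + c).
  move=> Va Vb Vc; have := WS 3%N (fun i => nth 0 [:: a; b; c] i) (leqnn _).
  rewrite !big_ord_recl big_ord0 /= addr0 addrA; apply.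
  by case=> [|[|[|i]]] //=; rewrite nth_nil; exact: nbhs_singleton.
have WA x y z : W x -> W y -> W z -> cs_set A (x + y - z) -> x + y = z.
  move=> Wx Wy Wz Axyz; apply/eqP; rewrite -subr_eq0; apply/eqP/W1A => //.
  by apply: W13 => //; exact: WN.
have lD : lcg D by have [V [V0 cV _]] := gD; exists V.
have [U1 [U10 cU1 U1P]] := lcg_in lD (filterI W0 U0).
have U1W : U1 `<=` W by move=> x /U1P[].
have [k [g [L [cL LU sL]]]] := compact_local_structure cS (quot_map_nbhs0 A U10).
have [L' [cL' L'U L'P1 L'P2]] := lift_compact_subgroup U10 U1W cU1 WA WN LU.
have hex i : exists h : tophom R D, forall t, quot_map A (h t) = g i t.
  by have [h hE _] := lift_one_parameter U10 U1W WA (g i); exists h.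
have [h hP] := choice hex.
exists k, h, L'; split=> //; first by move=> x /L'U/U1P[].
apply: locally_spansW.
have [W2 [W20 W2W W2N W2D]] := nbhs0_halve U10.
have [e e0 eP] := ev_small h W20.
exists e => // d d0 de.
apply: filterS (filterI W20 (tophom_nbhs0 (quot_map A) (sL d d0))) => x [/= W2x [v [l [vd Ll /= qx]]]].
exists v, (x - ev h v); split=> //; last by rewrite /= addrC subrK.
apply: L'P1.
  by apply: W2D => //; apply/W2N/eP => i; exact: lt_trans (vd i) de.
have qh : quot_map A (ev h v) = ev g v by rewrite hom_ev; apply: eq_bigr => i _; exact: hP.
by rewrite tophomB qh [quot_map A x]qx addrAC subrr add0r.
Qed.

End LocalStructure.

(** * Local coordinates *)

Section ClosedLine.
Variables (R : realType) (k : nat).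
Local Notation E := (euclidean_group R k).

Lemma euclid_scale_continuous (t : R) (w : E) (U : set E) : nbhs ((fun i => t * w i) : E) U ->
  exists2 e : R, 0 < e & nbhs w [set u | forall s, `|s - t| < e -> U (fun i => s * u i)].
Proof.
move=> Utw.
have : (fun p : R * E => (fun i => p.1 * p.2 i) : E) @ nbhs (t, w) --> ((fun i => t * w i) : E).
  apply/(prod_cvgP _ (fmap_filter _ (nbhs_filter (t, w)))) => i V Vi.
  have : (fun p : R * E => p.1 * p.2 i) @ nbhs (t, w) --> t * w i.
    apply: cvgM; first exact: cvg_fst.
    by apply: (@continuous_comp _ _ _ snd (fun u : E => u i) (t, w)); [exact: cvg_snd|exact: prod_proj_continuous].
  exact.
move=> /(_ U Utw)[[T N] /= [Tt Nw] TN].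
have [e /= e0 eT] := (nbhs_ballP _ _).1 Tt.
exists e => //; apply: filterS Nw => u Nu s st; apply: (TN (s, u)); split=> //=.
by apply: eT; rewrite /ball /= distrC.
Qed.

(** A closed subgroup of R^k that is not discrete contains a line: a cluster
    point w of the directions of its small elements v spans one, since t w is
    approximated by the multiples of v. *)
Lemma closed_subgroup_line (A : csubgroup E) :
  (forall d : R, 0 < d -> exists v, [/\ cs_set A v, exists i, v i != 0 & forall i, `|v i| < d]) ->
  exists w : E, (exists i, w i != 0) /\ forall t, cs_set A (fun i => t * w i).
Proof.
move=> small; apply: contrapT => noline.
have nl (w : E) : (exists i, w i != 0) -> exists t, ~ cs_set A (fun i => t * w i).
  by move=> w0; apply: contrapT => nt; apply: noline; exists w; split=> // t; apply: contrapT => nA; apply: nt; exists t.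
pose sph i : set E := [set w | forall j, (if j == i then [set 1] else `[-1, 1]%classic) (w j)].
have csph i : compact (sph i).
  apply: (@tychonoff 'I_k (fun=> R) (fun j => if j == i then [set 1] else `[-1, 1]%classic)) => j.
  by case: eqP => _; [exact: compact_set1|exact: segment_compact].
have disc i : exists2 d : R, 0 < d & forall v : E, cs_set A v -> v i != 0 -> `|v i| < d ->
    ~ sph i (fun j => v j / v i).
  pose Q (B : set E) := exists2 d : R, 0 < d &
    forall v : E, cs_set A v -> v i != 0 -> `|v i| < d -> ~ B (fun j => v j / v i).
  suff : Q (sph i) by [].
  apply: (compact_induction (csph i)).
  - by exists 1 => // v _ _ _ [].
  - move=> B C [d d0 dB] [e e0 eC]; exists (Num.min d e); first by rewrite lt_min d0.
    by move=> v Av vi; rewrite lt_min => /andP[vd ve] [/dB|/eC]; exact.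
  - by move=> B C BC [d d0 dC]; exists d => // v Av vi vd /BC; exact: dC.
  - move=> w wsph; have wi : w i = 1 by have := wsph i; rewrite eqxx.
    have [t nA] := nl w ltac:(by exists i; rewrite wi oner_neq0).
    have nAn : nbhs ((fun j => t * w j) : E) (~` cs_set A).
      by apply: open_nbhs_nbhs; split=> //; apply: closed_openC; exact: cs_closed.
    have [e e0 eP] := euclid_scale_continuous nAn.
    eexists; first exact: eP.
    exists e => // v Av vi ve /= Bv.
    pose m := Num.floor (t / v i).
    have /andP[m1 m2] : m%:~R <= t / v i < (m + 1)%:~R by exact: floor_itv.
    apply: (Bv (m%:~R * v i)).
      have -> : m%:~R * v i - t = (m%:~R - t / v i) * v i by rewrite mulrBl divfK.
      rewrite normrM (le_lt_trans _ ve)// ler_piMl// ler_norml.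
      by rewrite intrD in m2; apply/andP; split; lra.
    rewrite (_ : (fun j => _) = v *~ m); first by apply: subgroupMz => //; exact: subgroup_cs.
    apply/funext => j; transitivity (m%:~R * v j); first by field.
    rewrite mulrzl.
    by rewrite -[RHS]/(prod_proj (fun=> R : topologicalZmodType) j (v *~ m)) tophomMz.
have [D DP] : exists D : 'I_k -> R, forall i, 0 < D i /\ forall v : E, cs_set A v -> v i != 0 -> `|v i| < D i ->
    ~ sph i (fun j => v j / v i).
  have ex i : exists d : R, 0 < d /\ forall v : E, cs_set A v -> v i != 0 -> `|v i| < d ->
    ~ sph i (fun j => v j / v i) by have [d] := disc i; exists d.
  by have [D DP] := choice ex; exists D.
have : nbhs (0 : R) [set t | forall i, `|t| < D i].
  apply: (@filter_forall R _ _ (nbhs (0 : R))) => i; apply/nbhs0_real; exists (D i) => //.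
  by have [] := DP i.
move=> /nbhs0_real[d d0 dD].
have [v [Av [i0 vi0] vd]] := small d d0.
have [i vmax] : exists i, forall j, `|v j| <= `|v i|.
  case: (@Order.TotalTheory.arg_maxP _ _ _ i0 xpredT (fun j => `|v j|) isT) => i _ imax.
  by exists i => j; exact: imax.
have vi : 0 < `|v i| by apply: lt_le_trans (vmax i0); rewrite normr_gt0.
have vi' : v i != 0 by rewrite -normr_gt0.
have [_ /(_ v Av vi' (dD _ (vd i) i))] := DP i; apply => j.
case: eqP => [->|_]; first by rewrite /= divff.
by rewrite /= in_itv /= -ler_norml normrM normfV ler_pdivrMr// mul1r.
Qed.

End ClosedLine.

Section Coordinates.
Variable R : realType.
Variables (X Y : tabType) (q : tophom X Y).

Fact ev_cont k (g : 'I_k -> tophom R X) : continuous (fun v : euclidean_group R k => ev g v).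
Proof.
apply: additive_continuous => [v w|U U0]; first exact: evD.
have [d d0 dP] := ev_small g U0.
have : nbhs (0 : euclidean_group R k) [set v | forall i, `|v i| < d].
  apply: (@filter_forall _ _ _ (nbhs (0 : euclidean_group R k))) => i.
  have D0 : nbhs (0 : R) [set t | `|t| < d] by apply/nbhs0_real; exists d.
  exact: (tophom_nbhs0 (prod_proj (fun _ : 'I_k => R : topologicalZmodType) i) D0).
by apply: filterS => v vd; exact: dP.
Qed.

(** As long as small vectors are not determined by their image modulo the image
    of L, the closed subgroup of the vectors with image in that of L contains a
    line, along which one coordinate can be eliminated. *)
Lemma spans_independent (L : csubgroup X) k (g : 'I_k -> tophom R X) :
  compact L -> locally_spans q g L ->
  exists k' (g' : 'I_k' -> tophom R X), locally_spans q g' L /\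
    exists2 d : R, 0 < d & forall v l, (forall i, `|v i| < d) -> cs_set L l ->
      q (ev g' v) = q l -> forall i, v i = 0.
Proof.
move=> cL; have sL := subgroup_cs L.
elim: k g => [|k IHk] g gL; first by exists 0%N, g; split=> //; exists 1 => // v l _ _ _ [].
have [[d d0 dP]|nd] := pselect (exists2 d : R, 0 < d & forall v l, (forall i, `|v i| < d) ->
    cs_set L l -> q (ev g v) = q l -> forall i, v i = 0).
  by exists k.+1, g; split=> //; exists d.
pose A0 : set (euclidean_group R k.+1) := [set v | exists2 l, cs_set L l & q (ev g v) = q l].
have sA : is_subgroup A0.
  split; first by exists 0; [exact: cs0|rewrite ev0 !tophom0].
  move=> v w [l Ll vl] [m Lm wm]; exists (l - m); first exact: csB.
  by rewrite [ev g (v - w)](evB g) !tophomB vl wm.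
have clA : closed A0.
  have -> : A0 = (fun v => q (ev g v)) @^-1` (q @` L).
    by apply/seteqP; split=> v [l Ll lE]; exists l.
  have cq : continuous (fun v : euclidean_group R k.+1 => q (ev g v)).
    by move=> v; apply: continuous_comp; [exact: ev_cont|exact: hom_cont].
  move/continuous_closedP: cq; apply; apply: compact_closed; first exact: hausdorffP.
  by apply: compact_image => //; exact: hom_cont.
have [|w [[i0 wi0] wA]] := @closed_subgroup_line R k.+1 (CSubgroup sA.1 sA.2 clA).
  move=> d d0; apply: contrapT => nv; apply: nd; exists d => // v l vd Ll vl i.
  by apply/eqP; apply: contrapT => vi; apply: nv; exists v; split=> //; [exists l|exists i; apply/negP].
apply: (IHk (fun j => g (lift i0 j))) => d d0.
pose c := 1 + \sum_i `|w i / w i0|.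
have c0 : 0 < c by rewrite ltr_pwDl// sumr_ge0.
have dc : 0 < d / c by rewrite divr_gt0.
apply: filterS (gL _ dc) => _ [v [l [vd Ll ->]]].
have [l2 Ll2 wl2] := wA (v i0 / w i0).
exists (fun j => v (lift i0 j) - v i0 / w i0 * w (lift i0 j)), (l + l2); split.
- move=> j; apply: le_lt_trans (ler_normB _ _) _.
  have h : `|v i0 / w i0 * w (lift i0 j)| <= d / c * `|w (lift i0 j) / w i0|.
    rewrite mulrAC -mulrA normrM ler_wpM2r//; exact: ltW.
  have h2 : `|w (lift i0 j) / w i0| <= \sum_i `|w i / w i0|.
    by rewrite (bigD1 (lift i0 j))//= lerDl sumr_ge0.
  apply: (@lt_le_trans _ _ (d / c + d / c * `|w (lift i0 j) / w i0|)).
    by apply: ltr_leD; first exact: vd.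
  have -> : d / c + d / c * `|w (lift i0 j) / w i0| = d / c * (1 + `|w (lift i0 j) / w i0|).
    by rewrite mulrDr mulr1.
  rewrite mulrAC ler_pdivrMr// ler_pM2l//; rewrite /c; lra.
- exact: csD.
- rewrite addrA !hom_add addrAC; congr (_ + _).
  rewrite -wl2 -hom_add; congr (q _).
  rewrite /ev (bigD1_ord i0)//= [X in _ = _ + X](bigD1_ord i0)//=.
  rewrite divfK// [RHS]addrCA; congr (_ + _).
  by rewrite -big_split /=; apply: eq_bigr => j _; rewrite -hom_add subrK.
Qed.

(** The vector of a small point is unique, hence additive and continuous at 0.
    *)
Lemma local_coordinates (U : set X) : lcg X -> open_hom q -> nbhs 0 U ->
  exists k (g : 'I_k -> tophom R X) (L : csubgroup X) (v : 'I_k -> Y -> R) (N : set Y),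
  [/\ compact L /\ L `<=` U, nbhs 0 N,
      forall y, N y -> exists2 l, cs_set L l & y = q (ev g (v^~ y) + l),
      forall i x y, N x -> N y -> N (x + y) -> v i (x + y) = v i x + v i y &
      forall i (d : R), 0 < d -> nbhs 0 [set y | `|v i y| < d]].
Proof.
move=> lX oq U0.
have [k0 [g0 [L [cL LU gL0]]]] := local_structure R lX U0.
have gL0q : locally_spans q g0 L.
  move=> d d0; apply: filterS (oq _ (gL0 d d0)) => _ [x [v [l [vd Ll ->]]] <-].
  by exists v, l.
have [k [g [gL [d0 d00 d0P]]]] := spans_independent cL gL0q.
pose e := d0 / 4; have e0 : 0 < e by rewrite /e; lra.
pose N : set Y := [set y | exists v l, [/\ forall i, `|v i| < e, cs_set L l & y = q (ev g v + l)]].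
have N0 : nbhs 0 N by exact: gL.
have uniq_v v l v' l' : (forall i, `|v i - v' i| < d0) -> cs_set L l -> cs_set L l' ->
    q (ev g v + l) = q (ev g v' + l') -> v = v'.
  move=> vv Ll Ll' E; apply/funext => i; apply/eqP; rewrite -subr_eq0; apply/eqP.
  apply: (d0P (fun i => v i - v' i) (l' - l)) => //; first exact: csB.
  rewrite evB !tophomB; apply/eqP; rewrite subr_eq -subr_eq0; apply/eqP.
  by move: E; rewrite !hom_add => /eqP; rewrite -subr_eq0 => /eqP <-; zmod.
have ex y : exists v : 'I_k -> R, N y -> (forall i, `|v i| < e) /\ exists2 l, cs_set L l & y = q (ev g v + l).
  have [[v [l [vd Ll yE]]]|nN] := pselect (N y); last by exists (fun=> 0).
  by exists v => _; split=> //; exists l.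
have [v vP] := choice ex.
have vE y w l : (forall i, `|w i| < d0 - e) -> cs_set L l -> y = q (ev g w + l) -> N y -> v y = w.
  move=> wd Ll yE Ny; have [vd [l' Ll' yE']] := vP y Ny.
  apply: (@uniq_v _ l' _ l) => //; last by rewrite -yE' -yE.
  move=> i; apply: le_lt_trans (ler_normB _ _) _.
  by have := vd i; have := wd i; lra.
exists k, g, L, (fun i y => v y i), N; split=> //.
- by move=> y /vP[].
- move=> i x y Nx Ny Nxy.
  have [vx [l Ll xE]] := vP x Nx; have [vy [m Lm yE]] := vP y Ny.
  rewrite (@vE (x + y) (fun i => v x i + v y i) (l + m))//.
  + move=> j; apply: le_lt_trans (ler_normD _ _) _.
    by have := vx j; have := vy j; rewrite /e; lra.
  + exact: csD.
  + by rewrite {1}xE {1}yE evD -hom_add; congr (q _); zmod.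
- move=> i d d1; have dm : 0 < Num.min d e by rewrite lt_min d1.
  apply: filterS (filterI N0 (gL _ dm)) => y [Ny [w [l [wd Ll yE]]]] /=.
  have we j : `|w j| < d0 - e.
    by have := wd j; rewrite lt_min => /andP[_]; rewrite /e; lra.
  by rewrite (vE y w l)//; have := wd i; rewrite lt_min => /andP[].
Qed.

End Coordinates.

(** * Real homomorphisms on compactly generated groups *)

Section RealHoms.
Variable R : realType.

(** Induction on the sum of the absolute values of z, moving by one unit vector
    at a time so as to stay in the box. *)
Lemma locally_additive_lin (G : zmodType) n (e : 'I_n -> G) (w : G -> R) (b : nat) :
  (forall z z', (forall i, (`|z i| <= b.+1)%N) -> (forall i, (`|z' i| <= b.+1)%N) ->
     (forall i, (`|(z i + z' i)%R| <= b.+1)%N) ->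
     w (lin e z + lin e z') = w (lin e z) + w (lin e z')) ->
  forall z, (forall i, (`|z i| <= b.+1)%N) -> w (lin e z) = lin (fun i => w (e i)) z.
Proof.
move=> wD.
have w0 : w 0 = 0.
  have h : w 0 = w 0 + w 0.
    by have := wD (fun=> 0) (fun=> 0); rewrite lin0 (addr0 (0 : G)); apply.
  by apply: (addrI (w 0)); rewrite -h addr0.
have del i j : (absz (i == j :> 'I_n)%:Z <= b.+1)%N by case: (i == j).
have delN i j : (absz (- (i == j :> 'I_n)%:Z)%R <= b.+1)%N by case: (i == j).
have step z j (s : bool) : (forall i, (`|z i| <= b.+1)%N) ->
    (forall i, (`|(z i + (-1) ^+ s * (i == j)%:Z)%R| <= b.+1)%N) ->
    w (lin e z + e j *~ (-1) ^+ s) = w (lin e z) + w (e j) *~ (-1) ^+ s.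
  have lj : lin e (fun i => (i == j)%:Z) = e j by exact: lin_delta.
  have ljN : lin e (fun i => - (i == j)%:Z) = - e j by rewrite linN lj.
  case: s => zb zb'.
    have wN : w (- e j) = - w (e j).
      apply/eqP; rewrite -addr_eq0 addrC; apply/eqP.
      have := wD (fun i => (i == j)%:Z) (fun i => - (i == j)%:Z); rewrite lj ljN => <- //.
        by rewrite subrr.
      by move=> i; rewrite subrr.
    rewrite expr1 !mulrNz !mulr1z -wN -ljN wD// => i.
    by have := zb' i; rewrite expr1 mulN1r.
  by rewrite expr0 !mulr1z -lj wD// => i; have := zb' i; rewrite expr0 mul1r.
move=> z; have [N] := ubnP (\sum_i `|z i|)%N.
elim: N z => [|N IHN] z //; rewrite ltnS => zN zb.
have [[j zj]|nz] := pselect (exists j, z j != 0); last first.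
  have -> : z = fun=> 0.
    by apply/funext => i; apply/eqP; apply: contrapT => zi; apply: nz; exists i; apply/negP.
  by rewrite !lin0.
pose s := (z j < 0); pose z' i := z i - (-1) ^+ s * (i == j)%:Z.
have z'i i : (`|z' i| = `|z i| - (i == j))%N.
  rewrite /z' /s; have [->|ij] := eqVneq i j; last by rewrite mulr0 subr0 subn0.
  by move: zj; case: (ltP (z j) 0) => /= ? ?; rewrite ?expr1 ?expr0; lia.
have z'b i : (`|z' i| <= b.+1)%N by rewrite z'i; have := zb i; lia.
have zE : z = fun i => z' i + (-1) ^+ s * (i == j)%:Z.
  by apply/funext => i; rewrite /z' subrK.
have linE (E : zmodType) (u : 'I_n -> E) : lin u z = lin u z' + u j *~ (-1) ^+ s.
  rewrite {1}zE linD; congr (_ + _); rewrite /lin (bigD1 j)//= eqxx mulr1 big1 ?addr0// => i /negbTE ->.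
  by rewrite mulr0 mulr0z.
rewrite !linE step// ?IHN//.
  apply: (leq_trans _ zN); rewrite (bigD1 j)//= [X in (_ < X)%N](bigD1 j)//=.
  apply: (@leq_ltn_trans (`|z' j| + \sum_(i < n | i != j) `|z i|)%N).
    by rewrite leq_add2l; apply: leq_sum => i /negbTE ij; rewrite z'i ij subn0.
  by rewrite ltn_add2r z'i eqxx subn1 prednK// absz_gt0.
by move=> i; rewrite -[X in absz X]/((fun i => z' i + (-1) ^+ s * (i == j)%:Z) i) -zE.
Qed.

(** In the decomposition x = lin e z + m, put l x = lin (w o e) z + w m. The
    sum of two decompositions differs from the decomposition of the sum by a
    bounded lattice vector, on which w is linear. This is how homomorphisms to
    a quotient of R^k, such as the circle, lift if they are small on a large
    compact set. *)
Lemma local_hom_lift (G : tabType) (K0 : set G) : cgen G -> compact K0 ->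
  exists2 K1 : set G, compact K1 & K0 `<=` K1 /\ forall w : G -> R,
    (forall x y, K1 x -> K1 y -> K1 (x + y) -> w (x + y) = w x + w y) ->
    exists2 l : G -> R, {morph l : x y / x + y} & forall x, K0 x -> l x = w x.
Proof.
move=> gG cK0.
have [n [e [M [pe cM MP]]]] := cgen_decomposition gG (subgroup0 G).
have cM2 : compact (set_add M M) by exact: compact_add.
pose M' := set_add M (set_opp M).
have cP : compact (set_add (set_add M M) (set_opp M) `|` set_add K0 (set_opp M)).
  by apply: compactU; apply: compact_add => //; exact: compact_opp.
have [b bP] := pe _ cP.
have [L cL LP] := compact_lin e b.+1.
pose K1 := K0 `|` L `|` (set_add L M) `|` M `|` set_add M M.
exists K1; first by do !apply: compactU => //; exact: compact_add.
split=> [x K0x|w wD]; first by do 4!left.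
have KL x : L x -> K1 x by move=> Lx; left; left; left; right.
have KM x : M x -> K1 x by move=> Mx; left; right.
have KLM x y : L x -> M y -> K1 (x + y) by move=> Lx My; left; left; right; exact: set_addP.
have KMM x y : M x -> M y -> K1 (x + y) by move=> Mx My; right; exact: set_addP.
have wlin := @locally_additive_lin G n e w b.
have {wlin} wlin : forall z, (forall i, (`|z i| <= b.+1)%N) -> w (lin e z) = lin (fun i => w (e i)) z.
  apply: wlin => z z' zb zb' zzb; apply: wD; try (by apply: KL; exact: LP).
  by apply: KL; rewrite -linD; exact: LP.
have ex x : exists zm : ('I_n -> int) * G, M zm.2 /\ x = lin e zm.1 + zm.2.
  have [z [h [-> Mx]]] := MP x; exists (z, x - lin e z - 0); split=> //=.
  by rewrite subr0 addrC subrK.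
have [zm zmP] := choice ex.
pose z x := (zm x).1; pose m x := (zm x).2.
have Mm x : M (m x) by have [] := zmP x.
have xE x : x = lin e (z x) + m x by have [] := zmP x.
pose l x := lin (fun i => w (e i)) (z x) + w (m x).
exists l.
  move=> x y; pose z4 i := z (x + y) i - (z x i + z y i).
  have z4E : lin e z4 = m x + m y - m (x + y).
    rewrite /z4 linD linN linD; apply/eqP; rewrite -subr_eq0; apply/eqP.
    transitivity (lin e (z (x + y)) + m (x + y) - (lin e (z x) + m x) - (lin e (z y) + m y)); first zmod.
    by rewrite -!xE; zmod.
  have z4b i : (`|z4 i| <= b.+1)%N.
    apply: leqW; apply: (bP z4 0) => //; left; rewrite addr0 z4E.
    apply: set_addP; first exact: set_addP.
    by rewrite /set_opp /= opprK.
  have : w (m x + m y) = w (lin e z4) + w (m (x + y)).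
    rewrite -wD; first by rewrite z4E subrK.
    - by apply: KL; exact: LP.
    - exact: KM.
    - by apply: KLM => //; exact: LP.
  rewrite wD; [|exact: KM|exact: KM|exact: KMM].
  rewrite (wlin z4 z4b) /z4 linD linN linD /l => E.
  transitivity (lin (fun i => w (e i)) (z x) + lin (fun i => w (e i)) (z y) + (w (m x) + w (m y))); last zmod.
  rewrite E; zmod.
move=> x K0x; have zb i : (`|z x i| <= b.+1)%N.
  apply: leqW; apply: (bP (z x) 0) => //; right; rewrite addr0.
  rewrite -[lin e _](addrK (m x)) -xE; apply: set_addP => //.
  by rewrite /set_opp /= opprK.
rewrite {2}(xE x) wD ?wlin//; last by rewrite -xE; do 4!left.
- by apply: KL; exact: LP.
- exact: KM.
Qed.

Lemma additive_natmul (G : zmodType) (f : G -> R) x n : {morph f : x y / x + y} ->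
  f (x *+ n) = f x * n%:R.
Proof.
move=> fD; have := (additive_onMz (H := setT) (f := f) (x := x) n (subgroupT _)).
by move=> /(_ (fun x y _ _ => fD x y) I) /=; rewrite -pmulrn => ->; rewrite -pmulrn mulr_natr.
Qed.

Lemma eq0_bounded_multiples (a d : R) : (forall n, `|a * n.+1%:R| <= d) -> a = 0.
Proof.
move=> ad; apply: contrapT => /eqP; rewrite -normr_gt0 => a0.
have := ad (Num.truncn (d / `|a|)); rewrite normrM (ger0_norm (ler0n _ _)) leNgt => /negP; apply.
by rewrite mulrC -ltr_pdivrMr//; exact: truncnS_gt.
Qed.

(** The additive function is the limit of r (2^n x) / 2^n, which is squeezed
    between monotone sequences. *)
Lemma hyers (G : zmodType) (r : G -> R) (d : R) :
  (forall x y, `|r (x + y) - r x - r y| <= d) ->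
  exists2 l : G -> R, {morph l : x y / x + y} & forall x, `|l x - r x| <= d.
Proof.
move=> rD; have d0 : 0 <= d by apply: le_trans (rD 0 0).
have p0 n : 0 < 2 ^+ n :> R by rewrite exprn_gt0.
have rS x n : `|r (x *+ 2 ^ n.+1) - 2 * r (x *+ 2 ^ n)| <= d.
  have := rD (x *+ 2 ^ n) (x *+ 2 ^ n); rewrite -mulrnDr addnn -mul2n -expnS.
  by congr (`|_| <= _); ring.
pose lo x n := (r (x *+ 2 ^ n) - d) / 2 ^+ n; pose hi x n := (r (x *+ 2 ^ n) + d) / 2 ^+ n.
have loS x n : lo x n <= lo x n.+1.
  rewrite /lo exprS invfM mulrA ler_pM2r ?invr_gt0//.
  by have := rS x n; rewrite ler_norml => /andP[? ?]; lra.
have hiS x n : hi x n.+1 <= hi x n.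
  rewrite /hi exprS invfM mulrA ler_pM2r ?invr_gt0//.
  by have := rS x n; rewrite ler_norml => /andP[? ?]; lra.
have lohi x n m : lo x n <= hi x m.
  have lom a b : (a <= b)%N -> lo x a <= lo x b.
    move=> ab; rewrite -(subnK ab); elim: (b - a)%N => // c IHc.
    by rewrite addSn; exact: le_trans IHc (loS _ _).
  have him a b : (a <= b)%N -> hi x b <= hi x a.
    move=> ab; rewrite -(subnK ab); elim: (b - a)%N => // c IHc.
    by rewrite addSn; exact: le_trans (hiS _ _) IHc.
  have [nm|mn] := leqP n m.
    apply: le_trans (lom _ _ nm) _; rewrite /lo /hi ler_pM2r ?invr_gt0//; lra.
  apply: le_trans (him _ _ (ltnW mn)); rewrite /lo /hi ler_pM2r ?invr_gt0//; lra.
pose l x := sup [set lo x n | n in [set: nat]].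
have lP x n : `|l x * 2 ^+ n - r (x *+ 2 ^ n)| <= d.
  have h1 : lo x n <= l x.
    apply: ub_le_sup; last by exists n.
    by exists (hi x 0%N) => _ [k _ <-]; exact: lohi.
  have h2 : l x <= hi x n.
    by apply: ge_sup; [exists (lo x 0%N), 0%N|move=> _ [k _ <-]; exact: lohi].
  move: h1 h2; rewrite /lo /hi ler_pdivrMr// ler_pdivlMr// ler_norml => ? ?.
  by apply/andP; split; lra.
exists l => [x y|x]; last by have := lP x 0%N; rewrite expr0 mulr1 expn0 mulr1n.
apply/eqP; rewrite -subr_eq0; apply/eqP.
set a := _ - _; have aP n : `|a| * 2 ^+ n <= 4 * d.
  rewrite -(gtr0_norm (p0 n)) -normrM /a.
  have := lP x n; have := lP y n; have := lP (x + y) n; have := rD (x *+ 2 ^ n) (y *+ 2 ^ n).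
  rewrite -mulrnDl !ler_norml => /andP[? ?] /andP[? ?] /andP[? ?] /andP[? ?].
  by apply/andP; split; lra.
apply: contrapT => /eqP; rewrite -normr_gt0 => a0.
pose c := 4 * d / `|a|; have cE : 4 * d = `|a| * c by rewrite /c; field; rewrite gt_eqF.
have := aP (Num.truncn c).+1; rewrite leNgt => /negP; apply.
rewrite cE ltr_pM2l//; apply: lt_trans (truncnS_gt _) _.
by rewrite -natrX ltr_nat; exact: ltn_expl.
Qed.

Lemma real_additive_cont (G : topologicalZmodType) (l : G -> R) (V : set G) (d : R) :
  {morph l : x y / x + y} -> nbhs 0 V -> (forall x, V x -> `|l x| <= d) -> continuous l.
Proof.
move=> lD V0 Vd; apply: additive_continuous => // U /nbhs0_real[e e0 eU].
pose n := (Num.truncn (d / e)).+1.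
have [W [W0 WV _ WS]] := nbhs0_sums n V0.
apply: filterS W0 => x Wx; apply: eU.

have := Vd _ (WS n (fun=> x) (leqnn _) (fun=> Wx)).
rewrite sumr_const card_ord additive_natmul// normrM (ger0_norm (ler0n _ _)) => ld.
have n0 : 0 < n%:R :> R by rewrite ltr0n.
rewrite -(ltr_pM2r n0); apply: le_lt_trans ld _.
by rewrite mulrC -ltr_pdivrMr//; exact: truncnS_gt.
Qed.

Lemma hom_on_bounded (G : tabType) (H : csubgroup G) (l : G -> R) (K : set G) :
  hom_on H l -> compact K -> exists2 d : R, 0 <= d & forall x, K x -> cs_set H x -> `|l x| <= d.
Proof.
move=> [lD lc] cK; have sH := subgroup_cs H.
have cKH : compact (K `&` H) by apply: compact_closedI => //; exact: cs_closed.
pose Q (B : set G) := exists2 d : R, 0 <= d & forall x, B x -> cs_set H x -> `|l x| <= d.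
suff [d d0 dP] : Q (K `&` H) by exists d => // x Kx Hx; exact: dP.
apply: (compact_induction cKH).
- by exists 0 => // x [].
- move=> A B [d d0 dA] [e e0 eB]; exists (d + e); first exact: addr_ge0.
  move=> x [Ax|Bx] Hx; first by apply: le_trans (dA _ Ax Hx) _; rewrite lerDl.
  by apply: le_trans (eB _ Bx Hx) _; rewrite lerDr.
- by move=> A B AB [d d0 dB]; exists d => // x /AB; exact: dB.
- move=> s [_ Hs].
  have B1 : nbhs (0 : R) [set t | `|t| < 1] by apply/nbhs0_real; exists 1.
  have [V V0 V1] := lc _ B1.
  exists [set x | V (x - s)]; first by apply: nbhs_subr; rewrite subrr.
  exists (1 + `|l s|); first by rewrite addr_ge0.
  move=> x Vx Hx; have -> : l x = l (x - s) + l s by rewrite (additive_onB sH lD)// subrK.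
  apply: le_trans (ler_normD _ _) _; rewrite lerD2r; apply: ltW.
  by apply: V1 => //; exact: csB.
Qed.

(** The function r x = l (h x), where h x is the part in H of a decomposition
    of x, is additive up to a bounded error: the defect is the value of l on
    the part of H in a compact set. The additive function near r agrees with l
    on H, since their difference is bounded and additive there. *)
Lemma real_hom_extension (G : tabType) (H : csubgroup G) (K0 : set G) : cgen G -> compact K0 ->
  exists2 K1 : set G, compact K1 & forall l : G -> R, hom_on H l ->
    exists2 F : tophom G R, forall x, cs_set H x -> F x = l x &
      forall d : R, (forall x, K1 x -> cs_set H x -> `|l x| <= d) ->
        forall x, K0 x -> `|F x| <= 2 * d.
Proof.
move=> gG cK0; have sH := subgroup_cs H.
have [n [e [M [pe cM MP]]]] := cgen_decomposition gG sH.
have [V [V0 cV _]] := gG.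
pose P := set_add M (set_add M (set_opp M)) `|` (set_opp M `|` set_add (K0 `|` V) (set_opp M)).
have cP : compact P.
  have cN : compact (set_opp M) by exact: compact_opp.
  apply: compactU; first by do 2!apply: compact_add => //.
  by apply: compactU => //; apply: compact_add => //; exact: compactU.
have [b bP] := pe _ cP.
have [L cL LP] := compact_lin e b.
pose K1 := set_add P L.
have K1P z h : cs_set H h -> P (lin e z + h) -> K1 h.
  move=> Hh Ph; have -> : h = (lin e z + h) + lin e (fun i => - z i) by rewrite linN; zmod.
  by apply: set_addP => //; apply: LP => i; rewrite abszN; exact: (bP z h).
exists K1; first exact: compact_add.
move=> l lH; have [lD _] := lH.
have ex x : exists zh : ('I_n -> int) * G, cs_set H zh.2 /\ M (x - lin e zh.1 - zh.2).
  by have [z [h [Hh Mx]]] := MP x; exists (z, h).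
have [zh zhP] := choice ex.
pose z x := (zh x).1; pose h x := (zh x).2.
have Hh x : cs_set H (h x) by have [] := zhP x.
have Mx x : M (x - lin e (z x) - h x) by have [] := zhP x.
pose r x := l (h x).
have rP d : (forall x, K1 x -> cs_set H x -> `|l x| <= d) ->
    [/\ forall x y, `|r (x + y) - r x - r y| <= d, forall x, cs_set H x -> `|r x - l x| <= d &
        forall x, (K0 `|` V) x -> `|r x| <= d].
  move=> ld; split.
  - move=> x y; have Hd : cs_set H (h (x + y) - h x - h y) by do 2!apply: csB => //.
    rewrite /r -!(additive_onB sH lD)//; last by apply: csB.
    apply: ld => //; apply: (K1P (fun i => z (x + y) i - z x i - z y i)) => //.
    left; rewrite !linD !linN.
    exists (x - lin e (z x) - h x), ((y - lin e (z y) - h y) - (x + y - lin e (z (x + y)) - h (x + y))).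
    split=> //; last by zmod.
    by apply: set_addP => //; rewrite /set_opp /= opprK.
  - move=> x Hx; rewrite /r -(additive_onB sH lD)//; apply: ld; last exact: csB.
    apply: (K1P (z x)); first exact: csB.
    by right; left; rewrite /set_opp /=; have := Mx x; congr M; zmod.
  - move=> x Kx; apply: ld => //; apply: (K1P (z x)) => //; right; right.
    exists x, (- (x - lin e (z x) - h x)); split=> //; last by zmod.
    by rewrite /set_opp /= opprK.
have cK1 : compact K1 by exact: compact_add.
have [d0 d00 /rP[rD0 rH0 rK0]] := hom_on_bounded lH cK1.
have [F FD FP] := hyers rD0.
have FE x : cs_set H x -> F x = l x.
  move=> Hx; apply/eqP; rewrite -subr_eq0; apply/eqP.
  apply: (@eq0_bounded_multiples _ (d0 + d0)) => n'; set N := n'.+1.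
  have HN : cs_set H (x *+ N) by exact: (subgroupMn N sH).
  have lN : l (x *+ N) = l x * N%:R.
    by rewrite mulr_natr; exact: (additive_onMz N sH lD Hx).
  rewrite mulrBl -additive_natmul// -lN.
  have -> : F (x *+ N) - l (x *+ N) = (F (x *+ N) - r (x *+ N)) + (r (x *+ N) - l (x *+ N)) by ring.
  by apply: le_trans (ler_normD _ _) _; apply: lerD; [exact: FP|exact: rH0].
have Fc : continuous F.
  apply: (@real_additive_cont _ F V (d0 + d0)) => // x Vx.
  have -> : F x = (F x - r x) + r x by rewrite subrK.
  apply: le_trans (ler_normD _ _) _.
  by apply: lerD; [exact: FP|apply: rK0; right].
exists (TopHom Fc FD) => // d /rP[rD rH rK] x Kx /=.
(* The additive function close to r is unique. *)
have [F' FD' FP'] := hyers rD.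
have -> : F x = F' x.
  apply/eqP; rewrite -subr_eq0; apply/eqP.
  apply: (@eq0_bounded_multiples _ (d0 + d)) => n'; set N := n'.+1.
  rewrite mulrBl -!additive_natmul//.
  have -> : F (x *+ N) - F' (x *+ N) = (F (x *+ N) - r (x *+ N)) - (F' (x *+ N) - r (x *+ N)) by ring.
  by apply: le_trans (ler_normB _ _) _; apply: lerD; [exact: FP|exact: FP'].
have -> : F' x = (F' x - r x) + r x by rewrite subrK.
apply: le_trans (ler_normD _ _) _.
by have := FP' x; have := rK x (or_introl Kx); lra.
Qed.

End RealHoms.

(** * Homomorphisms into compact groups *)

Lemma add_homE (A B : topologicalZmodType) (f g : tophom A B) x : (f + g) x = f x + g x.
Proof. by []. Qed.

Lemma sub_homE (A B : topologicalZmodType) (f g : tophom A B) x : (f - g) x = f x - g x.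
Proof. by []. Qed.

Section CompactTargets.
Variable R : realType.
Local Notation circle := (circle R).
Local Notation dual A := (tophom A circle).

(** This says that the quotient G / H is codivisible, without forming the
    quotient. *)
Definition codivisible_mod (G : topologicalZmodType) (H : set G) : Prop :=
  forall n, (0 < n)%N -> forall chi : dual G, (forall x, H x -> chi x = 0) ->
    exists2 psi : dual G, forall x, H x -> psi x = 0 & psi *+ n = chi.

(** The dual statement is that the dual map from the characters of L to those
    of H lifts to the characters of G. Single characters extend, and the
    choices become additive after retracting the characters of G onto those
    that vanish on H, which form a divisible, hence injective, group. *)
Lemma compact_hom_extension (G L : tabType) (H : csubgroup G) (f : G -> L) :
  lcg G -> compact [set: L] -> codivisible_mod H -> hom_on H f ->
  exists F : tophom G L, forall x, cs_set H x -> F x = f x.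
Proof.
move=> lG cL dH fH; pose Z : set (dual G) := [set chi | forall x, cs_set H x -> chi x = 0].
have sZ : is_subgroup Z.
  split=> [x _ //|chi psi chiZ psiZ x Hx].
  by rewrite -[LHS]/(chi x - psi x) chiZ// psiZ// subrr.
have [rho [rhoD rhoE rhoZ]] := @divisible_extension _ _ Z Z id sZ sZ (fun _ _ _ _ => erefl)
  (fun _ => id) (fun n n0 chi chiZ => dH n n0 chi chiZ).
have ex (chi : dual L) : exists xi : dual G, forall x, cs_set H x -> xi x = chi (f x).
  exact: (character_extension lG (hom_on_comp chi fH)).
have [xi xiP] := choice ex.
(* The choice of an extension xi of chi o f becomes additive after subtraction
   of the component of xi in the divisible group Z. *)
pose Phi chi := xi chi - rho (xi chi).
have PhiD : {morph Phi : x y / x + y}.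
  move=> chi psi; pose dlt := xi (chi + psi) - xi chi - xi psi.
  have Zd : Z dlt.
    move=> x Hx; rewrite -[LHS]/(xi (chi + psi) x - xi chi x - xi psi x) !xiP//=.
    by zmod.
  have xE : xi (chi + psi) = dlt + xi chi + xi psi by rewrite /dlt; zmod.
  clearbody dlt; by rewrite /Phi xE !rhoD rhoE//; zmod.
have [F FE] := hom_to_compact cL PhiD.
exists F => x Hx; apply: (@compact_eq R _ cL) => chi.
by rewrite FE -[LHS]/(xi chi x - rho (xi chi) x) rhoZ// subr0 xiP.
Qed.

(** A compact group maps onto its image by a quotient map, so that characters
    of L that vanish on the kernel of q define continuous characters on its
    image. *)
Lemma compact_factor (L Y C : tabType) (q : tophom L Y) (f : tophom C Y) (chi : dual L) :
  compact [set: L] -> (forall c, exists l, q l = f c) -> (forall l, q l = 0 -> chi l = 0) ->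
  exists psi : dual C, forall c l, q l = f c -> psi c = chi l.
Proof.
move=> cL qf chiq; have [s sP] := choice qf.
have chiE c l : q l = f c -> chi (s c) = chi l.
  move=> lc; apply/eqP; rewrite -subr_eq0 -tophomB; apply/eqP/chiq.
  by rewrite tophomB sP lc subrr.
pose psi c := chi (s c).
have psiD : {morph psi : x y / x + y}.
  by move=> x y; rewrite /psi -hom_add; apply: chiE; rewrite hom_add !sP hom_add.
have psic : continuous psi.
  apply: additive_continuous => // U; rewrite nbhsE => -[V [oV V0] VU].
  pose B : set L := [set l | ~ V (chi l)].
  have cB : compact B.
    apply: (subclosed_compact _ cL) => //; apply: (@open_closedC _ (chi @^-1` V)).
    by apply: open_comp => // x _; exact: hom_cont.
  have clqB : closed (q @` B).
    apply: compact_closed; first exact: hausdorffP.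
    by apply: compact_image => //; exact: hom_cont.
  have : nbhs 0 (f @^-1` ~` (q @` B)).
    apply: tophom_nbhs0; apply: open_nbhs_nbhs; split; first exact: closed_openC.
    by move=> [l Bl ql]; apply: Bl; rewrite (chiq _ ql).
  apply: filterS => c /= nc; apply: VU; apply: contrapT => nV; apply: nc.
  by exists (s c); [exact: nV|exact: sP].
by exists (TopHom psic psiD) => c l lc; exact: chiE.
Qed.

(** The dual map is prescribed on the characters of L that vanish on the kernel
    of q; it extends to all characters since the dual of C is divisible. *)
Lemma compact_hom_lift (C L Y : tabType) (q : tophom L Y) (f : tophom C Y) :
  codivisible R C -> compact [set: L] -> (forall c, exists l, q l = f c) ->
  exists F : tophom C L, forall c, q (F c) = f c.
Proof.
move=> dC cL qf; have [s sP] := choice qf.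
pose Z : set (dual L) := [set chi | forall l, q l = 0 -> chi l = 0].
have sZ : is_subgroup Z.
  split=> [x _ //|chi psi chiZ psiZ x Hx].
  by rewrite -[LHS]/(chi x - psi x) chiZ// psiZ// subrr.
have ex (chi : dual L) : exists psi : dual C, Z chi -> forall c l, q l = f c -> psi c = chi l.
  have [Zc|nZ] := pselect (Z chi); last by exists 0.
  by have [psi psiP] := compact_factor cL qf Zc; exists psi.
have [phi phiP] := choice ex.
have phiD : additive_on Z phi.
  move=> chi psi Zc Zp; apply: tophom_eq => c.
  have Zcp : Z (chi + psi) by exact: (subgroupD sZ Zc Zp).
  rewrite -[RHS]/(phi chi c + phi psi c).
  by rewrite (phiP _ Zcp c (s c) (sP c)) (phiP _ Zc c (s c) (sP c)) (phiP _ Zp c (s c) (sP c)).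
have dT n : (0 < n)%N -> forall z : dual C, setT z -> exists2 y, setT y & y *+ n = z.
  by move=> n0 z _; have [y yn] := dC n n0 z; exists y.
have [Phi [PhiD PhiE _]] := divisible_extension sZ (subgroupT _) phiD (fun _ _ => I) dT.
have [F FE] := hom_to_compact cL PhiD.
exists F => c; apply/eqP; rewrite -(sP c) -subr_eq0 -tophomB; apply/eqP.
apply: contrapT => nk.
have [chi chiZ] := @characters_separate_subgroup R L (Defs.kernel q) _ (compact_lcg cL) nk.
by apply; rewrite tophomB FE PhiE// (phiP _ chiZ c (s c) (sP c)) subrr.
Qed.

Lemma cs_compact (G : tabType) (L : csubgroup G) : compact L -> compact [set: subgroup_type L].
Proof.
move=> cL; rewrite (_ : setT = [set x : subgroup_type L | cs_set L (\val x)]).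
  exact: sub_compact.
by apply/seteqP; split=> // x _; exact: subgroup_valP.
Qed.

Lemma hom_corestrict (G D : tabType) (H : set G) (L : csubgroup D) (f : G -> D) : is_subgroup H ->
  hom_on H f -> (forall x, H x -> cs_set L (f x)) ->
  exists2 g : G -> subgroup_type L, hom_on H g & forall x, H x -> \val (g x) = f x.
Proof.
move=> sH [fD fc] fL.
have ex x : exists y : subgroup_type L, H x -> \val y = f x.
  have [Hx|nH] := pselect (H x); last by exists 0.
  by exists (subgroup_sub (fL x Hx)).
have [g gP] := choice ex.
exists g => //; split=> [x y Hx Hy|U /sub_nbhs0P[V V0 VU]].
  by apply: val_inj; rewrite gP ?fD ?gP//; [rewrite -(gP x)// -(gP y)|exact: subgroupD].
by have [W W0 WV] := fc V V0; exists W => // x Hx Wx; apply: VU; rewrite gP//; exact: WV.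
Qed.

(** * Small homomorphisms *)

(** The local coordinates of f x are additive on a compact set of x, hence are
    given there by real homomorphisms l i. The difference maps generators of C,
    and so all of C, into the image of L. *)
Lemma small_hom_decomposition (X Y : tabType) (q : tophom X Y) (U : set X) :
  lcg X -> open_hom q -> nbhs 0 U ->
  exists k (g : 'I_k -> tophom R X) (L : csubgroup X), [/\ compact L, L `<=` U &
  forall (C : tabType) (K0 : set C) (d : R), cgen C -> compact K0 -> 0 < d ->
  exists (K1 : set C) (U1 : set Y), [/\ compact K1, nbhs 0 U1 &
  forall f : tophom C Y, (forall x, K1 x -> U1 (f x)) ->
  exists2 l : 'I_k -> tophom C R, forall i x, K0 x -> `|l i x| <= d &
    forall x, exists2 y, cs_set L y & f x = q (ev g (fun i => l i x) + y)]].
Proof.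
move=> lX oq U0; have [k [g [L [v [N [[cL LU] N0 NP vD vs]]]]]] := local_coordinates R lX oq U0.
exists k, g, L; split=> // C K0 d gC cK0 d0.
have [V [V0 cV VG]] := gC.
have [K1 cK1 [K01 K1P]] := local_hom_lift R gC (compactU cK0 cV).
have U10 : nbhs 0 (N `&` [set y | forall i, `|v i y| < d]).
  by apply: filterI => //; apply: filter_forall => i; exact: vs.
exists K1, (N `&` [set y | forall i, `|v i y| < d]); split=> // f fU.
have ex i : exists l : tophom C R, forall x, (K0 `|` V) x -> l x = v i (f x).
  have [x y Kx Ky Kxy|l lD lE] := K1P (fun x => v i (f x)).
    have := (fU _ Kxy).1; rewrite hom_add => Nxy.
    by apply: vD => //; [exact: (fU _ Kx).1|exact: (fU _ Ky).1].
  have lc : continuous l.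
    apply: (@real_additive_cont R C l V d) => // x Vx.
    by rewrite lE; [apply/ltW/(fU _ _).2/K01; right|right].
  by exists (TopHom lc lD).
have [l lE] := choice ex.
exists l => [i x Kx|].
  by rewrite lE; [apply/ltW/(fU _ _).2/K01; left|left].
pose B : set C := [set x | exists2 y, cs_set L y & f x = q (ev g (fun i => l i x) + y)].
apply: (VG B).
  split; first by exists 0; [exact: cs0|rewrite addr0 (_ : (fun i => _) = fun=> 0) ?ev0 ?tophom0//;
    apply/funext => i; rewrite tophom0].
  move=> x y [u Lu xE] [w Lw yE]; exists (u - w); first exact: csB.
  have -> : (fun i => l i (x - y)) = (fun i => l i x - l i y).
    by apply/funext => i; rewrite tophomB.
  by rewrite tophomB xE yE -tophomB evB; congr (q _); zmod.
move=> x Vx; have Kx : K1 x by apply: K01; right.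
have [y Ly fE] := NP _ (fU _ Kx).1; exists y => //; rewrite {1}fE; congr (q (ev g _ + y)).
by apply/funext => i; rewrite lE//; right.
Qed.

Section Parts.
Variables (C X : tabType) (k : nat) (g : 'I_k -> tophom R X) (l : 'I_k -> tophom C R).

Definition real_part : tophom C X := \sum_i hom_comp (g i) (l i).

Lemma real_partE x : real_part x = ev g (fun i => l i x).
Proof. exact: sum_tophomE. Qed.

End Parts.

(** The one-parameter parts of f lift through X by construction; the rest maps
    into the image of a small compact subgroup, to which it lifts by duality. *)
Lemma small_hom_lift_cgen (X Y C : tabType) (q : tophom X Y) (U : set X) (K0 : set C) :
  lcg X -> open_hom q -> nbhs 0 U -> cgen C -> codivisible R C -> compact K0 ->
  exists (K1 : set C) (U1 : set Y), [/\ compact K1, nbhs 0 U1 &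
  forall f : tophom C Y, (forall x, K1 x -> U1 (f x)) ->
  exists2 F : tophom C X, forall x, q (F x) = f x & forall x, K0 x -> U (F x)].
Proof.
move=> lX oq U0 gC dC cK0; have [V [V0 _ _ VD]] := nbhs0_halve U0.
have [k [g [L [cL LV dec]]]] := small_hom_decomposition lX oq V0.
have [d d0 dP] := ev_small g V0.
have [K1 [U1 [cK1 U10 K1P]]] := dec C K0 (d / 2) gC cK0 ltac:(lra).
exists K1, U1; split=> // f /K1P[l ld lE].
have h c : exists y : subgroup_type L, hom_comp q (sub_incl L) y = (f - hom_comp q (real_part g l)) c.
  have [y Ly fE] := lE c; exists (subgroup_sub Ly).
  by rewrite sub_homE /= real_partE fE hom_add addrAC subrr add0r.
have [F FE] := compact_hom_lift dC (cs_compact cL) h.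
exists (real_part g l + hom_comp (sub_incl L) F) => x.
  by rewrite add_homE hom_add [q (hom_comp _ _ x)]FE sub_homE addrC subrK.
move=> Kx; rewrite add_homE; apply: VD.
  by rewrite real_partE; apply: dP => i; apply: le_lt_trans (ld i x Kx) _; lra.
by apply: LV; exact: subgroup_valP.
Qed.

Lemma sub_cgen (G : tabType) (H : csubgroup G) : cgen G -> cgen (subgroup_type H).
Proof.
move=> gG; have [K [cK KP]] := cgen_subgroup gG (subgroup_cs H).
have [V [V0 cV _]] := gG.
exists [set x | (V `|` K) (\val x)]; split.
- by apply: sub_nbhs0; apply: filterS V0 => x; left.
- by apply: sub_compact; exact: compactU.
move=> A sA VA x.
pose B : set G := [set y | exists2 z : subgroup_type H, A z & \val z = y].
have sB : is_subgroup B.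
  split; first by exists 0 => //; case: sA.
  by move=> _ _ [y Ay <-] [z Az <-]; exists (y - z) => //; exact: sA.2.
have [|z Az /val_inj <- //] := KP B sB _ (\val x) (subgroup_valP x).
by move=> y [Ky Hy]; exists (subgroup_sub Hy) => //; apply: VA; right.
Qed.

Lemma small_hom_extension_cgen (G D : tabType) (H : csubgroup G) (U : set D) (K0 : set G) :
  cgen G -> codivisible_mod H -> lcg D -> nbhs 0 U -> compact K0 ->
  exists (K1 : set G) (U1 : set D), [/\ compact K1, nbhs 0 U1 &
  forall f : G -> D, hom_on H f -> (forall x, K1 x -> cs_set H x -> U1 (f x)) ->
  exists2 F : tophom G D, forall x, cs_set H x -> F x = f x & forall x, K0 x -> U (F x)].
Proof.
move=> gG dH lD U0 cK0; have [V [V0 _ _ VD]] := nbhs0_halve U0.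
have lG : lcg G by have [W [W0 cW _]] := gG; exists W.
have oid : open_hom (hom_id D) by move=> W W0; rewrite image_id.
have [k [g [L [cL LV dec]]]] := small_hom_decomposition lD oid V0.
have [d d0 dP] := ev_small g V0.
have [K2 cK2 K2P] := real_hom_extension R H gG cK0.
have [K1 [U1 [cK1 U10 K1P]]] := dec (subgroup_type H) _ (d / 4) (sub_cgen H gG) (sub_compact (H := H) cK2) ltac:(lra).
exists (sub_incl H @` K1), U1; split=> //; first by apply: compact_image => //; exact: hom_cont.
move=> f fH fK; have [f' f'E] := hom_on_restrict fH.
have [|l ld lE] := K1P f'.
  by move=> x Kx; rewrite f'E; apply: fK; [exists x|exact: subgroup_valP].
have ex i : exists F : tophom G R, (forall x : subgroup_type H, F (\val x) = l i x) /\ forall x, K0 x -> `|F x| <= d / 2.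
  have [m mH mE] := hom_on_extend0 (l i).
  have [F FE FK] := K2P m mH; exists F; split=> [x|x Kx].
    by rewrite FE ?mE//; exact: subgroup_valP.
  apply: le_trans (FK (d / 4) _ x Kx) _; last lra.
  move=> y Ky Hy; rewrite -[y]/(\val (subgroup_sub Hy)) mE; exact: ld.
have [m mP] := choice ex.
pose f1 x := f x - real_part g m x.
have f1H : hom_on H f1 by apply: hom_on_sub => //; exact: tophom_hom_on.
have f1L x : cs_set H x -> cs_set L (f1 x).
  move=> Hx; have [y Ly yE] := lE (subgroup_sub Hx).
  rewrite /f1 real_partE -[f x](f'E (subgroup_sub Hx)) yE /=.
  have -> : (fun i => m i x) = (fun i => l i (subgroup_sub Hx)).
    by apply/funext => i; rewrite -(mP i).1.
  by rewrite addrAC subrr add0r.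
have [f2 f2H f2E] := hom_corestrict (subgroup_cs H) f1H f1L.
have [F FE] := compact_hom_extension lG (cs_compact cL) dH f2H.
exists (real_part g m + hom_comp (sub_incl L) F) => x.
  by move=> Hx; rewrite add_homE /= FE// f2E// /f1 addrC subrK.
move=> Kx; rewrite add_homE; apply: VD.
  by rewrite real_partE; apply: dP => i; apply: le_lt_trans ((mP i).2 x Kx) _; lra.
by apply: LV; exact: subgroup_valP.
Qed.

End CompactTargets.

(** * Restriction to a kernel and lifting along a quotient *)

Lemma natmul_homE (A B : topologicalZmodType) (f : tophom A B) n x : (f *+ n) x = f x *+ n.
Proof. exact: (tophom_mulz f n%:Z x). Qed.

Section Factorization.
Variables (G Y Z : tabType) (p : tophom G Y) (f : tophom G Z).
Hypotheses (op : open_hom p) (pf : forall x, p x = 0 -> f x = 0).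

Lemma range_subgroup : is_subgroup (range p).
Proof.
split; first by exists 0 => //; rewrite tophom0.
by move=> _ _ [x _ <-] [y _ <-]; exists (x - y) => //; rewrite tophomB.
Qed.

Lemma range_nbhs0 : nbhs 0 (range p).
Proof. by apply: op; exact: filterT. Qed.

(** An open homomorphism is a quotient map onto its image. *)
Lemma hom_factor : exists2 g : Y -> Z, hom_on (range p) g & forall x, g (p x) = f x.
Proof.
have ex y : exists z, forall x, p x = y -> z = f x.
  have [[x _ xy]|ny] := pselect (range p y); last by exists 0 => x xy; exfalso; apply: ny; exists x.
  exists (f x) => x' x'y; apply/eqP; rewrite -subr_eq0 -tophomB; apply/eqP/pf.
  by rewrite tophomB xy x'y subrr.
have [g gP] := choice ex.
have gE x : g (p x) = f x by exact: gP.
exists g => //; split=> [_ _ [x _ <-] [y _ <-]|U U0]; first by rewrite -hom_add !gE hom_add.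
exists (p @` (f @^-1` U)); first by apply: op; exact: tophom_nbhs0.
by move=> _ _ [x Ux <-]; rewrite gE.
Qed.

End Factorization.

Lemma hom_onT (G D : topologicalZmodType) (f : G -> D) : hom_on setT f ->
  exists F : tophom G D, forall x, F x = f x.
Proof.
move=> [fD fc]; have fm : {morph f : x y / x + y} by move=> x y; exact: fD.
have cf : continuous f.
  apply: additive_continuous => // U /fc[V V0 VU]; apply: filterS V0 => x Vx; exact: VU.
by exists (TopHom cf fm).
Qed.

Lemma corestrict_tophom (G D : tabType) (L : csubgroup D) (f : tophom G D) :
  (forall x, cs_set L (f x)) ->
  exists g : tophom G (subgroup_type L), forall x, \val (g x) = f x.
Proof.
move=> fL; have [g gT gE] := @hom_corestrict G D setT L f (subgroupT _) (tophom_hom_on _ f) (fun x _ => fL x).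
by have [F FE] := hom_onT gT; exists F => x; rewrite FE gE.
Qed.

Lemma hom_on_compose (G D E : topologicalZmodType) (H : set G) (P : set D) (g : G -> D) (f : D -> E) :
  hom_on H g -> (forall x, H x -> P (g x)) -> hom_on P f -> hom_on H (fun x => f (g x)).
Proof.
move=> [gD gc] gP [fD fc]; split=> [x y Hx Hy|U /fc[V V0 VU]].
  by rewrite gD// fD//; exact: gP.
have [W W0 WV] := gc V V0; exists W => // x Hx Wx; apply: VU; [exact: gP|exact: WV].
Qed.

Section ExtensionOpen.
Variables (R : realType) (G Y : tabType) (p : tophom G Y).
Hypotheses (op : open_hom p) (dY : codivisible R Y).
Variables (V : set G) (V0 : nbhs 0 V).
Local Notation G' := (subgroup_type (generated_cs V0)).
Let p' : tophom G' Y := hom_comp p (sub_incl (generated_cs V0)).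

Let op' : open_hom p'.
Proof.
move=> U /sub_nbhs0P[B B0 BU].
apply: filterS (op (filterI B0 (generated_nbhs V0))) => _ [x [Bx Hx] <-].
by exists (@subgroup_sub _ (generated_cs V0) _ Hx) => //; exact: BU.
Qed.

(** The image of an open subgroup of G is open in Y, and characters of open
    subgroups extend. *)
Lemma codivisible_mod_generated : codivisible_mod R (Defs.kernel p').
Proof.
move=> n n0 chi chi0; have [g gR gE] := hom_factor op' chi0.
have [|y _ ->|chi' [chi'E _]] := @hom_glue Y (circle R) (range p') [set 0] g (fun=> 0)
  (circle_divisible (R := R)) (range_subgroup p') (subgroup0 Y) (range_nbhs0 op') gR.
- by move=> x y _ _; rewrite addr0.
- by rewrite (additive_on0 (range_subgroup p') gR.1).
have [psi psiE] := dY n0 chi'.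
exists (hom_comp psi p').
  by move=> x px; rewrite /= [p _]px tophom0.
apply: tophom_eq => x; rewrite natmul_homE -[hom_comp psi p' x]/(psi (p' x)) -natmul_homE psiE chi'E.
  exact: gE.
by exists x.
Qed.

Lemma extension_from_generated (D : tabType) (f : G -> D) (F' : tophom G' D) : divisible D ->
  hom_on (Defs.kernel p) f -> (forall x : G', p (\val x) = 0 -> F' x = f (\val x)) ->
  exists F : tophom G D, (forall x, p x = 0 -> F x = f x) /\ forall x : G', F (\val x) = F' x.
Proof.
move=> dD [fD _] F'E; have [g gH gE] := hom_on_extend0 F'.
have sK := subgroup_cs (Defs.kernel p).
have [|F [FE Ff]] := @hom_glue G D (generated_cs V0) (Defs.kernel p) g f dD (subgroup_cs _) sK (generated_nbhs V0) gH fD.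
  move=> x Gx px; rewrite -[x]/(\val (@subgroup_sub _ (generated_cs V0) _ Gx)) gE; exact: F'E.
exists F; split=> [x px|x]; first exact: Ff.
by rewrite FE ?gE//; exact: subgroup_valP.
Qed.

End ExtensionOpen.

(** Small homomorphisms extend from the kernel to a compactly generated open
    subgroup containing K0, with control on K0, and are then glued with f. *)
Lemma small_hom_extension (R : realType) (G Y D : tabType) (p : tophom G Y) (U : set D) (K0 : set G) :
  lcg G -> open_hom p -> codivisible R Y -> lcg D -> divisible D -> nbhs 0 U -> compact K0 ->
  exists (K1 : set G) (U1 : set D), [/\ compact K1, nbhs 0 U1 &
  forall f : G -> D, hom_on (Defs.kernel p) f -> (forall x, K1 x -> p x = 0 -> U1 (f x)) ->
  exists2 F : tophom G D, forall x, p x = 0 -> F x = f x & forall x, K0 x -> U (F x)].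
Proof.
move=> [V V0 cV] op dY lD dD U0 cK0.
have W0 : nbhs 0 (V `|` K0) by apply: filterS V0 => x; left.
have cW : compact (V `|` K0) by exact: compactU.
set G' := generated_cs W0.
have [K1 [U1 [cK1 U10 K1P]]] := small_hom_extension_cgen (generated_cgen W0 cW)
  (@codivisible_mod_generated R G Y p op dY _ W0) lD U0 (sub_compact (H := G') cK0).
exists (sub_incl G' @` K1), U1; split=> //; first by apply: compact_image => //; exact: hom_cont.
move=> f fH fK.
have f'H : hom_on (Defs.kernel (hom_comp p (sub_incl G'))) (fun x => f (sub_incl G' x)).
  by apply: (@hom_on_compose _ _ _ _ (Defs.kernel p) (sub_incl G') f) => //; exact: tophom_hom_on.
have [|F' F'E F'K] := K1P _ f'H.
  by move=> x Kx px; apply: fK => //; exists x.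
have [F [FE FF']] := extension_from_generated dD fH F'E.
exists F => // x Kx; have Gx : cs_set G' x by apply: generated_sub; right.
by rewrite -[x]/(\val (subgroup_sub Gx)) FF'; exact: F'K.
Qed.

Lemma codivisible_sub (R : realType) (Y : tabType) (H : csubgroup Y) : lcg Y ->
  codivisible R Y -> codivisible R (subgroup_type H).
Proof.
move=> lY dY n n0 chi; have [g gH gE] := hom_on_extend0 chi.
have [chi' chi'E] := character_extension lY gH.
have [psi psiE] := dY n n0 chi'; exists (hom_comp psi (sub_incl H)); apply: tophom_eq => x.
rewrite natmul_homE -[hom_comp _ _ x]/(psi (\val x)) -natmul_homE psiE chi'E ?gE//.
exact: subgroup_valP.
Qed.

(** On a compactly generated open subgroup containing K0 there is a small lift
    of q o f. It differs from f by a homomorphism into the kernel of q, which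
    extends to C because the kernel is divisible. *)
Lemma small_hom_lift (R : realType) (C X Y : tabType) (q : tophom X Y) (U : set X) (K0 : set C) :
  lcg C -> codivisible R C -> lcg X -> open_hom q -> divisible (subgroup_type (Defs.kernel q)) ->
  nbhs 0 U -> compact K0 ->
  exists (K1 : set C) (U1 : set Y), [/\ compact K1, nbhs 0 U1 &
  forall f : tophom C X, (forall x, K1 x -> U1 (q (f x))) ->
  exists2 F : tophom C X, forall x, q (F x) = q (f x) & forall x, K0 x -> U (F x)].
Proof.
move=> lC dC lX oq dk U0 cK0; have [V V0 cV] := lC.
have W0 : nbhs 0 (V `|` K0) by apply: filterS V0 => x; left.
have cW : compact (V `|` K0) by exact: compactU.
set C' := generated_cs W0.
have [K1 [U1 [cK1 U10 K1P]]] := small_hom_lift_cgen lX oq U0 (generated_cgen W0 cW)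
  (codivisible_sub (H := C') lC dC) (sub_compact (H := C') cK0).
exists (sub_incl C' @` K1), U1; split=> //; first by apply: compact_image => //; exact: hom_cont.
move=> f fK.
have [|F' F'E F'K] := K1P (hom_comp q (hom_comp f (sub_incl C'))).
  by move=> x Kx /=; apply: fK; exists x.
have hk x : cs_set (Defs.kernel q) ((hom_comp f (sub_incl C') - F') x).
  by rewrite sub_homE; change (q (hom_comp f (sub_incl C') x - F' x) = 0); rewrite tophomB F'E subrr.
have [h hE] := corestrict_tophom hk.
have [k kE] := hom_extend_open h dk (generated_nbhs W0).
exists (f - hom_comp (sub_incl _) k) => x.
  by rewrite sub_homE tophomB (subgroup_valP (k x)) subr0.
move=> Kx; have Cx : cs_set C' x by apply: generated_sub; right.
rewrite sub_homE /= -[x]/(\val (subgroup_sub Cx)) kE hE sub_homE /= subKr; exact: F'K.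
Qed.

(** The vanishing of Ext(Y, D). The projection p is only assumed to be open, so
    that the quotient may be an open subgroup of Y. *)
Definition extension_property (Y D : tabType) : Prop :=
  forall (G : tabType) (p : tophom G Y) (f : G -> D), lcg G -> open_hom p ->
    hom_on (Defs.kernel p) f -> exists F : tophom G D, forall x, p x = 0 -> F x = f x.

Section LiftExists.
Variables (D C X Y : tabType) (i : tophom D X) (q : tophom X Y) (f : tophom C Y).
Hypotheses (lC : lcg C) (lX : lcg X) (ext : extension_property C D) (oq : open_hom q).
Hypotheses (ii : injective i) (iq : forall x, q x = 0 -> exists y, i y = x) (qi : forall y, q (i y) = 0).
Hypothesis (oi : forall U, nbhs 0 U -> exists2 V, nbhs 0 V & forall y, V (i y) -> U y).
Hypothesis (qs : forall y, exists x, q x = y).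

Let E0 : set (pair_group C X) := [set e | f e.1 = q e.2].

Let sE : is_subgroup E0.
Proof.
split; first by rewrite /E0 /= !tophom0.
by move=> [c x] [d y] cx dy; rewrite /E0 /= !tophomB [f c]cx [f d]dy.
Qed.

Let clE : closed E0.
Proof.
pose h : tophom (pair_group C X) Y := hom_comp f (pair_fst C X) - hom_comp q (pair_snd C X).
have -> : E0 = Defs.kernel h.
  apply/seteqP; split=> e he.
    by change (f e.1 - q e.2 = 0); rewrite (he : f e.1 = q e.2) subrr.
  by apply/eqP; rewrite -subr_eq0; apply/eqP; exact: he.
exact: cs_closed.
Qed.

Let E := CSubgroup sE.1 sE.2 clE.
Let p : tophom (subgroup_type E) C := hom_comp (pair_fst C X) (sub_incl E).
Let r : tophom (subgroup_type E) X := hom_comp (pair_snd C X) (sub_incl E).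

Let frE e : f (p e) = q (r e). Proof. exact: (subgroup_valP e). Qed.

Let op : open_hom p.
Proof.
move=> U /sub_nbhs0P[B [[B1 B2] /= [B10 B20] BB] BU].
apply: filterS (filterI B10 (tophom_nbhs0 f (oq B20))) => c [/= B1c [x B2x xE]].
have Ecx : cs_set E (c, x) by rewrite /= /E0 /= xE.
by exists (subgroup_sub Ecx) => //; apply: BU; exact: BB.
Qed.

(** Pull the extension q back along f. An extension of the identity of D to the
    fibre product E splits it, and x - i (F e) is constant along the fibres of
    E over C. *)
Lemma hom_lift_exists : exists F : tophom C X, forall c, q (F c) = f c.
Proof.
have ex x : exists y, q x = 0 -> i y = x.
  have [/iq[y yx]|nx] := pselect (q x = 0); first by exists y.
  by exists 0.
have [j jP] := choice ex.
have jH : hom_on (Defs.kernel q) j.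
  split=> [x y qx qy|U /oi[V V0 VU]].
    by apply: ii; rewrite hom_add !jP//; rewrite hom_add [q x]qx [q y]qy addr0.
  by exists V => // x qx Vx; apply: VU; rewrite jP.
have jrH : hom_on (Defs.kernel p) (fun e => j (r e)).
  apply: (@hom_on_compose _ _ _ _ (Defs.kernel q) r j) => //; first exact: tophom_hom_on.
  by move=> e pe; change (q (r e) = 0); rewrite -frE [p e]pe tophom0.
have lE : lcg (subgroup_type E) by apply: sub_lcg; exact: pair_lcg.
have [F FE] := ext lE op jrH.
have kp e : p e = 0 -> (r - hom_comp i F) e = 0.
  move=> pe; rewrite sub_homE /= FE// jP ?subrr// -[LHS]frE pe tophom0 //.
have [g gp gE] := hom_factor op kp.
have pT : range p = setT.
  apply/seteqP; split=> // c _; have [x xE] := qs (f c).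
  have Ecx : cs_set E (c, x) by rewrite /= /E0 /= xE.
  by exists (subgroup_sub Ecx).
rewrite pT in gp; have [g' g'E] := hom_onT gp; exists g' => c.
have : range p c by rewrite pT.
move=> [e _ <-]; rewrite g'E gE sub_homE tophomB (_ : q (hom_comp i F e) = 0) ?subr0 ?frE//.
exact: qi.
Qed.

End LiftExists.

(** * Topological torsion groups *)

Section TopologicalTorsion.
Variable R : realType.
Local Notation circle := (circle R).
Local Notation dual A := (tophom A circle).

Lemma real_hom_linear (f : tophom R R) : exists c, forall t, f t = c * t.
Proof.
have B1 : nbhs (0 : R) [set t | `|t| < 1] by apply/nbhs0_real; exists 1.
have /nbhs0_real[d d0 dP] := tophom_nbhs0 f B1.
pose c := f (d / 2) / (d / 2); have d2 : 0 < d / 2 by lra.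
exists c => t; apply/eqP; rewrite -subr_eq0; apply/eqP.
pose g := f - scale_hom c.
have gd : g (d / 2) = 0 by rewrite sub_homE /= /c divfK ?gt_eqF// subrr.
have gB s : `|g s| <= 1 + `|c| * (d / 2).
  pose m := Num.floor (s / (d / 2)).
  have /andP[m1 m2] : m%:~R <= s / (d / 2) < (m + 1)%:~R by exact: floor_itv.
  pose u := s - d / 2 *~ m.
  have uE : u = s - m%:~R * (d / 2) by rewrite /u -mulrzl.
  have u0 : 0 <= u by rewrite uE subr_ge0 -ler_pdivlMr.
  have ud : u < d / 2 by move: m2; rewrite ltr_pdivrMr// intrD mulrDl mul1r uE; lra.
  have -> : g s = g u by rewrite /u tophomB tophomMz gd mul0rz subr0.
  rewrite sub_homE; apply: le_trans (ler_normB _ _) _; apply: lerD.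
    by apply/ltW/dP; rewrite ger0_norm//; lra.
  by rewrite /= normrM ler_wpM2l// ger0_norm// ltW.
rewrite -[LHS]/(g t); apply: (@eq0_bounded_multiples R _ (1 + `|c| * (d / 2))) => n.
by rewrite mulr_natr -tophomMn.
Qed.

(** R has no bounded subgroups. *)
Lemma compact_subgroup_real (X : tabType) (K : csubgroup X) (f : tophom X R) : compact K ->
  forall x, cs_set K x -> f x = 0.
Proof.
move=> cK x Kx; have [d _ dP] := hom_on_bounded (H := K) (tophom_hom_on K f) cK.
apply: (@eq0_bounded_multiples R _ d) => n; rewrite mulr_natr -tophomMn.
by apply: dP; exact: (subgroupMn _ (subgroup_cs K)).
Qed.

Section HalfE.

(** The integer k! (1 + 1 / 1! + ... + 1 / k!), which is odd for even k. *)
Fixpoint factsum (k : nat) : nat := if k is k'.+1 then (k'.+1 * factsum k' + 1)%N else 1%N.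

Let u k : R := (factsum k)%:R / (k`!)%:R.

Let fact0 k : 0 < (k`!)%:R :> R. Proof. by rewrite ltr0n fact_gt0. Qed.

Let factR k : (k.+1`!)%:R = k.+1%:R * (k`!)%:R :> R. Proof. by rewrite factS natrM. Qed.

Let uS k : u k.+1 = u k + 1 / (k.+1`!)%:R.
Proof.
rewrite /u /= natrD natrM factR mulrDl; congr (_ + _).
by field; rewrite ?gt_eqF// ltr0n.
Qed.

Let u_mono k n : u k <= u (k + n)%N.
Proof.
elim: n => [|n IHn]; first by rewrite addn0.
rewrite addnS uS; apply: le_trans IHn _; rewrite lerDl divr_ge0//.
Qed.

Let u_ub k n : u (k.+1 + n)%N + 1 / ((k.+1 + n)`!)%:R <= u k.+1 + 1 / (k.+1`!)%:R.
Proof.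
elim: n => [|n IHn]; first by rewrite addn0.
apply: le_trans IHn; rewrite addnS uS -addrA lerD2l.
set j := (k.+1 + n)%N; have j1 : (0 < j)%N by rewrite /j.
have j2 : 2 <= j.+1%:R :> R by rewrite (ler_nat _ 2).
have J0 := fact0 j; rewrite factR.
have -> : 1 / (j.+1%:R * j`!%:R) + 1 / (j.+1%:R * j`!%:R) = (2 / j.+1%:R) * (1 / j`!%:R) :> R.
  by field; rewrite !gt_eqF//; lra.
by apply: ler_piMl; [rewrite divr_ge0|rewrite ler_pdivrMr; lra].
Qed.

Let e := sup (range u).

Let ule j k : u j <= u k.+1 + 1 / (k.+1`!)%:R.
Proof.
have [jk|kj] := leqP j k.+1.
  have h := u_mono j (k.+1 - j); rewrite subnKC// in h.
  by apply: le_trans h _; rewrite lerDl divr_ge0.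
have h := u_ub k (j - k.+1); rewrite (subnKC (ltnW kj)) in h.
by apply: le_trans h; rewrite lerDl divr_ge0.
Qed.

Let e_lb k : u k <= e.
Proof.
apply: ub_le_sup; last by exists k.
by exists (u 1%N + 1 / (1`!)%:R) => _ [j _ <-]; exact: ule.
Qed.

Let e_ub k : e <= u k.+1 + 1 / (k.+1`!)%:R.
Proof. by apply: ge_sup; [exists (u 0%N), 0%N|move=> _ [j _ <-]; exact: ule]. Qed.

(** The multiple of e / 2 by k! is close to 1/2 modulo 1 for even k. *)
Lemma circle_not_torsion : exists t : R, ~ (fun k => cpi R t *+ k`!) @ \oo --> (0 : circle).
Proof.
exists (e / 2) => cv.
have [N _ NP] := cv _ (@cball_nbhs R (1 / 4) ltac:(lra)).
pose j := N.+2; pose k' := (N + N).+3; have kE : k'.+1 = (j * 2)%N by rewrite /j /k'; lia.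
have [/= t t4 tE] := NP k'.+1 ltac:(rewrite /k' /=; lia).
pose q := (j * factsum k')%N.
have fE : factsum k'.+1 = (2 * q + 1)%N.
  by rewrite -[factsum k'.+1]/(k'.+1 * factsum k' + 1)%N kE /q -mulnA mulnCA.
pose k := k'.+1.
pose f := (k`!)%:R : R; have f0 : 0 < f by exact: fact0.
pose th := (e - u k) * f / 2.
have k5 : 5 <= k.+1%:R :> R by rewrite (ler_nat _ 5) /k /k'; lia.
have i5 : k.+1%:R^-1 <= 1 / 5 :> R by rewrite -div1r ler_pdivrMr; lra.
have h1 : 1 / (k.+1`!)%:R * f = k.+1%:R^-1.
  by rewrite factR -/f; field; rewrite !gt_eqF// ltr0n.
have th0 : 0 <= th by have h : 0 <= e - u k; [rewrite subr_ge0 e_lb|rewrite /th; apply: divr_ge0 => //; apply: mulr_ge0 => //; exact: ltW].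
have th5 : th <= 1 / 5.
  have : (e - u k) * f <= (1 / (k.+1`!)%:R + 1 / (k.+1`!)%:R) * f.
    by rewrite ler_pM2r//; have := e_ub k; rewrite uS; lra.
  rewrite [X in _ <= X]mulrDl h1 => h2; rewrite /th ler_pdivrMr//; apply: le_trans h2 _.
  by rewrite (_ : 1 / 5 * 2 = 1 / 5 + 1 / 5); [exact: lerD|lra].
have eE : e / 2 *+ k`! = q%:R + (1 / 2 + th).
  rewrite -(mulr_natr (e / 2)) -/f.
  have uE : u k * f = (2 * q + 1)%:R by rewrite /u -/f fE divfK ?gt_eqF.
  rewrite natrD natrM in uE.
  by rewrite /th; lra.
move: tE; rewrite -tophomMn eE hom_add (_ : cpi R q%:R = 0) ?add0r; last exact: (cpi_int R q%:Z).
move: t4; rewrite ltr_norml => /andP[? ?] /cpi_inj.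
suff h : `|t - (1 / 2 + th)| < 1 by move=> /(_ h); lra.
by rewrite ltr_norml; apply/andP; split; lra.
Qed.

End HalfE.

(** The image of g under a character of T is trivial, since otherwise it would
    be the whole circle. *)
Lemma torsion_no_line (T : tabType) (g : tophom R T) : lcg T -> topological_torsion T ->
  forall t, g t = 0.
Proof.
move=> lT tT t0; apply: contrapT => gt0.
have [chi chig] := lcg_characters_separate R lT gt0.
have [a aE] := real_charE (hom_comp chi g).
have a0 : a != 0.
  by apply/eqP => a0; apply: chig; have /= -> := aE t0; rewrite a0 mul0r tophom0.
have [s ns] := circle_not_torsion; apply: ns => U /(tophom_nbhs0 chi)/(tT (g (s / a))).
rewrite /nbhs /=; apply: filterS => k /=; rewrite tophomMn.
by have /= -> := aE (s / a); rewrite mulrCA divff// mulr1.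
Qed.

(** In a compactly generated topological torsion group there is no discrete
    lattice, because the multiples of its points by k! tend to 0. *)
Lemma torsion_compact (T : tabType) (K : set T) : lcg T -> topological_torsion T -> compact K ->
  exists T0 : csubgroup T, compact T0 /\ K `<=` T0.
Proof.
move=> [V V0 cV] tT cK.
have W0 : nbhs 0 (V `|` K) by apply: filterS V0 => x; left.
have cW : compact (V `|` K) by exact: compactU.
exists (generated_cs W0); split; last by move=> x Kx; apply: generated_sub; right.
set T' := subgroup_type (generated_cs W0).
have [n [e [M [pe cM MP]]]] := cgen_decomposition (generated_cgen W0 cW) (subgroup0 T').
have [b bP] := pe _ (sub_compact (H := generated_cs W0) cV).
have n0 (i : 'I_n) : False.
  have [N _ NP] := tT (\val (e i)) V V0.
  pose k := (N + b).+1; have Vk : V (\val (e i) *+ k`!) by apply: NP; rewrite /k /=; lia.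
  have := bP (fun j => (j == i)%:Z * k`!%:Z) 0 erefl _ i.
  have -> : lin e (fun j => (j == i)%:Z * k`!%:Z) + 0 = e i *+ k`!.
    rewrite addr0 /lin (bigD1 i)//= eqxx mul1r big1 ?addr0// => j /negbTE ->.
    by rewrite mul0r mulr0z.
  rewrite eqxx mul1r /=.
  have -> : \val (e i *+ k`!) = \val (e i) *+ k`! by exact: (tophomMn (sub_incl _)).
  move=> /(_ Vk); apply/negP; rewrite -ltnNge; apply: leq_trans (fact_geq _).
  by rewrite /k; lia.
have -> : generated_cs W0 = sub_incl (generated_cs W0) @` M :> set T; last first.
  by apply: compact_image => //; exact: hom_cont.
apply/seteqP; split=> [x Gx|_ [x _ <-]]; last exact: subgroup_valP.
have [z [h [-> Mx]]] := MP (@subgroup_sub _ (generated_cs W0) _ Gx).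
exists (@subgroup_sub _ (generated_cs W0) _ Gx) => //.
move: Mx; rewrite /lin big1 ?subr0// => i _; case: (n0 i).
Qed.

Lemma compact_cover (X Z : tabType) (q : tophom X Z) (B : set Z) : lcg X -> open_hom q ->
  (forall z, exists x, q x = z) -> compact B ->
  exists2 C : set X, compact C & forall z, B z -> exists2 x, C x & q x = z.
Proof.
move=> [V V0 cV] oq qs cB.
pose Q (A : set Z) := exists2 C : set X, compact C & forall z, A z -> exists2 x, C x & q x = z.
suff : Q B by [].
apply: (compact_induction cB).
- by exists set0 => [|z []]; exact: compact0.
- move=> A A' [C cC CP] [C' cC' CP']; exists (C `|` C'); first exact: compactU.
  by move=> z [/CP[x Cx xz]|/CP'[x Cx xz]]; exists x => //; [left|right].
- by move=> A A' AA [C cC CP]; exists C => // z /AA/CP.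
- move=> z _; have [x xz] := qs z.
  exists [set z' | (q @` V) (z' - z)]; first by apply: nbhs_subr; rewrite subrr; exact: oq.
  exists (set_add [set x] V); first by apply: compact_add => //; exact: compact_set1.
  move=> z' [v Vv vE]; exists (x + v); first exact: set_addP.
  by rewrite hom_add xz vE addrC subrK.
Qed.

Lemma compact_preimage (X Z : tabType) (q : tophom X Z) (B : set Z) : lcg X -> open_hom q ->
  (forall z, exists x, q x = z) -> compact [set x | q x = 0] -> compact B -> compact (q @^-1` B).
Proof.
move=> lX oq qs ck cB; have [C cC CP] := compact_cover lX oq qs cB.
apply: (subclosed_compact _ (compact_add cC ck)).
  by move/continuous_closedP: (@hom_cont _ _ q); apply; apply: compact_closed => //; exact: hausdorffP.
move=> x /CP[c Cc cx]; exists c, (x - c); split=> //; last by rewrite addrC subrK.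
by rewrite /= tophomB cx subrr.
Qed.

Definition coord_hom m i : tophom (euclidean_group R m) R :=
  prod_proj (fun _ : 'I_m => R : topologicalZmodType) i.

Lemma euclid_nbhs0 m (U : set (euclidean_group R m)) : nbhs 0 U ->
  exists2 d : R, 0 < d & forall v, (forall i, `|v i| < d) -> U v.
Proof.
pose inj (i : 'I_m) : tophom R (euclidean_group R m) :=
  prod_lift (T := fun _ : 'I_m => R : topologicalZmodType) (fun j => if j == i then hom_id R else 0).
move=> U0; have [d d0 dP] := ev_small inj U0; exists d => // v vd.
suff <- : ev inj v = v by exact: dP.
apply: functional_extensionality_dep => j.
rewrite -[LHS]/(coord_hom j (ev inj v)) tophom_sum (bigD1 j)//= eqxx big1 ?addr0// => i ij.
by rewrite eq_sym (negbTE ij).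
Qed.

Section EuclidTorsion.
Variables (X T : tabType) (m : nat) (psi : tophom X (pair_group (euclidean_group R m) T)).
Hypotheses (lT : lcg T) (tT : topological_torsion T).

Definition real_coord i : tophom X R := hom_comp (coord_hom i) (hom_comp (pair_fst _ _) psi).
Definition torsion_part : tophom X T := hom_comp (pair_snd _ _) psi.

Lemma real_coord_part (rho : 'I_m -> tophom R X) (C : tabType) (l : 'I_m -> tophom C R) x i :
  (forall i j t, real_coord i (rho j t) = t * (i == j)%:R) ->
  real_coord i (real_part rho l x) = l i x.
Proof.
move=> rho1; transitivity (\sum_j l j x * (i == j)%:R).
  by rewrite real_partE tophom_sum; apply: eq_bigr => j _; exact: rho1.
rewrite (bigD1 i)//= eqxx mulr1 big1 ?addr0// => j.
by rewrite eq_sym => /negbTE ->; rewrite mulr0.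
Qed.

Lemma euclid_torsion_eq x y : (forall i, real_coord i x = real_coord i y) ->
  torsion_part x = torsion_part y -> psi x = psi y.
Proof.
move=> h1 h2; apply: injective_projections; last exact: h2.
by apply: functional_extensionality_dep => i; exact: h1.
Qed.

Lemma euclid_torsion_open (U : set X) : open_hom psi -> nbhs 0 U ->
  exists2 d : R, 0 < d & exists2 V, nbhs 0 V & forall (v : 'I_m -> R) t, (forall i, `|v i| < d) -> V t ->
    exists x, [/\ U x, forall i, real_coord i x = v i & torsion_part x = t].
Proof.
move=> opsi /opsi[[A B] /= [A0 B0] AB]; have [d d0 dA] := euclid_nbhs0 A0.
exists d => //; exists B => // v t vd Bt.
by have [|x Ux xE] := AB (v, t); [split=> //; exact: dA|exists x; split=> // [i|];
  rewrite /real_coord /torsion_part /= xE].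
Qed.

(** Apply the local structure of X: real coordinates vanish on its compact part
    K, and torsion parts vanish on its one-parameter groups. So the real
    coordinates of the latter span R^m, and K covers a neighbourhood of 0 in T.
    *)
Lemma euclid_torsion_lift : lcg X -> open_hom psi ->
  exists (rho : 'I_m -> tophom R X) (K : csubgroup X),
  [/\ forall i j t, real_coord i (rho j t) = t * (i == j)%:R, forall j t, torsion_part (rho j t) = 0,
      compact K, forall i x, cs_set K x -> real_coord i x = 0 &
      nbhs 0 [set t | exists2 x, cs_set K x & torsion_part x = t]].
Proof.
move=> lX opsi; have [k [g [L [cL _ sL]]]] := local_structure R lX (@filterT _ (nbhs (0 : X)) _).
have [d d0 [V V0 dV]] := euclid_torsion_open opsi (sL 1 ltr01).
have L0 i x : cs_set L x -> real_coord i x = 0 by exact: compact_subgroup_real.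
have g0 s t : torsion_part (g s t) = 0.
  exact: (torsion_no_line (hom_comp torsion_part (g s)) lT tT).
have ex j : exists w : 'I_k -> R, forall i, real_coord i (ev g w) = d / 2 * (i == j)%:R.
  have vd i : `|d / 2 * (i == j)%:R| < d.
    by case: (i == j); rewrite ?mulr1 ?mulr0 ?normr0// ger0_norm; lra.
  have [x [[w [l [_ Ll xE]]] x1 _]] := dV (fun i => d / 2 * (i == j)%:R) 0 vd (nbhs_singleton V0).
  by exists w => i; rewrite -[RHS](x1 i) (xE : x = ev g w + l) hom_add (L0 _ _ Ll) addr0.
have [w wP] := choice ex.
pose rho j := \sum_s hom_comp (g s) (scale_hom (2 / d * w j s)).
have rhoE j t : rho j t = ev g (fun s => 2 / d * w j s * t) by exact: sum_tophomE.
exists rho, L; split=> //.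
- move=> i j t; have [c cE] := choice (fun s => real_hom_linear (hom_comp (real_coord i) (g s))).
  have evE v : real_coord i (ev g v) = \sum_s c s * v s.
    by rewrite tophom_sum; apply: eq_bigr => s _; exact: cE.
  rewrite rhoE evE; have := wP j i; rewrite evE => E.
  have -> : \sum_s c s * (2 / d * w j s * t) = 2 / d * t * \sum_s c s * w j s.
    by rewrite mulr_sumr; apply: eq_bigr => s _; ring.
  by rewrite E; field; rewrite gt_eqF.
- by move=> j t; rewrite rhoE tophom_sum big1.
- apply: filterS V0 => t Vt.
  have [|x [[v [l [_ Ll xE]]] _ xt]] := dV (fun=> 0) t _ Vt; first by move=> i; rewrite normr0.
  exists l => //; rewrite -[RHS]xt (xE : x = ev g v + l) hom_add.
  by rewrite [torsion_part (ev g v)]tophom_sum big1 ?add0r.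
Qed.

End EuclidTorsion.

End TopologicalTorsion.

(** * Vanishing of extensions *)

Lemma lcab_lcg (A : lcabType) : lcg A.
Proof.
have [U] := @locally_compactP A 0 I; rewrite withinET => U0 [cU _].
by exists U.
Qed.

Section Vanishing.
Variable R : realType.

Section ChainMap.
Variables (A : lcabType) (S F : csubgroup A).
Hypothesis chain : canonical_chain R S F.

Lemma chain_open : nbhs 0 (cs_set F).
Proof.
have [_ _ [dF _] _] := chain.
have -> : cs_set F = quot_map F @^-1` [set 0].
  by apply/seteqP; split=> x /quot_map0.
have o0 : open [set 0 : quotient_group F] by exact: dF.
by apply: tophom_nbhs0; exact: open_nbhs_nbhs.
Qed.

(** By definition of the chain, F maps onto R^m x T with kernel S. *)
Lemma chain_map : exists (m : nat) (T : lcabType)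
    (psi : tophom (subgroup_type F) (pair_group (euclidean_group R m) T)),
  [/\ topological_torsion T, open_hom psi, forall z, exists x, psi x = z &
      forall x, psi x = 0 <-> cs_set S (\val x)].
Proof.
have [_ _ _ [m [T [tT [phi]]]]] := chain.
exists m, T, (hom_comp phi (quot_map (Defs.restrict S F))); split=> //.
- move=> U /(quot_map_nbhs0 (Defs.restrict S F))/(tophom_nbhs0 (iso_inv phi)).
  by apply: filterS => z [x Ux xz]; exists x => //=; rewrite [quot_pi _ _]xz iso_invK.
- move=> z; have [x xz] := quot_map_onto (iso_inv phi z).
  by exists x; rewrite -[LHS]/(phi (quot_map _ x)) xz iso_invK.
- move=> x; rewrite -[hom_comp _ _ x]/(phi (quot_map _ x)); split=> [px|Sx].
    have := congr1 (iso_inv phi) px; rewrite iso_homK tophom0.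
    by move=> /(quot_map0 (Defs.restrict S F)).
  by rewrite (_ : quot_map _ x = 0) ?tophom0//; apply/quot_map0.
Qed.

End ChainMap.

(** The real coordinates of f extend and are subtracted. What is left maps the
    compactly generated group H into the preimage of a compact subgroup of T,
    which is compact. *)
Lemma extension_compactly_generated (G X : tabType) (T : tabType) m (H : csubgroup G)
    (psi : tophom X (pair_group (euclidean_group R m) T)) (f : G -> X) :
  cgen G -> codivisible_mod R H -> lcg X -> lcg T -> topological_torsion T -> open_hom psi ->
  (forall z, exists x, psi x = z) -> compact [set x | psi x = 0] -> hom_on H f ->
  exists F : tophom G X, forall x, cs_set H x -> F x = f x.
Proof.
move=> gG dH lX lT tT opsi psis ck fH.
have lG : lcg G by have [W [W0 cW _]] := gG; exists W.
have [rho [_ [rho1 rho2 _ _ _]]] := euclid_torsion_lift lT tT lX opsi.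
have ex i : exists l : tophom G R, forall x, cs_set H x -> l x = real_coord psi i (f x).
  have [K _ KP] := real_hom_extension R H gG (@compact0 G).
  by have [l lE _] := KP _ (hom_on_comp (real_coord psi i) fH); exists l.
have [l lE] := choice ex.
pose f1 x := f x - real_part rho l x.
have f1H : hom_on H f1 by apply: hom_on_sub => //; exact: tophom_hom_on.
have f1c i x : cs_set H x -> real_coord psi i (f1 x) = 0.
  by move=> Hx; rewrite tophomB real_coord_part// lE// subrr.
have [f2 f2E] := hom_on_restrict f1H.
have [V [V0 cV VG]] := sub_cgen H gG.
have cTV : compact ((hom_comp (torsion_part psi) f2) @` V) by apply: compact_image => //; exact: hom_cont.
have [T0 [cT0 T0V]] := torsion_compact lT tT cTV.
pose B : set (pair_group (euclidean_group R m) T) := [set z | z.1 = 0 /\ cs_set T0 z.2].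
have cB : compact B.
  have -> : B = pair_inr (euclidean_group R m) T @` T0.
    by apply/seteqP; split=> [[a b] [/= -> Tb]|_ [b Tb <-]]; first exists b.
  by apply: compact_image => //; exact: hom_cont.
have cL := compact_preimage lX opsi psis ck cB.
have sL : is_subgroup (psi @^-1` B).
  split; first by rewrite /= tophom0; split=> //; exact: cs0.
  move=> x y [x1 x2] [y1 y2]; rewrite /= tophomB; split; last exact: csB.
  by rewrite -[LHS]/((psi x).1 - (psi y).1) x1 y1 subrr.
have clL : closed (psi @^-1` B) by apply: compact_closed => //; exact: hausdorffP.
pose L := CSubgroup sL.1 sL.2 clL.
have f1L x : cs_set H x -> cs_set L (f1 x).
  move=> Hx; rewrite -[x]/(\val (subgroup_sub Hx)) -f2E.
  apply: (VG [set x | cs_set L (f2 x)]).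
    split; first by rewrite /= tophom0; exact: (cs0 L).
    by move=> y z Ly Lz; rewrite /= tophomB; exact: (csB (c := L)).
  move=> y Vy; split; last by apply: T0V; exists y.
  apply: functional_extensionality_dep => i; rewrite f2E.
  exact: f1c (subgroup_valP y).
have [f3 f3H f3E] := hom_corestrict (subgroup_cs H) f1H f1L.
have [F FE] := compact_hom_extension lG (cs_compact (L := L) cL) dH f3H.
exists (real_part rho l + hom_comp (sub_incl L) F) => x Hx.
by rewrite add_homE /= FE// f3E// /f1 addrC subrK.
Qed.

Lemma extension_Z_part (Y : tabType) (D : lcabType) : codivisible R Y -> divisible D ->
  Z_part_zero R D -> extension_property Y D.
Proof.
move=> dY dD [S [F [chain F0]]] G p f [V V0 cV] op fH.
have FT x : cs_set F x by apply/quot_map0; exact: F0.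
have [m [T [psi [tT opsi psis psiS]]]] := chain_map chain.
have ck : compact [set x | psi x = 0].
  rewrite (_ : mkset _ = [set x | cs_set S (\val x)]).
    by apply: sub_compact; have [_ [cS _] _ _] := chain.
  by apply/seteqP; split=> x /= /psiS.
have [f1 f1H f1E] := hom_corestrict (subgroup_cs _) fH (fun x _ => FT (f x)).
set G' := generated_cs V0.
have f1'H : hom_on (Defs.kernel (hom_comp p (sub_incl G'))) (fun x => f1 (sub_incl G' x)).
  by apply: (@hom_on_compose _ _ _ _ (Defs.kernel p) (sub_incl G') f1) => //; exact: tophom_hom_on.
have [F1 F1E] := extension_compactly_generated (generated_cgen V0 cV)
  (@codivisible_mod_generated R G Y p op dY _ V0) (sub_lcg F (lcab_lcg D)) (lcab_lcg T) tT opsi psis ck f1'H.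
have [|F2 [F2E _]] := @extension_from_generated G Y p V V0 D f (hom_comp (sub_incl F) F1) dD fH.
  by move=> x px; rewrite -[LHS]/(\val (F1 x)) F1E// f1E.
by exists F2.
Qed.

Section SectionOpen.
Variables (Y : lcabType) (D G : tabType) (p : tophom G Y) (f : G -> D).
Hypotheses (dY : codivisible R Y) (dD : divisible D) (lG : lcg G) (op : open_hom p).
Hypothesis fH : hom_on (Defs.kernel p) f.
Variables (S F : csubgroup Y).
Hypotheses (chain : canonical_chain R S F) (S0 : S = [set 0] :> set Y).

Let Xs : set G := p @^-1` F.
Let sX : is_subgroup Xs.
Proof.
split; first by rewrite /Xs /= tophom0; exact: cs0.
by move=> x y Fx Fy; rewrite /Xs /= tophomB; exact: csB.
Qed.
Let X0 : nbhs 0 Xs. Proof. by apply: tophom_nbhs0; exact: chain_open chain. Qed.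
Let X := CSubgroup sX.1 sX.2 (open_subgroup_closed sX X0).

(** Over the open subgroup F of Y, which is a product of R^m and a topological
    torsion group, p has a section on a neighbourhood R^m x T0 of 0: the
    one-parameter groups rho lift R^m, and the compact subgroup K maps onto T0.
    If u x is x minus its part along rho, then u x minus the section at p (u x)
    lies in the kernel of p, and f of it extends f to an open subgroup. *)
Lemma extension_S1_aux : exists E : tophom G D, forall x, p x = 0 -> E x = f x.
Proof.
have [m [T [psi0 [tT opsi0 psis psiS]]]] := chain_map chain.
have lT := lcab_lcg T.
have [pX pXE] := @corestrict_tophom (subgroup_type X) Y F (hom_comp p (sub_incl X)) (fun x => subgroup_valP x).
have opX : open_hom pX.
  move=> U /sub_nbhs0P[B B0 BU].
  apply: filterS (sub_nbhs0 F (op B0)) => y [b Bb by_].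
  have Xb : cs_set X b by change (cs_set F (p b)); rewrite by_; exact: subgroup_valP.
  exists (subgroup_sub Xb); first exact: BU.
  by apply: val_inj; rewrite pXE.
pose psi := hom_comp psi0 pX.
have opsi : open_hom psi.
  move=> U U0; have -> : psi @` U = psi0 @` (pX @` U).
    by apply/seteqP; split=> [_ [x Ux <-]|_ [_ [x Ux <-] <-]]; [exists (pX x) => //; exists x|exists x].
  by apply: opsi0; exact: opX.
have psiK x y : psi x = psi y -> p (\val x) = p (\val y).
  move=> xy; apply/eqP; rewrite -subr_eq0 -tophomB; apply/eqP.
  have : psi0 (pX (x - y)) = 0 by rewrite -[LHS]/(psi (x - y)) tophomB xy subrr.
  by move=> /psiS; rewrite S0 pXE.
have lX : lcg (subgroup_type X) by exact: sub_lcg.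
have [rho [K [rho1 rho2 cK K1 K2]]] := euclid_torsion_lift lT tT lX opsi.
pose u := hom_id _ - real_part rho (real_coord psi).
have u1 i x : real_coord psi i (u x) = 0.
  by rewrite sub_homE tophomB real_coord_part// subrr.
have u2 x : torsion_part psi (u x) = torsion_part psi x.
  by rewrite sub_homE tophomB real_partE tophom_sum big1 ?subr0// => j _; rewrite rho2.
pose iK : tophom (subgroup_type K) Y := hom_comp p (hom_comp (sub_incl X) (sub_incl K)).
have cKs := cs_compact cK.
have clI : closed (range iK).
  by apply: compact_closed; [exact: hausdorffP|apply: compact_image => //; exact: hom_cont].
have sI := range_subgroup iK.
pose P := CSubgroup sI.1 sI.2 clI.
have [|sg sgE] := @compact_hom_lift R (subgroup_type P) (subgroup_type K) Y iK (sub_incl P)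
    (codivisible_sub (H := P) (lcab_lcg Y) dY) cKs.
  by move=> c; have [k _ kE] := subgroup_valP c; exists k.
pose pu := hom_comp p (hom_comp (sub_incl X) u).
pose O0 : set (subgroup_type X) := pu @^-1` P.
have sO : is_subgroup O0.
  split; first by change (cs_set P (pu 0)); rewrite tophom0; exact: cs0.
  by move=> x y Px Py; change (cs_set P (pu (x - y))); rewrite tophomB; exact: csB.
have O00 : nbhs 0 O0.
  apply: filterS (tophom_nbhs0 (torsion_part psi) K2) => x [k Kk kx].
  exists (subgroup_sub Kk) => //; apply: psiK; apply: euclid_torsion_eq => [i|].
    by rewrite u1 K1.
  by rewrite u2 -kx.
have [c cO cE] := hom_corestrict sO (tophom_hom_on O0 pu) (fun x Ox => Ox : cs_set P (pu x)).
pose w x := \val (u x) - \val (\val (sg (c x))).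
have wO : hom_on O0 w.
  apply: hom_on_sub; first exact: (tophom_hom_on O0 (hom_comp (sub_incl X) u)).
  exact: (hom_on_comp (hom_comp (sub_incl X) (hom_comp (sub_incl K) sg)) cO).
have wK x : O0 x -> cs_set (Defs.kernel p) (w x).
  move=> Ox; change (p (w x) = 0); rewrite /w tophomB.
  by rewrite [p (\val (\val _))]sgE [sub_incl P _]cE// subrr.
have sk : is_subgroup (Defs.kernel (hom_comp p (sub_incl X))) by exact: subgroup_cs.
have fXD : additive_on (Defs.kernel (hom_comp p (sub_incl X))) (fun x => f (\val x)).
  by move=> x y px py; apply: fH.1.
have [|E1 [_ E1E]] := hom_glue dD sO sk O00 (hom_on_compose wO wK fH) fXD.
  move=> x Ox px.
  have psix : psi x = 0 by rewrite -(tophom0 psi); rewrite /psi /= (_ : pX x = 0) ?tophom0//; apply: val_inj; rewrite pXE.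
  have ux : u x = x.
    rewrite sub_homE real_partE /ev big1 ?subr0// => i _.
    by rewrite (_ : real_coord psi i x = 0) ?tophom0// /real_coord /= [psi0 (pX x)]psix.
  have c0 : c x = 0.
    by apply: val_inj; rewrite cE//; change (p (\val (u x)) = 0); rewrite ux; exact: px.
  by rewrite /w ux c0 tophom0 subr0.
have [E EE] := hom_extend_open (H := X) E1 dD X0.
exists E => x px; have Xx : cs_set X x by change (cs_set F (p x)); rewrite px; exact: cs0.
by rewrite -[x]/(\val (@subgroup_sub _ X _ Xx)) EE E1E.
Qed.

End SectionOpen.

Lemma extension_S1_part (Y : lcabType) (D : tabType) : codivisible R Y -> divisible D ->
  S1_part_zero R Y -> extension_property Y D.
Proof. by move=> dY dD [S [F [chain S0]]] G p f lG op fH; exact: extension_S1_aux chain S0. Qed.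

End Vanishing.

(** * The adeles *)

Lemma filter_finite_all (X : Type) (I : eqType) (F : set_system X) (D : set I) (P : I -> set X) :
  Filter F -> finite_set D -> (forall i, D i -> F (P i)) -> F [set x | forall i, D i -> P i x].
Proof.
move=> FF /finite_seqP[s ->]; elim: s => [|i s IHs] FP.
  by apply: filterS filterT => x _ i.
have h1 : F (P i) by apply: FP; rewrite /= mem_head.
have h2 : F [set x | forall j, [set` s] j -> P j x].
  by apply: IHs => j js; apply: FP; rewrite /= in_cons [_ \in s]js orbT.
apply: filterS (filterI h1 h2) => x [Px Ps] j; rewrite /= in_cons => /predU1P[->//|]; exact: Ps.
Qed.

Section RestrictedProductCompact.
Variables (I : eqType) (G : I -> tabType) (H : forall i, osubgroup (G i)).
Hypothesis cH : forall i, compact (os_set (H i)).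
Local Notation P := (restricted_product H).

(** The topology of the box is that of the product of the H i, to which the
    theorem of Tychonoff applies. *)
Lemma restr_box_compact : compact (restr_box (fun i => os_set (H i)) : set P).
Proof.
move=> F FF FB.
pose F' : set_system (prod_group G) := [set A | F [set x : P | A (restr_val x)]].
have FF' : ProperFilter F' by exact: fmap_proper_filter.
have cB := @tychonoff I G (fun i => os_set (H i)) cH.
have [f [fH clf]] := cB F' FF' FB.
have fP : restricted_set H f.
  apply: (@sub_finite_set _ _ set0); last exact: finite_set0.
  by move=> i /= nH; apply: nH; exact: fH.
exists (restr_mk fP); split=> // A B FA /restr_nbhsP[V [[oV fV] Vf VB]].
have FA' : F' [set y | exists2 x : P, A x /\ restr_box (fun i => os_set (H i)) x & restr_val x = y].
  by apply: (@filterS _ F _ _ _ _ (filterI FA FB)) => x [Ax Bx]; exists x.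
have fN : nbhs (f : prod_group G) [set y | forall i, V i <> H i :> set _ -> V i (y i)].
  apply: (@filter_finite_all _ _ _ _ (fun i (y : prod_group G) => V i (y i)) (nbhs_filter (f : prod_group G)) fV) => i _; apply: (@prod_proj_continuous _ G i f).
  by apply: open_nbhs_nbhs; split; [exact: oV|exact: Vf].
have [_ [[x [Ax Bx] <-] Vx]] := clf _ _ FA' fN.
exists x; split=> //; apply: VB => i.
by have [VH|VH] := pselect (V i = H i :> set _); [rewrite VH; exact: Bx|exact: Vx].
Qed.

Lemma restricted_product_lcg : lcg P.
Proof.
exists (restr_box (fun i => os_set (H i))); last exact: restr_box_compact.
apply/restr_nbhsP; exists (fun i => os_set (H i)); split=> // [|i]; last exact: os0.
split=> [i|]; first exact: os_open.
rewrite (_ : mkset _ = set0); first exact: finite_set0.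
by apply/seteqP; split=> i //= /(_ erefl).
Qed.

End RestrictedProductCompact.

Section PadicCompact.
Variable p : {p : nat | prime p}.
Let pr_p : prime (\val p) := valP p.
Local Notation pv := (\val p : nat).

Definition padic_coord k : tophom (padic p) (quotient_group (padic_ball p k)) :=
  hom_comp (prod_proj (fun k => quotient_group (padic_ball p k)) k) (sub_incl (padic_subgroup p)).

Lemma padic_ext (x y : padic p) : (forall k, padic_coord k x = padic_coord k y) -> x = y.
Proof. by move=> xy; apply: val_inj; apply: functional_extensionality_dep. Qed.

Lemma padic_coordW (x : padic p) j k q : (j <= k)%N -> quot_map (padic_ball p k) q = padic_coord k x ->
  quot_map (padic_ball p j) q = padic_coord j x.
Proof.
move=> /subnKC <-; elim: (k - j)%N q => [|d IHd] q; first by rewrite addn0.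
rewrite addnS => qE.
have /padic_setP/(_ (j + d)%N)[r r1 r0] := subgroup_valP x.
apply: IHd; rewrite -[RHS]r0; apply/quot_piP; apply: padic_ballS.
by apply/quot_piP; rewrite -[LHS]/(quot_map _ q) qE.
Qed.

(** The denominator b is invertible modulo p^k, with inverse u. *)
Lemma padic_ball_approx k (q : rational_group) : cs_set (padic_ball p 0) q ->
  exists2 j : nat, (j < pv ^ k)%N & cs_set (padic_ball p k) (q - j%:R : rat).
Proof.
move=> [a [b [pb ->]]]; rewrite expn0 mul1r.
have pk0 : (0 < pv ^ k)%N by rewrite expn_gt0 prime_gt0.
have cop : coprime b (pv ^ k) by rewrite coprime_sym; apply: coprimeXl; rewrite prime_coprime.
have [u [v uv]] := Bezoutz b (pv ^ k)%N.
have {}uv : u * b + v * (pv ^ k)%N = 1 by rewrite uv /gcdz /= (eqP cop).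
pose j := absz ((a * u) %% (pv ^ k)%N)%Z.
have pkz : (pv ^ k)%N%:Z != 0 by rewrite eqz_nat -lt0n.
have jE : j%:Z = ((a * u) %% (pv ^ k)%N)%Z by rewrite /j gez0_abs// modz_ge0.
have jdiv := divz_eq (a * u) (pv ^ k)%N; rewrite -jE in jdiv.
exists j.
  by rewrite -ltz_nat jE; have := ltz_pmod (a * u) (d := (pv ^ k)%N); rewrite ltz_nat; apply.
set d := divz _ _ in jdiv.
exists (a * v + d * b%:Z), b; split=> //.
have bR : b%:R != 0 :> rat.
  by apply: contraNneq pb => /eqP; rewrite pnatr_eq0 => /eqP ->; rewrite dvdn0.
have E : a - j%:Z * b%:Z = (pv ^ k)%N%:Z * (a * v + d * b%:Z).
  have -> : j%:Z = a * u - d * (pv ^ k)%N by rewrite jdiv addrAC subrr add0r.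
  by transitivity (a * (u * b + v * (pv ^ k)%N) - (a * u - d * (pv ^ k)%N) * b); [rewrite uv mulr1|ring].
have := congr1 (fun z : int => z%:~R : rat) E; rewrite /= rmorphB !rmorphM /= => E'.
rewrite mulrA -[(pv ^ k)%:R * _]E'.
by field.
Qed.

Lemma padic_int_compact : compact (padic_int_set (p := p)).
Proof.
pose A k : set (quotient_group (padic_ball p k)) :=
  [set quot_map (padic_ball p k) (j%:R : rat) | j in `I_(pv ^ k)].
have cA k : compact (A k) by exact: compact_finite_image.
have cT := @tychonoff nat (fun k => quotient_group (padic_ball p k)) A cA.
have cP := sub_compact (H := padic_subgroup p) cT.
apply: (subclosed_compact _ cP).
  apply: (open_subgroup_closed (H := padic_int_set (p := p))).
    by split; [exact: padic_int0|exact: padic_intB].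
  by apply: open_nbhs_nbhs; split; [exact: padic_int_open|exact: padic_int0].
move=> x x0 k; have [q qE] := quot_map_onto (padic_coord k x).
have q0 : cs_set (padic_ball p 0) q.
  by apply/quot_map0; rewrite (padic_coordW (leq0n k) qE); exact: x0.
have [j jk jq] := padic_ball_approx k q0.
exists j => //; rewrite -[RHS]qE; apply/esym/quot_piP; exact: jq.
Qed.

End PadicCompact.

Lemma finite_adele_lcg : lcg finite_adele.
Proof. by apply: restricted_product_lcg => p; exact: padic_int_compact. Qed.

Lemma adele_lcg (R : realType) : lcg (adele R).
Proof.
apply: pair_lcg; last exact: finite_adele_lcg.
exists `[-1, 1]%classic; last exact: segment_compact.
apply/nbhs0_real; exists 1 => // t t1.
by rewrite /= in_itv /= -ler_norml ltW.
Qed.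

Section PadicDivision.
Variables (p : {p : nat | prime p}) (n : nat).
Hypothesis n0 : (0 < n)%N.
Let pr_p : prime (\val p) := valP p.
Local Notation pv := (\val p : nat).
Local Notation v := (logn pv n).

Let nR : n%:R != 0 :> rat. Proof. by rewrite pnatr_eq0 -lt0n. Qed.

(** The exponent of p in n is lost in the division; it is the reason for the
    shift by [logn p n] in the definition of the division of p-adic numbers. *)
Lemma padic_ball_div k (q : rat) : padic_ball_set pv (k + v) q -> padic_ball_set pv k (q / n%:R).
Proof.
move=> [a [b [pb ->]]].
have [n' pn' nE] := pfactor_coprime pr_p n0.
exists a, (b * n')%N; split.
  by rewrite Euclid_dvdM// negb_or pb -prime_coprime.
have bR : b%:R != 0 :> rat.
  by apply: contraNneq pb => /eqP; rewrite pnatr_eq0 => /eqP ->; rewrite dvdn0.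
have nE' : n%:R = n'%:R * (pv ^ v)%:R :> rat by rewrite {1}nE natrM.
have := nR; rewrite nE' mulf_eq0 negb_or => /andP[n'R pvR].
rewrite expnD !natrM; field; rewrite n'R bR pvR //.
Qed.

Definition quot_div_fun k (x : quotient_group (padic_ball p (k + v))) : quotient_group (padic_ball p k) :=
  quot_map (padic_ball p k) ((quot_repr x : rat) / n%:R : rat).

Lemma quot_div_funE k (q : rational_group) :
  quot_div_fun (quot_map (padic_ball p (k + v)) q) = quot_map (padic_ball p k) ((q : rat) / n%:R : rat).
Proof.
apply/quot_piP; have := padic_ball_div (@quot_repr_pi _ (padic_ball p (k + v)) q).
by rewrite mulrBl.
Qed.

Fact quot_div_cont k : continuous (@quot_div_fun k).
Proof.
move=> x U /nbhs_singleton Ux; apply: filterS (_ : nbhs x [set x]); first by move=> _ ->.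
by apply: open_nbhs_nbhs; split=> //; exact: quot_discrete.
Qed.

Fact quot_div_add k : {morph @quot_div_fun k : x y / x + y}.
Proof.
move=> x y; have [q <-] := quot_map_onto x; have [r <-] := quot_map_onto y.
by rewrite -hom_add !quot_div_funE -hom_add; congr (quot_map _ _); exact: mulrDl.
Qed.

Definition quot_div k := TopHom (@quot_div_cont k) (@quot_div_add k).

Lemma padic_div_exists : exists f : tophom (padic p) (padic p),
  forall k x, padic_coord p k (f x) = quot_div k (padic_coord p (k + v) x).
Proof.
have [|f fE] := @corestrict_tophom (padic p) (padic_tower p) (padic_subgroup p)
    (prod_lift (T := fun k => quotient_group (padic_ball p k))
      (fun k => hom_comp (quot_div k) (padic_coord p (k + v)))).
  move=> x; apply/padic_setP => k.
  have [q qE] := quot_map_onto (padic_coord p (k.+1 + v) x).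
  have qE' := @padic_coordW p x (k + v) (k.+1 + v) q ltac:(by rewrite leq_add2r) qE.
  exists ((q : rat) / n%:R : rat).
    by rewrite -[LHS]quot_div_funE qE.
  by rewrite -[LHS]quot_div_funE qE'.
by exists f => k x; rewrite -[LHS]/((\val (f x) : padic_tower p) k) fE.
Qed.

Definition padic_div : tophom (padic p) (padic p) := sval (cid padic_div_exists).

Lemma padic_divE k x : padic_coord p k (padic_div x) = quot_div k (padic_coord p (k + v) x).
Proof. by rewrite /padic_div; case: cid. Qed.

Lemma padic_divK x : padic_div x *+ n = x.
Proof.
apply: padic_ext => k; rewrite tophomMn padic_divE.
have [q qE] := quot_map_onto (padic_coord p (k + v) x).
rewrite -(padic_coordW (leq_addr v k) qE) -qE [quot_div k _]quot_div_funE -tophomMn.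
congr (quot_map _ _).
by rewrite -[LHS]mulr_natr divfK.
Qed.

Lemma padic_div_rat (q : rat) : padic_div (padic_of_rat p q) = padic_of_rat p (q / n%:R).
Proof.
apply: padic_ext => k; rewrite padic_divE.
by rewrite -[padic_coord p (k + v) _]/(quot_map _ (q : rational_group)) /= quot_div_funE.
Qed.

Lemma padic_div_int x : ~~ (pv %| n)%N -> padic_int_set x -> padic_int_set (padic_div x).
Proof.
move=> pn x0; have v0 : v = 0%N by apply/eqP; rewrite lognE pr_p n0 /= (negbTE pn).
change (padic_coord p 0 (padic_div x) = 0); rewrite padic_divE.
have [q qE] := quot_map_onto (padic_coord p (0 + v) x).
have : cs_set (padic_ball p 0) q.
  by apply/quot_map0; rewrite (padic_coordW (leq0n _) qE); exact: x0.
rewrite -qE /= quot_div_funE => q0; apply/quot_map0; apply: padic_ball_div.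
by rewrite v0.
Qed.

End PadicDivision.

Section AdeleDivision.
Variables (R : realType) (n : nat).
Hypothesis n0 : (0 < n)%N.
Local Notation primes := {p : nat | prime p}.

Let finite_dvd : finite_set [set p : primes | (\val p %| n)%N].
Proof.
apply: (@sub_finite_set _ _ (val @^-1` `I_n.+1)).
  by move=> p /= pn; rewrite ltnS; exact: dvdn_leq.
apply: finite_preimage; last exact: finite_II.
by move=> x y _ _; exact: val_inj.
Qed.

Fact fadele_divP (x : finite_adele) : restricted_set padic_int (fun p => padic_div p n0 (restr_val x p)).
Proof.
apply: (@sub_finite_set _ _ ([set p | ~ os_set (padic_int p) (restr_val x p)] `|`
                             [set p : primes | (\val p %| n)%N])).
  move=> p /= nint; apply: contrapT => /not_orP[/contrapT xp /negP pn].
  by apply: nint; exact: padic_div_int.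
by rewrite finite_setU; split=> //; exact: restr_valP.
Qed.

Definition fadele_div_fun (x : finite_adele) : finite_adele := restr_mk (fadele_divP x).

Fact fadele_div_add : {morph fadele_div_fun : x y / x + y}.
Proof.
move=> x y; apply: val_inj; apply: functional_extensionality_dep => p.
exact: (hom_add (padic_div p n0) (restr_val x p) (restr_val y p)).
Qed.

Fact fadele_div_cont : continuous fadele_div_fun.
Proof.
apply: (additive_continuous fadele_div_add) => U /restr_nbhsP[V [[oV fV] V0 VU]].
pose W p : set (padic p) := if pselect (V p = padic_int p :> set _ /\ ~~ (\val p %| n)%N)
  then os_set (padic_int p) else padic_div p n0 @^-1` V p.
apply/restr_nbhsP; exists W; split=> [||x Wx].
- split=> [p|].
    rewrite /W; case: pselect => /= _; first exact: padic_int_open.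
    by apply: open_comp => [x _|]; [exact: hom_cont|exact: oV].
  apply: (@sub_finite_set _ _ ([set p | V p <> padic_int p :> set _] `|`
                               [set p : primes | (\val p %| n)%N])).
    move=> p /= nW; apply: contrapT => /not_orP[/contrapT VH /negP pn].
    by apply: nW; rewrite /W; case: pselect => // -[].
  by rewrite finite_setU.
- move=> p; rewrite /W; case: pselect => /= _; first exact: padic_int0.
  by change (V p (padic_div p n0 0)); rewrite tophom0; exact: V0.
- apply: VU => p; have := Wx p; rewrite /W; case: pselect => /= [[-> pn]|_]; last exact.
  exact: padic_div_int.
Qed.

Definition fadele_div := TopHom fadele_div_cont fadele_div_add.

(** Division by n is continuous on each completion, and it preserves the p-adic
    integers for all p that do not divide n. *)
Lemma adele_div : exists2 f : tophom (adele R) (adele R), forall x, f x *+ n = x &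
  forall q : rat, f (Defs.diagonal R q) = Defs.diagonal R (q / n%:R : rat).
Proof.
pose f : tophom (adele R) (adele R) :=
  hom_comp (pair_inl R finite_adele) (hom_comp (scale_hom n%:R^-1) (pair_fst R finite_adele)) +
  hom_comp (pair_inr R finite_adele) (hom_comp fadele_div (pair_snd R finite_adele)).
have fE x : f x = (n%:R^-1 * x.1, fadele_div x.2).
  rewrite add_homE /= /GRing.add /= /add_pair /=; congr pair; first by rewrite addr0.
  by rewrite add0r.
have nR : n%:R != 0 :> R by rewrite pnatr_eq0 -lt0n.
exists f => [x|q].
  apply: injective_projections.
    rewrite -[LHS]/(pair_fst R finite_adele (f x *+ n)) tophomMn fE.
    change (n%:R^-1 * x.1 *+ n = x.1).
    by rewrite -(mulr_natr (_ * x.1)) mulrAC mulVf// mul1r.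
  rewrite -[LHS]/(pair_snd R finite_adele (f x *+ n)) tophomMn fE /=.
  apply: val_inj; apply: functional_extensionality_dep => p.
  transitivity (restr_val (fadele_div_fun x.2) p *+ n); last exact: padic_divK.
  by elim: (n) => [|m IHm]; rewrite ?mulr0n// !mulrS -IHm.
rewrite fE; apply: injective_projections => /=.
  by rewrite rmorphM /= fmorphV /= ratr_nat mulrC.
apply: val_inj; apply: functional_extensionality_dep => p.
exact: padic_div_rat.
Qed.

End AdeleDivision.

Lemma rational_divisible : divisible rational_group.
Proof.
move=> n n0 q; exists ((q : rat) / n%:R : rat).
by rewrite -[LHS]mulr_natr divfK// pnatr_eq0 -lt0n.
Qed.

(** Division by n on the adeles induces an automorphism of the quotient, which
    divides characters by composition. *)
Lemma adele_class_codivisible (R : realType) : codivisible R (adele_class_group R).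
Proof.
move=> n n0 chi; have [f fn fq] := adele_div R n0.
pose q := quot_map (diagonal_subgroup R).
have [|g gR gE] := @hom_factor _ _ _ q (hom_comp chi (hom_comp q f)) (@open_quot_map _ _).
  move=> x /quot_map0[r _ <-]; rewrite /= fq.
  rewrite (_ : quot_pi _ _ = 0) ?tophom0//.
  by apply/(quot_map0 (diagonal_subgroup R)); exists (r / n%:R : rat).
have qT : range q = setT.
  by apply/seteqP; split=> // z _; have [x xz] := quot_map_onto z; exists x.
rewrite qT in gR; have [psi psiE] := hom_onT gR; exists psi.
apply: tophom_eq => z; have [x <-] := quot_map_onto z.
by rewrite natmul_homE psiE gE -[hom_comp chi _ x]/(chi (q (f x))) -(tophomMn chi) -(tophomMn q) fn.
Qed.

(** * Strict exactness *)

(** Openness onto the image, in terms of neighbourhoods of 0. *)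
Definition relatively_open (A B : topologicalZmodType) (f : tophom A B) : Prop :=
  forall U, nbhs 0 U -> exists2 W, nbhs 0 W & forall x, W (f x) -> exists2 x', U x' & f x' = f x.

Lemma strict_relatively_open (A B : tabType) (f : tophom A B) :
  strict_hom f -> relatively_open f.
Proof.
move=> [_ top _] U U0.
pose q := quot_map (Defs.kernel f).
have /nbhs_singleton : nbhs 0 (q @` U)° by apply: nbhs_interior; exact: quot_map_nbhs0.
have /top[W oW WE] : open (q @` U)° by exact: open_interior.
have qf x : coimage_map (q x) = f x by exact: coimage_mapE.
rewrite WE => W0; exists W.
  by apply: open_nbhs_nbhs; split=> //; rewrite -(tophom0 f) -qf tophom0.
move=> x Wx; have : (q @` U)° (q x) by rewrite WE /= qf.
by move=> /interior_subset[y Uy yx]; exists y => //; rewrite -!qf yx.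
Qed.

Lemma relatively_open_strict (A B : tabType) (f : tophom A B) :
  relatively_open f -> closed (range f) -> strict_hom f.
Proof.
move=> ro clf; pose q := quot_map (Defs.kernel f).
have qf x : coimage_map (q x) = f x by exact: coimage_mapE.
have q_onto z : exists x, q x = z by exact: quot_map_onto.
split.
- move=> z w; have [x <-] := q_onto z; have [y <-] := q_onto w; rewrite !qf => fxy.
  by apply/quot_piP; change (f (x - y) = 0); rewrite tophomB fxy subrr.
- move=> U; split=> [oU|[V oV ->]]; last first.
    have cc : continuous (@coimage_map A B f).
      move=> z W; have [x <-] := q_onto z; rewrite qf => /(@hom_cont _ _ f x) Wx.
      have := quot_pi_nbhs (Defs.kernel f) Wx.
      by apply: filterS => _ [y Wy <-]; change (W (coimage_map (q y))); rewrite qf.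
    by apply: open_comp => // z _; exact: cc.
  pose V := \bigcup_(O in [set O : set B | open O /\ forall z, O (coimage_map z) -> U z]) O.
  exists V; first by apply: bigcup_open => O [].
  apply/seteqP; split=> z; last by move=> [N [_ NU]]; exact: NU.
  have [x <-] := q_onto z => Ux.
  have : nbhs 0 [set y | U (q (x + y))].
    have Uqx : nbhs (q x) U by exact: open_nbhs_nbhs.
    have := @hom_cont _ _ q x U Uqx; rewrite -{1}(addr0 x) => /nbhs_shift.
    exact.
  move=> /ro[W W0 WP]; rewrite nbhsE in W0; case: W0 => O [oO O0] OW.
  exists [set b | O (b - f x)].
    split.
      rewrite openE => b Ob; apply: (@nbhs_subr _ (f x) b O).
      by apply: open_nbhs_nbhs; split.
    move=> w; have [y <-] := q_onto w; rewrite qf => Oy.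
    have [|y' Uy' y'E] := WP (y - x); first by apply: OW; rewrite tophomB.
    suff <- : q (x + y') = q y by [].
    apply/quot_piP; change (f (x + y' - y) = 0).
    by rewrite tophomB hom_add y'E tophomB; zmod.
  by rewrite /= qf subrr.
- have -> : range (@coimage_map A B f) = range f; last by [].
  apply/seteqP; split=> _ [z _ <-]; last by exists (q z).
  by have [x <-] := q_onto z; exists x.
Qed.

(** The image of a differential is closed as the kernel of the next one. *)
Lemma strictly_exactP (X : bcomplex) : exact_complex X ->
  (forall (i j : int) (ij : i + 1 = j), relatively_open (cdiff X ij)) -> strictly_exact X.
Proof.
move=> ex ro; split=> // i j ij; apply: relatively_open_strict; first exact: ro.
have -> : range (cdiff X ij) = Defs.kernel (cdiff X (erefl (j + 1))).
  apply/seteqP; split=> [_ [x _ <-]|x xk]; first exact: cdiffK.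
  by have [y yx] := ex _ _ _ ij (erefl (j + 1)) x xk; exists y.
exact: cs_closed.
Qed.

(** What strict exactness means for a short complex: i is an embedding onto the
    kernel of q, and q is an open surjection. *)
Record short_exact (A1 A2 A3 : tabType) (i : tophom A1 A2) (q : tophom A2 A3) : Prop := ShortExact {
  se_inj : injective i;
  se_emb : forall U, nbhs 0 U -> exists2 V, nbhs 0 V & forall y, V (i y) -> U y;
  se_ker : forall x, q x = 0 -> exists y, i y = x;
  se_comp : forall y, q (i y) = 0;
  se_open : open_hom q;
  se_onto : forall z, exists x, q x = z }.

Lemma strictly_exact_short (A1 A2 A3 : tabType) (i : tophom A1 A2) (q : tophom A2 A3)
  (qi : forall x, q (i x) = 0) : strictly_exact (short_complex qi) -> short_exact i q.
Proof.
move=> [ex st].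
have inj : injective i.
  move=> x y xy; apply/eqP; rewrite -subr_eq0; apply/eqP.
  have [|z zE] := ex 0 1 2 erefl erefl (x - y : A1); last by rewrite -zE.
  by change (i (x - y) = 0); rewrite tophomB xy subrr.
have onto z : exists x, q x = z by exact: (ex 2 3 4 erefl erefl (z : A3) erefl).
split=> //.
- move=> U /(strict_relatively_open (st 1 2 erefl))[W W0 WP]; exists W => // y Wy.
  by have [x' Ux' /inj <-] := WP y Wy.
- by move=> x qx; exact: (ex 1 2 3 erefl erefl (x : A2) qx).
- move=> U /(strict_relatively_open (st 2 3 erefl))[W W0 WP]; apply: filterS W0 => z Wz.
  have [x xz] := onto z.
  have [|x' Ux' x'E] := WP x; first by change (W (q x)); rewrite xz.
  by exists x' => //; rewrite -xz; exact: x'E.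
Qed.

Section ProductFactor.
Variables (I : eqType) (T : I -> tabType) (i0 : I).
Hypothesis trivial : forall i, i <> i0 -> forall x : T i, x = 0.

(** The inclusion of a factor of a product; the match transports along i0 = j.
    *)
Definition prod_incl_fun j : tophom (T i0) (T j) :=
  match i0 =P j with
  | ReflectT e => match e in _ = j return tophom (T i0) (T j) with erefl => hom_id (T i0) end
  | ReflectF _ => 0
  end.

Definition prod_incl : tophom (T i0) (prod_group T) := prod_lift prod_incl_fun.

Lemma prod_inclE x : prod_incl x i0 = x.
Proof. by rewrite /= /prod_incl_fun; case: eqP => // e; rewrite (eq_irrelevance e erefl). Qed.

Lemma prod_inclK (f : prod_group T) : prod_incl (f i0) = f.
Proof.
apply: functional_extensionality_dep => j.
have [->|ji] := pselect (j = i0); first exact: prod_inclE.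
by rewrite [LHS]trivial// [RHS]trivial.
Qed.

End ProductFactor.

(** * Hom complexes with one object concentrated in degree 0 *)

Lemma tophom_from_trivial (A B : topologicalZmodType) (f : tophom A B) :
  (forall x : A, x = 0) -> f = 0.
Proof. by move=> A0; apply: tophom_eq => x; rewrite (A0 x) tophom0. Qed.

Lemma tophom_to_trivial (A B : topologicalZmodType) (f : tophom A B) :
  (forall x : B, x = 0) -> f = 0.
Proof. by move=> B0; apply: tophom_eq => x; exact: B0. Qed.

Lemma single_trivial (A : tabType) (n : int) : n <> 0 -> forall x : single A n, x = 0.
Proof. by case: n => [[|n]|n] // _ x; exact: zero_groupP. Qed.

Section HomFromSingle.
Variables (C : tabType) (B : bcomplex).
Local Notation X := (hom_complex (single C) B).
Local Notation H n := (tophom C (B n)).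

Fact src_index_proof (n : int) : (0 : int, n).1 + n == (0 : int, n).2.
Proof. by rewrite /= add0r. Qed.

Definition src_index n : hom_index n := exist _ (0, n) (src_index_proof n).

Definition src_factor (n : int) (i : hom_index n) : tabType :=
  tophom (single C (\val i).1) (B (\val i).2).

Lemma src_trivial n (i : hom_index n) : i <> src_index n -> forall f : src_factor i, f = 0.
Proof.
move=> ii f; apply: tophom_from_trivial; apply: single_trivial => i1.
apply: ii; apply: val_inj; have /eqP := valP i.
case: i f i1 => [[p q] /= pq] _ i1 /=; rewrite i1 in pq *.
by rewrite add0r => <-.
Qed.

Definition src_incl n : tophom (H n) (X n) := prod_incl (@src_factor n) (src_index n).
Definition src_proj n : tophom (X n) (H n) := prod_proj (@src_factor n) (src_index n).

Lemma src_inclE n h : src_proj n (src_incl n h) = h.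
Proof. exact: prod_inclE. Qed.

Lemma src_inclK n f : src_incl n (src_proj n f) = f.
Proof. by apply: prod_inclK; exact: src_trivial. Qed.

(** The component of degree n of the Hom complex is Hom(C, B n), with index (0,
    n), and the second term of the differential vanishes. *)
Lemma src_diff (n m : int) (nm : n + 1 = m) (f : X n) x :
  src_proj m (cdiff X nm f) x = cdiff B nm (src_proj n f x).
Proof.
transitivity (@hom_diff (single C) B n m nm f (src_index m) x); first by [].
rewrite hom_diffE /= tophom0 mul0rz subr0.
have gen (q' : int) (e : n = q') (pf : (0 : int) + n == q') (h : q' + 1 = m) :
    cdiff B h (f (exist _ (0, q') pf) x) = cdiff B nm (src_proj n f x).
  case: _ / e pf h => pf h; rewrite (eq_irrelevance h nm) /src_proj /= /src_index.
  by rewrite (bool_irrelevance pf (src_index_proof n)).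
apply: gen; exact: (canRL (addrK 1) nm).
Qed.

Lemma hom_from_single_exact :
  (forall (i j k : int) (ij : i + 1 = j) (jk : j + 1 = k) (g : H j),
     (forall x, cdiff B jk (g x) = 0) -> exists h : H i, forall x, cdiff B ij (h x) = g x) ->
  (forall (i j : int) (ij : i + 1 = j), relatively_open (hom_post C (cdiff B ij))) ->
  strictly_exact X.
Proof.
move=> ex ro; apply: strictly_exactP => [i j k ij jk f df|i j ij U U0].
  have [x|h hE] := ex i j k ij jk (src_proj j f); first by rewrite -src_diff df tophom0.
  exists (src_incl i h); rewrite -(src_inclK f) -(src_inclK (cdiff X ij _)); congr (src_incl j _).
  by apply: tophom_eq => x; rewrite src_diff src_inclE.
have [W W0 WP] := ro i j ij _ (tophom_nbhs0 (src_incl i) U0).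
exists (src_proj j @^-1` W); first exact: tophom_nbhs0.
move=> f Wf; have dE (g : X i) : src_proj j (cdiff X ij g) = hom_post C (cdiff B ij) (src_proj i g).
  by apply: tophom_eq => x; rewrite src_diff.
have [|h Uh hE] := WP (src_proj i f); first by rewrite -dE.
exists (src_incl i h) => //.
by rewrite -(src_inclK (cdiff X ij f)) -(src_inclK (cdiff X ij _)) !dE src_inclE hE.
Qed.

End HomFromSingle.

Section HomToSingle.
Variables (A : bcomplex) (D : tabType).
Local Notation X := (hom_complex A (single D)).
Local Notation H n := (tophom (A (- n)) D).

Fact tgt_index_proof (n : int) : (- n, 0 : int).1 + n == (- n, 0 : int).2.
Proof. by rewrite /= addNr. Qed.

Definition tgt_index n : hom_index n := exist _ (- n, 0) (tgt_index_proof n).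

Definition tgt_factor (n : int) (i : hom_index n) : tabType :=
  tophom (A (\val i).1) (single D (\val i).2).

Lemma tgt_trivial n (i : hom_index n) : i <> tgt_index n -> forall f : tgt_factor i, f = 0.
Proof.
move=> ii f; apply: tophom_to_trivial; apply: single_trivial => i2.
apply: ii; apply: val_inj; have /eqP := valP i.
case: i f i2 => [[p q] /= pq] _ i2 /=; rewrite i2 in pq *.
by move=> /eqP; rewrite addr_eq0 => /eqP ->.
Qed.

Definition tgt_incl n : tophom (H n) (X n) := prod_incl (@tgt_factor n) (tgt_index n).
Definition tgt_proj n : tophom (X n) (H n) := prod_proj (@tgt_factor n) (tgt_index n).

Lemma tgt_inclE n h : tgt_proj n (tgt_incl n h) = h.
Proof. exact: prod_inclE. Qed.

Lemma tgt_inclK n f : tgt_incl n (tgt_proj n f) = f.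
Proof. by apply: prod_inclK; exact: tgt_trivial. Qed.

Fact tgt_diff_proof (n m : int) : n + 1 = m -> - m + 1 = - n.
Proof. by move=> <-; rewrite opprD subrK. Qed.

(** The component of degree n of the Hom complex is Hom(A (- n), D), with index
    (- n, 0), and the first term of the differential vanishes. *)
Lemma tgt_diff (n m : int) (nm : n + 1 = m) (f : X n) x :
  tgt_proj m (cdiff X nm f) x =
    - (tgt_proj n f (cdiff A (tgt_diff_proof nm) x) *~ (-1) ^ n).
Proof.
transitivity (@hom_diff A (single D) n m nm f (tgt_index m) x); first by [].
rewrite hom_diffE /= add0r; congr (- (_ *~ _)).
have gen (p' : int) (h : - m + 1 = p') (e : p' = - n) (pf : p' + n == 0) :
    f (exist _ (p', 0) pf) (cdiff A h x) = tgt_proj n f (cdiff A (tgt_diff_proof nm) x).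
  move: h pf; rewrite e => h pf; rewrite (eq_irrelevance h (tgt_diff_proof nm)).
  by rewrite /tgt_proj /= /tgt_index (bool_irrelevance pf (tgt_index_proof n)).
by apply: gen; exact: tgt_diff_proof.
Qed.

Lemma hom_to_single_exact :
  (forall (i j k : int) (ij : i + 1 = j) (jk : j + 1 = k) (g : tophom (A j) D),
     (forall x, g (cdiff A ij x) = 0) -> exists h : tophom (A k) D, forall x, h (cdiff A jk x) = g x) ->
  (forall (i j : int) (ij : i + 1 = j), relatively_open (hom_pre D (cdiff A ij))) ->
  strictly_exact X.
Proof.
move=> ex ro.
(* The sign in the differential is absorbed into the homomorphism h. *)
have sgn (n : int) : exists b : bool, forall y : D, - (y *~ (-1) ^ n) = if b then y else - y.
  have [->|->] : (-1 : int) ^ n = 1 \/ (-1 : int) ^ n = - 1.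
  - case: n => n; first by rewrite -[_ ^ _]/((-1) ^+ n) -signr_odd; case: odd; [right|left].
    rewrite -[_ ^ _]/(((-1) ^+ n.+1)^-1) -signr_odd; case: odd; last by left; rewrite invr1.
    by right; rewrite expr1 invrN1.
  - by exists false => y; rewrite mulr1z.
  - by exists true => y; rewrite mulrNz mulr1z opprK.
pose sg (b : bool) n (h : tophom (A n) D) := if b then h else - h.
have dE (i j : int) (ij : i + 1 = j) : exists b, forall g : X i,
    tgt_proj j (cdiff X ij g) = sg b _ (hom_pre D (cdiff A (tgt_diff_proof ij)) (tgt_proj i g)).
  have [b bP] := sgn i; exists b => g; apply: tophom_eq => x.
  by rewrite tgt_diff bP; case: b {bP}.
apply: strictly_exactP => [i j k ij jk f df|i j ij U U0].
  have [x|h hE] := ex _ _ _ (tgt_diff_proof jk) (tgt_diff_proof ij) (tgt_proj j f).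
    have [b bE] := dE j k jk; have := bE f; rewrite df tophom0.
    move=> /(congr1 (fun g : tophom _ D => g x)) /=; case: b {bE} => //=.
    by move=> /esym/eqP; rewrite oppr_eq0 => /eqP.
  have [b bE] := dE i j ij; exists (tgt_incl i (sg b _ h)).
  rewrite -(tgt_inclK f) -(tgt_inclK (cdiff X ij _)) bE tgt_inclE; congr (tgt_incl j _).
  by apply: tophom_eq => x; rewrite -hE; case: b {bE} => //=; rewrite opprK.
have [W W0 WP] := ro _ _ (tgt_diff_proof ij) _ (tophom_nbhs0 (tgt_incl i) U0).
have [b bE] := dE i j ij.
exists (tgt_proj j @^-1` [set h | W (sg b _ h)]).
  apply: tophom_nbhs0; case: (b) => //; exact: nbhs0N.
move=> f Wf; have [|h Uh hE] := WP (tgt_proj i f).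
  have : W (sg b _ (tgt_proj j (cdiff X ij f))) by [].
  by rewrite bE; case: (b) => //=; rewrite opprK.
exists (tgt_incl i h) => //.
by rewrite -(tgt_inclK (cdiff X ij f)) -(tgt_inclK (cdiff X ij _)) !bE tgt_inclE hE.
Qed.

End HomToSingle.

(** * Hom complexes of short exact sequences *)

(** Smallness on a compact set is the form in which the compact-open topology
    enters the openness statements. *)
Lemma tophom_nbhs0P (A B : topologicalZmodType) (U : set (tophom A B)) : nbhs 0 U ->
  exists (K : set A) (V : set B), [/\ compact K, nbhs 0 V &
    forall f : tophom A B, (forall x, K x -> V (f x)) -> U f].
Proof.
move=> U0; pose F : set_system (tophom A B) := [set S | exists (K : set A) (V : set B),
  [/\ compact K, nbhs 0 V & forall f : tophom A B, (forall x, K x -> V (f x)) -> S f]].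
have FF : Filter F.
  split.
  - by exists set0, setT; split=> //; [exact: compact0|exact: filterT].
  - move=> S T [K [V [cK V0 KV]]] [L [W [cL W0 LW]]]; exists (K `|` L), (V `&` W).
    split; [exact: compactU|exact: filterI|move=> f fP; split].
      by apply: KV => x Kx; have [] := fP x (or_introl Kx).
    by apply: LW => x Lx; have [] := fP x (or_intror Lx).
  - by move=> S T ST [K [V [cK V0 KV]]]; exists K, V; split=> // f /KV/ST.
have F0 : F --> (0 : tophom A B).
  apply/tophom_cvgP => K O cK oO KO.
  have [[x Kx]|K0] := pselect (exists x, K x).
    exists K, O; split=> //; last by move=> f fO _ [y Ky <-]; exact: fO.
    by apply: open_nbhs_nbhs; split=> //; apply: KO; exists x.
  exists K, setT; split=> //; first exact: filterT.
  by move=> f _ _ [y Ky <-]; exfalso; apply: K0; exists y.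
exact: (F0 U U0).
Qed.

Lemma tophom_nbhs0_set (A : topologicalZmodType) (B : topologicalZmodType) (K : set A) (V : set B) :
  compact K -> nbhs 0 V -> nbhs 0 [set f : tophom A B | forall x, K x -> V (f x)].
Proof.
move=> cK; rewrite nbhsE => -[N [oN N0] NV].
have /tophom_cvgP/(_ K N cK oN) := @cvg_id _ (nbhs (0 : tophom A B)).
have KN : (0 : tophom A B) @` K `<=` N by move=> _ [x _ <-].
by move=> /(_ KN); apply: (@filterS _ (nbhs (0 : tophom A B))) => f fN x Kx; apply/NV/fN; exists x.
Qed.

Section MainTheorems.
Variable R : realType.

Lemma relatively_open_from_trivial (A B : topologicalZmodType) (f : tophom A B) :
  (forall x : A, x = 0) -> relatively_open f.
Proof.
move=> A0 U U0; exists setT; first exact: filterT.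
by move=> x _; exists x => //; rewrite (A0 x); exact: nbhs_singleton.
Qed.

Lemma relatively_open_to_trivial (A B : topologicalZmodType) (f : tophom A B) :
  (forall x : B, x = 0) -> relatively_open f.
Proof.
move=> B0 U U0; exists setT; first exact: filterT.
by move=> x _; exists 0; [exact: nbhs_singleton|rewrite [LHS]B0 [RHS]B0].
Qed.

Lemma divisible_kernel (A1 A2 A3 : tabType) (i : tophom A1 A2) (q : tophom A2 A3) :
  short_exact i q -> divisible A1 -> divisible (subgroup_type (Defs.kernel q)).
Proof.
move=> se dA n n0 x; have [y yx] := se_ker se (subgroup_valP x).
have [z zn] := dA n n0 y.
have qz : cs_set (Defs.kernel q) (i z) by exact: (se_comp se).
exists (subgroup_sub qz); apply: val_inj.
rewrite -[LHS]/(sub_incl (Defs.kernel q) (subgroup_sub qz *+ n)) tophomMn -[RHS]yx -zn.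
by rewrite tophomMn.
Qed.

(** Exactness in degree 2 is the universal property of the kernel, and in
    degree 3 it is the existence of lifts. The differentials are open onto
    their images because d1 is an embedding and because small homomorphisms
    have small lifts. *)
Theorem hom_from_exact (C D1 D2 D3 : tabType) (d1 : tophom D1 D2) (d2 : tophom D2 D3)
  (d2d1 : forall x, d2 (d1 x) = 0) :
  short_exact d1 d2 -> lcg C -> codivisible R C -> lcg D2 -> divisible D1 -> extension_property C D1 ->
  strictly_exact (hom_complex (single C) (short_complex d2d1)).
Proof.
move=> se lC dC lD dD ext; apply: hom_from_single_exact => [i j k ij jk|i j ij].
  case: _ / ij jk; case: i => [[|[|[|[|n]]]]|n] jk g gk.
  - have gk' x : d1 (g x) = 0 by move: (gk x); case: _ / jk gk.
    by exists 0 => x; apply: (se_inj se); rewrite gk' [X in d1 X](_ : _ = 0) ?tophom0.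
  - have gk' x : d2 (g x) = 0 by move: (gk x); case: _ / jk gk.
    have gr x : exists y, d1 y = g x by exact: (se_ker se (gk' x)).
    have [h hE] := choice gr.
    have hD : {morph h : x y / x + y}.
      by move=> x y; apply: (se_inj se); rewrite hom_add !hE hom_add.
    have hc : continuous h.
      apply: additive_continuous => // U /(se_emb se)[V V0 VU].
      by apply: filterS (tophom_nbhs0 g V0) => x Vx; apply: VU; rewrite hE.
    by exists (TopHom hc hD) => x; exact: hE.
  - by have [h hE] := hom_lift_exists (g : tophom C D3) lC lD ext (se_open se) (se_inj se) (se_ker se) (se_comp se) (se_emb se) (se_onto se); exists h.
  - by exists 0 => x; rewrite [LHS]zero_groupP [RHS]zero_groupP.
  - by exists 0 => x; rewrite [LHS]zero_groupP [RHS]zero_groupP.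
  - case: n jk g gk => [|n] jk g gk; exists 0 => x; by rewrite [LHS]zero_groupP [RHS]zero_groupP.
case: _ / ij; case: i => [[|[|[|[|n]]]]|n].
- by apply: relatively_open_from_trivial; move=> f; apply: tophom_to_trivial => x; exact: zero_groupP.
- move=> U /tophom_nbhs0P[K [V [cK V0 KV]]]; have [W W0 WV] := se_emb se V0.
  exists [set f : tophom C D2 | forall x, K x -> W (f x)]; first exact: tophom_nbhs0_set.
  by move=> f Wf; exists f => //; apply: KV => x Kx; apply: WV; exact: Wf.
- move=> U /tophom_nbhs0P[K [V [cK V0 KV]]].
  have [K1 [U1 [cK1 U10 K1P]]] := small_hom_lift lC dC lD (se_open se) (divisible_kernel se dD) V0 cK.
  exists [set f : tophom C D3 | forall x, K1 x -> U1 (f x)]; first exact: tophom_nbhs0_set.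
  move=> f Wf; have [F FE FK] := K1P f Wf; exists F; first exact: KV.
  by apply: tophom_eq => x; exact: FE.
- by apply: relatively_open_to_trivial; move=> f; apply: tophom_to_trivial => x; exact: zero_groupP.
- by apply: relatively_open_from_trivial; move=> f; apply: tophom_to_trivial => x; exact: zero_groupP.
- by apply: relatively_open_from_trivial; move=> f; apply: tophom_to_trivial => x; exact: zero_groupP.
Qed.

(** Exactness at Hom(C2, D) is the universal property of the quotient, and at
    Hom(C1, D) it is the existence of extensions. The differentials are open
    onto their images because compact subsets of C3 lift to C2 and because
    small homomorphisms have small extensions. *)
Theorem hom_to_exact (C1 C2 C3 D : tabType) (c1 : tophom C1 C2) (c2 : tophom C2 C3)
  (c2c1 : forall x, c2 (c1 x) = 0) :
  short_exact c1 c2 -> lcg C2 -> codivisible R C3 -> lcg D -> divisible D -> extension_property C3 D ->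
  strictly_exact (hom_complex (short_complex c2c1) (single D)).
Proof.
move=> se lC dC lD dD ext.
(* A homomorphism on C1 is a homomorphism on the kernel of c2. *)
have [j jE] : exists j : C2 -> C1, forall y, j (c1 y) = y.
  have ex x : exists y, forall y', c1 y' = x -> y = y'.
    have [[y yx]|ny] := pselect (exists y, c1 y = x).
      by exists y => y'; rewrite -yx => /(se_inj se).
    by exists 0 => y' y'x; exfalso; apply: ny; exists y'.
  by have [j jP] := choice ex; exists j => y; exact: jP.
have jH : hom_on (Defs.kernel c2) j.
  split=> [x y /(se_ker se)[x' <-] /(se_ker se)[y' <-]|U /(se_emb se)[V V0 VU]].
    by rewrite -hom_add !jE.
  by exists V => // x /(se_ker se)[x' <-] Vx; rewrite jE; exact: VU.
have gjH (g : tophom C1 D) : hom_on (Defs.kernel c2) (g \o j) by exact: hom_on_comp.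
apply: hom_to_single_exact => [i j' k ij jk|i j' ij].
  case: _ / jk; case: _ / ij; case: i => [[|[|[|[|n]]]]|n] g gk.
  - have [F FE] := ext C2 c2 _ lC (se_open se) (gjH g).
    by exists F => x; rewrite /= FE ?(se_comp se)//= jE.
  - have [|h hT hE] := @hom_factor _ _ _ c2 g (se_open se).
      by move=> x /(se_ker se)[y <-]; exact: gk.
    have cT : range c2 = setT.
      by apply/seteqP; split=> // z _; have [x xz] := se_onto se z; exists x.
    by rewrite cT in hT; have [h' h'E] := hom_onT hT; exists h' => x; rewrite h'E; exact: hE.
  - exists 0 => x; have [y yx] := se_onto se x.
    by rewrite -[X in g X]yx; apply/esym; exact: gk.
  - by exists 0 => x; rewrite (zero_groupP x) !tophom0.
  - by exists 0 => x; rewrite (zero_groupP x) !tophom0.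
  - by case: n g gk => [|n] g gk; exists 0 => x; rewrite (zero_groupP x) !tophom0.
case: _ / ij; case: i => [[|[|[|[|n]]]]|n].
- by apply: relatively_open_to_trivial; move=> f; apply: tophom_from_trivial => x; exact: zero_groupP.
- move=> U /tophom_nbhs0P[K [V [cK V0 KV]]].
  have [K1 [U1 [cK1 U10 K1P]]] := small_hom_extension lC (se_open se) dC lD dD V0 cK.
  have cK1' : compact [set y | K1 (c1 y)].
    have cI : compact (K1 `&` Defs.kernel c2) by apply: compact_closedI => //; exact: cs_closed.
    have -> : [set y | K1 (c1 y)] = j @` (K1 `&` Defs.kernel c2).
      apply/seteqP; split=> [y Ky|_ [x [Kx qx] <-]].
        by exists (c1 y) => //; split=> //; exact: (se_comp se).
      by have [y yx] := se_ker se qx; rewrite -yx in Kx *; rewrite jE.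
    have [h hE] := hom_on_restrict jH.
    have -> : j @` (K1 `&` Defs.kernel c2) = h @` [set x | K1 (\val x)].
      apply/seteqP; split=> [_ [x [Kx qx] <-]|_ [x Kx <-]].
        by exists (@subgroup_sub _ (Defs.kernel c2) _ qx) => //; rewrite hE.
      by exists (\val x); [split=> //; exact: subgroup_valP|rewrite hE].
    by apply: compact_image; [exact: hom_cont|exact: sub_compact].
  exists [set f : tophom C1 D | forall y, K1 (c1 y) -> U1 (f y)].
    exact: (tophom_nbhs0_set (K := [set y | K1 (c1 y)])).
  move=> f Wf; pose g := hom_comp f c1.
  have [|F FE FK] := K1P (g \o j) (gjH g).
    by move=> x Kx /(se_ker se)[y yx]; rewrite -yx /= jE; apply: Wf; rewrite yx.
  exists F; first exact: KV.
  by apply: tophom_eq => y; rewrite /= FE ?(se_comp se)//= jE.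
- move=> U /tophom_nbhs0P[K [V [cK V0 KV]]].
  have [L cL LK] := compact_cover lC (se_open se) (se_onto se) cK.
  exists [set f : tophom C2 D | forall y, L y -> V (f y)].
    exact: (tophom_nbhs0_set (K := L)).
  move=> f Wf; exists f => //; apply: KV => z /LK[x Lx <-]; exact: Wf.
- by apply: relatively_open_from_trivial; move=> f; apply: tophom_from_trivial => x; exact: zero_groupP.
- by apply: relatively_open_from_trivial; move=> f; apply: tophom_from_trivial => x; exact: zero_groupP.
- case: n => [|n]; by [apply: relatively_open_to_trivial; move=> f; apply: tophom_from_trivial => x; exact: zero_groupP].
Qed.

Lemma diagonal_short_exact (E : tabType) (phi : top_iso (adele_class_group R) E) :
  short_exact (Defs.diagonal R) (hom_comp phi (quot_map (diagonal_subgroup R))).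
Proof.
have [U U0 Uq] := diagonal_discrete R.
have inj : injective (Defs.diagonal R).
  move=> q r qr; apply/eqP; rewrite -subr_eq0; apply/eqP/Uq.
  by rewrite tophomB qr subrr; exact: nbhs_singleton.
split=> //.
- by move=> V V0; exists U => // y /Uq ->; exact: nbhs_singleton.
- move=> x px; have := congr1 (iso_inv phi) px; rewrite [iso_inv phi _]iso_homK tophom0.
  by move=> /(quot_map0 (diagonal_subgroup R))[q _ <-]; exists q.
- by move=> y; exact: adele_complexK.
- move=> V /(quot_map_nbhs0 (diagonal_subgroup R))/(tophom_nbhs0 (iso_inv phi)).
  by apply: filterS => z [x Ux xz]; exists x => //=; rewrite [quot_pi _ _]xz iso_invK.
- move=> z; have [x xz] := quot_map_onto (iso_inv phi z).
  by exists x; rewrite -[LHS]/(phi (quot_map _ x)) xz iso_invK.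
Qed.

Lemma codivisible_iso (A B : tabType) (phi : top_iso A B) : codivisible R A -> codivisible R B.
Proof.
move=> dA n n0 chi; have [psi psiE] := dA n n0 (hom_comp chi phi).
exists (hom_comp psi (iso_inv phi)); apply: tophom_eq => x.
by rewrite natmul_homE -[hom_comp _ _ x]/(psi (iso_inv phi x)) -natmul_homE psiE /= iso_invK.
Qed.

End MainTheorems.

Theorem proposition3p6 (R : realType)
  (C1 C2 C3 : lcabType) (c1 : tophom C1 C2) (c2 : tophom C2 C3)
  (c2c1 : forall x, c2 (c1 x) = 0)
  (D1 D2 D3 : lcabType) (d1 : tophom D1 D2) (d2 : tophom D2 D3)
  (d2d1 : forall x, d2 (d1 x) = 0)
  (C D : lcabType)
  (codivC1 : codivisible R C1) (codivC2 : codivisible R C2)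
  (codivC3 : codivisible R C3)
  (divD1 : divisible D1) (divD2 : divisible D2) (divD3 : divisible D3)
  (exC : strictly_exact (short_complex c2c1))
  (exD : strictly_exact (short_complex d2d1))
  (codivC : codivisible R C) (divD : divisible D) :
  [/\ (* (i) *)
      Z_part_zero R D1 -> Z_part_zero R D2 -> Z_part_zero R D3 ->
      strictly_exact (hom_complex (single C) (short_complex d2d1)),
      (* (ii), with the last term A/Q, and Q^vee for any A/Q ~ Q^vee *)
      S1_part_zero R C ->
      strictly_exact (hom_complex (single C)
        (adele_complex (top_iso_id (adele_class_group R)))) /\
      forall phi : top_iso (adele_class_group R)
                           (pontryagin_dual R rational_group),
        strictly_exact (hom_complex (single C) (adele_complex phi)),
      (* (iii) *)
      S1_part_zero R C1 -> S1_part_zero R C2 -> S1_part_zero R C3 ->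
      strictly_exact (hom_complex (short_complex c2c1) (single D)) &
      (* (iv) *)
      Z_part_zero R D ->
      strictly_exact (hom_complex
        (adele_complex (top_iso_id (adele_class_group R))) (single D)) /\
      forall phi : top_iso (adele_class_group R)
                           (pontryagin_dual R rational_group),
        strictly_exact (hom_complex (adele_complex phi) (single D))].
Proof.
have seC := strictly_exact_short exC; have seD := strictly_exact_short exD.
have lC := lcab_lcg C; have lD := lcab_lcg D.
split.
- move=> ZD1 _ _; apply: (hom_from_exact d2d1 seD lC codivC (lcab_lcg D2) divD1).
  exact: (extension_Z_part codivC divD1 ZD1).
- move=> SC; have adele_exact (E : tabType) (phi : top_iso (adele_class_group R) E) :
      strictly_exact (hom_complex (single C) (adele_complex phi)).
    apply: (hom_from_exact _ (diagonal_short_exact phi) lC codivC (adele_lcg R) rational_divisible).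
    exact: (extension_S1_part codivC rational_divisible SC).
  by split=> [|phi]; exact: adele_exact.
- move=> _ _ SC3; apply: (hom_to_exact c2c1 seC (lcab_lcg C2) codivC3 lD divD).
  exact: (extension_S1_part codivC3 divD SC3).
- move=> ZD; have adele_exact (E : tabType) (phi : top_iso (adele_class_group R) E) :
      strictly_exact (hom_complex (adele_complex phi) (single D)).
    have dE := codivisible_iso phi (@adele_class_codivisible R).
    apply: (hom_to_exact _ (diagonal_short_exact phi) (adele_lcg R) dE lD divD).
    exact: (extension_Z_part dE divD ZD).
  by split=> [|phi]; exact: adele_exact.
Qed.
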